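(* Let $\alpha\in(0,1]$, let $\sigma,\eta>0$ be constants and let $f\in H^2(\mathbb{R})$. The solution $v$ to the fractional telegraph problem $$(\sigma/\eta)\, D^\alpha_t v(t,x) + D^{2\alpha}_t v(t,x) = \frac{\partial^2 v}{\partial x^2}(t,x),\qquad t>0,\ x\in\mathbb{R},$$ with $v(0,x)=f(x)$ and, only in the case $\alpha\in(1/2,1]$, also $\frac{\partial v}{\partial t}(0,x)=0$ (for a.e. $x$), admits the representation $$v(t,x)=\mathbf{E}[f(x+Z^{\mathtt{tel}}_t)],\qquad t>0,\ x\in\mathbb{R}.$$
   Context: Fractional derivative. $D^\nu_t$ is the Caputo-Dzhrbashyan derivative: for $\nu\in(0,1)\cup(1,2)$ and $n=\lceil \nu\rceil$, $$D^\nu_t\varphi(t,x)=\frac{1}{\Gamma(n-\nu)}\int_0^t \frac{\partial^n\varphi}{\partial s^n}(s,x)\,(t-s)^{n-\nu-1}\,ds,$$ while $D^1_t=\partial/\partial t$ and $D^2_t=\partial^2/\partial t^2$. Probabilistic objects. - $\{\theta_j\}_{j\ge 0}$ are i.i.d. with $\mathbf{P}(\theta_j=1)=\mathbf{P}(\theta_j=-1)=1/2$. - $e_0=0$ and $\{e_j\}_{j\ge1}$ are i.i.d. with $\mathbf{P}(e_j>t)=e^{-(\sigma/\eta)t}$, $t\ge 0$; $T_n=\sum_{j=0}^n e_j$ (so $T_0=0$), and $N_t=\max\{n\ge0: T_n\le t\}$ is the associated Poisson process. - $H=\{H_t\}_{t\ge0}$ is an $\alpha$-stable subordinator with $\mathbf{E}[e^{-\lambda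 H_t}]=e^{-t\lambda^\alpha}$, $\lambda>0$ (for $\alpha=1$, $H_t=t$), and $L_t=\inf\{s\ge0: H_s>t\}$ is its inverse. - The families $\{\theta_j\}$, $\{e_j\}$ and $H$ are mutually independent. - $N^L_t=N_{L_t}$ and $T^L_n=H_{T_n}$, so that $N^L_t=n$ iff $T^L_n\le t<T^L_{n+1}$ (a.s.). - $Z^{\mathtt{tel}}_t=\sum_{j=1}^{N^L_t}\theta_j e_j+\theta_{1+N^L_t}\,\big(L_t-T_{N^L_t}\big)$, $t\ge 0$. Solution class. The solution is considered in the weighted anisotropic space $H^{2\alpha,1}_\mu((0,\infty)\times\mathbb{R})$ of functions for which $$\|v\|^2_{L^2(\mu)}+\|D^{2\alpha}_tv\|^2_{L^2(\mu)}+\Big\|\frac{\partial v}{\partial x}\Big\|^2_{L^2(\mu)}<\infty,\qquad \|\varphi\|^2_{L^2(\mu)}=\int_0^\infty t^\zeta e^{-\beta t}\|\varphi(t,\cdot)\|^2_{L^2(\mathbb{R})}\,dt,$$ with parameters $\beta>0$, $\zeta>-1$.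
   Formalization: A solution is also required to have D^{2α}_t v integrable up to t=0 as an L²(R)-valued function; this is automatic for ζ<1, and without it the claim fails for large ζ (e.g. α=1/2, f=0, ζ>3/2: the nonzero fundamental solution has v(0,x)=0 for x≠0). *)

(* Defs.v *)
From HB Require Import structures.
From mathcomp Require Export all_boot all_order all_algebra.
From mathcomp Require Export all_classical all_reals all_analysis.
Export Order.TTheory GRing.Theory Num.Theory.
Export numFieldNormedType.Exports.

Set Implicit Arguments.
Unset Strict Implicit.
Unset Printing Implicit Defensive.

Local Open Scope classical_set_scope.
Local Open Scope ring_scope.

Notation leb R := (@lebesgue_measure R).

(** * Sobolev spaces on the line *)

Definition L2 {R : realType} (g : R -> R) : Prop := g \in Lfun (leb R) 2%:E.

Definition L2norm {R : realType} (g : R -> R) : \bar R :=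
  'N[leb R]_2%:E[EFin \o g]%E.

Definition test_function {R : realType} (phi : R -> R) : Prop :=
  (forall k x, derivable (derive1n k phi) x 1) /\
  exists M : R, forall x, M < `|x| -> phi x = 0.

(* [g] is the [k]-th distributional derivative of [f] on R *)
Definition weak_derivative {R : realType} (k : nat) (f g : R -> R) : Prop :=
  [/\ locally_integrable setT f, locally_integrable setT g &
    forall phi, test_function phi ->
      \int[leb R]_x (f x * derive1n k phi x) =
      (-1) ^+ k * \int[leb R]_x (g x * phi x)].

Definition sobolev {R : realType} (k : nat) (f : R -> R) : Prop :=
  L2 f /\
  forall j, (j <= k)%N -> exists2 g, L2 g & weak_derivative j f g.

(** * Caputo derivatives in time of functions [v t x] *)

Definition Gamma {R : realType} (z : R) : R :=
  \int[leb R]_(s in `]0, +oo[) (s `^ (z - 1) * expR (- s)).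

Definition ceiln {R : realType} (nu : R) : nat := `|Num.ceil nu|%N.

Definition caputo {R : realType} (nu : R) (v : R -> R -> R) (t x : R) : R :=
  let n := ceiln nu in
  if nu == n%:R then derive1n n (v ^~ x) t
  else (Gamma (n%:R - nu))^-1 *
       \int[leb R]_(s in `[0, t])
         (derive1n n (v ^~ x) s * (t - s) `^ (n%:R - nu - 1)).

(* The classical epsilon-delta definition; the intervals [u i, w i] of a finite
   non-overlapping family are listed from left to right. *)
Definition abs_continuous {R : realType} (D : set R) (h : R -> R) : Prop :=
  forall eps : R, 0 < eps -> exists2 del : R, 0 < del &
    forall (m : nat) (u w : nat -> R),
      (forall i, (i < m)%N -> [/\ D (u i), D (w i) & u i <= w i]) ->
      (forall i, (i.+1 < m)%N -> w i <= u i.+1) ->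
      \sum_(i < m) (w i - u i) < del ->
      \sum_(i < m) `|h (w i) - h (u i)| < eps.

(* The class AC^n on bounded subintervals of [0, +oo[ on which the integral
   formula for the Caputo derivative is meaningful.  Absolute continuity of
   h^(n-1) on ]0, T[ gives it a limit at 0, so for n = 2 the right derivative
   of [h] at 0 exists and is the limit of h' at 0. *)
Definition ACn {R : realType} (n : nat) (h : R -> R) : Prop :=
  [/\ h t @[t --> 0^'+] --> h 0,
      forall k, (k.+1 < n)%N -> forall t, 0 < t -> derivable (derive1n k h) t 1 &
      forall T, 0 < T -> abs_continuous `]0, T[ (derive1n n.-1 h)].

(** * The weighted anisotropic space and solutions *)

Definition L2mu {R : realType} (beta zeta : R) (phi : R -> R -> R) : Prop :=
  measurable_fun [set z : R * R | 0 < z.1] (fun z : R * R => phi z.1 z.2) /\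
  (\int[leb R]_(t in `]0%R, +oo[)
     ((t `^ zeta * expR (- beta * t))%:E * L2norm (phi t) ^+ 2) < +oo)%E.

Definition Hmu {R : realType} (nu beta zeta : R) (v : R -> R -> R) : Prop :=
  [/\ L2mu beta zeta v,
      {ae leb R, forall x, ACn (ceiln nu) (v ^~ x)},
      L2mu beta zeta (caputo nu v) &
      exists2 vx, L2mu beta zeta vx &
        {ae leb R, forall t, 0 < t -> weak_derivative 1 (v t) (vx t)}].

(* Third clause: D^(2 alpha) v is Bochner integrable near t = 0 as an L^2(R)-valued
   function.  For zeta < 1 this follows from D^(2 alpha) v \in L^2(mu) by
   Cauchy-Schwarz.  For larger zeta the weight does not control v near t = 0 and
   the initial conditions for a.e. x alone do not determine v: the singular
   solution issued from a Dirac mass at x = 0 also has zero initial data for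
   every x != 0 (for alpha = 1/2 it behaves like the heat kernel). *)
Definition telegraph_solution {R : realType} (alpha sigma eta beta zeta : R)
    (f : R -> R) (v : R -> R -> R) : Prop :=
  [/\ Hmu (2 * alpha) beta zeta v,
      {ae leb R, forall t, 0 < t -> exists2 vxx,
         weak_derivative 2 (v t) vxx &
         {ae leb R, forall x,
            sigma / eta * caputo alpha v t x + caputo (2 * alpha) v t x
            = vxx x}},
      forall T, 0 < T ->
        (\int[leb R]_(t in `]0%R, T[) L2norm (caputo (2 * alpha) v t) < +oo)%E,
      {ae leb R, forall x, v 0 x = f x} &
      2^-1 < alpha ->
        {ae leb R, forall x,
           h^-1 * (v h x - v 0 x) @[h --> 0^'+] --> (0 : R)}].

(** * Independence *)

(* mutual independence of the random variables [X i] *)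
Definition mutually_independent {d} {Omega : measurableType d} {R : realType}
    (P : probability Omega R) {I : eqType} (X : I -> Omega -> R) : Prop :=
  forall (s : seq I) (B : I -> set R), uniq s ->
    (forall i, measurable (B i)) ->
    P (\bigcap_(i in [set` s]) X i @^-1` B i) =
    (\prod_(i <- s) P (X i @^-1` B i))%E.

(* sigma-algebra generated by the [X i], [i] in [D] *)
Definition sigma_gen {Omega I : Type} {R : realType}
    (D : set I) (X : I -> Omega -> R) : set (set Omega) :=
  <<s [set A | exists i B, [/\ D i, measurable (B : set R) & A = X i @^-1` B]] >>.

Definition independent3 {d} {Omega : measurableType d} {R : realType}
    (P : probability Omega R) (F G K : set (set Omega)) : Prop :=
  forall A B C, F A -> G B -> K C ->
    P (A `&` B `&` C) = (P A * P B * P C)%E.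

(** * The telegraph process time-changed by an inverse stable subordinator *)

(* For alpha = 1 the Laplace transform forces H_t = t almost surely. *)
Definition stable_subordinator {d} {Omega : measurableType d} {R : realType}
    (P : probability Omega R) (alpha : R) (H : R -> {RV P >-> R}) : Prop :=
  [/\ {ae P, forall w, [/\ H 0 w = 0,
         forall s t, 0 <= s -> s <= t -> H s w <= H t w &
         forall t, 0 <= t -> H s w @[s --> t^'+] --> H t w]},
      forall t : nat -> R, 0 <= t 0%N -> (forall i, t i <= t i.+1) ->
        mutually_independent P (fun i w => H (t i.+1) w - H (t i) w),
      forall (s t : R) (B : set R), 0 <= s -> 0 <= t -> measurable B ->
        P ((fun w => H (s + t) w - H s w) @^-1` B) = P (H t @^-1` B) &
      forall t lambda : R, 0 <= t -> 0 < lambda ->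
        'E_P[fun w => expR (- lambda * H t w)%R]%E
        = (expR (- t * lambda `^ alpha))%:E].

Definition telegraph_data {d} {Omega : measurableType d} {R : realType}
    (P : probability Omega R) (alpha rate : R)
    (theta e : nat -> {RV P >-> R}) (H : R -> {RV P >-> R}) : Prop :=
  [/\ mutually_independent P (fun j w => theta j w) /\
      (forall j, P [set w | theta j w = 1] = (2^-1)%:E /\
                 P [set w | theta j w = -1] = (2^-1)%:E),
      (forall w, e 0%N w = 0) /\
      mutually_independent P (fun j w => e j.+1 w) /\
      (forall j (t : R), 0 <= t ->
         P [set w | t < e j.+1 w] = (expR (- rate * t))%:E),
      stable_subordinator alpha H &
      independent3 P (sigma_gen setT (fun j w => theta j w))
                     (sigma_gen setT (fun j w => e j w))
                     (sigma_gen [set t : R | 0 <= t] (fun t w => H t w))].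

Section Process.
Context {Omega : Type} {R : realType}.
Implicit Types (theta e : nat -> Omega -> R) (H : R -> Omega -> R) (w : Omega).

Definition arrival e (n : nat) w : R := \sum_(0 <= j < n.+1) e j w.

(* N_s = max {n | T_n <= s}; the (null) event that there is no maximum is sent
   to the default value 0 *)
Definition counting_process e (s : R) w : nat :=
  xget 0%N [set n | arrival e n w <= s /\
                    forall m, arrival e m w <= s -> (m <= n)%N].

Definition inverse_process H (t : R) w : R := inf [set s | 0 <= s /\ t < H s w].

Definition Ztel theta e H (t : R) w : R :=
  let L := inverse_process H t w in
  let N := counting_process e L w in
  \sum_(1 <= j < N.+1) theta j w * e j w
  + theta (1 + N)%N w * (L - arrival e N w).

End Process.

(* Main.v *)
(** The solution and the average [u t x] of [f] along the telegraph process have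
    the same Laplace transform in time.

    For the solution, the Caputo derivatives become powers of [s]: testing the
    transform [V s] against a test function in [x] gives
    [V'' = a (V - f / s)] weakly, with [q = s^alpha], [lam = sigma / eta] and
    [a = q (q + lam)].

    For the process, an exponential time of rate [s] independent of [H] is turned
    by the inverse subordinator into an exponential time of rate [q], so the
    subordination disappears.  Conditioning on the renewal epochs then yields the
    renewal equation [U = (q / s) E f + lam E U] for the transform [U s] of [u],
    where [E] is the convolution with [exp(-p |x|) / 2], [p = q + lam], i.e.
    [E = p (p^2 - d^2/dx^2)^-1].  Hence [U'' = a (U - f / s)] weakly as well.

    The equation [h'' = a h] with [a > 0] has no nonzero solution with bounded
    local L^1 norms, so [U s = V s] almost everywhere for every large integer [s].
    By Lerch's theorem, which only needs integer values of [s], [u] and [v] agree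
    for almost all [t]; they agree for all [t > 0] since [v] is continuous and [u]
    is right-continuous in [t]. *)

From HB Require Import structures.
Require Import Defs.
From mathcomp Require Import measurable_realfun ring lra.

Set Implicit Arguments.
Unset Strict Implicit.
Unset Printing Implicit Defensive.

Local Open Scope classical_set_scope.
Local Open Scope ring_scope.

(** The exceptional null sets come in opposite orders: the weak equation holds for almost every [t]
    and then almost every [x], the Caputo identities for almost every [x] and then almost every [t].
    Exchanging them needs time derivatives that are measurable jointly in [(t, x)], so [upper_deriv]
    replaces the bare derivative. At a fixed [x] only the Caputo derivative of order [2 * alpha] is
    under control; [v] and its derivative of order [alpha] are recovered from it as fractional
    integrals, and the case distinctions on [alpha] end there. Near [t = 0] its [L^2] norm in [x] is
    integrable, later the norm is square integrable against the weight; for [s >= beta / 2 + 1] both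
    give [L^1] bounds in [x] that are local and uniform under translation. This is the class in
    which uniqueness is proved, and the reason why Lerch's theorem starts from a large integer. On
    the side of the process, [f] is replaced by a bounded continuous representative [g], to which a
    constant is added so that Tonelli and monotone convergence act on nonnegative functions. *)

Section almost_everywhere.
Context {d} {T : measurableType d} {R : realType} (mu : {measure set T -> \bar R}).

Lemma aeS (P Q : T -> Prop) : (forall x, P x -> Q x) ->
  {ae mu, forall x, P x} -> {ae mu, forall x, Q x}.
Proof. by move=> PQ; apply: filterS. Qed.

Lemma aeI (P Q : T -> Prop) : {ae mu, forall x, P x} -> {ae mu, forall x, Q x} ->
  {ae mu, forall x, P x /\ Q x}.
Proof. exact: filterI. Qed.

Lemma ae_eq_integrable (D : set T) (f g : T -> \bar R) :
  measurable D -> measurable_fun D f -> measurable_fun D g ->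
  {ae mu, forall x, D x -> f x = g x} -> mu.-integrable D f -> mu.-integrable D g.
Proof.
move=> mD mf mg fg /integrableP[_ intf]; apply/integrableP; split => //.
rewrite (@ae_eq_integral _ _ _ _ _ (abse \o f)) //; try exact: measurableT_comp.
by apply: filterS fg => x /= + Dx => ->.
Qed.

Lemma ge0_integralZl_R (k : R) (f : T -> R) : 0 <= k -> measurable_fun setT f ->
  (forall x, 0 <= f x) ->
  (\int[mu]_x (k * f x)%:E = k%:E * \int[mu]_x (f x)%:E)%E.
Proof.
move=> k0 mf f0; rewrite -ge0_integralZl//; first exact/measurable_EFinP.
by move=> x _; rewrite lee_fin.
Qed.

Lemma ge0_integralZr_R (k : R) (f : T -> R) : 0 <= k -> measurable_fun setT f ->
  (forall x, 0 <= f x) ->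
  (\int[mu]_x (f x * k)%:E = \int[mu]_x (f x)%:E * k%:E)%E.
Proof.
move=> k0 mf f0; rewrite muleC -ge0_integralZl_R//.
by under eq_integral do rewrite mulrC.
Qed.

End almost_everywhere.

Lemma ae_neq {R : realType} (x : R) : {ae leb R, forall t, t <> x}.
Proof.
exists [set x]; split; first exact: measurable_set1.
  exact: lebesgue_measure_set1.
by move=> t /= /contrapT.
Qed.

(** * Absolutely continuous functions *)

(** The inner clause of [abs_continuous] with [eps] and [del] exposed. The bounds drawn from it must
    use one and the same pair for all subintervals, in particular for those that extend towards
    [0]. *)
Definition ac_modulus {R : realType} (D : set R) (h : R -> R) (eps del : R) :=
  forall (m : nat) (u w : nat -> R),
    (forall i, (i < m)%N -> [/\ D (u i), D (w i) & u i <= w i]) ->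
    (forall i, (i.+1 < m)%N -> w i <= u i.+1) ->
    \sum_(i < m) (w i - u i) < del ->
    \sum_(i < m) `|h (w i) - h (u i)| < eps.

Lemma abs_continuous_unif {R : realType} (D : set R) (h : R -> R) :
  abs_continuous D h -> forall eps : R, 0 < eps -> exists2 del : R, 0 < del &
    forall x y, D x -> D y -> x <= y -> y - x < del -> `|h y - h x| < eps.
Proof.
move=> hD eps /hD[del del0 H]; exists del => // x y Dx Dy xy yx.
have := H 1%N (fun=> x) (fun=> y); rewrite !big_ord_recl !big_ord0 !addr0.
by apply.
Qed.

Lemma abs_continuous_right {R : realType} (a b : R) (h : R -> R) (x : R) :
  abs_continuous `]a, b[ h -> a < x -> x < b -> h t @[t --> x^'+] --> h x.
Proof.
move=> /abs_continuous_unif hD ax xb; apply/cvgrPdist_lt => e /hD[del del0 H].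
near=> t; rewrite distrC; apply: H.
- by rewrite /= in_itv/= ax xb.
- rewrite /= in_itv/=; apply/andP; split.
    by rewrite (lt_trans ax)//; near: t; exact: nbhs_right_gt.
  by near: t; exact: nbhs_right_lt.
- by near: t; exact: nbhs_right_ge.
- by rewrite ltrBlDl; near: t; apply: nbhs_right_lt; rewrite ltrDl.
Unshelve. all: by end_near. Qed.

Lemma abs_continuous_cts {R : realType} (a b : R) (h : R -> R) (x : R) :
  abs_continuous `]a, b[ h -> a < x -> x < b -> {for x, continuous h}.
Proof.
move=> /abs_continuous_unif hD ax xb; apply/cvgrPdist_lt => e /hD[del del0 H].
near=> t.
have Dt : `]a, b[%classic t.
  by rewrite /= in_itv/=; apply/andP; split; near: t; [exact: lt_nbhsr|exact: lt_nbhsl].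
have Dx : `]a, b[%classic x by rewrite /= in_itv/= ax.
have xt : `|x - t| < del by near: t; exact: cvgr_dist_lt.
have [le|/ltW le] := leP x t.
  by rewrite distrC; apply: H => //; rewrite -(@ger0_norm _ (t - x)) ?subr_ge0// distrC.
by apply: H => //; rewrite -(@ger0_norm _ (x - t)) ?subr_ge0.
Unshelve. all: by end_near. Qed.

(* on an interval shorter than the modulus for 1, every variation is at most 1 *)
Lemma abs_continuous_bounded_variation {R : realType} (a b x y : R) (h : R -> R) :
  abs_continuous `]a, b[ h -> a < x -> x <= y -> y < b ->
  bounded_variation x y h.
Proof.
move=> /(_ 1 ltr01)[del del0 H] ax xy yb.
have short c d : x <= c -> c <= d -> d <= y -> d - c < del -> bounded_variation c d h.
  move=> xc cd dy cdel; exists 1 => _ [s cds <-].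
  rewrite /variation big_mkord; apply/ltW.
  pose t := fun i : nat => nth d (c :: s) i.
  have tge i : c <= t i.
    have [si|si] := ltnP i (size s).+1; first exact: itv_partition_nth_ge.
    by rewrite /t nth_default.
  have tle i : t i <= d.
    have [si|si] := ltnP i (size s).+1; first exact: itv_partition_nth_le.
    by rewrite /t nth_default.
  have tD i : `]a, b[%classic (t i).
    by rewrite /= in_itv/= (lt_le_trans ax)/= ?(le_lt_trans (tle i))// ?(le_lt_trans dy)// (le_trans xc).
  apply: (H (size s) t (fun i => t i.+1)) => //.
    move=> i si; split => //; move: cds => [+ _].
    by move=> /(pathP d) /(_ _ si) /ltW.
  have -> : \sum_(i < size s) (t i.+1 - t i) = t (size s) - t 0%N.
    by rewrite -(big_mkord xpredT (fun i => t i.+1 - t i)) telescope_sumr.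
  rewrite (le_lt_trans _ cdel)// lerB//; exact: tge.
have [N] : exists N : nat, (y - x) / (del / 2) < N%:R.
  by exists (Num.bound ((y - x) / (del / 2))); apply: archi_boundP; rewrite divr_ge0 ?subr_ge0// divr_ge0// ltW.
rewrite ltr_pdivrMr ?divr_gt0// => yN.
(* [N] steps of length [del / 2] lead from [x] to [y]; each is shorter than [del], so [short]
   applies, and total variations add up. *)
suff steps M z : z <= y -> x <= z -> z <= x + M%:R * (del / 2) ->
    bounded_variation x z h.
  by apply: (steps N) => //; rewrite -lerBlDl ltW.
elim: M z => [|M IH] z zy xz zN.
  have -> : z = x by apply/eqP; rewrite eq_le xz andbT (le_trans zN)// mul0r addr0.
  exact: bounded_variationxx.
have [zN'|/ltW zN'] := leP z (x + M%:R * (del / 2)); first exact: IH.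
set c := x + M%:R * (del / 2) in zN'.
have xc : x <= c by rewrite lerDl mulr_ge0// ltW// divr_gt0.
apply/(bounded_variationP _ xz).
rewrite (@total_variationD _ _ _ c)// fin_numD; apply/andP; split.
  by apply/bounded_variationP => //; apply: IH => //; rewrite (le_trans zN').
apply/bounded_variationP => //; apply: short => //.
rewrite ltrBlDl (le_lt_trans zN)// /c mulrSr mulrDl mul1r addrA ltrD2l.
by rewrite gtr_pMr// invf_lt1// ltr1n.
Qed.

(** Stated for an additive set function because it is applied both to Lebesgue measure and to a
    signed charge. *)
Lemma additive_cells {R : realType} (nu : set (measurableTypeR R) -> \bar R)
    (X : set R) (t : nat -> R) (n : nat) :
  nu set0 = 0%E -> additive2 nu ->
  measurable X -> (forall i, t i <= t i.+1) ->
  nu (X `&` `]t 0%N, t n]) =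
  (\sum_(i < n) nu (X `&` `]t i, t i.+1%N]))%E.
Proof.
move=> nu0 nuU mX tn; elim: n => [|n IH].
  by rewrite big_ord0 set_itvoc0 setI0.
have t0n : t 0%N <= t n by elim: n {IH} => // n /le_trans; apply.
rewrite big_ord_recr/= -IH -nuU//.
- rewrite -setIUr; congr (nu (_ `&` _)).
  apply/seteqP; split => x /=; rewrite !in_itv/=.
    move=> /andP[-> /= xt]; have [?|?] := leP x (t n); [by left|by right].
  by case=> /andP[h1 h2]; rewrite ?h1 ?h2 ?(le_trans h2)// (le_lt_trans t0n).
- exact: measurableI.
- exact: measurableI.
- rewrite setIACA setIid (_ : `]t 0%N, t n] `&` _ = set0) ?setI0//.
  apply/seteqP; split => x //= []; rewrite !in_itv/= => /andP[_ h1] /andP[h2 _].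
  by move: (le_lt_trans h1 h2); rewrite ltxx.
Qed.

(* the grid of all (clipped) end points: each cell is inside X or disjoint from X *)
Lemma ocitv_union_grid {R : realType} (F : seq (R * R)) (a b : R) : a <= b ->
  let X := \bigcup_(p in [set` F]) `]p.1, p.2]%classic in
  exists (t : nat -> R) (n : nat), [/\ forall i, t i <= t i.+1,
    t 0%N = a, t n = b, forall i, a <= t i <= b &
    forall i, (i < n)%N -> X `&` `]t i, t i.+1%N] = `]t i, t i.+1%N]%classic \/
      X `&` `]t i, t i.+1%N] = set0].
Proof.
move=> ab X.
pose clip (x : R) := Num.max a (Num.min b x).
have clipab x : a <= clip x <= b.
  by rewrite /clip le_max lexx /= ge_max ab ge_min lexx.
pose s := sort <=%R [seq clip x | x <- [seq p.1 | p <- F] ++ [seq p.2 | p <- F]].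
have sab x : x \in s -> a <= x <= b by rewrite mem_sort => /mapP[y _ ->].
have as_sorted : sorted <=%R (a :: s).
  rewrite /= path_sortedE; last exact: le_trans.
  rewrite (sort_sorted le_total) andbT.
  by apply/allP => x /sab/andP[].
pose t i := nth b (a :: s) i.
have tab i : a <= t i <= b.
  rewrite /t; have [si|si] := ltnP i (size (a :: s)); last first.
    by rewrite nth_default// ab lexx.
  have := mem_nth b si; rewrite inE => /predU1P[->|/sab//].
  by rewrite lexx ab.
have tm i j : (i <= j)%N -> t i <= t j.
  move=> ij; have [sj|sj] := ltnP j (size (a :: s)).
    apply: (sorted_leq_nth (@le_trans _ _) (@lexx _ _)) => //.
    by rewrite inE (leq_ltn_trans ij).
  by rewrite {2}/t nth_default//; case/andP: (tab i).
(* The index [size (a :: s)] is past the end of the list, where [nth] returns its default [b]; so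
   the grid ends at [b]. *)
exists t, (size (a :: s)); split => //.
- by move=> i; exact: tm.
- by rewrite /t nth_default.
move=> i _.
(* No clipped end point lies strictly inside the [i]-th cell. Hence an interval of [F] that meets
   the cell contains it. *)
have dicho x : x \in [seq p.1 | p <- F] ++ [seq p.2 | p <- F] ->
    clip x <= t i \/ t i.+1 <= clip x.
  move=> xF; have : clip x \in a :: s by rewrite inE mem_sort map_f// orbT.
  move=> /(nthP b)[j js <-]; rewrite -!/(t _).
  by have [ij|ij] := leqP j i; [left; exact: tm|right; exact: tm].
have cell z z' p : p \in F -> t i < z <= t i.+1 -> t i < z' <= t i.+1 ->
    p.1 < z <= p.2 -> p.1 < z' <= p.2.
  move=> pF /andP[tz zt] /andP[tz' z't] /andP[pz zp].
  have az : a < z by case/andP: (tab i) => + _ => /le_lt_trans; apply.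
  have az' : a < z' by case/andP: (tab i) => + _ => /le_lt_trans; apply.
  have zb : z <= b by case/andP: (tab i.+1) => _; exact: le_trans.
  have z'b : z' <= b by case/andP: (tab i.+1) => _; exact: le_trans.
  apply/andP; split.
    have : p.1 \in [seq p.1 | p <- F] ++ [seq p.2 | p <- F].
      by rewrite mem_cat map_f.
    move=> /dicho[|]; rewrite /clip.
      by rewrite ge_max => /andP[_]; rewrite ge_min => /orP[bt|/le_lt_trans]; [
        move: (le_lt_trans bt (lt_le_trans tz zb)); rewrite ltxx|apply].
    rewrite le_max => /orP[ta|]; first by move: (lt_le_trans az (le_trans zt ta)); rewrite ltxx.
    by rewrite le_min => /andP[_ tp]; move: (lt_le_trans pz (le_trans zt tp)); rewrite ltxx.
  have : p.2 \in [seq p.1 | p <- F] ++ [seq p.2 | p <- F].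
    by rewrite mem_cat map_f ?orbT.
  move=> /dicho[|]; rewrite /clip.
    rewrite ge_max => /andP[_]; rewrite ge_min => /orP[bt|pt].
      by move: (le_lt_trans bt (lt_le_trans tz zb)); rewrite ltxx.
    by move: (lt_le_trans tz (le_trans zp pt)); rewrite ltxx.
  rewrite le_max => /orP[ta|]; first by move: (lt_le_trans az (le_trans zt ta)); rewrite ltxx.
  by rewrite le_min => /andP[_]; exact: le_trans.
have [[z [[p /= pF pz] zt]]|no] :=
    pselect (exists z, X z /\ `]t i, t i.+1%N]%classic z); [left|right].
  apply/seteqP; split => [z' []//|z' z't]; split => //.
  by exists p => //=; move: pz zt z't; rewrite /= !in_itv/= => ? ? ?; exact: (@cell z).
by apply/seteqP; split => // z [Xz zt]; apply: no; exists z.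
Qed.

Lemma lebesgue_stieltjes_itvoc {R : realType} (F : cumulative R R) (x y : R) :
  x <= y -> lebesgue_stieltjes_measure F `]x, y]%classic = (F y - F x)%:E.
Proof.
move=> xy; rewrite /lebesgue_stieltjes_measure /measure_extension/=.
rewrite measurable_mu_extE/= ?wlength_itv_bnd//.
exact: is_ocitv.
Qed.

Lemma cumulative_of {R : realType} (F : R -> R) : nondecreasing F ->
  right_continuous F -> exists C : cumulative R R, C = F :> (R -> R).
Proof.
move=> Fnd Frc; pose Fm := isCumulative.Build R _ R F Fnd Frc.
by exists (HB.pack_for (cumulative R R) F Fm).
Qed.

Lemma lebesgue_stieltjes_add {R : realType} (F G K : cumulative R R) :
  K = F \+ G :> (R -> R) ->
  forall A : set (measurableTypeR R), measurable A ->
  lebesgue_stieltjes_measure K A =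
  (lebesgue_stieltjes_measure F A + lebesgue_stieltjes_measure G A)%E.
Proof.
move=> KE A mA.
pose m1 : {measure set (measurableTypeR R) -> \bar R} := lebesgue_stieltjes_measure F.
pose m2 : {measure set (measurableTypeR R) -> \bar R} := lebesgue_stieltjes_measure G.
apply: eq_trans (measure_addE m1 m2 A).
apply: lebesgue_stieltjes_measure_unique mA => X [[x y] _ <-]/=.
apply: eq_trans (esym (measure_addE m1 m2 _)).
have [xy|yx] := leP x y; last first.
  by rewrite set_itv_ge ?bnd_simp ?measure0 ?adde0// -leNgt ltW.
have -> : m1 `]x, y]%classic = (F y - F x)%:E by exact: lebesgue_stieltjes_itvoc.
have -> : m2 `]x, y]%classic = (G y - G x)%:E by exact: lebesgue_stieltjes_itvoc.
by rewrite lebesgue_stieltjes_itvoc// -EFinD KE/=; congr (_%:E); ring.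
Qed.

(* Lebesgue-Stieltjes charge of [h], as the difference of the measures of its
   total variation and of the total variation minus [h] *)
Lemma abs_continuous_charge {R : realType} (c d a b : R) (h : R -> R) :
  abs_continuous `]c, d[ h -> c < a -> a <= b -> b < d ->
  exists nu : {charge set (measurableTypeR R) -> \bar R},
    [/\ forall x y, a <= x -> x <= y -> y <= b -> nu `]x, y]%classic = (h y - h x)%:E,
        forall A, measurable A -> nu A = nu (A `&` `]a, b]) &
        forall eps del : R, ac_modulus `]c, d[ h eps del ->
          forall A, measurable A -> A `<=` `]a, b]%classic ->
            (leb R A < del%:E)%E -> (`|nu A| <= eps%:E)%E].
Proof.
move=> hac ca ab bd.
have bv y : a <= y -> y <= b -> bounded_variation a y h.
  by move=> ay yb; apply: (abs_continuous_bounded_variation hac) => //; exact: le_lt_trans bd.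
have tvfin y : a <= y -> y <= b -> total_variation a y h \is a fin_num.
  by move=> ay yb; apply/bounded_variationP => //; exact: bv.
(* Clamping at [b], together with the value [0] below [a], extends the two variation functions to
   the line as constants outside [[a, b]]. *)
pose m (x : R) := Num.min x b.
pose Pf x := if x < a then 0 else fine (total_variation a (m x) h).
pose Nf x := if x < a then 0 else fine (total_variation a (m x) h) - (h (m x) - h a).
have mb x : m x <= b by rewrite /m ge_min lexx orbT.
have am x : a <= x -> a <= m x by move=> ax; rewrite /m le_min ax.
have mm x y : x <= y -> m x <= m y by move=> xy; rewrite /m le_min2.
have tvD x y : a <= x -> x <= y -> fine (total_variation a (m y) h) =
    fine (total_variation a (m x) h) + fine (total_variation (m x) (m y) h).
  move=> ax xy; rewrite (@total_variationD _ a _ (m x)) ?am ?mm//.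
  rewrite fineD ?tvfin ?am//; apply/bounded_variationP; first exact: mm.
  by apply: (abs_continuous_bounded_variation hac); rewrite ?mm ?(lt_le_trans ca) ?am ?(le_lt_trans (mb _)).
have tvge x y : a <= x -> x <= y ->
    `|h (m y) - h (m x)| <= fine (total_variation (m x) (m y) h).
  move=> ax xy; rewrite -lee_fin fineK ?total_variation_ge ?mm//.
  apply/bounded_variationP; first exact: mm.
  by apply: (abs_continuous_bounded_variation hac); rewrite ?mm ?(lt_le_trans ca) ?am ?(le_lt_trans (mb _)).
have Pnd : nondecreasing Pf.
  move=> x y xy; rewrite /Pf; case: ifPn => xa; case: ifPn => ya //.
  - rewrite fine_ge0// total_variation_ge0// am// leNgt//.
  - by move: xa; rewrite (le_lt_trans xy ya).
  - rewrite -leNgt in xa; rewrite (tvD x y)// lerDl.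
    by rewrite (le_trans (normr_ge0 _) (tvge _ _ xa xy)).
have Nnd : nondecreasing Nf.
  move=> x y xy; rewrite /Nf; case: ifPn => xa; case: ifPn => ya //.
  - have ay : a <= y by rewrite leNgt.
    have := @tvge a y (lexx _) ay.
    have -> : m a = a by rewrite /m; apply/min_idPl.
    by rewrite subr_ge0; apply: le_trans; exact: ler_norm.
  - by move: xa; rewrite (le_lt_trans xy ya).
  - rewrite -leNgt in xa; rewrite (tvD x y)//.
    by have := le_trans (ler_norm _) (tvge x y xa xy); lra.
have hrc x : a <= x -> x < b -> h (m t) @[t --> x^'+] --> h (m x).
  move=> ax xb; have -> : m x = x by apply/min_idPl/ltW.
  have := @abs_continuous_right _ _ _ _ x hac (lt_le_trans ca ax) (lt_trans xb bd).
  apply: cvg_trans; apply: near_eq_cvg; near=> t.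
  suff -> : m t = t by [].
  by apply/min_idPl; near: t; exact: nbhs_right_ltW.
have Prc : right_continuous Pf.
  move=> x; have [xa|ax] := ltP x a.
    apply: (@cvg_trans _ (cst (0 : R) t @[t --> x^'+])).
      apply: near_eq_cvg; near=> t; rewrite /Pf ifT//.
    by rewrite /Pf xa; exact: cvg_cst.
  have [xb|bx] := ltP x b; last first.
    apply: (@cvg_trans _ (cst (Pf x) t @[t --> x^'+])); last exact: cvg_cst.
    apply: near_eq_cvg; near=> t.
    have xt : x <= t by near: t; exact: nbhs_right_ge.
    rewrite /Pf !ifF ?ltNge ?ax ?(le_trans ax)//.
    rewrite /m (min_idPr bx) (min_idPr _)//; exact: le_trans xt.
  have -> : Pf x = fine (total_variation a x h).
    by rewrite /Pf ltNge ax/= /m (min_idPl _)// ltW.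
  have h1 : h t @[t --> x^'+] --> h x.
    exact: (abs_continuous_right hac (lt_le_trans ca ax) (lt_trans xb bd)).
  have := total_variation_right_continuous ax xb h1 (bv _ ab (lexx _)).
  apply: cvg_trans; apply: near_eq_cvg; near=> t.
  have xt : x <= t by near: t; exact: nbhs_right_ge.
  rewrite /Pf ifF; last by rewrite ltNge (le_trans ax).
  suff -> : m t = t by [].
  by apply/min_idPl; near: t; exact: nbhs_right_ltW.
have Nrc : right_continuous Nf.
  move=> x; have [xa|ax] := ltP x a.
    apply: (@cvg_trans _ (cst (0 : R) t @[t --> x^'+])).
      apply: near_eq_cvg; near=> t; rewrite /Nf ifT//.
    by rewrite /Nf xa; exact: cvg_cst.
  have -> : Nf = Pf \- (fun x => if x < a then 0 else h (m x) - h a).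
    by apply/funext => y; rewrite /Nf /Pf/=; case: ifPn; rewrite ?subr0.
  apply: cvgB; first exact: Prc.
  have [xb|bx] := ltP x b; last first.
    apply: (@cvg_trans _ (cst (h b - h a) t @[t --> x^'+])); last first.
      by rewrite ltNge ax/= /m (min_idPr bx); exact: cvg_cst.
    apply: near_eq_cvg; near=> t.
    have xt : x <= t by near: t; exact: nbhs_right_ge.
    rewrite ifF ?ltNge ?(le_trans ax)//.
    by rewrite /m (min_idPr _)//; exact: le_trans xt.
  rewrite ltNge ax/=; apply: (@cvg_trans _ ((h (m t) - h a) @[t --> x^'+])).
    apply: near_eq_cvg; near=> t.
    have xt : x <= t by near: t; exact: nbhs_right_ge.
    by rewrite ifF// ltNge (le_trans ax).
  by apply: cvgB; [exact: hrc|exact: cvg_cst].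
have [PC PCE] := cumulative_of Pnd Prc.
have [NC NCE] := cumulative_of Nnd Nrc.
(* The Stieltjes measure of [Qf] is the sum of Lebesgue measure and of the two variation measures.
   One approximation of [A] in this measure therefore controls lengths and [nu] alike. *)
pose Qf x := x + (Pf x + Nf x).
have Qnd : nondecreasing Qf.
  by move=> x y xy; rewrite /Qf lerD// lerD//; [exact: Pnd|exact: Nnd].
have Qrc : right_continuous Qf.
  move=> x; apply: cvgD; last by apply: cvgD; [exact: Prc|exact: Nrc].
  by apply: cvg_within_filter; exact: cvg_id.
have [QC QCE] := cumulative_of Qnd Qrc.
pose I := `]a, b]%classic : set (measurableTypeR R).
have mI : measurable I by exact: measurable_itv.
pose muP := lebesgue_stieltjes_measure PC.
pose muN := lebesgue_stieltjes_measure NC.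
have PI : (muP I < +oo)%E by rewrite /muP lebesgue_stieltjes_itvoc// ltry.
have NI : (muN I < +oo)%E by rewrite /muN lebesgue_stieltjes_itvoc// ltry.
pose nuP := charge_of_finite_measure (mfrestr mI PI).
pose nuN := charge_of_finite_measure (mfrestr mI NI).
pose nu : {charge set (measurableTypeR R) -> \bar R} := cadd nuP (copp nuN).
have nuE A : nu A = (muP (A `&` I) - muN (A `&` I))%E by [].
have nuoc x y : a <= x -> x <= y -> y <= b -> nu `]x, y]%classic = (h y - h x)%:E.
  move=> ax xy yb; rewrite nuE.
  have -> : `]x, y] `&` I = `]x, y]%classic.
    apply/setIidPl => z /=; rewrite !in_itv/= => /andP[xz zy].
    by rewrite /I/= in_itv/= (le_lt_trans ax)//= (le_trans zy).
  rewrite /muP /muN !lebesgue_stieltjes_itvoc// -EFinB; congr (_%:E).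
  rewrite PCE NCE /Pf /Nf !ifF; try by rewrite ltNge ?ax ?(le_trans ax).
  have -> : m x = x by apply/min_idPl/(le_trans xy).
  have -> : m y = y by apply/min_idPl.
  lra.
have nuI A : measurable A -> nu A = nu (A `&` I) by rewrite !nuE -!setIA setIid.
pose muQ := lebesgue_stieltjes_measure QC.
have muQE A : measurable A -> muQ A = (leb R A + (muP A + muN A))%E.
  move=> mA; have PNnd : nondecreasing (Pf \+ Nf).
    by move=> x y xy; rewrite /= lerD//; [exact: Pnd|exact: Nnd].
  have PNrc : right_continuous (Pf \+ Nf).
    by move=> x; apply: cvgD; [exact: Prc|exact: Nrc].
  have [PN PNE] := cumulative_of PNnd PNrc.
  rewrite /muQ (@lebesgue_stieltjes_add _ idfun PN) ?(@lebesgue_stieltjes_add _ PC NC PN)//.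
    by rewrite PNE PCE NCE.
  by rewrite QCE PNE.
have QI : (muQ I < +oo)%E by rewrite /muQ lebesgue_stieltjes_itvoc// ltry.
have QD V B : measurable V -> measurable B -> muQ V \is a fin_num -> B `<=` V ->
    muQ (V `\` B) = (muQ V - muQ B)%E.
  move=> mV mB Vf BV; have := @measureD _ _ R (lebesgue_stieltjes_measure QC) V B mV mB.
  by rewrite setIidr//; apply; rewrite -/muQ -ge0_fin_numE ?measure_ge0.
have nuQ A : measurable A -> A `<=` I -> (`|nu A| <= muQ A)%E.
  move=> mA AI; rewrite nuE (setIidl AI) muQE//.
  rewrite (le_trans (lee_abs_sub _ _))// !gee0_abs ?measure_ge0//.
  by rewrite leeDr// measure_ge0.
exists nu; split => // eps del0 ACdel A mA AI Adel.
apply/lee_addgt0Pr => k' k'0.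
have lA : leb R A \is a fin_num.
  by rewrite ge0_fin_numE ?measure_ge0// (lt_trans Adel) ?ltry.
(* Two errors of size [k] must fit into [k'], and adding [k] to the length of [A] must stay below
   [del0]. *)
pose k := Num.min (k' / 2) ((del0 - fine (leb R A)) / 2).
have k0 : 0 < k.
  by rewrite lt_min !divr_gt0 ?subr_gt0// -lte_fin fineK.
have kk' : k + k <= k' by rewrite [leRHS](splitr k') lerD// ge_min lexx.
have lAk : fine (leb R A) + k < del0.
  have : k <= (del0 - fine (leb R A)) / 2 by rewrite ge_min lexx orbT.
  have : fine (leb R A) < del0 by rewrite -lte_fin fineK.
  lra.
have QA : muQ A \is a fin_num.
  by rewrite ge0_fin_numE ?measure_ge0// (le_lt_trans _ QI)// le_measure ?inE.
(* [muQ A] is an infimum over countable covers by half-open intervals, and [F] is such a cover with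
   excess at most [k]. *)
have /ereal_inf_lt[_ [F [Fm AF] <-] /ltW Fle] : (muQ A < muQ A + k%:E)%E.
  by rewrite lteDl// lte_fin.
have mF i : measurable (F i : set (measurableTypeR R)).
  exact: sub_sigma_algebra.
pose U : set (measurableTypeR R) := \bigcup_i F i.
have mU : measurable U by exact: bigcupT_measurable.
pose V := U `&` I.
have mV : measurable V by exact: measurableI.
have AV : A `<=` V by move=> x Ax; split; [exact: AF|exact: AI].
have QV : (muQ V <= muQ A + k%:E)%E.
  apply: le_trans Fle; apply: (@le_trans _ _ (muQ U)).
    by rewrite le_measure ?inE//; exact: subIsetl.
  by apply: ereal_inf_lbound; exists F => //; split.
have QVf : muQ V \is a fin_num.
  by rewrite ge0_fin_numE ?measure_ge0// (le_lt_trans QV)// lte_add_pinfty ?ltry// -ge0_fin_numE ?measure_ge0.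
have dV B : measurable B -> B `<=` V -> (muQ V <= muQ B + k%:E)%E ->
    (`|nu V - nu B| <= k%:E)%E.
  move=> mB BV QB.
  have -> : (nu V - nu B = nu (V `\` B))%E.
    by rewrite chargeD// setIidr.
  rewrite (le_trans (nuQ _ _ _))//; first exact: measurableD.
    by move=> x [[]].
  rewrite QD// leeBlDr; first by rewrite addeC.
  by rewrite ge0_fin_numE ?measure_ge0// (le_lt_trans _ QI)// le_measure ?inE// => x /BV[].
(* Finitely many intervals of the cover. [W n] need not be comparable with [A], but both lie in [V]
   with [muQ] defect at most [k], so [V] serves as intermediary. *)
pose W n : set (measurableTypeR R) := \big[setU/set0]_(i < n) F i `&` I.
have mW n : measurable (W n).
  by apply: measurableI => //; exact: bigsetU_measurable.
have WV n : W n `<=` V.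
  by move=> x [+ Ix]; rewrite -bigcup_mkord => -[i _ Fi]; split => //; exists i.
have [n Wn] : exists n, (muQ V <= muQ (W n) + k%:E)%E.
  have cvgW : muQ (W n) @[n --> \oo] --> muQ V.
    have -> : V = \bigcup_n W n.
      rewrite /V /W /U; apply/seteqP; split => x.
        move=> [[i _ Fi] Ix]; exists i.+1 => //; split => //.
        by rewrite -bigcup_mkord; exists i => /=.
      by move=> [i _ []]; rewrite -bigcup_mkord => -[j _ Fj] Ix; split => //; exists j.
    apply: nondecreasing_cvg_mu => //.
      by rewrite -/V; exact: bigcupT_measurable.
    apply/nondecreasing_seqP => i; apply/subsetPset; apply: setSI.
    by rewrite big_ord_recr/=; exact: subsetUl.
  apply: contrapT => /forallNP nW.
  have : (limn (fun n => muQ (W n)) <= muQ V - k%:E)%E.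
    apply: lime_le; first by apply/cvg_ex; exists (muQ V).
    apply: nearW => n; rewrite leeBrDr//; apply: ltW; rewrite ltNge.
    by apply/negP/nW.
  by rewrite (cvg_lim _ cvgW)// leeBrDr// -(fineK QVf) -EFinD lee_fin gerDl leNgt k0.
have WI : W n `<=` I by move=> x [].
have lW : (leb R (W n) < del0%:E)%E.
  apply: (@le_lt_trans _ _ (leb R V)); first by rewrite le_measure ?inE//; exact: WV.
  have QA' : (muQ V <= muQ A + k%:E)%E := QV.
  have lVA : (leb R (V `\` A) <= k%:E)%E.
    apply: (@le_trans _ _ (muQ (V `\` A))).
      by rewrite muQE ?leeDl ?adde_ge0 ?measure_ge0//; exact: measurableD.
    by rewrite QD// leeBlDr// addeC.
  have -> : V = A `|` (V `\` A) by rewrite setDUK.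
  rewrite measureU//; [|exact: measurableD|by apply/seteqP; split=> x // [? []]].
  apply: (@le_lt_trans _ _ (fine (leb R A) + k)%:E).
    by rewrite EFinD fineK// leeD2l.
  by rewrite lte_fin.
have nuW : (`|nu (W n)| <= eps%:E)%E.
  pose f i := xget (0, 0) [set p : R * R | F i = `]p.1, p.2]%classic].
  have fE i : F i = `](f i).1, (f i).2]%classic.
    have [[x y] _ Fxy] := Fm i.
    by rewrite /f; case: xgetP => [p _ //|/(_ (x, y))]; case.
  have [t [N [tn t0 tN tab tX]]] := ocitv_union_grid [seq f i | i <- iota 0 n] ab.
  set X := (X in forall i, _ -> X `&` _ = _ \/ _) in tX.
  rewrite -/X in tX.
  have WX : W n = X `&` `]t 0%N, t N].
    rewrite t0 tN /W -bigcup_mkord; congr (_ `&` _).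
    apply/seteqP; split => x.
      move=> [i /= ni]; rewrite fE => xi; exists (f i) => //=.
      by apply/mapP; exists i => //; rewrite mem_iota.
    move=> [p /= /mapP[i]]; rewrite mem_iota/= add0n => ni -> xi.
    by exists i => //; rewrite fE.
  have mX : measurable (X : set (measurableTypeR R)).
    by apply: fin_bigcup_measurable => [|p _]; [exact: finite_seq|exact: measurable_itv].
  (* A cell outside [X] is kept as the degenerate interval [[t i, t i]]. The whole grid is then an
     admissible family for [ac_modulus], and such cells contribute [0] to both sums. *)
  pose w i := if pselect (X `&` `]t i, t i.+1] = `]t i, t i.+1]%classic) then t i.+1 else t i.
  have wE i : (i < N)%N -> X `&` `]t i, t i.+1] = `]t i, w i]%classic.
    by move=> /tX; rewrite /w; case: pselect => /= [Xi _|? [//|Xi]]; rewrite Xi// set_itvoc0.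
  have tw i : t i <= w i by rewrite /w; case: pselect.
  have wt i : w i <= t i.+1 by rewrite /w; case: pselect => /=.
  have wab i : a <= w i <= b by rewrite /w; case: pselect => /=.
  have lt : leb R (W n) = (\sum_(i < N) (w i - t i))%:E.
    rewrite WX (@additive_cells _ (leb R))//.
      rewrite -sumEFin; apply: eq_bigr => i _; rewrite wE//.
      by rewrite /lebesgue_measure lebesgue_stieltjes_itvoc.
    by move=> B C mB mC BC; rewrite measureU.
  have nt : nu (W n) = (\sum_(i < N) (h (w i) - h (t i)))%:E.
    rewrite WX (@additive_cells _ nu)//; [|exact: charge0|exact: chargeU].
    rewrite -sumEFin; apply: eq_bigr => i _; rewrite wE// nuoc//.
      by case/andP: (tab i).
    by case/andP: (wab i).
  rewrite nt lee_fin (le_trans (ler_norm_sum _ _ _))// ltW//.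
  apply: (ACdel N t w).
  - move=> i iN; split => //; rewrite /= in_itv/=.
      by case/andP: (tab i) => ? ?; rewrite (lt_le_trans ca)//= (le_lt_trans _ bd).
    by case/andP: (wab i) => ? ?; rewrite (lt_le_trans ca)//= (le_lt_trans _ bd).
  - by move=> i iN; exact: wt.
  - by rewrite -lte_fin -lt.
have -> : nu A = ((nu V - nu (W n)) - (nu V - nu A) + nu (W n))%E.
  have := fin_num_measure nu _ mV; have := fin_num_measure nu _ mA.
  have := fin_num_measure nu _ (mW n).
  move=> /fineK <- /fineK <- /fineK <-; rewrite -!EFinB -EFinD; congr (_%:E); ring.
apply: (le_trans (lee_abs_add _ _)); rewrite addeC leeD//.
apply: (le_trans (lee_abs_sub _ _)).
apply: (@le_trans _ _ (k%:E + k%:E)%E); last by rewrite -EFinD lee_fin.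
by apply: leeD; apply: dV.
Unshelve. all: by end_near. Qed.

(** Smallness of the charge on short sets makes it absolutely continuous, so it has a Radon-Nikodym
    density, and Lebesgue differentiation identifies the density with the derivative of [h]. The
    bound in the last clause is uniform in [a]; this yields integrability up to [0] later. *)
Lemma abs_continuous_density {R : realType} (c d a b : R) (h : R -> R) :
  abs_continuous `]c, d[ h -> c < a -> a < b -> b < d ->
  exists g : R -> R, [/\ (leb R).-integrable setT (EFin \o g),
    forall x y, a <= x -> x <= y -> y <= b -> h y - h x = \int[leb R]_(t in `]x, y]) g t,
    {ae leb R, forall x, a < x -> x < b -> is_derive x 1 h (g x)} &
    forall eps del : R, ac_modulus `]c, d[ h eps del -> b - a < del ->
      (\int[leb R]_(t in `]a, b]) `|(g t)%:E| <= (eps + eps)%:E)%E].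
Proof.
move=> hac ca ab bd.
have [nu [nuoc nuI nuac]] := abs_continuous_charge hac ca (ltW ab) bd.
have numu : nu `<< leb R.
  apply/null_content_dominatesP => A mA A0; rewrite nuI//.
  apply/eqP; rewrite -abse_eq0 eq_le abse_ge0 andbT.
  apply/lee_addgt0Pr => e e0; rewrite add0e.
  have [del del0 ace] := hac _ e0.
  apply: (nuac _ _ ace); first by apply: measurableI => //; exact: measurable_itv.
    exact: subIsetr.
  apply: (@le_lt_trans _ _ (leb R A)); last by rewrite A0 lte_fin.
  by rewrite le_measure ?inE//; apply: measurableI => //; exact: measurable_itv.
pose G := Radon_Nikodym nu (leb R).
have Gfin x : G x \is a fin_num := Radon_Nikodym_fin_num x numu.
have Gint : (leb R).-integrable setT G := Radon_Nikodym_integrable numu.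
have GE A : measurable A -> nu A = (\int[leb R]_(x in A) G x)%E := Radon_Nikodym_integral numu.
pose g x := fine (G x).
have gG : EFin \o g = G by apply/funext => x /=; rewrite fineK.
have gint : (leb R).-integrable setT (EFin \o g) by rewrite gG.
have ghE x y : a <= x -> x <= y -> y <= b -> h y - h x = \int[leb R]_(t in `]x, y]) g t.
  move=> ax xy yb; rewrite /Rintegral.
  have -> : (\int[leb R]_(t in `]x, y]) (g t)%:E = (h y - h x)%:E)%E; last by [].
  rewrite -nuoc// GE//.
  by apply: eq_integral => t _; rewrite -gG.
exists g; split => //.
- have gi y : (leb R).-integrable [set` Interval (BRight a) (BRight y)] (EFin \o g).
    exact: integrableS gint.
  have /= ftc := @FTC1 R g (BRight a) gi (open_integrable_locally openT gint).
  apply: aeS ftc => x ftcx ax xb; have [dF FE] := ftcx ax.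
  pose F y := \int[leb R]_(t in `]a, y]) g t.
  have FD : is_derive x 1 F (g x).
    by apply: DeriveDef; [exact: dF|rewrite -derive1E; exact: FE].
  apply: (@near_eq_is_derive _ _ _ (fun y => h a + F y)).
    near=> y; have ay : a < y by near: y; exact: lt_nbhsr.
    have yb : y < b by near: y; exact: lt_nbhsl.
    by rewrite /F -(ghE _ _ (lexx _) (ltW ay) (ltW yb)) addrC subrK.
  have -> : g x = 0 + g x by rewrite add0r.
  exact: is_deriveD.
- move=> eps del ace badel.
  pose I := `]a, b]%classic : set (measurableTypeR R).
  have mg : measurable_fun setT g.
    by apply/measurable_EFinP; exact: measurable_int gint.
  (* On a set where [g] keeps its sign, the integral of [|g|] is the absolute value of the charge of
     the set; each of the two sets contributes at most [eps]. *)
  pose A := I `&` [set x | 0 <= g x]; pose B := I `&` [set x | g x < 0].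
  have mA : measurable A.
    apply: measurableI; first exact: measurable_itv.
    by rewrite -[X in measurable X]setTI; exact: measurable_fun_le.
  have mB : measurable B.
    apply: measurableI; first exact: measurable_itv.
    by have := mg measurableT _ (measurable_itv `]-oo, 0[); rewrite setTI preimage_itvNyo.
  have IAB : I = A `|` B.
    rewrite -setIUr (_ : _ `|` _ = setT) ?setIT//; apply/seteqP; split => // x _ /=.
    by have [|] := leP 0 (g x); [left|right].
  have small D : measurable D -> D `<=` I -> (`|nu D| <= eps%:E)%E.
    move=> mD DI; apply: (nuac _ _ ace) => //.
    apply: (@le_lt_trans _ _ (leb R I)); first by rewrite le_measure ?inE//; exact: measurable_itv.
    by rewrite /I lebesgue_measure_itv/= lte_fin ab -EFinB lte_fin.
  rewrite -/I IAB ge0_integral_setU//; last 2 first.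
  + by apply: measurableT_comp => //; apply: measurable_funTS; exact/measurable_EFinP.
  + apply/disj_setPS => x [[_ /= g0] [_ /=]]; lra.
  rewrite EFinD leeD//.
    apply: le_trans (small A mA _); last exact: subIsetl.
    rewrite GE//; apply: le_trans (lee_abs _).
    have -> : (\int[leb R]_(x in A) `|(g x)%:E| = \int[leb R]_(x in A) G x)%E; last by [].
    by apply: eq_integral => x; rewrite inE => -[_ /= g0]; rewrite -gG/= ger0_norm.
  apply: le_trans (small B mB _); last exact: subIsetl.
  rewrite GE//.
  have -> : (\int[leb R]_(x in B) `|(g x)%:E| = \int[leb R]_(x in B) - G x)%E.
    by apply: eq_integral => x; rewrite inE => -[_ /= g0]; rewrite -gG/= ltr0_norm.
  rewrite integralN/=; last first.
    by apply: integrable_add_def => //; exact: integrableS Gint.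
  by rewrite -abseN lee_abs.
Unshelve. all: by end_near. Qed.

(* a version of the derivative that is measurable in all parameters *)
Definition upper_deriv {R : realType} (h : R -> R) (t : R) : R :=
  fine (limn_esup (fun k : nat => (k.+1%:R * (h (t + k.+1%:R^-1) - h t))%:E)).

Lemma upper_derivE {R : realType} (h : R -> R) (t l : R) :
  is_derive t 1 h l -> upper_deriv h t = l.
Proof.
move=> [dh hl]; rewrite /upper_deriv.
suff /cvg_limn_einf_sup[_ ->] :
  ((k.+1%:R * (h (t + k.+1%:R^-1) - h t))%:E @[k --> \oo] --> l%:E)%E by [].
apply: cvg_EFin; first exact: nearW.
have : (fun y => y^-1 *: (h (y *: 1 + t) - h t)) @ 0^' --> l by rewrite -hl.
move=> hy.
have h0 : harmonic @ \oo --> (0 : R)^'.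
  move=> A HA.
  have : \forall n \near \oo, harmonic n != 0 :> R -> A (harmonic n) by exact: cvg_harmonic HA.
  by apply: filterS => n; apply; rewrite /= invr_neq0.
have := cvg_comp _ _ h0 hy; apply: cvg_trans; apply: near_eq_cvg.
by near=> k; rewrite /= invrK /GRing.scale/= mulr1 (addrC t).
Unshelve. all: by end_near. Qed.

(** The family [h z] and the point [t z] vary together, so the lemma serves for one time variable as
    well as jointly in time and space. *)
Lemma measurable_upper_deriv {d} {T : measurableType d} {R : realType} (D : set T)
    (h : T -> R -> R) (t : T -> R) : measurable D ->
  (forall k : nat, measurable_fun D (fun z => h z (t z + k.+1%:R^-1))) ->
  measurable_fun D (fun z => h z (t z)) ->
  measurable_fun D (fun z => upper_deriv (h z) (t z)).
Proof.
move=> mD mh mh0; rewrite /upper_deriv.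
apply: (@measurableT_comp _ _ _ _ _ _ (@fine R)); first exact: fine_measurable.
apply: measurable_fun_limn_esup => k.
apply/measurable_EFinP; apply: measurable_funM; first exact: measurable_cst.
by apply: measurable_funB.
Qed.

Lemma abs_continuous_measurable {R : realType} (h : R -> R) :
  (forall T : R, 0 < T -> abs_continuous `]0, T[ h) ->
  forall k : R, 0 <= k -> measurable_fun (`]0, +oo[%classic : set R) (fun t : R => h (t + k)).
Proof.
move=> hac k k0; apply: open_continuous_measurable_fun; first exact: interval_open.
move=> x; rewrite inE/= in_itv/= andbT => x0.
apply: continuous_comp; last first.
  have x1 : 0 < x + k + 1 by rewrite addr_gt0// ltr_wpDr.
  by apply: (abs_continuous_cts (hac _ x1)); rewrite ?ltrDl// ltr_wpDr.
by apply: continuousD => //; exact: cst_continuous.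
Qed.

Lemma measurable_upper_deriv_ac {R : realType} (h : R -> R) :
  (forall T : R, 0 < T -> abs_continuous `]0, T[ h) ->
  measurable_fun (`]0, +oo[%classic : set R) (upper_deriv h).
Proof.
move=> hac; apply: (@measurable_upper_deriv _ _ _ _ (fun=> h) id) => //.
- by move=> k; apply: abs_continuous_measurable.
- have := abs_continuous_measurable hac (lexx 0).
  by rewrite (_ : (fun t : R => h (t + 0)) = h)//; apply/funext => t; rewrite addr0.
Qed.

Section fundamental_theorem.
Context {R : realType} (h : R -> R).
Context (hac : forall T : R, 0 < T -> abs_continuous `]0, T[ h).
Let w := upper_deriv h.

(** Wherever the derivative exists it equals [w], so the densities found on the intervals []1/(k+1),
    k+2[] agree almost everywhere with one function, and only countably many null sets are
    discarded. *)
Lemma abs_continuous_derive :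
  {ae leb R, forall t : R, 0 < t -> is_derive t 1 h (w t)}.
Proof.
have : forall k : nat, {ae leb R, forall x : R, k.+1%:R^-1 < x -> x < 1 + k.+1%:R ->
    is_derive x 1 h (w x)}.
  move=> k.
  have k0 : (0 : R) < k.+1%:R^-1 by rewrite invr_gt0.
  have k1 : k.+1%:R^-1 < 1 + k.+1%:R :> R.
    by rewrite (@le_lt_trans _ _ 1)// ?ltrDl// invf_le1// ler1n.
  have k2 : 1 + k.+1%:R < 2 + k.+1%:R :> R by rewrite ltrD2r ltr1n.
  have [g [_ _ gd _]] := abs_continuous_density (hac (lt_trans (lt_trans k0 k1) k2)) k0 k1 k2.
  apply: aeS gd => x gdx kx xk; have dx := gdx kx xk.
  by rewrite /w (upper_derivE dx).
move=> /ae_foralln; apply: aeS => x hx x0.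
have [k xk] : exists k : nat, k.+1%:R^-1 < x /\ x < 1 + k.+1%:R.
  exists (maxn (Num.bound x) (Num.bound x^-1)); split.
    rewrite invf_plt ?posrE//; apply: lt_le_trans (archi_boundP _) _; first by rewrite invr_ge0 ltW.
    by rewrite ler_nat ltnW// ltnS leq_maxr.
  apply: lt_le_trans (archi_boundP (ltW x0)) _.
  by rewrite -nat1r addrA ler_wpDl// ler_nat leq_maxl.
by case: xk => *; exact: (hx k).
Qed.

Lemma abs_continuous_ftc x y : 0 < x -> x <= y ->
  (leb R).-integrable `]x, y] (EFin \o w) /\
  h y - h x = \int[leb R]_(t in `]x, y]) w t.
Proof.
move=> x0; rewrite le_eqVlt => /predU1P[<-|xy].
  rewrite subrr set_itvoc0 Rintegral_set0; split => //.
  exact: integrable_set0.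
have y1 : y < y + 1 by rewrite ltrDl.
have [g [gint hg gd _]] := abs_continuous_density (hac (lt_trans (lt_trans x0 xy) y1)) x0 xy y1.
have gw : {ae leb R, forall t, `]x, y]%classic t -> (EFin \o g) t = (EFin \o w) t}.
  apply: aeS (aeI gd (ae_neq y)) => t [gdt ty]; rewrite /= in_itv/= => /andP[xt].
  rewrite le_eqVlt => /orP[/eqP//|tly].
  by rewrite /w (upper_derivE (gdt xt tly)).
have mw : measurable_fun `]x, y] (EFin \o w).
  apply/measurable_EFinP; apply: measurable_funS (measurable_upper_deriv_ac hac) => //.
  by move=> t /=; rewrite !in_itv/= andbT => /andP[xt _]; exact: lt_trans xt.
have gi : (leb R).-integrable `]x, y] (EFin \o g) by exact: integrableS gint.
split.
  by apply: (ae_eq_integrable _ _ _ gw) => //; exact: measurable_int gi.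
rewrite (hg _ _ (lexx _) (ltW xy) (lexx _)) /Rintegral; congr fine.
by apply: ae_eq_integral gw => //; exact: measurable_int gi.
Qed.

(** The condition on [h] says nothing at [0] itself. Integrability near [0] comes from the modulus
    for [eps = 1]: with [k] below the modulus, the integral of the absolute derivative over []a, k]]
    is at most [2] for every [a], and [a] tends to [0]. *)
Lemma abs_continuous_derive_integrable T : (leb R).-integrable `]0, T] (EFin \o w).
Proof.
have [T0|T0] := leP T 0.
  by rewrite set_itv_ge ?bnd_simp -?leNgt//; exact: integrable_set0.
have T1 : 0 < T + 1 by rewrite addr_gt0.
have [del del0 ace] := hac T1 ltr01.
pose k := Num.min (del / 2) T.
have k0 : 0 < k by rewrite lt_min divr_gt0.
have kT : k <= T by rewrite ge_min lexx orbT.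
have kdel : k < del by rewrite gt_min ltr_pdivrMr// ltr_pMr// ltr1n.
have mw (D : set R) : measurable D -> D `<=` `]0, +oo[ -> measurable_fun D (EFin \o w).
  move=> mD D0; apply/measurable_EFinP.
  exact: measurable_funS (measurable_upper_deriv_ac hac).
have -> : `]0, T]%classic = `]0, k] `|` `]k, T] :> set R.
  apply/seteqP; split => t /=; rewrite !in_itv/=.
    by move=> /andP[-> tT]; have [|kt] := leP t k; [left|right].
  by case=> /andP[h1 h2]; rewrite ?h1 ?h2 ?(le_trans h2)// (lt_trans k0).
have [ikT _] := abs_continuous_ftc k0 kT.
apply/integrableP; split.
  apply: mw; first by apply: measurableU; exact: measurable_itv.
  by move=> t [] /=; rewrite !in_itv/= andbT => /andP[h1 _]//; exact: lt_trans h1.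
rewrite ge0_integral_setU//; last 2 first.
- apply: measurableT_comp => //; apply: mw; first by apply: measurableU; exact: measurable_itv.
  by move=> t [] /=; rewrite !in_itv/= andbT => /andP[h1 _]//; exact: lt_trans h1.
- apply/disj_setPS => t []/=; rewrite !in_itv/= => /andP[_ tk] /andP[kt _].
  by move: (le_lt_trans tk kt); rewrite ltxx.
apply: lte_add_pinfty; last by have /integrableP[] := ikT.
pose I n := `]k / n.+2%:R, k]%classic : set R.
have UI : \bigcup_n I n = `]0, k]%classic.
  apply/seteqP; split => t.
    move=> [n _]; rewrite /I/= !in_itv/= => /andP[nt ->]; rewrite andbT.
    by apply: lt_trans nt; rewrite divr_gt0.
  rewrite /= in_itv/= => /andP[t0 tk]; exists (Num.bound (k / t)) => //.
  rewrite /I/= in_itv/= tk andbT ltr_pdivrMr// -ltr_pdivrMl// mulrC.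
  apply: lt_le_trans (archi_boundP _) _; first by rewrite divr_ge0// ltW.
  by rewrite ler_nat ltnW// ltnW.
have cvgI : (\int[leb R]_(x in I n) `|(w x)%:E| @[n --> \oo] -->
    \int[leb R]_(x in `]0%R, k]) `|(w x)%:E|)%E.
  rewrite -UI; apply: ge0_nondecreasing_set_cvg_integral => //.
  - apply/nondecreasing_seqP => n; apply/subsetPset => t; rewrite /I/= !in_itv/=.
    move=> /andP[nt ->]; rewrite andbT (le_lt_trans _ nt)//.
    by rewrite ler_pM2l// lef_pV2 ?posrE// ler_nat.
  - by move=> n; exact: measurable_itv.
  - move=> n; apply: measurableT_comp => //; apply: mw; first exact: measurable_itv.
    move=> t; rewrite /I/= !in_itv/= andbT => /andP[nt _].
    by apply: lt_trans nt; rewrite divr_gt0.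
suff : (\int[leb R]_(x in `]0%R, k]) `|(w x)%:E| <= (1 + 1)%:E)%E.
  by move=> /le_lt_trans; apply; rewrite ltry.
rewrite -(cvg_lim _ cvgI)//; apply: lime_le; first by apply/cvg_ex; eexists; exact: cvgI.
apply: nearW => n; rewrite /I.
set a := k / n.+2%:R.
have a0 : 0 < a by rewrite divr_gt0.
have ak : a < k by rewrite ltr_pdivrMr// ltr_pMr// ltr1n.
have kT1 : k < T + 1 by rewrite (le_lt_trans kT)// ltrDl.
have [g [gint hg gd gle]] := abs_continuous_density (hac T1) a0 ak kT1.
apply: le_trans (gle _ _ ace _); last by rewrite (lt_trans _ kdel)// ltrBlDr ltrDl.
have aw (D : set R) : D = `]a, k]%classic -> measurable_fun D (EFin \o w).
  move=> ->; apply: mw; first exact: measurable_itv.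
  by move=> t; rewrite /= !in_itv/= andbT => /andP[nt _]; exact: lt_trans nt.
have -> : (\int[leb R]_(x in `]a, k]) `|(w x)%:E| =
  \int[leb R]_(x in `]a, k]) `|(g x)%:E|)%E; last by [].
apply: ae_eq_integral => //.
- by apply: measurableT_comp => //; exact: aw.
- apply: measurableT_comp => //.
  by apply: measurable_funTS; exact: measurable_int gint.
- apply: aeS (aeI gd (ae_neq k)) => t [gdt ty]; rewrite /= in_itv/= => /andP[xt].
  rewrite le_eqVlt => /orP[/eqP//|tly].
  by rewrite /w (upper_derivE (gdt xt tly)).
Qed.
End fundamental_theorem.

(** * Integration on the line and Fubini *)

Section real_fubini.
Context {d1 d2} {T1 : measurableType d1} {T2 : measurableType d2} {R : realType}.
Context (m1 : {sigma_finite_measure set T1 -> \bar R}).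
Context (m2 : {sigma_finite_measure set T2 -> \bar R}).
Implicit Types F : T1 * T2 -> R.

Lemma measurable_Rintegral_snd F : measurable_fun setT F ->
  measurable_fun setT (fun x => \int[m2]_y F (x, y)).
Proof.
move=> /measurable_EFinP mF; apply: measurableT_comp => //.
have -> : (fun x => \int[m2]_y (F (x, y))%:E)%E =
   (fun x => \int[m2]_y ((EFin \o F)^\+%E (x, y)) - \int[m2]_y ((EFin \o F)^\-%E (x, y)))%E.
  apply/funext => x; rewrite integralE.
  by congr (_ - _)%E; apply: eq_integral => y _; rewrite ?funeposE ?funenegE.
apply: emeasurable_funB.
  by apply: (measurable_fun_fubini_tonelli_F (EFin \o F)^\+%E) => //; exact: measurable_funepos.
by apply: (measurable_fun_fubini_tonelli_F (EFin \o F)^\-%E) => //; exact: measurable_funeneg.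
Qed.

Lemma integrable_Rintegral_snd F : (m1 \x m2)%E.-integrable setT (EFin \o F) ->
  m1.-integrable setT (EFin \o (fun x => \int[m2]_y F (x, y))).
Proof.
move=> iF; have iF1 := integrable_fubini_F iF.
have mF : measurable_fun setT F by apply/measurable_EFinP; exact: measurable_int iF.
apply: (ae_eq_integrable _ _ _ _ iF1) => //.
- exact: measurable_int iF1.
- by apply/measurable_EFinP; exact: measurable_Rintegral_snd.
- apply: aeS (integrable_ae measurableT iF1) => x fx _.
  by rewrite /= /Rintegral fineK//; exact: fx.
Qed.

Lemma Rintegral_snd_prod F : (m1 \x m2)%E.-integrable setT (EFin \o F) ->
  \int[m1]_x \int[m2]_y F (x, y) = fine (\int[(m1 \x m2)%E]_z (F z)%:E)%E.
Proof.
move=> iF; have iF1 := integrable_fubini_F iF.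
rewrite /Rintegral -(integral12_prod_meas1 iF); congr fine.
apply: ae_eq_integral => //.
- exact: measurable_int (integrable_Rintegral_snd iF).
- exact: measurable_int iF1.
- apply: aeS (integrable_ae measurableT iF1) => x fx _.
  by rewrite /= fineK//; exact: fx.
Qed.

End real_fubini.

Section real_fubini_swap.
Context {d1 d2} {T1 : measurableType d1} {T2 : measurableType d2} {R : realType}.
Context (m1 : {sigma_finite_measure set T1 -> \bar R}).
Context (m2 : {sigma_finite_measure set T2 -> \bar R}).
Implicit Types F : T1 * T2 -> R.

Lemma measurable_Rintegral_fst F : measurable_fun setT F ->
  measurable_fun setT (fun y => \int[m1]_x F (x, y)).
Proof.
move=> mF; apply: (measurable_Rintegral_snd m1 (F := F \o (fun z => (z.2, z.1)))).
by apply: (measurableT_comp mF); exact: measurable_fun_pair.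
Qed.

Lemma integrable_prod_swap F : (m1 \x m2)%E.-integrable setT (EFin \o F) ->
  (m2 \x m1)%E.-integrable setT (EFin \o (F \o (fun z => (z.2, z.1)))).
Proof.
move=> iF; have mF : measurable_fun setT (EFin \o F) by exact: measurable_int iF.
have mF' : measurable_fun setT (EFin \o (F \o (fun z => (z.2, z.1)))).
  by apply: (measurableT_comp mF); exact: measurable_fun_pair.
by apply/(integrable12ltyP _ _ mF')/(integrable21ltyP _ _ mF).
Qed.

Lemma integrable_Rintegral_fst F : (m1 \x m2)%E.-integrable setT (EFin \o F) ->
  m2.-integrable setT (EFin \o (fun y => \int[m1]_x F (x, y))).
Proof. by move=> /integrable_prod_swap /integrable_Rintegral_snd. Qed.

Lemma Rfubini F : (m1 \x m2)%E.-integrable setT (EFin \o F) ->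
  \int[m1]_x \int[m2]_y F (x, y) = \int[m2]_y \int[m1]_x F (x, y).
Proof.
move=> iF; rewrite Rintegral_snd_prod//.
have /Rintegral_snd_prod /= -> := integrable_prod_swap iF.
rewrite -(integral12_prod_meas1 iF) -(integral12_prod_meas1 (integrable_prod_swap iF)).
by rewrite Fubini.
Qed.

Lemma integrable_prod_of_ge0 F : measurable_fun setT F ->
  (\int[m1]_x \int[m2]_y `|F (x, y)|%:E < +oo)%E ->
  (m1 \x m2)%E.-integrable setT (EFin \o F).
Proof. by move=> mF h; apply/integrable12ltyP => //; apply/measurable_EFinP. Qed.

End real_fubini_swap.

Section lebesgue_affine.
Context {R : realType}.
Local Notation mu := (leb R).

(** Translations, reflections and dilations are all handled by this criterion: Lebesgue measure is
    determined by its values on half-open intervals. *)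
Lemma lebesgue_pushforward (k : {nonneg R}) (phi : R -> R) :
  measurable_fun setT phi ->
  (forall x y, x <= y -> (k%:num%:E * mu (phi @^-1` `]x, y]) = (y - x)%:E)%E) ->
  forall A, measurable A -> mu A = (k%:num%:E * mu (phi @^-1` A))%E.
Proof.
move=> mphi phiE A mA.
pose mx := isMeasurableFun.Build _ _ (measurableTypeR R) (measurableTypeR R) phi mphi.
pose f : {mfun measurableTypeR R >-> measurableTypeR R} :=
  HB.pack_for {mfun measurableTypeR R >-> measurableTypeR R} phi mx.
have := @lebesgue_measure_unique R (mscale k (pushforward mu f)) _ A mA.
apply => _ [[x y] _ <-].
rewrite /=; change (mu `]x, y]%classic = k%:num%:E * mu (phi @^-1` `]x, y]))%E.
have [xy|yx] := leP x y; last first.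
  have E0 : `]x, y]%classic = set0 :> set R.
    by rewrite set_itv_ge// bnd_simp -leNgt ltW.
  by rewrite /= E0 preimage_set0 !measure0 mule0.
have := phiE _ _ xy; rewrite /f/= => ->.
by rewrite lebesgue_measure_itv/= lte_fin; case: ltP => // yx; rewrite (le_anti (introT andP (conj xy yx))) subrr.
Qed.

Lemma ge0_integral_lebesgue_map (k : {nonneg R}) (phi : R -> R) (f : R -> \bar R) :
  measurable_fun setT phi ->
  (forall x y, x <= y -> (k%:num%:E * mu (phi @^-1` `]x, y]) = (y - x)%:E)%E) ->
  measurable_fun setT f -> (forall x, (0 <= f x)%E) ->
  (\int[mu]_x f x = k%:num%:E * \int[mu]_x f (phi x))%E.
Proof.
move=> mphi phiE mf f0.
pose mx := isMeasurableFun.Build _ _ (measurableTypeR R) (measurableTypeR R) phi mphi.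
pose g : {mfun measurableTypeR R >-> measurableTypeR R} :=
  HB.pack_for {mfun measurableTypeR R >-> measurableTypeR R} phi mx.
have -> : (\int[mu]_x f (phi x) = \int[pushforward mu g]_x f x)%E.
  by rewrite ge0_integral_pushforward// preimage_setT.
rewrite -(ge0_integral_mscale (pushforward mu g) measurableT k)//.
by apply: eq_measure_integral => A mA _; exact: lebesgue_pushforward.
Qed.

Lemma ge0_integral_shift (a : R) (f : R -> \bar R) :
  measurable_fun setT f -> (forall x, (0 <= f x)%E) ->
  (\int[mu]_x f (x + a)%R = \int[mu]_x f x)%E.
Proof.
move=> mf f0; rewrite [RHS](@ge0_integral_lebesgue_map 1%:nng (fun x => x + a))//.
- by rewrite mul1e.
- exact: measurable_funD.
- move=> x y xy; rewrite mul1e.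
  have -> : (fun x : R => x + a) @^-1` `]x, y] = `]x - a, y - a]%classic.
    by apply/seteqP; split => z /=; rewrite !in_itv/= ltrBlDr lerBrDr.
  rewrite lebesgue_measure_itv/= !lte_fin ltrD2r; case: ltP => yx.
    by rewrite -!EFinB; congr EFin; ring.
  by rewrite (le_anti (introT andP (conj xy yx))) subrr.
Qed.

Lemma ge0_integral_opp (f : R -> \bar R) :
  measurable_fun setT f -> (forall x, (0 <= f x)%E) ->
  (\int[mu]_x f (- x)%R = \int[mu]_x f x)%E.
Proof.
move=> mf f0; rewrite [RHS](@ge0_integral_lebesgue_map 1%:nng (fun x => - x))//.
- by rewrite mul1e.
- exact: oppr_measurable.
- move=> x y xy; rewrite mul1e.
  have -> : (fun x : R => - x) @^-1` `]x, y] = `[- y, - x[%classic.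
    by apply/seteqP; split => z /=; rewrite !in_itv/= lerNl ltrNr andbC.
  rewrite lebesgue_measure_itv/= !lte_fin ltrN2; case: ltP => yx.
    by rewrite -!EFinB; congr EFin; ring.
  by rewrite (le_anti (introT andP (conj xy yx))) subrr.
Qed.

Lemma ge0_integral_scale (c : R) (f : R -> \bar R) : 0 < c ->
  measurable_fun setT f -> (forall x, (0 <= f x)%E) ->
  (\int[mu]_x f (c * x)%R = c^-1%:E * \int[mu]_x f x)%E.
Proof.
move=> c0 mf f0.
rewrite [X in (_ * X)%E](@ge0_integral_lebesgue_map (NngNum (ltW c0)) (fun x => c * x))//=.
- by rewrite muleA -EFinM mulVf ?gt_eqF// mul1e.
- exact: measurable_funM.
- move=> x y xy.
  have -> : (fun x : R => c * x) @^-1` `]x, y] = `]x / c, y / c]%classic.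
    by apply/seteqP; split => z /=; rewrite !in_itv/= ltr_pdivrMr// ler_pdivlMr// mulrC.
  rewrite lebesgue_measure_itv/= !lte_fin ltr_pM2r ?invr_gt0//; case: ltP => yx.
    by rewrite -EFinB -EFinM -mulrBl mulrC divfK ?gt_eqF.
  by rewrite (le_anti (introT andP (conj xy yx))) subrr mule0.
Qed.

Lemma integral_shift (a : R) (f : R -> \bar R) : measurable_fun setT f ->
  (\int[mu]_x f (x + a)%R = \int[mu]_x f x)%E.
Proof.
move=> mf; rewrite integralE [RHS]integralE; congr (_ - _)%E.
  rewrite -[RHS](ge0_integral_shift a) //; last exact: measurable_funepos.
  by apply: eq_integral => x _; rewrite !funeposE.
rewrite -[RHS](ge0_integral_shift a) //; last exact: measurable_funeneg.
by apply: eq_integral => x _; rewrite !funenegE.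
Qed.

Lemma Rintegral_shift (a : R) (f : R -> R) : measurable_fun setT f ->
  \int[mu]_x f (x + a) = \int[mu]_x f x.
Proof.
move=> mf; rewrite /Rintegral; congr fine.
by rewrite -(integral_shift a (f := EFin \o f))//; exact/measurable_EFinP.
Qed.

Lemma integrable_shift (a : R) (f : R -> R) : mu.-integrable setT (EFin \o f) ->
  mu.-integrable setT (EFin \o (fun x => f (x + a))).
Proof.
move=> /[dup] /measurable_int mf /integrableP[_ fi].
apply/integrableP; split.
  by apply: (measurableT_comp mf); exact: measurable_funD.
rewrite (ge0_integral_shift a (f := fun x => `|(f x)%:E|%E))//.
exact: measurableT_comp.
Qed.

End lebesgue_affine.

Section integral_ae_eq_nonmeasurable.
Context {d} {T : measurableType d} {R : realType} (mu : {measure set T -> \bar R}).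
Import HBNNSimple.

(* [f] need not be measurable, so the library's [ge0_ae_eq_integral] does not apply *)
Lemma ge0_ae_eq_integral_nonmeasurable (f g : T -> \bar R) :
  (forall x, 0 <= f x)%E -> (forall x, 0 <= g x)%E ->
  {ae mu, forall x, f x = g x} -> (\int[mu]_x f x <= \int[mu]_x g x)%E.
Proof.
move=> f0 g0 [N [mN N0 fgN]].
rewrite ge0_integralTE// [leRHS]ge0_integralTE//.
apply: ge_ereal_sup => _ [h /= hf <-].
(* A simple function below [f] is cut to [0] on the exceptional null set: its integral is unchanged
   and it now lies below [g]. *)
pose mNc := measurableC mN.
pose h' := mul_nnsfun h (indic_nnsfun R mNc).
have h'h : sintegral mu h = sintegral mu h'.
  rewrite -!integralT_nnsfun.
  apply: ge0_ae_eq_integral => //.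
  - by apply/measurable_EFinP; exact: measurable_funP.
  - by apply/measurable_EFinP; exact: measurable_funP.
  - by move=> x _; rewrite lee_fin.
  - by move=> x _; rewrite lee_fin.
  - exists N; split => // x /= hx; apply: contrapT => xN; apply: hx => _.
    by rewrite /h'/= mindicE mem_set// mulr1.
rewrite h'h; apply: ereal_sup_ubound; exists h' => //= x.
rewrite mindicE; have [xN|xN] := pselect (N x).
  by rewrite memNset ?mulr0//= => /(_ xN).
rewrite mem_set// mulr1.
have <- : f x = g x by apply: contrapT => fgx; apply: xN; exact: fgN.
exact: hf.
Qed.

(** Meant for integrands known only almost everywhere, such as Caputo integrands or [Ztel], for
    which measurability is not at hand. *)
Lemma ae_eq_integral_nonmeasurable (D : set T) (f g : T -> \bar R) :
  {ae mu, forall x, D x -> f x = g x} ->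
  (\int[mu]_(x in D) f x = \int[mu]_(x in D) g x)%E.
Proof.
move=> fg; rewrite integral_mkcond [RHS]integral_mkcond.
have {}fg : {ae mu, forall x, (f \_ D) x = (g \_ D) x}.
  by apply: aeS fg => x fgx; rewrite !patchE; case: ifPn => // /set_mem.
rewrite integralE [RHS]integralE; congr (_ - _)%E; apply/eqP; rewrite eq_le;
  apply/andP; split; apply: ge0_ae_eq_integral_nonmeasurable => //;
  apply: aeS fg => x fgx; by rewrite ?funeposE ?funenegE fgx.
Qed.

End integral_ae_eq_nonmeasurable.

(** * Fractional integrals *)

Section exponential_integral.
Context {R : realType}.

(** Functions of time are extended by [0] to the whole line, so that Laplace transforms and
    convolutions are integrals over [R] to which Fubini applies without bookkeeping of domains. *)
Definition posexp (s t : R) : R := if 0 < t then expR (- s * t) else 0.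

Lemma posexp_ge0 s t : 0 <= posexp s t.
Proof. by rewrite /posexp; case: ifP => // _; exact: expR_ge0. Qed.

Lemma measurable_pos_if (f : R -> R) : measurable_fun (`]0, +oo[%classic : set R) f ->
  measurable_fun setT (fun t : R => if 0 < t then f t else 0).
Proof.
move=> mf; have -> : (fun t : R => if 0 < t then f t else 0) = f \_ `]0, +oo[.
  by apply/funext => t; rewrite patchE mem_setE in_itv/= andbT.
by apply/(measurable_restrictT _ (measurable_itv _)).
Qed.

Lemma measurable_posexp s : measurable_fun setT (posexp s).
Proof.
apply: measurable_pos_if; apply: measurable_funTS.
by apply: measurableT_comp => //; exact: measurable_funM.
Qed.

Lemma integral_posexp s : 0 < s -> (\int[leb R]_t (posexp s t)%:E = (s^-1)%:E)%E.
Proof.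
move=> s0.
have := integral_exponential_pdf s0.
have -> : (\int[leb R]_x (exponential_pdf s x)%:E = \int[leb R]_x (s%:E * (posexp s x)%:E))%E.
  apply: ge0_ae_eq_integral => //.
  - by apply/measurable_EFinP; exact: measurable_exponential_pdf.
  - apply/measurable_EFinP/measurable_funM => //; exact: measurable_posexp.
  - by move=> x _; rewrite lee_fin exponential_pdf_ge0// ltW.
  - by move=> x _; rewrite -EFinM lee_fin mulr_ge0 ?posexp_ge0// ltW.
  - apply: aeS (ae_neq 0) => x /eqP x0 _; rewrite -EFinM; congr EFin.
    rewrite /posexp; case: ltgtP x0 => // x0 _.
      by rewrite exponential_pdfE// ltW.
    by rewrite lt0_exponential_pdf// mulr0.
rewrite ge0_integralZl ?lee_fin ?ltW//; last 2 first.
- by apply/measurable_EFinP; exact: measurable_posexp.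
- by move=> x _; rewrite lee_fin posexp_ge0.
move=> /(congr1 (fun x => s^-1%:E * x)%E).
by rewrite muleA -EFinM mulVf ?gt_eqF// mul1e mule1.
Qed.

End exponential_integral.

Section power_kernel.
Context {R : realType}.
Implicit Types a b s t : R.
Local Notation mu := (leb R).

Definition pker a t : R := if 0 < t then t `^ (a - 1) else 0.

Lemma pker_ge0 a t : 0 <= pker a t.
Proof. by rewrite /pker; case: ifP => // _; exact: powR_ge0. Qed.

Lemma pker_le0 a t : t <= 0 -> pker a t = 0.
Proof. by move=> t0; rewrite /pker ltNge t0. Qed.

Lemma measurable_pker a : measurable_fun setT (pker a).
Proof. by apply: measurable_pos_if; apply: measurable_funTS; exact: measurable_powR. Qed.

Lemma pker1 t : pker 1 t = if 0 < t then 1 else 0.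
Proof. by rewrite /pker subrr powRr0. Qed.

Lemma pkerM a t u : 0 < t -> pker a (t * u) = t `^ (a - 1) * pker a u.
Proof.
move=> t0; rewrite /pker pmulr_rgt0//; case: ifP => u0; last by rewrite mulr0.
by rewrite powRM// ltW.
Qed.

(** Extended-real values: the Tonelli identities below hold before finiteness is known, and
    finiteness for [a > 0] is proved afterwards. *)
Definition eGamma a : \bar R := (\int[mu]_t (pker a t * expR (- t))%:E)%E.

Lemma eGamma_Gamma a : fine (eGamma a) = Gamma a.
Proof.
rewrite /Gamma /Rintegral [in RHS]integral_mkcond; congr fine.
apply: eq_integral => t _; rewrite patchE mem_setE in_itv/= andbT /pker.
by case: ifP => // _; rewrite mul0r.
Qed.

Lemma integral_pker_laplace a s : 0 < s ->
  (\int[mu]_t (pker a t * expR (- s * t))%:E = (s `^ (- a))%:E * eGamma a)%E.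
Proof.
move=> s0.
have mf : measurable_fun setT (fun t => (pker a t * expR (- t))%:E).
  apply/measurable_EFinP/measurable_funM; first exact: measurable_pker.
  by apply: measurableT_comp => //; exact: oppr_measurable.
have f0 t : (0 <= (pker a t * expR (- t))%:E)%E.
  by rewrite lee_fin mulr_ge0 ?pker_ge0 ?expR_ge0.
have := ge0_integral_scale s0 mf f0; rewrite -/(eGamma a) => h.
rewrite (_ : (s `^ (- a))%:E * _ = (s * s `^ (- a))%:E * (s^-1%:E * eGamma a))%E; last first.
  by rewrite muleA -EFinM mulrAC mulfV ?gt_eqF// mul1r.
rewrite -h -ge0_integralZl_R.
- apply: eq_integral => t _; congr EFin.
  rewrite pkerM// mulNr !mulrA; congr (_ * _).
  suff -> : s * s `^ (- a) * s `^ (a - 1) = 1 by rewrite mul1r.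
  have sn0 : s != 0 by rewrite gt_eqF.
  rewrite -{1}(powRr1 (ltW s0)) -!powRD ?sn0 ?implybT//.
  by rewrite (_ : _ + _ + _ = 0) ?powRr0//; ring.
- by rewrite mulr_ge0 ?powR_ge0// ltW.
- apply/measurable_EFinP/(measurableT_comp mf); exact: measurable_funM.
- by move=> t; rewrite -lee_fin.
Qed.

Definition eBeta a b : \bar R := (\int[mu]_s (pker a (1 - s) * pker b s)%:E)%E.

Lemma integral_pker_conv a b t :
  (\int[mu]_s (pker a (t - s) * pker b s)%:E = (pker (a + b) t)%:E * eBeta a b)%E.
Proof.
have [t0|t0] := leP t 0.
  rewrite pker_le0// mul0e integral0_eq// => s _; congr EFin.
  have [s0|s0] := leP s 0; first by rewrite [pker b s]pker_le0// mulr0.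
  by rewrite pker_le0 ?mul0r// subr_le0 (le_trans t0)// ltW.
have tn0 : t != 0 by rewrite gt_eqF.
have mr c : measurable_fun setT (fun s : R => pker a (c - s) * pker b s).
  apply: measurable_funM; last exact: measurable_pker.
  by apply: (measurableT_comp (measurable_pker a)); exact: measurable_funB.
have r0 c s : 0 <= pker a (c - s) * pker b s by rewrite mulr_ge0 ?pker_ge0.
have mt : measurable_fun setT (fun s : R => pker a (t - t * s) * pker b (t * s)).
  by apply: (measurableT_comp (mr t)); exact: measurable_funM.
have rE0 s : (0 <= (pker a (t - s) * pker b s)%:E)%E by rewrite lee_fin.
have mE : measurable_fun setT (fun s : R => (pker a (t - s) * pker b s)%:E).
  by apply/measurable_EFinP; exact: mr.
have scale := ge0_integral_scale t0 mE rE0.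
have E1 := @ge0_integralZl_R _ _ _ mu t _ (ltW t0) mt (fun s => r0 t (t * s)).
have E2 := @ge0_integralZl_R _ _ _ mu (pker (a + b) t) _ (pker_ge0 _ _) (mr 1) (r0 1).
transitivity (t%:E * \int[mu]_s (pker a (t - t * s) * pker b (t * s))%:E)%E.
  by rewrite scale muleA -EFinM (mulfV tn0) mul1e.
rewrite -E1 /eBeta -E2; apply: eq_integral => s _; congr EFin.
have -> : t - t * s = t * (1 - s) by ring.
have -> : pker (a + b) t = t * t `^ (a - 1) * t `^ (b - 1).
  rewrite /pker t0 (_ : a + b - 1 = 1 + (a - 1) + (b - 1)); last by ring.
  rewrite (@powRD _ t (1 + (a - 1)) (b - 1)) ?tn0 ?implybT//.
  by rewrite (@powRD _ t 1 (a - 1)) ?tn0 ?implybT// (powRr1 (ltW t0)).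
rewrite !pkerM//; move: (pker a (1 - s)) (pker b s) => x y; ring.
Qed.

(** The convolution of [pker a t * expR (- t)] with [pker b t * expR (- t)] is integrated twice:
    over the product it gives the two Gamma factors, along the convolution it gives the Beta
    integral. *)
Lemma eGammaM a b : (eGamma a * eGamma b = eGamma (a + b) * eBeta a b)%E.
Proof.
pose g c := fun t => pker c t * expR (- t).
have mg c : measurable_fun setT (g c).
  apply: measurable_funM; first exact: measurable_pker.
  by apply: measurableT_comp => //; exact: oppr_measurable.
have g0 c t : 0 <= g c t by rewrite mulr_ge0 ?pker_ge0 ?expR_ge0.
pose F (z : R * R) := g a (z.1 - z.2) * g b z.2.
have mF : measurable_fun setT F.
  apply: measurable_funM; last by apply: (measurableT_comp (mg b)); exact: measurable_snd.
  by apply: (measurableT_comp (mg a)); apply: measurable_funB; [exact: measurable_fst|exact: measurable_snd].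
have F0 z : (0 <= (F z)%:E)%E by rewrite lee_fin mulr_ge0.
have mFE : measurable_fun setT (EFin \o F) by exact/measurable_EFinP.
have := fubini_tonelli (m1 := mu) (m2 := mu) (EFin \o F) mFE F0 => /=.
have -> : (\int[mu]_x \int[mu]_y (F (x, y))%:E =
    \int[mu]_x ((pker (a + b) x * expR (- x))%:E * eBeta a b))%E.
  apply: eq_integral => t _.
  have -> : (\int[mu]_y (F (t, y))%:E =
     \int[mu]_y (expR (- t) * (pker a (t - y) * pker b y))%:E)%E.
    apply: eq_integral => s _; congr EFin; rewrite /F /g/=.
    rewrite (_ : - (t - s) = - t + s); last by ring.
    rewrite expRD expRN [expR (- s)]expRN.
    by field; rewrite !gt_eqF ?expR_gt0.
  have mc : measurable_fun setT (fun y : R => pker a (t - y) * pker b y).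
    apply: measurable_funM; last exact: measurable_pker.
    by apply: (measurableT_comp (measurable_pker a)); exact: measurable_funB.
  have c0 y : 0 <= pker a (t - y) * pker b y by rewrite mulr_ge0 ?pker_ge0.
  rewrite (@ge0_integralZl_R _ _ _ mu _ _ (expR_ge0 _) mc c0).
  by rewrite integral_pker_conv muleA -EFinM mulrC.
have -> : (\int[mu]_y \int[mu]_x (F (x, y))%:E =
    \int[mu]_y (eGamma a * (g b y)%:E))%E.
  apply: eq_integral => s _.
  have ms : measurable_fun setT (fun x : R => g a (x - s)).
    by apply: (measurableT_comp (mg a)); exact: measurable_funB.
  rewrite (@ge0_integralZr_R _ _ _ mu _ _ (g0 b s) ms (fun x => g0 a (x - s))).
  congr (_ * _)%E; apply: (ge0_integral_shift (- s) (f := EFin \o g a)).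
    by apply/measurable_EFinP; exact: mg.
  by move=> x; rewrite lee_fin; exact: g0.
rewrite ge0_integralZl//; last 3 first.
- by apply/measurable_EFinP; exact: mg.
- by move=> x _; rewrite lee_fin; exact: g0.
- by apply: integral_ge0 => x _; rewrite lee_fin mulr_ge0 ?pker_ge0 ?expR_ge0.
rewrite -/(eGamma b) => <-.
rewrite ge0_integralZr//.
- by apply/measurable_EFinP; exact: mg.
- by move=> x _; rewrite lee_fin; exact: g0.
- by apply: integral_ge0 => x _; rewrite lee_fin mulr_ge0 ?pker_ge0.
Qed.

(** With [m = |a - 1| + 1], positive in all cases, write [ln s = ln (s / (2 m)) + ln (2 m)] and
    bound the first logarithm by its argument. *)
Lemma pker_exp_le a s : 1 <= s ->
  s `^ (a - 1) <= expR ((`|a - 1| + 1) * ln (2 * (`|a - 1| + 1))) * expR (s / 2).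
Proof.
move=> s1; have s0 : 0 < s by rewrite (lt_le_trans _ s1).
set m := `|a - 1| + 1; have m0 : 0 < m by rewrite ltr_wpDl.
rewrite -expRD /powR gt_eqF// ler_expR.
have l0 : 0 <= ln s by rewrite ln_ge0.
apply: (@le_trans _ _ (m * ln s)).
  by rewrite ler_wpM2r// (le_trans (ler_norm _))// lerDl.
have -> : ln s = ln (s / (2 * m)) + ln (2 * m).
  by rewrite -lnM ?posrE ?divr_gt0 ?mulr_gt0// divfK// gt_eqF// mulr_gt0.
rewrite mulrDr addrC lerD2l -ler_pdivlMl// (le_trans (ltW (ln_sublinear _)))// ?divr_gt0 ?mulr_gt0//.
by rewrite le_eqVlt; apply/orP; left; apply/eqP; field; rewrite ?gt_eqF.
Qed.

Lemma integral_pker01 a : 0 < a ->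
  (\int[mu]_(t in `]0%R, 1%R]) (pker a t)%:E <= (a^-1)%:E)%E.
Proof.
move=> a0.
(* On [[1/(n+2), 1]] the power has the primitive [t^a / a], and the bound [1 / a] does not depend on
   [n]. The shift by [2] keeps the left end point below [1]. *)
pose I n := `[n.+2%:R^-1, 1]%classic : set R.
have UI : \bigcup_n I n = `]0, 1]%classic.
  apply/seteqP; split => t.
    move=> [n _]; rewrite /I/= !in_itv/= => /andP[nt ->]; rewrite andbT.
    by apply: lt_le_trans nt; rewrite invr_gt0.
  rewrite /= in_itv/= => /andP[t0 t1]; exists (Num.bound t^-1) => //.
  rewrite /I/= in_itv/= t1 andbT invf_ple ?posrE//.
  apply/ltW; apply: lt_le_trans (archi_boundP _) _; first by rewrite invr_ge0 ltW.
  by rewrite ler_nat ltnW// ltnW.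
have cvgI : (\int[mu]_(x in I n) (pker a x)%:E @[n --> \oo] -->
    \int[mu]_(x in `]0%R, 1%R]) (pker a x)%:E)%E.
  rewrite -UI; apply: ge0_nondecreasing_set_cvg_integral => //.
  - apply/nondecreasing_seqP => n; apply/subsetPset => t; rewrite /I/= !in_itv/=.
    move=> /andP[nt ->]; rewrite andbT (le_trans _ nt)//.
    by rewrite lef_pV2 ?posrE// ler_nat.
  - by move=> n; exact: measurable_itv.
  - by move=> n; apply/measurable_EFinP; apply: measurable_funTS; exact: measurable_pker.
  - by move=> n x _; rewrite lee_fin pker_ge0.
rewrite -(cvg_lim _ cvgI)//; apply: lime_le; first by apply/cvg_ex; eexists; exact: cvgI.
apply: nearW => n; rewrite /I.
set e := n.+2%:R^-1.
have e0 : 0 < e by rewrite invr_gt0.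
have e1 : e < 1 by rewrite invf_lt1// ltr1n.
have cp (x : R) (p : R) : 0 < x -> {for x, continuous (fun t => t `^ p)}.
  move=> x0; apply: differentiable_continuous; apply/derivable1_diffP.
  by apply: derivable_powR; rewrite in_itv/= x0.
have -> : (\int[mu]_(x in `[e, 1%R]) (pker a x)%:E =
    \int[mu]_(x in `[e, 1%R]) (x `^ (a - 1))%:E)%E.
  apply: eq_integral => x; rewrite inE/= in_itv/= => /andP[ex _].
  by rewrite /pker (lt_le_trans e0 ex).
rewrite (@continuous_FTC2 _ _ (fun t => a^-1 * t `^ a))//.
- by rewrite powR1 mulr1 -EFinB lee_fin lerBlDr lerDl mulr_ge0 ?powR_ge0// invr_ge0 ltW.
- apply: continuous_in_subspaceT => x; rewrite inE/= in_itv/= => /andP[ex _].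
  by apply: cp; exact: lt_le_trans ex.
- split.
  + move=> x; rewrite in_itv/= => /andP[ex _]; apply: derivableM => //.
    by apply: derivable_powR; rewrite in_itv/= (lt_trans e0).
  + apply: cvg_at_right_filter; apply: cvgM; first exact: cvg_cst.
    exact: cp.
  + apply: cvg_at_left_filter; apply: cvgM; first exact: cvg_cst.
    exact: cp.
- move=> x; rewrite in_itv/= => /andP[ex _].
  have x0 : 0 < x by exact: lt_trans ex.
  rewrite derive1Ml; last by apply: derivable_powR; rewrite in_itv/= x0.
  by rewrite powR_derive1 ?in_itv/= ?x0// mulrA mulVf ?mul1r// gt_eqF.
Qed.

(** Up to [1] the integrand is dominated by the power, beyond [1] by a multiple of
    [expR (- t / 2)]. *)
Lemma eGamma_lty a : 0 < a -> (eGamma a < +oo)%E.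
Proof.
move=> a0; rewrite /eGamma.
set C := expR ((`|a - 1| + 1) * ln (2 * (`|a - 1| + 1))).
have C0 : 0 <= C by exact: expR_ge0.
have m01 : measurable_fun setT (fun t : R => pker a t * \1_(`]0, 1]%classic : set R) t).
  by apply: measurable_funM; [exact: measurable_pker|exact: measurable_indic].
apply: (@le_lt_trans _ _ (\int[mu]_t ((pker a t * \1_(`]0, 1]%classic : set R) t)%:E + (C * posexp 2^-1 t)%:E))%E).
  apply: ge0_le_integral => //.
  - by move=> t _; rewrite lee_fin mulr_ge0 ?pker_ge0 ?expR_ge0.
  - apply/measurable_EFinP/measurable_funM; first exact: measurable_pker.
    by apply: measurableT_comp => //; exact: oppr_measurable.
  - apply: emeasurable_funD; first exact/measurable_EFinP.
    by apply/measurable_EFinP/measurable_funM => //; exact: measurable_posexp.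
  - move=> t _; rewrite -EFinD lee_fin.
    have [t0|t0] := leP t 0.
      by rewrite pker_le0// !mul0r add0r mulr_ge0// posexp_ge0.
    have [t1|t1] := leP t 1.
      rewrite indicE mem_set/= ?in_itv/= ?t0 ?t1// mulr1 ler_wpDr ?mulr_ge0 ?posexp_ge0//.
      by rewrite ler_piMr ?pker_ge0// -expR0 ler_expR oppr_le0 ltW.
    rewrite ler_wpDl ?mulr_ge0 ?pker_ge0// /pker /posexp t0.
    apply: (@le_trans _ _ (C * expR (t / 2) * expR (- t))).
      by rewrite ler_wpM2r ?expR_ge0// pker_exp_le// ltW.
    by rewrite -mulrA -expRD ler_wpM2l// ler_expR le_eqVlt; apply/orP; left; apply/eqP; field.
rewrite ge0_integralD//; last 4 first.
- by move=> t _; rewrite lee_fin mulr_ge0 ?pker_ge0.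
- exact/measurable_EFinP.
- by move=> t _; rewrite lee_fin mulr_ge0 ?posexp_ge0.
- by apply/measurable_EFinP/measurable_funM => //; exact: measurable_posexp.
apply: lte_add_pinfty.
  have -> : (\int[mu]_x (pker a x * \1_(`]0, 1]%classic : set R) x)%:E =
     \int[mu]_(x in `]0%R, 1%R]) (pker a x)%:E)%E.
    rewrite [RHS]integral_mkcond; apply: eq_integral => t _.
    by rewrite patchE indicE; case: ifP; rewrite ?mulr1 ?mulr0.
  by apply: le_lt_trans (integral_pker01 a0) _; rewrite ltry.
rewrite ge0_integralZl_R//; [|exact: measurable_posexp|exact: posexp_ge0].
by rewrite integral_posexp ?invr_gt0// -EFinM ltry.
Qed.

Lemma eGamma_gt0 a : (0 < eGamma a)%E.
Proof.
have m0 : measurable_fun setT (fun t => pker a t * expR (- t)).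
  apply: measurable_funM; first exact: measurable_pker.
  by apply: measurableT_comp => //; exact: oppr_measurable.
have ge0 t : 0 <= pker a t * expR (- t) by rewrite mulr_ge0 ?pker_ge0 ?expR_ge0.
rewrite lt0e integral_ge0 ?andbT; last by move=> t _; rewrite lee_fin.
apply/eqP => G0.
have : (\int[mu]_t `|(pker a t * expR (- t))%:E| = 0)%E.
  by rewrite -G0; apply: eq_integral => t _; rewrite gee0_abs ?lee_fin.
have mE : measurable_fun setT (fun t : R => (pker a t * expR (- t))%:E).
  exact/measurable_EFinP.
move=> /(ae_eq_integral_abs mu measurableT mE) [N [mN N0 hN]].
have : (mu `]0%R, 1%R] <= mu N)%E.
  rewrite le_measure ?inE//= => t; rewrite /= in_itv/= => /andP[t0 _]; apply: hN => /=.
  move=> /(_ Logic.I) [] /eqP; rewrite mulf_eq0 [expR _ == 0]gt_eqF ?expR_gt0// orbF /pker t0.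
  by rewrite gt_eqF// powR_gt0.
by rewrite N0 lebesgue_measure_itv/= lte_fin ltr01 oppr0 adde0 lee_fin ler10.
Qed.

Lemma eGammaE a : 0 < a -> eGamma a = (Gamma a)%:E.
Proof.
move=> a0; rewrite -eGamma_Gamma fineK// ge0_fin_numE ?eGamma_lty//.
exact/ltW/eGamma_gt0.
Qed.

Lemma Gamma_gt0 a : 0 < a -> 0 < Gamma a.
Proof. by move=> a0; rewrite -lte_fin -eGammaE// eGamma_gt0. Qed.

Lemma Gamma1 : Gamma 1 = 1 :> R.
Proof.
apply: EFin_inj; rewrite -eGammaE//.
rewrite -[X in _ = X%:E]invr1 -integral_posexp//; apply: eq_integral => t _; congr EFin.
by rewrite pker1 /posexp mulN1r; case: ifP; rewrite ?mul1r ?mul0r.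
Qed.

End power_kernel.

Section fractional_kernel.
Context {R : realType}.
Implicit Types a b s t : R.
Local Notation mu := (leb R).

(* [locked] keeps unification from looking inside the kernel *)
Definition fker a t : R := locked ((Gamma a)^-1 * pker a t).

Lemma fkerE a t : fker a t = (Gamma a)^-1 * pker a t. Proof. by rewrite /fker -lock. Qed.

Lemma fker_ge0 a t : 0 < a -> 0 <= fker a t.
Proof. by move=> a0; rewrite fkerE mulr_ge0 ?pker_ge0// invr_ge0 ltW ?Gamma_gt0. Qed.

Lemma fker_le0 a t : t <= 0 -> fker a t = 0.
Proof. by move=> t0; rewrite fkerE pker_le0 ?mulr0. Qed.

Lemma measurable_fker a : measurable_fun setT (fker a).
Proof.
rewrite (_ : fker a = fun t => (Gamma a)^-1 * pker a t); last by apply/funext => t; exact: fkerE.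
by apply: measurable_funM => //; exact: measurable_pker.
Qed.

Lemma integral_fker_laplace a s : 0 < a -> 0 < s ->
  (\int[mu]_t (fker a t * expR (- s * t))%:E = (s `^ (- a))%:E)%E.
Proof.
move=> a0 s0; under eq_integral do rewrite fkerE -mulrA.
rewrite ge0_integralZl_R.
- rewrite integral_pker_laplace// eGammaE// -!EFinM; congr EFin.
  by rewrite mulrCA mulVf ?mulr1// gt_eqF ?Gamma_gt0.
- by rewrite invr_ge0 ltW ?Gamma_gt0.
- apply: measurable_funM; first exact: measurable_pker.
  by apply: measurableT_comp => //; exact: measurable_funM.
- by move=> t; rewrite mulr_ge0 ?pker_ge0 ?expR_ge0.
Qed.

(** This is the reason for the Gamma factor in [fker]: orders add under convolution, with no
    constant. *)
Lemma integral_fker_conv a b t : 0 < a -> 0 < b ->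
  (\int[mu]_s (fker a (t - s) * fker b s)%:E = (fker (a + b) t)%:E)%E.
Proof.
move=> a0 b0; have ab0 : 0 < a + b by rewrite addr_gt0.
have := eGammaM a b; rewrite !eGammaE// -EFinM => GM.
have BE : eBeta a b = ((Gamma a * Gamma b) / Gamma (a + b))%:E.
  rewrite mulrC EFinM GM muleA -EFinM mulVf ?mul1e// gt_eqF// Gamma_gt0//.
have -> : (\int[mu]_s (fker a (t - s) * fker b s)%:E =
  \int[mu]_s (((Gamma a)^-1 * (Gamma b)^-1) * (pker a (t - s) * pker b s))%:E)%E.
  by apply: eq_integral => s _; congr EFin; rewrite !fkerE mulrACA.
rewrite ge0_integralZl_R.
- rewrite integral_pker_conv BE -!EFinM; congr EFin; rewrite fkerE.
  move: (Gamma_gt0 a0) (Gamma_gt0 b0) (Gamma_gt0 ab0).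
  move: (Gamma a) (Gamma b) (Gamma (a + b)) (pker _ _) => x y z u x0 y0 z0.
  by field; rewrite !gt_eqF.
- by rewrite mulr_ge0// invr_ge0 ltW ?Gamma_gt0.
- apply: measurable_funM; last exact: measurable_pker.
  by apply: (measurableT_comp (measurable_pker a)); exact: measurable_funB.
- by move=> s; rewrite mulr_ge0 ?pker_ge0.
Qed.

Lemma fker1 t : fker 1 t = if 0 < t then 1 else 0.
Proof. by rewrite fkerE Gamma1 invr1 mul1r pker1. Qed.

End fractional_kernel.

Section nonneg_scaling.
Context {d} {T : measurableType d} {R : realType} (mu : {measure set T -> \bar R}).

(** A positive factor preserves the infinite cases, and [fine] sends them to [0]. The rule thus
    applies to functions that are merely measurable, such as convolution integrands at exceptional
    times. *)
Lemma RintegralMl_ge0 (k : R) (f : T -> R) : 0 <= k -> measurable_fun setT f ->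
  \int[mu]_x (k * f x) = k * \int[mu]_x f x.
Proof.
rewrite le_eqVlt => /predU1P[<- _|k0 mf].
  by rewrite mul0r /Rintegral integral0_eq// => x _; rewrite mul0r.
have mF : measurable_fun setT (EFin \o f) by exact/measurable_EFinP.
rewrite /Rintegral integralE [in RHS]integralE.
have -> : (\int[mu]_x ((EFin \o (fun x => k * f x)%R)^\+ x) =
    k%:E * \int[mu]_x ((EFin \o f)^\+ x))%E.
  rewrite -ge0_integralZl ?lee_fin ?ltW//; last 1 first.
  - exact: measurable_funepos.
  apply: eq_integral => x _; rewrite !funeposE /= maxeMr ?lee_fin ?ltW//.
  by rewrite mule0 EFinM.
have -> : (\int[mu]_x ((EFin \o (fun x => k * f x)%R)^\- x) =
    k%:E * \int[mu]_x ((EFin \o f)^\- x))%E.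
  rewrite -ge0_integralZl ?lee_fin ?ltW//; last 1 first.
  - exact: measurable_funeneg.
  apply: eq_integral => x _; rewrite !funenegE /= maxeMr ?lee_fin ?ltW//.
  by rewrite mule0 -EFinM mulrN.
have : (0 <= \int[mu]_x ((EFin \o f)^\+ x))%E by exact: integral_ge0.
have : (0 <= \int[mu]_x ((EFin \o f)^\- x))%E by exact: integral_ge0.
case: (\int[mu]_x ((EFin \o f)^\- x))%E => [a||]//;
  case: (\int[mu]_x ((EFin \o f)^\+ x))%E => [b||]// _ _.
- by rewrite -!EFinM -EFinB /= mulrBr.
- by rewrite gt0_muley ?lte_fin//= mulr0.
- by rewrite gt0_muley ?lte_fin//= mulr0.
- by rewrite gt0_muley ?lte_fin//= mulr0.
Qed.

Lemma RintegralMr_ge0 (k : R) (f : T -> R) : 0 <= k -> measurable_fun setT f ->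
  \int[mu]_x (f x * k) = (\int[mu]_x f x) * k.
Proof.
move=> k0 mf; rewrite mulrC -RintegralMl_ge0//.
by apply: eq_Rintegral => x _; rewrite mulrC.
Qed.

Lemma ge0_le_integral_nonmeasurable (f g : T -> \bar R) :
  (forall x, 0 <= f x)%E -> (forall x, f x <= g x)%E ->
  (\int[mu]_x f x <= \int[mu]_x g x)%E.
Proof.
move=> f0 fg; have g0 x : (0 <= g x)%E by exact: le_trans (fg x).
rewrite ge0_integralTE// [leRHS]ge0_integralTE//.
apply: le_ereal_sup => _ [h /= hf <-]; exists h => //= x.
exact: le_trans (hf x) (fg x).
Qed.

Lemma ge0_integrable (f : T -> R) : measurable_fun setT f -> (forall x, 0 <= f x) ->
  (\int[mu]_x (f x)%:E < +oo)%E -> mu.-integrable setT (EFin \o f).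
Proof.
move=> mf f0 fi; apply/integrableP; split; first exact/measurable_EFinP.
by under eq_integral do rewrite /= ger0_norm//.
Qed.

End nonneg_scaling.

Lemma measurable_integral_snd {d1 d2} {T1 : measurableType d1} {T2 : measurableType d2}
    {R : realType} (m2 : {sigma_finite_measure set T2 -> \bar R}) (F : T1 * T2 -> R) :
  measurable_fun setT F -> (forall z, 0 <= F z) ->
  measurable_fun setT (fun x => \int[m2]_y (F (x, y))%:E)%E.
Proof.
move=> mF F0; apply: (measurable_fun_fubini_tonelli_F (EFin \o F)) => //.
exact/measurable_EFinP.
Qed.

Section fractional_integral.
Context {R : realType}.
Implicit Types a b s t : R.
Local Notation mu := (leb R).

(* Riemann-Liouville integral of order [b]; the kernel degenerates at order 0 *)
Definition fint b (g : R -> R) t : R :=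
  if b == 0 then g t else \int[mu]_r (fker b (t - r) * g r).

Lemma fint0 g : fint 0 g = g.
Proof. by apply/funext => t; rewrite /fint eqxx. Qed.

Lemma fintE b g t : 0 < b -> fint b g t = \int[mu]_r (fker b (t - r) * g r).
Proof. by move=> b0; rewrite /fint gt_eqF. Qed.

Lemma measurable_fker_sub a t : measurable_fun setT (fun r : R => fker a (t - r)).
Proof. by apply: (measurableT_comp (measurable_fker a)); exact: measurable_funB. Qed.

Lemma measurable_fker_sub2 a :
  measurable_fun setT (fun z : R * R => fker a (z.1 - z.2)).
Proof. by apply: (measurableT_comp (measurable_fker a)); exact: measurable_funB. Qed.

Lemma measurable_expN s : measurable_fun setT (fun t : R => expR (- s * t)).
Proof. by apply: measurableT_comp => //; exact: measurable_funM. Qed.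

Lemma laplace_fker_conv_ge0 a s (G : R -> R) : 0 < a -> 0 < s ->
  measurable_fun setT G -> (forall t, 0 <= G t) ->
  (\int[mu]_t \int[mu]_r (fker a (t - r) * G r * expR (- s * t))%:E =
   (s `^ (- a))%:E * \int[mu]_r (G r * expR (- s * r))%:E)%E.
Proof.
move=> a0 s0 mG G0.
pose F (z : R * R) := fker a (z.1 - z.2) * G z.2 * expR (- s * z.1).
have mF : measurable_fun setT F.
  apply: measurable_funM; first apply: measurable_funM.
  - exact: measurable_fker_sub2.
  - exact: (measurableT_comp mG).
  - exact: (measurableT_comp (measurable_expN s)).
have F0 z : 0 <= F z by rewrite /F !mulr_ge0 ?expR_ge0 ?fker_ge0.
have := @fubini_tonelli _ _ _ _ R mu mu (fun z => (F z)%:E).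
rewrite /F/= => ->; last 2 first.
- exact/measurable_EFinP.
- by move=> z; rewrite lee_fin; exact: F0.
rewrite -ge0_integralZl//; last 3 first.
- apply/measurable_EFinP/measurable_funM => //; exact: measurable_expN.
- by move=> r _; rewrite lee_fin mulr_ge0 ?expR_ge0.
- by rewrite lee_fin powR_ge0.
apply: eq_integral => r _.
transitivity (\int[mu]_t ((G r * expR (- s * r)) * (fker a (t - r) * expR (- s * (t - r))))%:E)%E.
  apply: eq_integral => t _; congr EFin.
  have -> : - s * t = - s * r + - s * (t - r) by ring.
  by rewrite expRD; ring.
have mk : measurable_fun setT (fun t => fker a t * expR (- s * t)).
  by apply: measurable_funM; [exact: measurable_fker|exact: measurable_expN].
rewrite ge0_integralZl_R ?mulr_ge0 ?expR_ge0//.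
- rewrite (ge0_integral_shift (- r) (f := fun t => (fker a t * expR (- s * t))%:E)).
  + by rewrite integral_fker_laplace// muleC.
  + exact/measurable_EFinP.
  + by move=> t; rewrite lee_fin mulr_ge0 ?expR_ge0 ?fker_ge0.
- by apply: (measurableT_comp mk); exact: measurable_funB.
- by move=> t; rewrite mulr_ge0 ?expR_ge0 ?fker_ge0.
Qed.

Lemma measurable_laplace_fker_conv a s (G : R -> R) : 0 < a ->
  measurable_fun setT G -> (forall t, 0 <= G t) ->
  measurable_fun setT
    (fun t => \int[mu]_r (fker a (t - r) * G r * expR (- s * t))%:E)%E.
Proof.
move=> a0 mG G0.
apply: (measurable_integral_snd mu
  (F := fun z : R * R => fker a (z.1 - z.2) * G z.2 * expR (- s * z.1))) => [|z].
  apply: measurable_funM; first apply: measurable_funM.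
  - exact: measurable_fker_sub2.
  - exact: (measurableT_comp mG).
  - exact: (measurableT_comp (measurable_expN s)).
by rewrite !mulr_ge0 ?expR_ge0 ?fker_ge0.
Qed.

(** Absolute convergence of the double integral is the convolution theorem for the nonnegative
    function [|g|]; Fubini then gives the signed version. *)
Lemma laplace_fint b s (g : R -> R) : 0 <= b -> 0 < s -> measurable_fun setT g ->
  mu.-integrable setT (fun t => (g t * expR (- s * t))%:E) ->
  mu.-integrable setT (fun t => (fint b g t * expR (- s * t))%:E) /\
  \int[mu]_t (fint b g t * expR (- s * t)) = s `^ (- b) * \int[mu]_t (g t * expR (- s * t)).
Proof.
rewrite le_eqVlt => /predU1P[<- s0 mg ig|b0 s0 mg ig].
  by rewrite fint0 oppr0 powRr0 mul1r.
pose F (z : R * R) := fker b (z.1 - z.2) * g z.2 * expR (- s * z.1).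
have mF : measurable_fun setT F.
  apply: measurable_funM; first apply: measurable_funM.
  - exact: measurable_fker_sub2.
  - exact: (measurableT_comp mg).
  - exact: (measurableT_comp (measurable_expN s)).
have iF : (mu \x mu)%E.-integrable setT (EFin \o F).
  apply: integrable_prod_of_ge0 => //.
  have -> : (\int[mu]_x \int[mu]_y `|F (x, y)|%:E =
     \int[mu]_t \int[mu]_r (fker b (t - r) * `|g r| * expR (- s * t))%:E)%E.
    apply: eq_integral => t _; apply: eq_integral => r _; congr EFin.
    by rewrite /F/= !normrM [X in X * _ * _]ger0_norm ?fker_ge0// [X in _ * X]ger0_norm ?expR_ge0.
  rewrite laplace_fker_conv_ge0//; last exact: measurableT_comp.
  apply: lte_mul_pinfty; rewrite ?lee_fin ?powR_ge0//.
  have /integrableP[_] := ig; apply: le_lt_trans; apply: ge0_le_integral_nonmeasurable => t.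
    by rewrite lee_fin mulr_ge0 ?expR_ge0.
  by rewrite lee_fin normrM [X in _ <= _ * X]ger0_norm ?expR_ge0.
have FE t : \int[mu]_r F (t, r) = fint b g t * expR (- s * t).
  rewrite fintE// -RintegralMr_ge0 ?expR_ge0//.
  by apply: measurable_funM => //; exact: measurable_fker_sub.
split.
  rewrite (_ : (fun t => _) = EFin \o (fun t => \int[mu]_r F (t, r))).
    exact: integrable_Rintegral_snd.
  by apply/funext => t /=; rewrite FE.
transitivity (\int[mu]_t \int[mu]_r F (t, r)).
  by apply: eq_Rintegral => t _; rewrite FE.
rewrite Rfubini//.
rewrite -RintegralZl//.
apply: eq_Rintegral => r _.
have mk : measurable_fun setT (fun t => fker b t * expR (- s * t)).
  by apply: measurable_funM; [exact: measurable_fker|exact: measurable_expN].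
transitivity (\int[mu]_t ((fker b (t - r) * expR (- s * (t - r))) * (g r * expR (- s * r)))).
  apply: eq_Rintegral => t _; rewrite /F/=.
  have -> : - s * t = - s * r + - s * (t - r) by ring.
  by rewrite expRD; ring.
have ik : mu.-integrable setT (EFin \o (fun t => fker b t * expR (- s * t))).
  apply: ge0_integrable => // [t|]; first by rewrite mulr_ge0 ?expR_ge0 ?fker_ge0.
  by rewrite integral_fker_laplace// ltry.
rewrite RintegralZr//; last exact: (integrable_shift (- r) ik).
congr (_ * _).
rewrite (Rintegral_shift (- r) (f := fun t => fker b t * expR (- s * t)))//.
by rewrite /Rintegral integral_fker_laplace.
Qed.

Lemma fint_norm_le b (g : R -> R) t : 0 < b -> measurable_fun setT g ->
  (`|fint b g t|%:E <= \int[mu]_r (fker b (t - r) * `|g r|)%:E)%E.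
Proof.
move=> b0 mg; rewrite fintE//.
have mfg : measurable_fun setT (fun r : R => (fker b (t - r) * g r)%:E).
  by apply/measurable_EFinP/measurable_funM => //; exact: measurable_fker_sub.
apply: (@le_trans _ _ `|\int[mu]_r (fker b (t - r) * g r)%:E|%E).
  rewrite /Rintegral; case: (\int[mu]_r (fker b (t - r) * g r)%:E)%E => //=;
  by rewrite ?normr0 ?leey.
apply: le_trans (le_abse_integral _ _ _) _ => //.
rewrite le_eqVlt; apply/orP; left; apply/eqP; apply: eq_integral => r _ /=.
by rewrite normrM (ger0_norm (fker_ge0 _ b0)).
Qed.

(** Supported in positive times and integrable on bounded intervals, without a growth bound: this is
    all that is known of the time derivatives of [v] at a fixed [x]. Their Laplace transforms may
    diverge, hence the truncations below. *)
Definition causal (g : R -> R) := [/\ measurable_fun setT g,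
  forall t, t <= 0 -> g t = 0 &
  forall T, (\int[mu]_t (`|g t| * (t <= T)%R%:R)%:E < +oo)%E].

Lemma measurable_le_ind T : measurable_fun setT (fun t : R => (t <= T)%R%:R : R).
Proof.
rewrite (_ : (fun t => _) = \1_(`]-oo, T]%classic : set R)).
  by apply: measurable_indic; exact: measurable_itv.
by apply/funext => t; rewrite indicE mem_setE in_itv.
Qed.

(** For [t <= k] the kernel only sees [r <= t], so cutting [g] at [k] changes nothing. The truncated
    function has a finite Laplace transform at [1], hence so does its convolution, which is then
    finite almost everywhere. *)
Lemma fint_abs_lty a g : 0 < a -> causal g ->
  {ae mu, forall t, (\int[mu]_r (fker a (t - r) * `|g r|)%:E < +oo)%E}.
Proof.
move=> a0 [mg g0 gi].
have : forall k : nat, {ae mu, forall t, t <= k%:R ->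
    (\int[mu]_r (fker a (t - r) * `|g r|)%:E < +oo)%E}.
  move=> k; pose G (r : R) := `|g r| * (r <= k%:R)%R%:R.
  have mG : measurable_fun setT G.
    by apply: measurable_funM; [exact: measurableT_comp|exact: measurable_le_ind].
  have G0 r : 0 <= G r by rewrite mulr_ge0.
  pose J (t : R) := (\int[mu]_r (fker a (t - r) * G r * expR (- 1 * t))%:E)%E.
  have JE : (\int[mu]_t J t = _)%E := laplace_fker_conv_ge0 a0 ltr01 mG G0.
  have mJ : measurable_fun setT J by exact: measurable_laplace_fker_conv.
  have J0 t : (0 <= J t)%E.
    by apply: integral_ge0 => r _; rewrite lee_fin !mulr_ge0 ?expR_ge0 ?fker_ge0.
  have iJ : mu.-integrable setT J.
    apply/integrableP; split => //.
    have -> : (\int[mu]_t `|J t| = \int[mu]_t J t)%E.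
      by apply: eq_integral => t _; rewrite gee0_abs.
    rewrite JE powR1 mul1e; apply: le_lt_trans (gi k%:R).
    apply: ge0_le_integral_nonmeasurable => t; first by rewrite lee_fin mulr_ge0 ?expR_ge0.
    rewrite lee_fin; have [t0|t0] := leP t 0; first by rewrite /G g0// normr0 !mul0r.
    by rewrite -/(G t) ler_piMr// -[leRHS]expR0 ler_expR mulN1r oppr_le0 ltW.
  apply: aeS (integrable_ae measurableT iJ) => t /(_ Logic.I) Jt tk.
  have -> : (\int[mu]_r (fker a (t - r) * `|g r|)%:E = (expR t)%:E * J t)%E.
    have mX : measurable_fun setT (fun r : R => fker a (t - r) * G r * expR (- 1 * t)).
      by apply: measurable_funM => //; apply: measurable_funM => //; exact: measurable_fker_sub.
    have X0 r : 0 <= fker a (t - r) * G r * expR (- 1 * t).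
      by rewrite !mulr_ge0 ?expR_ge0 ?fker_ge0.
    rewrite /J -(ge0_integralZl_R mu (expR_ge0 t) mX X0).
    apply: eq_integral => r _; congr EFin.
    rewrite mulN1r mulrCA -expRD subrr expR0 mulr1 /G.
    have [rk|kr] := leP r k%:R; first by rewrite mulr1.
    by rewrite fker_le0 ?mul0r// subr_le0 (le_trans tk)// ltW.
  by apply: lte_mul_pinfty => //; rewrite ?lee_fin ?expR_ge0// ltey_eq Jt.
move=> /ae_foralln; apply: aeS => t h.
by apply: (h (Num.bound `|t|)); exact: le_trans (ler_norm _) (ltW (archi_boundP _)).
Qed.

(** The semigroup property of the kernels, by Fubini at each [t] where the convolution with [|g|]
    converges; this is why it holds only almost everywhere. *)
Lemma fint_add a b g : 0 <= a -> 0 <= b -> causal g ->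
  {ae mu, forall t, fint a (fint b g) t = fint (a + b) g t}.
Proof.
rewrite le_eqVlt => /predU1P[<- _ _|a0]; first by apply: aeW => t; rewrite fint0 add0r.
rewrite le_eqVlt => /predU1P[<- _|b0 cg]; first by apply: aeW => t; rewrite fint0 addr0.
have ab0 : 0 < a + b by rewrite addr_gt0.
have [mg _ _] := cg.
apply: aeS (fint_abs_lty ab0 cg) => t tfin.
pose F (z : R * R) := fker a (t - z.1) * (fker b (z.1 - z.2) * g z.2).
have mF : measurable_fun setT F.
  apply: measurable_funM; first exact: (measurableT_comp (measurable_fker_sub a t)).
  apply: measurable_funM; first exact: measurable_fker_sub2.
  exact: (measurableT_comp mg).
have kE r : (\int[mu]_s (fker a (t - s) * fker b (s - r))%:E = (fker (a + b) (t - r))%:E)%E.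
  rewrite -[RHS](integral_fker_conv (t - r) a0 b0).
  rewrite -(ge0_integral_shift (- r) (f := fun s => (fker a (t - r - s) * fker b s)%:E)).
  - by apply: eq_integral => s _; rewrite opprB addrA subrK.
  - apply/measurable_EFinP/measurable_funM; last exact: measurable_fker.
    exact: measurable_fker_sub.
  - by move=> s; rewrite lee_fin mulr_ge0 ?fker_ge0.
have mkk r : measurable_fun setT (fun s => fker a (t - s) * fker b (s - r)).
  apply: measurable_funM; first exact: measurable_fker_sub.
  by apply: (measurableT_comp (measurable_fker b)); exact: measurable_funB.
have iF : (mu \x mu)%E.-integrable setT (EFin \o F).
  apply: integrable_prod_of_ge0 => //.
  have := @fubini_tonelli _ _ _ _ R mu mu (fun z => `|F z|%:E).
  move=> ->//; last by apply/measurable_EFinP; exact: measurableT_comp.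
  apply: le_lt_trans tfin; rewrite le_eqVlt; apply/orP; left; apply/eqP.
  apply: eq_integral => r _.
  transitivity (\int[mu]_s ((fker a (t - s) * fker b (s - r)) * `|g r|)%:E)%E.
    apply: eq_integral => s _; congr EFin; rewrite /F/= !normrM.
    by rewrite [X in X * (_ * _)]ger0_norm ?fker_ge0// [X in _ * (X * _)]ger0_norm ?fker_ge0// mulrA.
  have kk0 s : 0 <= fker a (t - s) * fker b (s - r) by rewrite mulr_ge0 ?fker_ge0.
  by rewrite (ge0_integralZr_R mu (normr_ge0 (g r)) (mkk r) kk0) kE EFinM.
rewrite !fintE//.
transitivity (\int[mu]_s \int[mu]_r F (s, r)).
  apply: eq_Rintegral => s _; rewrite fintE// -RintegralMl_ge0 ?fker_ge0//.
  apply: measurable_funM => //; exact: measurable_fker_sub.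
rewrite Rfubini//; apply: eq_Rintegral => r _.
transitivity (\int[mu]_s ((fker a (t - s) * fker b (s - r)) * g r)).
  by apply: eq_Rintegral => s _; rewrite /F/= mulrA.
rewrite RintegralZr//; last first.
  apply: ge0_integrable; first exact: mkk.
    by move=> s; rewrite mulr_ge0 ?fker_ge0.
  by rewrite kE ltry.
by rewrite /Rintegral kE.
Qed.

Lemma measurable_fint b (g : R -> R) : measurable_fun setT g ->
  measurable_fun setT (fint b g).
Proof.
move=> mg; have [->|b0] := eqVneq b 0; first by rewrite fint0.
rewrite /fint (negbTE b0).
apply: (measurable_Rintegral_snd mu (F := fun z : R * R => fker b (z.1 - z.2) * g z.2)).
apply: measurable_funM; first exact: measurable_fker_sub2.
exact: (measurableT_comp mg).
Qed.

Lemma fint_le0 b g t : (forall t, t <= 0 -> g t = 0) -> t <= 0 -> fint b g t = 0.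
Proof.
move=> g0 t0; rewrite /fint; case: ifP => _; first exact: g0.
rewrite /Rintegral integral0_eq// => r _; have [r0|r0] := leP r 0.
  by rewrite g0// mulr0.
by rewrite fker_le0 ?mul0r// subr_le0 (le_trans t0)// ltW.
Qed.

Lemma causal_fint b g : 0 <= b -> causal g -> causal (fint b g).
Proof.
rewrite le_eqVlt => /predU1P[<-|b0]; first by rewrite fint0.
move=> [mg g0 gi]; split => [|t|T]; [exact: measurable_fint|exact: fint_le0|].
pose G (r : R) := `|g r| * (r <= T)%R%:R.
have mG : measurable_fun setT G.
  by apply: measurable_funM; [exact: measurableT_comp|exact: measurable_le_ind].
have G0 r : 0 <= G r by rewrite mulr_ge0.
pose J (t : R) := (\int[mu]_r (fker b (t - r) * G r * expR (- 1 * t))%:E)%E.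
(* For [t <= T] the factor [expR T * expR (- t)] is at least [1]; it turns the local integral into a
   Laplace transform at [1]. *)
apply: (@le_lt_trans _ _ (\int[mu]_t ((expR T)%:E * J t))%E).
  apply: ge0_le_integral_nonmeasurable => t; first by rewrite lee_fin mulr_ge0.
  have [tT|tT] := leP t T; last first.
    rewrite mulr0 mule_ge0 ?lee_fin ?expR_ge0//; apply: integral_ge0 => r _.
    by rewrite lee_fin !mulr_ge0 ?expR_ge0 ?fker_ge0.
  rewrite mulr1; apply: le_trans (fint_norm_le t b0 mg) _.
  have mX : measurable_fun setT (fun r : R => fker b (t - r) * G r * expR (- 1 * t)).
    by apply: measurable_funM => //; apply: measurable_funM => //; exact: measurable_fker_sub.
  have X0 r : 0 <= fker b (t - r) * G r * expR (- 1 * t).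
    by rewrite !mulr_ge0 ?expR_ge0 ?fker_ge0.
  rewrite -(ge0_integralZl_R mu (expR_ge0 T) mX X0).
  apply: ge0_le_integral_nonmeasurable => r; first by rewrite lee_fin mulr_ge0 ?fker_ge0.
  rewrite lee_fin /G; have [rk|kr] := leP r T; last first.
    by rewrite fker_le0 ?mul0r ?mulr0// subr_le0 (le_trans tT)// ltW.
  rewrite mulr1 mulrCA ler_peMr ?mulr_ge0 ?fker_ge0//.
  by rewrite -expRD -[leLHS]expR0 ler_expR mulN1r subr_ge0.
have mJ := measurable_laplace_fker_conv 1 b0 mG G0.
have J0 t : (0 <= J t)%E.
  by apply: integral_ge0 => r _; rewrite lee_fin !mulr_ge0 ?expR_ge0 ?fker_ge0.
have T0 : (0 <= (expR T)%:E)%E by rewrite lee_fin expR_ge0.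
have -> : (\int[mu]_t ((expR T)%:E * J t) = (expR T)%:E * \int[mu]_t J t)%E.
  exact: ge0_integralZl.
rewrite laplace_fker_conv_ge0// powR1 mul1e; apply: lte_mul_pinfty; rewrite ?lee_fin ?expR_ge0//.
apply: le_lt_trans (gi T); apply: ge0_le_integral_nonmeasurable => t.
  by rewrite lee_fin mulr_ge0 ?expR_ge0.
rewrite lee_fin; have [t0|t0] := leP t 0; first by rewrite /G g0// normr0 !mul0r.
by rewrite -/(G t) ler_piMr// -[leRHS]expR0 ler_expR mulN1r oppr_le0 ltW.
Qed.

Lemma fint_ae_eq b g g' t : {ae mu, forall r, g r = g' r} -> 0 < b ->
  fint b g t = fint b g' t.
Proof.
move=> gg' b0; rewrite !fintE//; congr fine; apply: ae_eq_integral_nonmeasurable.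
by apply: aeS gg' => r -> _.
Qed.

End fractional_integral.

(** * Caputo derivatives *)

Section caputo_representation.
Context {R : realType}.
Local Notation mu := (leb R).
Implicit Types (h g : R -> R) (t : R).

Lemma ceiln1 (nu : R) : 0 < nu -> nu <= 1 -> ceiln nu = 1%N.
Proof. by move=> n0 n1; rewrite /ceiln (ceil_def (m := 1)) ?subrr ?n0. Qed.

Lemma ceiln2 (nu : R) : 1 < nu -> nu <= 2 -> ceiln nu = 2%N.
Proof. by move=> n0 n1; rewrite /ceiln (ceil_def (m := 2)) ?n0. Qed.

Lemma causal_integrable g T : causal g -> mu.-integrable `[0, T] (EFin \o g).
Proof.
move=> [mg g0 /(_ T)]; have mG : measurable_fun `[0, T] (EFin \o g).
  by apply/measurable_EFinP; exact: measurable_funTS.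
move=> gi; apply/integrableP; split => //; apply: le_lt_trans gi.
rewrite integral_mkcond; apply: ge0_le_integral_nonmeasurable => t; rewrite patchE.
  by case: ifP.
case: ifPn => [|_]; last by rewrite lee_fin mulr_ge0.
by rewrite inE/= in_itv/= => /andP[_ ->]; rewrite mulr1.
Qed.

Lemma fint1_primitive g t : causal g -> fint 1 g t = \int[mu]_(r in `[0, t]) g r.
Proof.
move=> [mg g0 _]; rewrite fintE// [in RHS]/Rintegral integral_mkcond; congr fine.
apply: ae_eq_integral_nonmeasurable; apply: aeS (ae_neq t) => r /eqP rt _.
rewrite patchE mem_setE in_itv/= fker1 subr_gt0.
have [r0|r0] := leP 0 r; first by rewrite le_eqVlt (negbTE rt)/=; case: ifP; rewrite ?mul1r ?mul0r.
by rewrite g0 ?mulr0 ?if_same// ltW.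
Qed.

Lemma fint1_bound g T : causal g -> exists2 M, 0 <= M & forall t, t <= T -> `|fint 1 g t| <= M.
Proof.
move=> [mg g0 /(_ T) gi].
have I0 : (0 <= \int[mu]_t (`|g t| * (t <= T)%R%:R)%:E)%E.
  by apply: integral_ge0 => r _; rewrite lee_fin mulr_ge0.
exists (fine (\int[mu]_t (`|g t| * (t <= T)%R%:R)%:E)) => [|t tT]; first exact: fine_ge0.
rewrite -lee_fin fineK ?ge0_fin_numE//; apply: le_trans (fint_norm_le _ _ _) _ => //.
apply: ge0_le_integral_nonmeasurable => r; first by rewrite lee_fin mulr_ge0 ?fker_ge0.
rewrite lee_fin fker1 subr_gt0 mulrC ler_wpM2l//.
by case: ltP => // rt; rewrite (le_trans (ltW rt)).
Qed.

Lemma fint1_cvg0 g : causal g -> fint 1 g x @[x --> 0] --> 0.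
Proof.
move=> cg; have := parameterized_integral_cvg_left ltr01 (causal_integrable 1 cg).
rewrite /parameterized_integral.
by apply: cvg_trans; apply: near_eq_cvg; near=> x; rewrite fint1_primitive.
Unshelve. all: by end_near. Qed.

Lemma fint1B g x y : causal g -> 0 <= x -> x <= y ->
  fint 1 g y - fint 1 g x = \int[mu]_(t in `]x, y]) g t.
Proof.
move=> cg x0 xy; rewrite !fint1_primitive// Rintegral_itvB ?bnd_simp//.
exact: causal_integrable.
Qed.

Definition tderiv h t := if 0 < t then upper_deriv h t else 0.

Lemma causal_tderiv h : (forall T : R, 0 < T -> abs_continuous `]0, T[ h) -> causal (tderiv h).
Proof.
move=> hac; have mt : measurable_fun setT (tderiv h).
  by apply: measurable_pos_if; exact: measurable_upper_deriv_ac.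
split => // [t|T]; first by rewrite /tderiv; case: ltgtP.
have /integrableP[_] := abs_continuous_derive_integrable hac T.
rewrite integral_mkcond; apply: le_lt_trans; apply: ge0_le_integral_nonmeasurable => t.
  by rewrite lee_fin mulr_ge0.
rewrite patchE mem_setE in_itv/= /tderiv; have [t0|t0]/= := ltP 0 t; last by rewrite normr0 mul0r.
by case: (t <= T); rewrite ?mulr1 ?mulr0.
Qed.

Lemma tderiv_increment h x y : (forall T : R, 0 < T -> abs_continuous `]0, T[ h) ->
  0 < x -> x <= y -> h y - h x = fint 1 (tderiv h) y - fint 1 (tderiv h) x.
Proof.
move=> hac x0 xy; rewrite (fint1B (causal_tderiv hac) (ltW x0) xy).
have [_ ->] := abs_continuous_ftc hac x0 xy.
apply: eq_Rintegral => t; rewrite inE/= in_itv/= => /andP[xt _].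
by rewrite /tderiv (lt_trans x0).
Qed.

Lemma abs_continuous_primitive h t : (forall T : R, 0 < T -> abs_continuous `]0, T[ h) ->
  h t @[t --> 0^'+] --> h 0 -> 0 < t -> h t - h 0 = fint 1 (tderiv h) t.
Proof.
move=> hac h0 t0; set w := tderiv h.
have c1 : (h t - h x) @[x --> 0^'+] --> h t - h 0 by apply: cvgB => //; exact: cvg_cst.
have c2 : (fint 1 w t - fint 1 w x) @[x --> 0^'+] --> fint 1 w t - 0.
  apply: cvgB; first exact: cvg_cst.
  by apply: cvg_at_right_filter; exact: (fint1_cvg0 (causal_tderiv hac)).
rewrite -[RHS]subr0; apply: (cvg_unique _ c1) => //.
apply: cvg_trans c2; apply: near_eq_cvg; near=> x.
apply/esym/tderiv_increment => //.
by apply/ltW; near: x; exact: nbhs_right_lt.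
Unshelve. all: by end_near. Qed.

Lemma is_derive_derive1 h t : derivable h t 1 -> is_derive t 1 h (derive1 h t).
Proof. by move=> dh; rewrite derive1E; exact: derivableP. Qed.

(** On positive times [h'] is the primitive of [h''] plus a constant [l]. By the mean value theorem
    a difference quotient at a small [t] equals [h' c = l + fint 1 w c] with [c < t]; the quotient
    and the primitive are both small, hence so is [l]. *)
Lemma ACn2_derive h : ACn 2 h ->
  t^-1 * (h t - h 0) @[t --> 0^'+] --> (0 : R) ->
  forall t, 0 < t -> derive1 h t = fint 1 (tderiv (derive1 h)) t.
Proof.
move=> [h0 /(_ 0%N isT) dh hac] init; set w := tderiv _.
have cw := causal_tderiv hac; rewrite -/w in cw.
pose l := derive1 h 1 - fint 1 w 1.
have lE t : 0 < t -> derive1 h t = l + fint 1 w t.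
  move=> t0; have [t1|t1] := leP t 1.
    have : derive1 h 1 - derive1 h t = fint 1 w 1 - fint 1 w t := tderiv_increment hac t0 t1.
    rewrite /l; move: (derive1 h 1) (derive1 h t) (fint 1 w 1) (fint 1 w t) => a b c k; lra.
  have : derive1 h t - derive1 h 1 = fint 1 w t - fint 1 w 1.
    exact: tderiv_increment hac ltr01 (ltW t1).
  rewrite /l; move: (derive1 h 1) (derive1 h t) (fint 1 w 1) (fint 1 w t) => a b c k; lra.
suff l0 : l = 0 by move=> t t0; rewrite lE// l0 add0r.
apply/eqP; rewrite -normr_le0; apply/ler_addgt0Pr => e e0; rewrite add0r.
have e2 : 0 < e / 2 by rewrite divr_gt0.
have /cvgr0Pnorm_lt/(_ _ e2) := fint1_cvg0 cw.
move=> [del /= del0 hdel].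
have /cvgr0Pnorm_lt/(_ _ e2) init2 := init.
have [t [t0 tdel ht]] : exists t, [/\ 0 < t, t < del & `|t^-1 * (h t - h 0)| < e / 2].
  near (0 : R)^'+ => t; exists t; split => //; near: t; first [exact: init2|exact: nbhs_right_lt].
have [||c] := @MVT R h (derive1 h) 0 t t0.
- by move=> x; rewrite in_itv/= => /andP[x0 _]; apply: is_derive_derive1; exact: dh.
- apply/continuous_within_itvP => //; split => //.
  + move=> x; rewrite in_itv/= => /andP[x0 _].
    by apply: differentiable_continuous; apply/derivable1_diffP; exact: dh.
  + apply: cvg_at_left_filter; apply: differentiable_continuous; apply/derivable1_diffP; exact: dh.
rewrite in_itv/= => /andP[c0 ct]; rewrite subr0 => hc.
have wc : `|fint 1 w c| < e / 2.
  by apply: hdel; rewrite /= sub0r normrN gtr0_norm ?(lt_trans ct).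
move: ht; rewrite hc lE// mulrC mulfK ?gt_eqF// => lw.
have -> : l = (l + fint 1 w c) - fint 1 w c by rewrite addrK.
by rewrite (le_trans (ler_normB _ _))// [leRHS]splitr; apply: lerD; exact: ltW.
Unshelve. all: by end_near. Qed.

Lemma lipschitz_abs_continuous h (D : set R) M : 0 <= M ->
  (forall x y, D x -> D y -> x <= y -> `|h y - h x| <= M * (y - x)) -> abs_continuous D h.
Proof.
move=> M0 hM e e0; exists (e / (M + 1)); first by rewrite divr_gt0// ltr_wpDl.
move=> m u w uw _ sm; apply: (@le_lt_trans _ _ (M * \sum_(i < m) (w i - u i))).
  rewrite mulr_sumr; apply: ler_sum => i _.
  by have [] := uw i (ltn_ord i) => *; exact: hM.
apply: (@le_lt_trans _ _ (M * (e / (M + 1)))); first by rewrite ler_wpM2l// ltW.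
by rewrite mulrCA gtr_pMr// ltr_pdivrMr ?mul1r ?ltrDl// ltr_wpDl.
Qed.

Lemma derivable_abs_continuous h w T : causal w ->
  (forall t, 0 < t -> is_derive t 1 h (fint 1 w t)) -> abs_continuous `]0, T[ h.
Proof.
move=> cw dh; have [M M0 hM] := fint1_bound T cw.
apply: (lipschitz_abs_continuous M0) => x y.
rewrite /= !in_itv/= => /andP[x0 xT] /andP[y0 yT]; rewrite le_eqVlt => /predU1P[->|xy].
  by rewrite !subrr normr0 mulr0.
have [||c] := @MVT R h (fint 1 w) x y xy.
- by move=> z; rewrite in_itv/= => /andP[xz _]; apply: dh; exact: lt_trans xz.
- apply: derivable_within_continuous => z; rewrite in_itv/= => /andP[xz _].
  by have [] : is_derive z 1 h (fint 1 w z) by apply: dh; exact: lt_le_trans xz.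
rewrite in_itv/= => /andP[xc cy] ->; rewrite normrM (gtr0_norm (_ : 0 < y - x)) ?subr_gt0//.
by rewrite ler_wpM2r ?subr_ge0 ?(ltW xy)// hM// ltW// (lt_trans cy).
Qed.

Section at_point.
Context (v : R -> R -> R) (x : R).
Local Notation h := (v ^~ x).

Lemma tderiv_derive1n n : (forall T : R, 0 < T -> abs_continuous `]0, T[ (derive1n n h)) ->
  {ae mu, forall t : R, 0 < t -> derive1n n.+1 h t = tderiv (derive1n n h) t}.
Proof.
move=> hac; apply: aeS (abs_continuous_derive hac) => t ht t0.
have [_ dt] := ht t0.
by rewrite derive1nS derive1E dt /tderiv t0.
Qed.

Lemma caputo_fint nu n t : ceiln nu = n.+1 -> nu < n.+1%:R ->
  (forall T : R, 0 < T -> abs_continuous `]0, T[ (derive1n n h)) ->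
  caputo nu v t x = fint (n.+1%:R - nu) (tderiv (derive1n n h)) t.
Proof.
move=> nuE nun hac; rewrite /caputo nuE lt_eqF//.
have b0 : 0 < n.+1%:R - nu by rewrite subr_gt0.
have [mw w0 _] := causal_tderiv hac.
rewrite fintE//; transitivity ((Gamma (n.+1%:R - nu))^-1 *
    \int[mu]_r (pker (n.+1%:R - nu) (t - r) * tderiv (derive1n n h) r)).
  congr (_ * _); rewrite /Rintegral integral_mkcond; congr fine.
  apply: ae_eq_integral_nonmeasurable.
  (* The Caputo integral runs over the closed interval, whereas the kernel is cut for [r >= t] and
     [tderiv] for [r <= 0]; the two end points are discarded. *)
  have := aeI (aeI (ae_neq t) (ae_neq 0)) (tderiv_derive1n hac).
  apply: aeS => r [[rt r0] wE] _; rewrite patchE mem_setE.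
  have -> : (r \in `[0, t]) = (0 <= r) && (r <= t) by rewrite in_itv.
  rewrite [r <= t]le_eqVlt.
  rewrite /pker subr_gt0 (negbTE (introN eqP rt)) orFb.
  have [r1|r1] := ltP 0 r; last first.
    rewrite w0// mulr0; case: ifP => // /andP[r2 _].
    by case: r0; apply/le_anti; rewrite r1 r2.
  rewrite (ltW r1) andTb wE//.
  by case: ifP => _; [rewrite mulrC|rewrite mul0r].
rewrite -RintegralMl_ge0 ?invr_ge0 ?ltW ?Gamma_gt0//.
  by apply: eq_Rintegral => r _; rewrite fkerE mulrA.
apply: measurable_funM => //.
by apply: (measurableT_comp (measurable_pker _)); exact: measurable_funB.
Qed.

(** Writing [I] for the fractional integral, the witness is [I^(1 - 2 alpha) h'] for [alpha <= 1/2]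
    and [I^(2 - 2 alpha) h''] otherwise; the rest is additivity of the orders. The vanishing initial
    slope enters in the second case through [h' = I^1 h'']. Integer orders are treated apart: the
    Caputo derivative is then an ordinary derivative, which agrees with the witness only almost
    everywhere. *)
Lemma caputo_representation alpha : 0 < alpha -> alpha <= 1 ->
  ACn (ceiln (2 * alpha)) h ->
  (2^-1 < alpha -> t^-1 * (h t - h 0) @[t --> 0^'+] --> (0 : R)) ->
  [/\ forall T, 0 < T -> abs_continuous `]0, T[ h,
    h t @[t --> 0^'+] --> h 0,
    forall t, 0 < t -> caputo alpha v t x = fint (1 - alpha) (tderiv h) t &
    exists c, [/\ causal c,
      {ae mu, forall t : R, 0 < t -> caputo (2 * alpha) v t x = c t},
      {ae mu, forall t : R, 0 < t -> h t - h 0 = fint (2 * alpha) c t} &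
      {ae mu, forall t : R, fint (1 - alpha) (tderiv h) t = fint alpha c t}]].
Proof.
move=> a0 a1 acn init.
have n1 : ceiln alpha = 1%N by exact: ceiln1.
have h0 : h t @[t --> 0^'+] --> h 0 by case: acn.
have [a2|a2] := leP alpha 2^-1.
  have a22 : 2 * alpha <= 1 by rewrite mulrC -ler_pdivlMr// mul1r.
  have n2 : ceiln (2 * alpha) = 1%N by apply: ceiln1 => //; rewrite mulr_gt0.
  move: acn; rewrite n2 => -[_ _ hac].
  have cw := causal_tderiv hac.
  have al1 : alpha < 1 by rewrite (le_lt_trans a2)// invf_lt1// ltr1n.
  split => // [t t0|]; first exact: (@caputo_fint alpha 0).
  exists (fint (1 - 2 * alpha) (tderiv h)); split.
  - by apply: causal_fint => //; rewrite subr_ge0.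
  - move: a22; rewrite le_eqVlt => /predU1P[a22|a22].
      apply: aeS (tderiv_derive1n hac) => t /[apply].
      by rewrite /caputo n2 a22 eqxx subrr fint0.
    by apply: aeW => t t0; rewrite (@caputo_fint _ 0).
  - have := @fint_add R (2 * alpha) (1 - 2 * alpha) (tderiv h).
    move=> /(_ _ _ cw); rewrite subr_ge0 mulr_ge0 ?(ltW a0)// => /(_ isT a22).
    apply: aeS => t -> t0; rewrite subrKC.
    exact: abs_continuous_primitive.
  - have := @fint_add R alpha (1 - 2 * alpha) (tderiv h).
    move=> /(_ _ _ cw); rewrite subr_ge0 (ltW a0)// => /(_ isT a22).
    by apply: aeS => t ->; congr fint; ring.
have a22 : 2 * alpha <= 2 by rewrite ler_piMr.
have n2 : ceiln (2 * alpha) = 2%N.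
  by apply: ceiln2 => //; rewrite mulrC -ltr_pdivrMr// mul1r.
move: acn; rewrite n2 => acn2; have dE := ACn2_derive acn2 (init a2).
have [_ /(_ 0%N isT) dh hac2] := acn2.
have cw := causal_tderiv hac2; set w := tderiv _ in cw dE.
have dw t : 0 < t -> is_derive t 1 h (fint 1 w t).
  by move=> t0; rewrite -dE//; apply: is_derive_derive1; exact: dh.
have hac T : 0 < T -> abs_continuous `]0, T[ h.
  by move=> T0; exact: (derivable_abs_continuous T cw dw).
have tE : tderiv h = fint 1 w.
  apply/funext => t; rewrite /tderiv; case: ltP => [t0|t0].
    by rewrite (upper_derivE (dw t t0)).
  by have [_ w0 _] := cw; rewrite fint_le0.
split => // [t t0|].
  move: a1; rewrite le_eqVlt => /predU1P[al1|al1]; last exact: (@caputo_fint alpha 0).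
  by rewrite /caputo n1 al1 eqxx subrr fint0 tE -dE.
have b0 : 0 <= 2 - 2 * alpha by rewrite subr_ge0.
exists (fint (2 - 2 * alpha) w); split.
- exact: causal_fint.
- move: a22; rewrite le_eqVlt => /predU1P[a22|a22].
    apply: aeS (@tderiv_derive1n 1 hac2) => t /[apply].
    by rewrite /caputo n2 a22 eqxx subrr fint0.
  by apply: aeW => t t0; rewrite (@caputo_fint _ 1).
- have e1 := @fint_add R (2 * alpha) (2 - 2 * alpha) w (ltW (mulr_gt0 (ltr0n _ 2) a0)) b0 cw.
  have e2 := @fint_add R 1 1 w ler01 ler01 cw.
  apply: aeS (aeI e1 e2) => t [-> h2] t0; rewrite subrKC -[2]/(1 + 1) -h2 -tE.
  exact: abs_continuous_primitive.
- have e1 := @fint_add R alpha (2 - 2 * alpha) w (ltW a0) b0 cw.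
  have a1' : 0 <= 1 - alpha by rewrite subr_ge0.
  have e2 := @fint_add R (1 - alpha) 1 w a1' ler01 cw.
  apply: aeS (aeI e1 e2) => t [-> h2]; rewrite tE h2; congr fint; ring.
Qed.

End at_point.
End caputo_representation.

(** * Test functions and uniformly locally integrable functions *)

Section test_functions.
Context {R : realType}.
Implicit Types phi : R -> R.

Lemma test_function_derive phi : test_function phi -> test_function (derive1 phi).
Proof.
move=> [dphi [M phi0]]; split => [k x|]; first by rewrite -derive1Sn; exact: dphi.
exists M => x Mx; rewrite derive1E -(derive_cst (0 : R) x 1); apply: near_eq_derive.
have : \forall y \near x, M < `|y| by apply: (cvgr_gt _ (@norm_continuous _ R x)); exact: Mx.
by apply: filterS => y; exact: phi0.
Qed.

Lemma test_function_derive1n phi n : test_function phi -> test_function (derive1n n phi).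
Proof. by move=> tphi; elim: n => // n; rewrite derive1nS; exact: test_function_derive. Qed.

Lemma test_function_is_derive phi (x : R) : test_function phi -> is_derive x 1 phi (derive1 phi x).
Proof. by move=> [/(_ 0%N x) dphi _]; rewrite derive1E; exact: derivableP. Qed.

Lemma test_function_continuous phi : test_function phi -> continuous phi.
Proof.
move=> tphi x; apply: differentiable_continuous; apply/derivable1_diffP.
by have [] := test_function_is_derive x tphi.
Qed.

Lemma test_function_measurable phi : test_function phi -> measurable_fun setT phi.
Proof. by move=> /test_function_continuous; exact: continuous_measurable_fun. Qed.

Lemma test_function_bound phi : test_function phi ->
  exists M B, 0 <= B /\ forall x, `|phi x| <= B * (`|x| <= M)%R%:R.
Proof.
move=> tphi; have [_ [M0 phi0]] := tphi.
pose M := `|M0|; have MM : - M <= M by rewrite -subr_ge0 opprK /M addr_ge0.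
have [|c _ hc] := @EVT_max R (fun x => `|phi x|) (- M) M MM.
  apply: continuous_subspaceT => x; apply: continuous_comp; last exact: norm_continuous.
  exact: test_function_continuous.
exists M, `|phi c|; split => // x; have [xM|xM] := leP `|x| M.
  by rewrite mulr1; apply: hc; rewrite in_itv/= -ler_norml.
by rewrite mulr0 phi0 ?normr0// (le_lt_trans _ xM)// ler_norm.
Qed.

End test_functions.

Section uniformly_locally_integrable.
Context {R : realType}.
Local Notation mu := (leb R).
Implicit Types (g h phi psi : R -> R).

Lemma measurable_near_ind (y M : R) :
  measurable_fun setT (fun x : R => (`|x - y| <= M)%R%:R : R).
Proof.
rewrite (_ : (fun x => _) = \1_(`[y - M, y + M]%classic : set R)).
  by apply: measurable_indic; exact: measurable_itv.
by apply/funext => t; rewrite indicE mem_setE in_itv/= ler_distl.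
Qed.

Lemma integral_near_ind (M y : R) :
  (\int[mu]_x ((`|x - y| <= M)%R%:R : R)%:E <= `|2 * M|%:E)%E.
Proof.
have -> : (\int[mu]_x ((`|x - y| <= M)%R%:R : R)%:E =
    \int[mu]_x (\1_(`[y - M, y + M]%classic : set R) x)%:E)%E.
  by apply: eq_integral => t _; rewrite indicE mem_setE in_itv/= ler_distl.
rewrite integral_indic// setIT.
rewrite [leLHS](_ : _ = lebesgue_measure (`[y - M, y + M]%classic : set R))//.
rewrite lebesgue_measure_itv/=; case: ifP => _; last by rewrite lee_fin.
rewrite -EFinD lee_fin (_ : y + M - (y - M) = 2 * M) ?ler_norm//; ring.
Qed.

(** Local [L^1] norms bounded uniformly in the centre [y]. The class contains [L^2], the bounded
    functions and the Laplace transform of [v], and it excludes the exponential solutions of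
    [h'' = a h]. *)
Definition uli g := measurable_fun setT g /\
  forall M : R, exists B : R, forall y : R,
    (\int[mu]_x (`|g x| * (`|x - y| <= M)%R%:R)%:E <= B%:E)%E.

Lemma uli_bounded g (B : R) : measurable_fun setT g -> (forall x, `|g x| <= B) -> uli g.
Proof.
move=> mg gB; have B0 : 0 <= B by exact: le_trans (gB 0).
split => // M; exists (B * `|2 * M|) => y.
apply: (@le_trans _ _ (\int[mu]_x (B * (`|x - y| <= M)%R%:R)%:E)%E).
  apply: ge0_le_integral_nonmeasurable => x; first by rewrite lee_fin mulr_ge0.
  by rewrite lee_fin ler_wpM2r.
rewrite ge0_integralZl_R//; last exact: measurable_near_ind.
by rewrite EFinM lee_wpmul2l ?lee_fin// integral_near_ind.
Qed.

Lemma uli_le g h : measurable_fun setT g -> uli h ->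
  {ae mu, forall x, `|g x| <= `|h x|} -> uli g.
Proof.
move=> mg [mh hh] gh; split => // M; have [B hB] := hh M; exists B => y.
have m1 : measurable_fun setT (fun x => (`|g x| * (`|x - y| <= M)%R%:R)%:E).
  apply/measurable_EFinP/measurable_funM; last exact: measurable_near_ind.
  exact: measurableT_comp.
have m2 : measurable_fun setT (fun x => (`|h x| * (`|x - y| <= M)%R%:R)%:E).
  apply/measurable_EFinP/measurable_funM; last exact: measurable_near_ind.
  exact: measurableT_comp.
apply: le_trans (hB y); apply: ae_ge0_le_integral => //.
by apply: aeS gh => x ghx _; rewrite lee_fin ler_wpM2r.
Qed.

Lemma uli_add g h : uli g -> uli h -> uli (fun x => g x + h x).
Proof.
move=> [mg hg] [mh hh]; split => [|M]; first exact: measurable_funD.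
have [B1 hB1] := hg M; have [B2 hB2] := hh M; exists (B1 + B2) => y.
have m1 : measurable_fun setT (fun x => (`|g x| * (`|x - y| <= M)%R%:R)%:E).
  apply/measurable_EFinP/measurable_funM; last exact: measurable_near_ind.
  exact: measurableT_comp.
have m2 : measurable_fun setT (fun x => (`|h x| * (`|x - y| <= M)%R%:R)%:E).
  apply/measurable_EFinP/measurable_funM; last exact: measurable_near_ind.
  exact: measurableT_comp.
rewrite EFinD; apply: le_trans (leeD (hB1 y) (hB2 y)).
rewrite -ge0_integralD//.
apply: ge0_le_integral_nonmeasurable => x; first by rewrite lee_fin mulr_ge0.
by rewrite -EFinD lee_fin -mulrDl ler_wpM2r// ler_normD.
Qed.

Lemma uli_scale (k : R) g : uli g -> uli (fun x => k * g x).
Proof.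
move=> [mg hg]; split => [|M]; first exact: measurable_funM.
have [B hB] := hg M; exists (`|k| * B) => y.
rewrite EFinM; apply: le_trans (lee_wpmul2l _ (hB y)); last by rewrite lee_fin.
rewrite -ge0_integralZl_R//.
  apply: ge0_le_integral_nonmeasurable => x; first by rewrite lee_fin mulr_ge0.
  by rewrite lee_fin normrM mulrA.
apply: measurable_funM; last exact: measurable_near_ind.
exact: measurableT_comp.
Qed.

(** The constant depends on the size and width of [psi] but not on its position, so convolutions
    with a test function are bounded. *)
Lemma uli_pairing_bound g (M B : R) : uli g -> 0 <= B -> exists C : R, forall (y : R) psi,
  measurable_fun setT psi -> (forall x, `|psi x| <= B * (`|x - y| <= M)%R%:R) ->
  mu.-integrable setT (EFin \o (fun x => g x * psi x)) /\
  `|\int[mu]_x (g x * psi x)| <= C.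
Proof.
move=> [mg hg] B0; have [C hC] := hg M; exists (B * C) => y psi mpsi psiB.
have le1 : (\int[mu]_x `|(g x * psi x)%:E| <= (B * C)%:E)%E.
  rewrite EFinM; apply: le_trans (lee_wpmul2l _ (hC y)); last by rewrite lee_fin.
  rewrite -ge0_integralZl_R//.
    apply: ge0_le_integral_nonmeasurable => x; first by [].
    by rewrite /= lee_fin normrM mulrCA ler_wpM2l.
  apply: measurable_funM; last exact: measurable_near_ind.
  exact: measurableT_comp.
have ig : mu.-integrable setT (EFin \o (fun x => g x * psi x)).
  apply/integrableP; split; first by apply/measurable_EFinP; exact: measurable_funM.
  by apply: le_lt_trans le1 _; rewrite ltry.
split => //; rewrite -lee_fin; apply: le_trans le1.
rewrite /Rintegral; apply: le_trans (le_abse_integral _ _ _) => //.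
- by rewrite -abse_EFin fineK// integrable_fin_num.
- exact: measurable_int ig.
Qed.

Lemma uli_test_integrable g phi : uli g -> test_function phi ->
  mu.-integrable setT (EFin \o (fun x => g x * phi x)).
Proof.
move=> ug tphi; have [M [B [B0 hB]]] := test_function_bound tphi.
have [C /(_ 0 phi)] := uli_pairing_bound M ug B0.
move=> /(_ (test_function_measurable tphi)) [] // x.
by rewrite subr0.
Qed.

Lemma L2normE g : L2norm g = ((\int[mu]_x (g x ^+ 2)%:E) `^ 2^-1)%E.
Proof.
rewrite /L2norm unlock; congr poweR; apply: eq_integral => x _.
rewrite [LHS](_ : _ = (`|g x|%:E `^ 2)%E)// poweR_EFin powR_mulrn//.
by rewrite real_normK// num_real.
Qed.

Lemma L2norm_ge0 g : (0 <= L2norm g)%E. Proof. exact: Lnorm_ge0. Qed.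

Lemma L2_local (M : R) : exists2 S : R, 0 < S & forall (y : R) g, measurable_fun setT g ->
  (\int[mu]_x (`|g x| * (`|x - y| <= M)%R%:R)%:E <= S%:E * L2norm g)%E.
Proof.
(* Hoelder's inequality against the indicator, whose [L^2] norm is at most the square root of the
   length [2 M]; the summand [1] makes [S] positive. *)
pose S := `|2 * M| `^ 2^-1 + 1.
exists S => [|y g mg]; first by rewrite ltr_wpDl ?powR_ge0.
pose k (x : R) : R := (`|x - y| <= M)%R%:R.
have mk : measurable_fun setT k by exact: measurable_near_ind.
have := @hoelder _ _ R mu g k 2 2 mg mk (ltr0n _ 2) (ltr0n _ 2).
have half2 : 2^-1 + 2^-1 = 1 :> R by rewrite [RHS](splitr 1) mul1r.
move=> /(_ half2); rewrite Lnorm1 => h.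
have -> : (\int[mu]_x (`|g x| * k x)%:E = \int[mu]_x `|(EFin \o (g \* k)%R) x|)%E.
  by apply: eq_integral => x _; rewrite /= normrM [X in _ = (_ * X)%:E]ger0_norm.
apply: le_trans h _; rewrite muleC; apply: lee_wpmul2r; first exact: L2norm_ge0.
rewrite -/(L2norm k) L2normE.
apply: (@le_trans _ _ (`|2 * M|%:E `^ 2^-1)%E); last first.
  by rewrite poweR_EFin lee_fin lerDl.
apply: gt0_ler_poweR.
- by rewrite invr_ge0.
- by rewrite in_itv/= leey andbT; apply: integral_ge0 => x _; rewrite lee_fin sqr_ge0.
- by rewrite in_itv/= leey andbT lee_fin.
- apply: le_trans (integral_near_ind M y); rewrite le_eqVlt; apply/orP; left; apply/eqP.
  by apply: eq_integral => x _; rewrite /k; case: (_ <= _); rewrite ?expr1n ?expr0n.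
Qed.

Lemma L2P g : L2 g -> measurable_fun setT g /\ (L2norm g < +oo)%E.
Proof. by rewrite /L2 inE /= => /andP[]; rewrite !inE. Qed.

Lemma uli_L2 g : L2 g -> uli g.
Proof.
move=> /L2P[mg gfin]; split => // M; have [S S0 hS] := L2_local M.
have gf : L2norm g \is a fin_num by rewrite ge0_fin_numE// L2norm_ge0.
exists (S * fine (L2norm g)) => y.
by rewrite EFinM fineK//; exact: hS.
Qed.

(** Tonelli for [|g|]: the double integral vanishes in one order, hence in the other. *)
Lemma ae_swap (g : R * R -> R) : measurable_fun setT g ->
  {ae mu, forall x, {ae mu, forall t, g (t, x) = 0}} ->
  {ae mu, forall t, {ae mu, forall x, g (t, x) = 0}}.
Proof.
move=> mg g0; pose F (z : R * R) : R := `|g z|.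
have mF : measurable_fun setT F by exact: measurableT_comp.
have F0 z : 0 <= F z by exact: normr_ge0.
have I0 : (\int[mu]_t \int[mu]_x (F (t, x))%:E = 0)%E.
  have := @fubini_tonelli _ _ _ _ R mu mu (fun z => (F z)%:E).
  move=> ->//; last exact/measurable_EFinP.
  rewrite (_ : 0%E = \int[mu]_x (cst 0%E x))%E; last by rewrite integral0.
  apply: ae_eq_integral_nonmeasurable; apply: aeS g0 => x gx _.
  rewrite (_ : cst 0%E x = \int[mu]_t (cst 0%E t))%E; last by rewrite integral0.
  by apply: ae_eq_integral_nonmeasurable; apply: aeS gx => t gt _; rewrite /F gt normr0.
have mI : measurable_fun setT (fun t => \int[mu]_x (F (t, x))%:E)%E.
  exact: measurable_integral_snd.
have : (\int[mu]_t `|\int[mu]_x (F (t, x))%:E| = 0)%E.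
  rewrite -[RHS]I0; apply: eq_integral => t _.
  by rewrite gee0_abs//; apply: integral_ge0 => x _; rewrite lee_fin.
move=> /(ae_eq_integral_abs mu measurableT mI); apply: aeS => t /(_ Logic.I)/= It.
have mgt : measurable_fun setT (fun x => (g (t, x))%:E).
  by apply/measurable_EFinP; apply: (measurableT_comp mg); exact: measurable_fun_pair.
have : (\int[mu]_x `|(g (t, x))%:E| = 0)%E by exact: It.
move=> /(ae_eq_integral_abs mu measurableT mgt); apply: aeS => x /(_ Logic.I)/=.
by move=> /eqP; rewrite eqe => /eqP.
Qed.

End uniformly_locally_integrable.

(** * Laplace transform of the solution *)

Section laplace_tools.
Context {R : realType}.
Local Notation mu := (leb R).

Lemma measurable_pos_fst_set : measurable [set z : R * R | 0 < z.1].
Proof.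
rewrite (_ : [set z | _] = fst @^-1` (`]0, +oo[%classic : set R)).
    rewrite -[X in measurable X]setTI; apply: measurable_fst => //; exact: measurable_itv.
by apply/seteqP; split => z; rewrite /= in_itv/= andbT.
Qed.

Lemma measurable_pos_fst (phi : R * R -> R) :
  measurable_fun [set z : R * R | 0 < z.1] phi ->
  measurable_fun setT (fun z : R * R => if 0 < z.1 then phi z else 0).
Proof.
move=> mphi; have -> : (fun z : R * R => if 0 < z.1 then phi z else 0) =
    phi \_ [set z : R * R | 0 < z.1].
  apply/funext => z; rewrite patchE; case: ifP => z0; first by rewrite mem_set.
  by rewrite memNset//= z0.
by apply/(measurable_restrictT _ measurable_pos_fst_set).
Qed.

Lemma measurable_fint2 b (G : R * R -> R) : measurable_fun setT G ->
  measurable_fun setT (fun z : R * R => fint b (fun r => G (r, z.2)) z.1).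
Proof.
move=> mG; have [->|b0] := eqVneq b 0.
  by rewrite (_ : (fun z => _) = G)//; apply/funext => -[t x]; rewrite fint0.
rewrite (_ : (fun z => _) =
  fun z : R * R => \int[mu]_r (fker b (z.1 - r) * G (r, z.2))); last first.
  by apply/funext => z; rewrite /fint (negbTE b0).
apply: (measurable_Rintegral_snd mu
  (F := fun p : (R * R) * R => fker b (p.1.1 - p.2) * G (p.2, p.1.2))).
have m11 : measurable_fun setT (fun p : (R * R) * R => p.1.1).
  exact: (measurableT_comp measurable_fst measurable_fst).
have m12 : measurable_fun setT (fun p : (R * R) * R => p.1.2).
  exact: (measurableT_comp measurable_snd measurable_fst).
apply: measurable_funM.
  by apply: (measurableT_comp (measurable_fker b)); exact: measurable_funB.
by apply: (measurableT_comp mG); exact: measurable_fun_pair.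
Qed.

Lemma measurable_section (G : R * R -> R) x : measurable_fun setT G ->
  measurable_fun setT (fun t => G (t, x)).
Proof. by move=> mG; apply: (measurableT_comp mG); exact: measurable_fun_pair. Qed.

Lemma measurable_section2 (G : R * R -> R) t : measurable_fun setT G ->
  measurable_fun setT (fun x => G (t, x)).
Proof. by move=> mG; apply: (measurableT_comp mG); exact: measurable_fun_pair. Qed.

Lemma laplace_fint_abs b s (g : R -> R) : 0 <= b -> 0 < s -> measurable_fun setT g ->
  (\int[mu]_t (`|fint b g t| * expR (- s * t))%:E <=
   (s `^ (- b))%:E * \int[mu]_t (`|g t| * expR (- s * t))%:E)%E.
Proof.
rewrite le_eqVlt => /predU1P[<-|b0] s0 mg; first by rewrite fint0 oppr0 powRr0 mul1e.
have mg' : measurable_fun setT (fun t => `|g t|) by exact: measurableT_comp.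
rewrite -(laplace_fker_conv_ge0 b0 s0 mg' (fun t => normr_ge0 _)).
apply: ge0_le_integral_nonmeasurable => t; first by rewrite lee_fin mulr_ge0 ?expR_ge0.
rewrite ge0_integralZr_R ?expR_ge0//.
- by rewrite EFinM lee_wpmul2r ?lee_fin ?expR_ge0// fint_norm_le.
- by apply: measurable_funM => //; exact: measurable_fker_sub.
- by move=> r; rewrite mulr_ge0 ?fker_ge0.
Qed.

Lemma measurable_L2norm (c : R * R -> R) : measurable_fun setT c ->
  measurable_fun setT (fun t => L2norm (fun x => c (t, x))).
Proof.
move=> mc; rewrite (_ : (fun t => _) =
    (fun t => (\int[mu]_x (c (t, x) ^+ 2)%:E) `^ 2^-1)%E); last first.
  by apply/funext => t; rewrite L2normE.
apply: (measurableT_comp (measurable_poweR _)).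
apply: (measurable_integral_snd mu (F := fun z => c z ^+ 2)) => [|z].
  exact: measurable_funX.
exact: sqr_ge0.
Qed.

(* for [t >= 1], [e^(-st) n <= t^zeta e^(-beta t) n^2 + e^(-t)] by AM-GM *)
Lemma exp_weight_bound (beta zeta s t : R) (n : \bar R) : -1 < zeta -> beta / 2 + 1 <= s ->
  1 <= t -> (0 <= n)%E ->
  ((expR (- s * t))%:E * n <=
   (t `^ zeta * expR (- beta * t))%:E * n ^+ 2 + (expR (- 1 * t))%:E)%E.
Proof.
move=> z1 bs t1 n0; have t0 : 0 < t by exact: lt_le_trans t1.
set w := t `^ zeta * expR (- beta * t).
have w0 : 0 < w by rewrite mulr_gt0 ?expR_gt0 ?powR_gt0.
(* From [2 s >= beta + 2], and from [expR (- t) <= 1 / t <= t^zeta] for [t >= 1], because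
   [zeta > -1]. The threshold [beta / 2 + 1] has its origin here. *)
have wE : expR (- s * t) ^+ 2 <= w * expR (- 1 * t).
  rewrite -expRM_natl mulr_natl /w -mulrA -expRD.
  apply: (@le_trans _ _ (expR (- t) * expR (- beta * t + -1 * t))).
    rewrite -expRD ler_expR -mulr_natl; nra.
  rewrite ler_wpM2r ?expR_ge0//.
  apply: (@le_trans _ _ (t `^ (-1))); last by rewrite ler_powR// ltW.
  rewrite powR_inv1 ?(ltW t0)// expRN lef_pV2 ?posrE ?expR_gt0//.
  by rewrite (le_trans _ (expR_ge1Dx t))// lerDr.
case: n n0 => [n|_|//]; last first.
  by rewrite expe2 mulyy !gt0_muley ?lte_fin ?expR_gt0//= addye.
rewrite lee_fin => n0; rewrite -EFin_expe -!EFinM -EFinD lee_fin.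
set a := expR (- s * t) in wE *; set b := expR (- 1 * t) in wE *.
rewrite -subr_ge0 -(pmulr_rge0 _ (mulr_gt0 (ltr0n R 4) w0)).
have -> : 4 * w * (w * n ^+ 2 + b - a * n) = (2 * w * n - a) ^+ 2 + (4 * (w * b) - a ^+ 2).
  by ring.
by rewrite addr_ge0 ?sqr_ge0// subr_ge0 (le_trans wE)// ler_peMl ?ler1n// (le_trans (sqr_ge0 a)).
Qed.

(** Tonelli puts the integral in [x] inside, where it is bounded by a multiple of the norm [N t]
    whatever the centre [y]. On []0, 1[] integrability of [N] is assumed; from time [1] on
    [exp_weight_bound] trades the exponential for the weighted square of [N]. *)
Lemma laplace_local_bound (beta zeta s M : R) (c : R * R -> R) : -1 < zeta ->
  beta / 2 + 1 <= s -> 0 < s ->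
  measurable_fun setT c -> (forall t x, t <= 0 -> c (t, x) = 0) ->
  (\int[mu]_(t in `]0%R, 1%R[) L2norm (fun x => c (t, x)) < +oo)%E ->
  (\int[mu]_(t in `]0%R, +oo[)
     ((t `^ zeta * expR (- beta * t))%:E * L2norm (fun x => c (t, x)) ^+ 2) < +oo)%E ->
  exists B : R, forall y : R,
    (\int[mu]_x \int[mu]_t (`|c (t, x)| * expR (- s * t) * (`|x - y| <= M)%R%:R)%:E <= B%:E)%E.
Proof.
move=> z1 bs s0 mc c0; set N := fun t => L2norm (fun x => c (t, x)).
move=> I1 I2; rewrite integral_mkcond in I1; rewrite integral_mkcond in I2.
set A1 := _ \_ _ in I1; set A2 := _ \_ _ in I2.
have mN : measurable_fun setT N by exact: measurable_L2norm.
have N0 t : (0 <= N t)%E by exact: L2norm_ge0.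
have m1 : measurable_fun setT A1.
  by apply/(measurable_restrictT _ (measurable_itv _)); exact: measurable_funTS.
have m2 : measurable_fun setT A2.
  apply/(measurable_restrictT _ (measurable_itv _)); apply: measurable_funTS.
  apply: emeasurable_funM.
    apply/measurable_EFinP/measurable_funM; first exact: measurable_powR.
    exact: measurable_expN.
  by rewrite (_ : (fun t => _) = (fun t => N t * N t)%E) //; exact: emeasurable_funM.
have A10 t : (0 <= A1 t)%E.
  by rewrite /A1 patchE; case: ifP => // _; exact: N0.
have A20 t : (0 <= A2 t)%E.
  rewrite /A2 patchE; case: ifP => // _.
  by rewrite mule_ge0 ?lee_fin ?mulr_ge0 ?powR_ge0 ?expR_ge0// expe2 mule_ge0 ?L2norm_ge0.
have [S S0 hS] := L2_local (R := R) M.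
have P0 t : (0 <= (posexp 1 t)%:E :> \bar R)%E by rewrite lee_fin posexp_ge0.
have mP : measurable_fun setT (fun t : R => (posexp 1 t)%:E).
  by apply/measurable_EFinP; exact: measurable_posexp.
have m12 : measurable_fun setT (fun t => A1 t + A2 t)%E by exact: emeasurable_funD.
have G0 t : (0 <= A1 t + A2 t + (posexp 1 t)%:E)%E by rewrite !adde_ge0.
have IG : (\int[mu]_t (S%:E * (A1 t + A2 t + (posexp 1 t)%:E)) < +oo)%E.
  rewrite ge0_integralZl//; [|exact: emeasurable_funD|by rewrite lee_fin ltW].
  apply: lte_mul_pinfty; [by rewrite lee_fin ltW|by []|].
  rewrite ge0_integralD//; last by move=> t _; rewrite adde_ge0.
  rewrite ge0_integralD//.
  apply: lte_add_pinfty; first exact: lte_add_pinfty.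
  by rewrite [X in (X < _)%E](integral_posexp ltr01) ltry.
exists (fine (\int[mu]_t (S%:E * (A1 t + A2 t + (posexp 1 t)%:E)))) => y.
rewrite fineK; last first.
  rewrite ge0_fin_numE//; apply: integral_ge0 => t _.
  by rewrite mule_ge0// lee_fin ltW.
pose F (z : R * R) : R := `|c z| * expR (- s * z.1) * (`|z.2 - y| <= M)%R%:R.
have mF : measurable_fun setT F.
  apply: measurable_funM; first apply: measurable_funM.
  - exact: measurableT_comp.
  - exact: (measurableT_comp (measurable_expN s)).
  - exact: (measurableT_comp (measurable_near_ind y M)).
have F0 z : 0 <= F z by rewrite /F !mulr_ge0 ?expR_ge0.
have := @fubini_tonelli _ _ _ _ R mu mu (fun z => (F z)%:E).
move=> /(_ _ _)/esym; rewrite /F/= => -> //; last exact/measurable_EFinP.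
apply: ge0_le_integral_nonmeasurable => t.
  by apply: integral_ge0 => x _; rewrite lee_fin; exact: (F0 (t, x)).
have mct : measurable_fun setT (fun x => c (t, x)) by exact: measurable_section2.
have -> : (\int[mu]_x (`|c (t, x)| * expR (- s * t) * (`|x - y| <= M)%R%:R)%:E =
    (expR (- s * t))%:E * \int[mu]_x (`|c (t, x)| * (`|x - y| <= M)%R%:R)%:E)%E.
  rewrite -ge0_integralZl_R ?expR_ge0//.
  - by apply: eq_integral => x _; rewrite mulrCA mulrA.
  - apply: measurable_funM; last exact: measurable_near_ind.
    exact: measurableT_comp.
have [t0|t0] := leP t 0.
  rewrite integral0_eq ?mule0; last by move=> x _; rewrite c0// normr0 mul0r.
  by rewrite mule_ge0// lee_fin ltW.
apply: (@le_trans _ _ ((expR (- s * t))%:E * (S%:E * N t))%E).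
  by apply: lee_wpmul2l; [rewrite lee_fin expR_ge0|exact: hS].
rewrite muleCA; apply: lee_wpmul2l; first by rewrite lee_fin ltW.
have A2t : A2 t = ((t `^ zeta * expR (- beta * t))%:E * N t ^+ 2)%E.
  by rewrite /A2 patchE mem_set//= in_itv/= t0.
have [t1|t1] := ltP t 1.
  have A1t : A1 t = N t by rewrite /A1 patchE mem_set//= in_itv/= t0 t1.
  rewrite A1t -addeA; apply: (@le_trans _ _ (N t)); last by rewrite leeDl// adde_ge0.
  rewrite -[leRHS]mul1e; apply: lee_wpmul2r => //.
  by rewrite lee_fin -[leRHS]expR0 ler_expR mulNr oppr_le0 mulr_ge0// ltW.
rewrite A2t -addeA; apply: le_trans (exp_weight_bound z1 bs t1 (N0 t)) _.
by rewrite /posexp t0 leeDr.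
Qed.

Lemma integrable_prod_le (F : R * R -> R) (H : R -> R) : measurable_fun setT F ->
  mu.-integrable setT (EFin \o H) ->
  {ae mu, forall x, (\int[mu]_t `|F (t, x)|%:E <= (H x)%:E)%E} ->
  (mu \x mu)%E.-integrable setT (EFin \o F).
Proof.
move=> mF iH FH; apply: integrable_prod_of_ge0 => //.
have mA : measurable_fun setT (fun z => `|F z|) by exact: measurableT_comp.
have := @fubini_tonelli _ _ _ _ R mu mu (fun z => `|F z|%:E).
move=> ->//; last exact/measurable_EFinP.
have /integrableP[mH] := iH; apply: le_lt_trans; apply: ae_ge0_le_integral => //.
- by move=> x _; apply: integral_ge0.
- apply: (measurable_integral_snd mu (F := fun z => `|F (z.2, z.1)|)) => //.
  by apply: (measurableT_comp mA); exact: measurable_fun_pair.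
- exact: measurableT_comp.
- apply: aeS FH => x h _; apply: le_trans h _.
  by rewrite lee_fin ler_norm.
Qed.

End laplace_tools.

Lemma ae_ge0_le_integral_nonmeasurable {d} {T : measurableType d} {R : realType}
    (mu : {measure set T -> \bar R}) (f g : T -> \bar R) :
  (forall x, 0 <= f x)%E -> (forall x, 0 <= g x)%E -> {ae mu, forall x, f x <= g x}%E ->
  (\int[mu]_x f x <= \int[mu]_x g x)%E.
Proof.
move=> f0 g0 fg.
have -> : (\int[mu]_x f x = \int[mu]_x (mine (f x) (g x)))%E.
  by apply: ae_eq_integral_nonmeasurable; apply: aeS fg => x fgx _; rewrite min_l.
apply: ge0_le_integral_nonmeasurable => x; first by rewrite le_min f0 g0.
by rewrite ge_min lexx orbT.
Qed.

Section laplace_of_solution.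
Context {R : realType} (alpha sigma eta beta zeta : R) (f : R -> R) (v : R -> R -> R).
Context (alpha_gt0 : 0 < alpha) (alpha_le1 : alpha <= 1) (zeta_gtN1 : -1 < zeta).
Context (f_L2 : L2 f) (v_sol : telegraph_solution alpha sigma eta beta zeta f v).
Local Notation mu := (leb R).
Local Notation lam := (sigma / eta).

(** Measurability of [v] and of its Caputo derivative is given for positive times; cutting at [0]
    makes them measurable on the plane. *)
Definition vpos (z : R * R) : R := if 0 < z.1 then v z.1 z.2 else 0.
Definition cpos (z : R * R) : R := if 0 < z.1 then caputo (2 * alpha) v z.1 z.2 else 0.

Lemma measurable_vpos : measurable_fun setT vpos.
Proof. by have [[[mv _] _ _ _] _ _ _ _] := v_sol; exact: measurable_pos_fst. Qed.

Lemma measurable_cpos : measurable_fun setT cpos.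
Proof. by have [[_ _ [mc _] _] _ _ _ _] := v_sol; exact: measurable_pos_fst. Qed.

Lemma cpos_le0 t x : t <= 0 -> cpos (t, x) = 0.
Proof. by move=> t0; rewrite /cpos/= ltNge t0. Qed.

Let c1 x t := cpos (t, x).

(** The function [c] of [caputo_representation] is obtained separately for each [x]. Here it is
    replaced by the jointly measurable [cpos], with which it agrees for almost every [t]. *)
Definition regular_at x := [/\ forall T, 0 < T -> abs_continuous `]0, T[ (v ^~ x),
  v t x @[t --> 0^'+] --> f x,
  forall t, 0 < t -> caputo alpha v t x = fint (1 - alpha) (tderiv (v ^~ x)) t,
  {ae mu, forall t : R, fint (1 - alpha) (tderiv (v ^~ x)) t = fint alpha (c1 x) t} &
  {ae mu, forall t : R, vpos (t, x) =
     (if 0 < t then f x else 0) + fint (2 * alpha) (c1 x) t}].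

Lemma ae_regular : {ae mu, forall x, regular_at x}.
Proof.
have [[_ acn _ _] _ _ v0 init] := v_sol.
have init' : {ae mu, forall x, 2^-1 < alpha ->
    h^-1 * (v h x - v 0 x) @[h --> 0^'+] --> (0 : R)}.
  have [h|h] := ltP 2^-1 alpha; first by apply: aeS (init h) => x hx _.
  by apply: aeW => x.
apply: aeS (aeI (aeI acn init') v0) => x [[acnx initx] v0x].
have [hac h0 ca [c [[mc cle0 ci] cE hE faE]]] :=
  caputo_representation alpha_gt0 alpha_le1 acnx initx.
have cc : {ae mu, forall t, c1 x t = c t}.
  apply: aeS cE => t ht; rewrite /c1 /cpos/=; case: ltP => t0; first exact: ht.
  by rewrite cle0.
split => //.
- by rewrite -v0x.
- apply: aeS faE => t ->; exact/esym/fint_ae_eq.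
- apply: aeS hE => t ht; rewrite (fint_ae_eq _ cc) ?mulr_gt0// /vpos/=.
  case: ltP => t0; last by rewrite fint_le0// addr0.
  by rewrite -ht// v0x addrC subrK.
Qed.

Lemma measurable_tderiv2 : measurable_fun setT (fun z : R * R => tderiv (v ^~ z.2) z.1).
Proof.
apply: (measurable_pos_fst (phi := fun z : R * R => upper_deriv (v ^~ z.2) z.1)).
apply: (measurable_upper_deriv (h := fun z : R * R => v ^~ z.2)).
- exact: measurable_pos_fst_set.
- move=> k; apply: (@eq_measurable_fun _ _ _ _ _
      (fun z : R * R => vpos (z.1 + k.+1%:R^-1, z.2))).
    move=> z; rewrite inE/= => z0; rewrite /vpos/= ifT// addr_gt0//.
  apply: measurable_funTS; apply: (measurableT_comp measurable_vpos).
  by apply: measurable_fun_pair => //; exact: measurable_funD.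
- apply: (@eq_measurable_fun _ _ _ _ _ vpos).
    by move=> z; rewrite inE/= => z0; rewrite /vpos z0.
  by apply: measurable_funTS; exact: measurable_vpos.
Qed.

(** The equation is assumed for almost every [t] and then almost every [x], while [ae_regular] works
    at a fixed [x]. Both fractional integrals are jointly measurable, so [ae_swap] exchanges the
    quantifiers for their equality; the first of them is the Caputo derivative at every [t > 0]. *)
Lemma ae_caputo_alpha :
  {ae mu, forall t, {ae mu, forall x, 0 < t -> caputo alpha v t x = fint alpha (c1 x) t}}.
Proof.
have mg : measurable_fun setT (fun z : R * R =>
    fint (1 - alpha) (tderiv (v ^~ z.2)) z.1 - fint alpha (c1 z.2) z.1).
  apply: measurable_funB; last exact: measurable_fint2 measurable_cpos.
  exact: (measurable_fint2 _ measurable_tderiv2).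
have := ae_swap mg; move=> /(_ _)[].
  by apply: aeS ae_regular => x [_ _ _ h _]; apply: aeS h => t /= ->; rewrite subrr.
move=> N [mN N0 hN]; exists N; split => //; apply: subset_trans hN => t /= nt h; apply: nt.
apply: aeS (aeI h ae_regular) => x [/eqP]; rewrite subr_eq0 => /eqP gx [_ _ ca _ _] t0.
by rewrite ca.
Qed.

Section fixed_s.
Context (s : R) (s_gt0 : 0 < s) (s_ge : beta / 2 + 1 <= s).

Definition c_abs_laplace x : R := \int[mu]_t (`|c1 x t| * expR (- s * t)).
Definition c_laplace x : R := \int[mu]_t (c1 x t * expR (- s * t)).
Definition v_laplace x : R := \int[mu]_t (vpos (t, x) * expR (- s * t)).

Let mexp2 : measurable_fun setT (fun z : R * R => expR (- s * z.1)).
Proof. exact: (measurableT_comp (measurable_expN s)). Qed.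

Let mcx x : measurable_fun setT (c1 x).
Proof. exact: (measurable_section x measurable_cpos). Qed.

Lemma c_local_bound M : exists B : R, forall y : R,
  (\int[mu]_x \int[mu]_t (`|cpos (t, x)| * expR (- s * t) * (`|x - y| <= M)%R%:R)%:E <= B%:E)%E.
Proof.
have [[_ _ [_ cfin] _] _ third _ _] := v_sol.
have cE t : 0 < t -> (fun x => cpos (t, x)) = caputo (2 * alpha) v t.
  by move=> t0; apply/funext => x; rewrite /cpos/= t0.
apply: (@laplace_local_bound R beta zeta) => //.
- exact: measurable_cpos.
- exact: cpos_le0.
- rewrite (_ : (\int[mu]_(t in _) _)%E =
    (\int[mu]_(t in `]0%R, 1%R[) L2norm (caputo (2 * alpha) v t))%E).
    exact: third ltr01.
  by apply: eq_integral => t; rewrite inE/= in_itv/= => /andP[t0 _]; rewrite cE.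
- rewrite (_ : (\int[mu]_(t in _) _)%E = (\int[mu]_(t in `]0%R, +oo[)
     ((t `^ zeta * expR (- beta * t))%:E * L2norm (caputo (2 * alpha) v t) ^+ 2))%E) //.
  by apply: eq_integral => t; rewrite inE/= in_itv/= andbT => t0; rewrite cE.
Qed.

Lemma ae_c_integrable : {ae mu, forall x,
  (\int[mu]_t (`|c1 x t| * expR (- s * t))%:E < +oo)%E}.
Proof.
have : forall k : nat, {ae mu, forall x, `|x| <= k%:R ->
    (\int[mu]_t (`|c1 x t| * expR (- s * t))%:E < +oo)%E}.
  move=> k; have [B /(_ 0) hB] := c_local_bound k%:R.
  pose J x := (\int[mu]_t (`|cpos (t, x)| * expR (- s * t) * (`|x - 0| <= k%:R)%R%:R)%:E)%E.
  have J0 x : (0 <= J x)%E.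
    by apply: integral_ge0 => t _; rewrite lee_fin !mulr_ge0 ?expR_ge0.
  have mJ : measurable_fun setT J.
    apply: (measurable_integral_snd mu (F := fun z => `|cpos (z.2, z.1)| *
      expR (- s * z.2) * (`|z.1 - 0| <= k%:R)%R%:R)).
      apply: measurable_funM; first apply: measurable_funM.
      - apply: measurableT_comp => //; apply: (measurableT_comp measurable_cpos).
        exact: measurable_fun_pair.
      - exact: (measurableT_comp (measurable_expN s)).
      - exact: (measurableT_comp (measurable_near_ind 0 k%:R)).
    by move=> z; rewrite !mulr_ge0 ?expR_ge0.
  have iJ : mu.-integrable setT J.
    apply/integrableP; split => //.
    have -> : (\int[mu]_x `|J x| = \int[mu]_x J x)%E.
      by apply: eq_integral => x _; rewrite gee0_abs.
    by apply: le_lt_trans hB _; rewrite ltry.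
  apply: aeS (integrable_ae measurableT iJ) => x /(_ Logic.I) Jx xk.
  have -> : (\int[mu]_t (`|c1 x t| * expR (- s * t))%:E = J x)%E.
    by apply: eq_integral => t _; rewrite subr0 xk mulr1.
  by rewrite ltey_eq Jx.
move=> /ae_foralln; apply: aeS => x h.
by apply: (h (Num.bound `|x|)); exact/ltW/archi_boundP.
Qed.

Lemma measurable_c_abs_laplace : measurable_fun setT c_abs_laplace.
Proof.
apply: (measurable_Rintegral_fst mu (F := fun z => `|cpos z| * expR (- s * z.1))).
apply: measurable_funM => //; apply: measurableT_comp => //; exact: measurable_cpos.
Qed.

Lemma measurable_c_laplace : measurable_fun setT c_laplace.
Proof.
apply: (measurable_Rintegral_fst mu (F := fun z => cpos z * expR (- s * z.1))).
by apply: measurable_funM => //; exact: measurable_cpos.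
Qed.

Lemma measurable_v_laplace : measurable_fun setT v_laplace.
Proof.
apply: (measurable_Rintegral_fst mu (F := fun z => vpos z * expR (- s * z.1))).
by apply: measurable_funM => //; exact: measurable_vpos.
Qed.

Lemma c_abs_laplace_ge0 x : 0 <= c_abs_laplace x.
Proof. by apply: Rintegral_ge0 => t _; rewrite mulr_ge0 ?expR_ge0. Qed.

Lemma uli_c_abs_laplace : uli c_abs_laplace.
Proof.
split; first exact: measurable_c_abs_laplace.
move=> M; have [B hB] := c_local_bound M; exists B => y; apply: le_trans (hB y).
apply: ge0_le_integral_nonmeasurable => x; first by rewrite lee_fin mulr_ge0.
have mx : measurable_fun setT (fun t => `|c1 x t| * expR (- s * t)).
  by apply: measurable_funM; [exact: measurableT_comp|exact: measurable_expN].
rewrite ge0_integralZr_R//.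
rewrite EFinM; apply: lee_wpmul2r; first by rewrite lee_fin.
rewrite ger0_norm ?c_abs_laplace_ge0// /c_abs_laplace /Rintegral.
have : (0 <= \int[mu]_t (`|c1 x t| * expR (- s * t))%:E)%E.
  by apply: integral_ge0 => t _; rewrite lee_fin mulr_ge0 ?expR_ge0.
by case: (\int[mu]_t (`|c1 x t| * expR (- s * t))%:E)%E => //= _; rewrite leey.
Qed.

Let c_integrable x : (\int[mu]_t (`|c1 x t| * expR (- s * t))%:E < +oo)%E ->
  mu.-integrable setT (fun t => (c1 x t * expR (- s * t))%:E).
Proof.
move=> h; apply/integrableP; split.
  by apply/measurable_EFinP/measurable_funM; [exact: mcx|exact: measurable_expN].
apply: le_lt_trans h; apply: ge0_le_integral_nonmeasurable => t; first by [].
by rewrite /= lee_fin normrM [X in _ * X]ger0_norm ?expR_ge0.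
Qed.

Lemma uli_c_laplace : uli c_laplace.
Proof.
apply: (uli_le measurable_c_laplace uli_c_abs_laplace).
apply: aeS ae_c_integrable => x cx; rewrite [leRHS]ger0_norm ?c_abs_laplace_ge0//.
apply: le_trans (le_normr_Rintegral _ (c_integrable cx)) _ => //.
rewrite le_eqVlt; apply/orP; left; apply/eqP; apply: eq_Rintegral => t _.
by rewrite normrM [X in _ * X]ger0_norm ?expR_ge0.
Qed.

Lemma integral_pos_exp (k : R) :
  mu.-integrable setT (fun t : R => ((if 0 < t then k else 0) * expR (- s * t))%:E) /\
  \int[mu]_t ((if 0 < t then k else 0) * expR (- s * t)) = k / s.
Proof.
have ip : mu.-integrable setT (EFin \o (@posexp R s)).
  apply: ge0_integrable; [exact: measurable_posexp|exact: posexp_ge0|].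
  by rewrite integral_posexp// ltry.
have E t : (if 0 < t then k else 0) * expR (- s * t) = k * posexp s t.
  by rewrite /posexp; case: ifP; rewrite ?mul0r ?mulr0.
split.
  rewrite (_ : (fun t => _) = (fun t => k%:E * (EFin \o posexp s) t)%E).
    exact: integrableZl.
  by apply/funext => t; rewrite E.
transitivity (\int[mu]_t (k * posexp s t)); first by apply: eq_Rintegral => t _; rewrite E.
by rewrite RintegralZl// /Rintegral integral_posexp.
Qed.

(** The transform of [f + I^(2 alpha) c], with the constant [f] switched on at time [0]. The third
    clause bounds the transform of [|v|] and feeds Fubini's theorem. *)
Lemma ae_v_laplace : {ae mu, forall x,
  [/\ mu.-integrable setT (fun t => (vpos (t, x) * expR (- s * t))%:E),
    v_laplace x = f x / s + s `^ (- (2 * alpha)) * c_laplace x &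
    (\int[mu]_t (`|vpos (t, x)| * expR (- s * t))%:E <=
      (`|f x| / s + s `^ (- (2 * alpha)) * c_abs_laplace x)%:E)%E]}.
Proof.
have a2 : 0 <= 2 * alpha by rewrite mulr_ge0// ltW.
apply: aeS (aeI ae_regular ae_c_integrable) => x [[_ _ _ _ vE] cx].
have [i1 e1] := laplace_fint a2 s_gt0 (mcx x) (c_integrable cx).
have [i2 e2] := integral_pos_exp (f x).
have mvx : measurable_fun setT (fun t => vpos (t, x) * expR (- s * t)).
  apply: measurable_funM; last exact: measurable_expN.
  exact: (measurable_section x measurable_vpos).
pose g (t : R) := (if 0 < t then f x else 0) * expR (- s * t) +
  fint (2 * alpha) (c1 x) t * expR (- s * t).
have ig : mu.-integrable setT (EFin \o g).
  rewrite (_ : EFin \o g = (fun t => ((if 0 < t then f x else 0) * expR (- s * t))%:E) \+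
    (fun t => (fint (2 * alpha) (c1 x) t * expR (- s * t))%:E))%E; last by apply/funext.
  exact: integrableD.
have gE : {ae mu, forall t, (vpos (t, x) * expR (- s * t)) = g t}.
  by apply: aeS vE => t ->; rewrite /g mulrDl.
split.
- apply: (@ae_eq_integrable _ _ _ mu setT (EFin \o g)) => //.
  + exact: measurable_int ig.
  + exact/measurable_EFinP.
  + by apply: aeS gE => t /= -> _.
- transitivity (\int[mu]_t g t).
    by congr fine; apply: ae_eq_integral_nonmeasurable; apply: aeS gE => t -> _.
  by rewrite RintegralD// e1 e2.
- have le1 := laplace_fint_abs a2 s_gt0 (mcx x).
  have [i3 e3] := integral_pos_exp `|f x|.
  have e3' : (\int[mu]_t ((if 0 < t then `|f x| else 0) * expR (- s * t))%:E = (`|f x| / s)%:E)%E.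
    by rewrite -e3 /Rintegral fineK// integrable_fin_num.
  have m1 : measurable_fun setT (fun t : R => ((if 0 < t then `|f x| else 0) * expR (- s * t))%:E).
    exact: measurable_int i3.
  have m2 : measurable_fun setT (fun t : R => (`|fint (2 * alpha) (c1 x) t| * expR (- s * t))%:E).
    apply/measurable_EFinP/measurable_funM; last exact: measurable_expN.
    by apply: measurableT_comp => //; exact: measurable_fint.
  apply: (@le_trans _ _ (\int[mu]_t (((if 0 < t then `|f x| else 0) * expR (- s * t))%:E +
      (`|fint (2 * alpha) (c1 x) t| * expR (- s * t))%:E))%E).
    apply: ae_ge0_le_integral_nonmeasurable => [t|t|].
    + by rewrite lee_fin mulr_ge0 ?expR_ge0.
    + by rewrite adde_ge0// lee_fin mulr_ge0 ?expR_ge0//; case: ifP.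
    + apply: aeS vE => t ->; rewrite -EFinD lee_fin -mulrDl ler_wpM2r ?expR_ge0//.
      apply: le_trans (ler_normD _ _) _; rewrite lerD2r.
      by case: ifP; rewrite ?normr0.
  rewrite ge0_integralD//.
  + rewrite e3' EFinD leeD2l//; apply: le_trans le1 _; rewrite EFinM.
    rewrite /c_abs_laplace /Rintegral fineK// ge0_fin_numE//.
    by apply: integral_ge0 => t _; rewrite lee_fin mulr_ge0 ?expR_ge0.
  + by move=> t _; rewrite lee_fin mulr_ge0 ?expR_ge0//; case: ifP.
Qed.

Lemma uli_v_laplace : uli v_laplace.
Proof.
apply: (@uli_le _ _ (fun x => s^-1 * f x + s `^ (- (2 * alpha)) * c_laplace x)).
- exact: measurable_v_laplace.
- by apply: uli_add; apply: uli_scale; [exact: uli_L2|exact: uli_c_laplace].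
- by apply: aeS ae_v_laplace => x [_ -> _]; rewrite [_ / s]mulrC.
Qed.

(** The two sides of the tested equation, with the Laplace weight and not yet integrated. In [F2]
    the derivative of order [alpha] already appears as a fractional integral of [c1], which makes
    [F2] measurable on the plane. *)
Let F1 phi (z : R * R) := vpos z * expR (- s * z.1) * derive1n 2 phi z.2.
Let F2 (phi : R -> R) (z : R * R) :=
  (lam * fint alpha (c1 z.2) z.1 + cpos z) * expR (- s * z.1) * phi z.2.

Let integrable_F1 phi : test_function phi -> (mu \x mu)%E.-integrable setT (EFin \o (F1 phi)).
Proof.
move=> tphi; have t2 := test_function_derive1n 2 tphi.
have mp := test_function_measurable t2.
have uh : uli (fun x => s^-1 * `|f x| + s `^ (- (2 * alpha)) * c_abs_laplace x).
  apply: uli_add; apply: uli_scale; last exact: uli_c_abs_laplace.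
  have uf := uli_L2 f_L2; apply: (uli_le _ uf); first by apply: measurableT_comp => //; case: uf.
  by apply: aeW => x; rewrite normr_id.
have ih := uli_test_integrable uh t2.
apply: (@integrable_prod_le R _ (fun x => `|(s^-1 * `|f x| + s `^ (- (2 * alpha)) * c_abs_laplace x)
   * derive1n 2 phi x|)).
- apply: measurable_funM; last exact: (measurableT_comp mp).
  by apply: measurable_funM => //; exact: measurable_vpos.
- exact: (integrable_norm ih).
- apply: aeS ae_v_laplace => x [_ _ h].
  have -> : (\int[mu]_t `|F1 phi (t, x)|%:E =
      \int[mu]_t ((`|vpos (t, x)| * expR (- s * t)) * `|derive1n 2 phi x|)%:E)%E.
    by apply: eq_integral => t _; rewrite /F1 !normrM [X in _ * X * _]ger0_norm ?expR_ge0.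
  rewrite ge0_integralZr_R//.
  + rewrite normrM EFinM; apply: lee_wpmul2r; first by rewrite lee_fin.
    apply: le_trans h _; rewrite lee_fin [_ / s]mulrC ler_norm//.
  + apply: measurable_funM; last exact: measurable_expN.
    by apply: measurableT_comp => //; exact: (measurable_section x measurable_vpos).
Qed.

Let integrable_F2 phi : 0 < lam -> test_function phi ->
  (mu \x mu)%E.-integrable setT (EFin \o (F2 phi)).
Proof.
move=> lam0 tphi; have mp := test_function_measurable tphi.
pose k := lam * s `^ (- alpha) + 1.
have ih := uli_test_integrable (uli_scale k uli_c_abs_laplace) tphi.
apply: (@integrable_prod_le R _ (fun x => `|k * c_abs_laplace x * phi x|)).
- apply: measurable_funM; last exact: (measurableT_comp mp).
  apply: measurable_funM => //; apply: measurable_funD; last exact: measurable_cpos.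
  by apply: measurable_funM => //; exact: (measurable_fint2 _ measurable_cpos).
- exact: (integrable_norm ih).
- apply: aeS ae_c_integrable => x cx.
  have mfi : measurable_fun setT (fint alpha (c1 x)) by exact: measurable_fint.
  have m1 : measurable_fun setT (fun t => `|fint alpha (c1 x) t| * expR (- s * t)).
    by apply: measurable_funM; [exact: measurableT_comp|exact: measurable_expN].
  have m2 : measurable_fun setT (fun t => `|c1 x t| * expR (- s * t)).
    by apply: measurable_funM; [exact: measurableT_comp|exact: measurable_expN].
  have p1 t : 0 <= `|fint alpha (c1 x) t| * expR (- s * t) by rewrite mulr_ge0 ?expR_ge0.
  have p2 t : 0 <= `|c1 x t| * expR (- s * t) by rewrite mulr_ge0 ?expR_ge0.
  pose G t := lam * (`|fint alpha (c1 x) t| * expR (- s * t)) + `|c1 x t| * expR (- s * t).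
  have G0 t : 0 <= G t by rewrite addr_ge0// mulr_ge0// ltW.
  have mG : measurable_fun setT G by apply: measurable_funD => //; exact: measurable_funM.
  apply: (@le_trans _ _ (\int[mu]_t (G t * `|phi x|)%:E)%E).
    apply: ge0_le_integral_nonmeasurable => t; first by [].
    rewrite lee_fin /F2/= !normrM ler_wpM2r// [X in _ * X]ger0_norm ?expR_ge0//.
    rewrite /G mulrA -mulrDl ler_wpM2r ?expR_ge0//.
    by apply: le_trans (ler_normD _ _) _; rewrite normrM (gtr0_norm lam0).
  rewrite ge0_integralZr_R// normrM EFinM; apply: lee_wpmul2r; first by rewrite lee_fin.
  have -> : (\int[mu]_t (G t)%:E = lam%:E * \int[mu]_t (`|fint alpha (c1 x) t| * expR (- s * t))%:E +
      \int[mu]_t (`|c1 x t| * expR (- s * t))%:E)%E.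
    rewrite -ge0_integralZl_R ?(ltW lam0)// -ge0_integralD//.
    - by move=> t _; rewrite lee_fin mulr_ge0// ltW.
    - by apply/measurable_EFinP; exact: measurable_funM.
    - exact/measurable_EFinP.
  have cE : (\int[mu]_t (`|c1 x t| * expR (- s * t))%:E = (c_abs_laplace x)%:E)%E.
    rewrite /c_abs_laplace /Rintegral fineK// ge0_fin_numE//.
    by apply: integral_ge0 => t _; rewrite lee_fin.
  have := laplace_fint_abs (ltW alpha_gt0) s_gt0 (mcx x); rewrite cE => h.
  apply: (@le_trans _ _ (lam%:E * ((s `^ (- alpha))%:E * (c_abs_laplace x)%:E) + (c_abs_laplace x)%:E)%E).
    by apply: leeD2r; apply: lee_wpmul2l => //; rewrite lee_fin ltW.
  rewrite -!EFinM -EFinD lee_fin; apply: le_trans (ler_norm _).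
  by rewrite /k mulrDl mul1r mulrA.
Qed.

(** Testing in [x] at a fixed time and transforming in [t] commute by Fubini. The equation first
    gives [k * c_laplace] on the right, with [k = lam s^(-alpha) + 1]; since [c_laplace = s^(2
    alpha) (v_laplace - f / s)], the coefficient becomes [lam s^alpha + s^(2 alpha)]. *)
Lemma v_laplace_weak phi : 0 < lam -> test_function phi ->
  \int[mu]_x (v_laplace x * derive1n 2 phi x) =
  (lam * s `^ alpha + s `^ (2 * alpha)) *
   (\int[mu]_x (v_laplace x * phi x) - s^-1 * \int[mu]_x (f x * phi x)).
Proof.
move=> lam0 tphi; have t2 := test_function_derive1n 2 tphi.
have iF1 := integrable_F1 tphi; have iF2 := integrable_F2 lam0 tphi.
have mp := test_function_measurable tphi.
have L : \int[mu]_x (v_laplace x * derive1n 2 phi x) = \int[mu]_t \int[mu]_x F1 phi (t, x).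
  rewrite Rfubini//; congr fine; apply: ae_eq_integral_nonmeasurable.
  apply: aeS ae_v_laplace => x [iv _ _] _; congr EFin.
  by rewrite /v_laplace -RintegralZr.
pose k := lam * s `^ (- alpha) + 1.
have Rr : \int[mu]_x (k * c_laplace x * phi x) = \int[mu]_t \int[mu]_x F2 phi (t, x).
  rewrite Rfubini//; congr fine; apply: ae_eq_integral_nonmeasurable.
  apply: aeS ae_c_integrable => x cx _; congr EFin.
  have ic := c_integrable cx.
  have [i1 e1] := laplace_fint (ltW alpha_gt0) s_gt0 (mcx x) ic.
  have i1' := integrableZl measurableT lam i1.
  transitivity (\int[mu]_t ((lam * (fint alpha (c1 x) t * expR (- s * t)) + c1 x t * expR (- s * t)) * phi x)).
    rewrite RintegralZr//; last first.
      rewrite (_ : EFin \o _ = (fun t => lam%:E * (fint alpha (c1 x) t * expR (- s * t))%:E) \+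
        (fun t => (c1 x t * expR (- s * t))%:E))%E; last by apply/funext.
      exact: integrableD.
    by rewrite RintegralD// RintegralZl// e1 /k mulrDl mul1r mulrA.
  by apply: eq_Rintegral => t _; rewrite /F2/= mulrA -mulrDl.
have LR : \int[mu]_x (v_laplace x * derive1n 2 phi x) = \int[mu]_x (k * c_laplace x * phi x).
  rewrite L Rr; congr fine; apply: ae_eq_integral_nonmeasurable.
  have [_ weak _ _ _] := v_sol.
  apply: aeS (aeI weak ae_caputo_alpha) => t [wt ct] _; congr EFin.
  have [t0|t0] := ltP 0 t; last first.
    rewrite /Rintegral !integral0_eq// => x _; congr EFin.
      rewrite /F2/= cpos_le0// fint_le0// ?mulr0 ?addr0 ?mul0r//.
      by move=> r r0; exact: cpos_le0.
    by rewrite /F1/= /vpos/= ltNge t0/= !mul0r.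
  have {wt} [vxx [_ _ wk] eqn] := wt t0.
  transitivity (expR (- s * t) * \int[mu]_x (v t x * derive1n 2 phi x)).
    rewrite -RintegralMl_ge0 ?expR_ge0//.
      by apply: eq_Rintegral => x _; rewrite /F1/= /vpos/= t0 mulrAC mulrC.
    apply: measurable_funM; last exact: test_function_measurable.
    rewrite (_ : v t = fun x => vpos (t, x)); first exact: measurable_section2 measurable_vpos.
    by apply/funext => x; rewrite /vpos/= t0.
  rewrite wk// sqrrN expr1n mul1r.
  transitivity (expR (- s * t) * \int[mu]_x ((lam * fint alpha (c1 x) t + cpos (t, x)) * phi x)).
    congr (_ * _); congr fine; apply: ae_eq_integral_nonmeasurable.
    apply: aeS (aeI eqn ct) => x [<- ->//] _; congr EFin.
    by rewrite /cpos/= t0.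
  rewrite -RintegralMl_ge0 ?expR_ge0//.
    by apply: eq_Rintegral => x _; rewrite /F2/= mulrA [expR _ * _]mulrC.
  apply: measurable_funM => //.
  apply: (measurable_section2 (G := fun z => lam * fint alpha (c1 z.2) z.1 + cpos z)).
  apply: measurable_funD; last exact: measurable_cpos.
  by apply: measurable_funM => //; exact: (measurable_fint2 _ measurable_cpos).
rewrite LR.
have iv := uli_test_integrable uli_v_laplace tphi.
have if_ := uli_test_integrable (uli_L2 f_L2) tphi.
set a := _ + _.
have if1 : mu.-integrable setT (EFin \o (fun x => s^-1 * (f x * phi x))).
  exact: (integrableZl measurableT s^-1 if_).
have ivf : mu.-integrable setT (EFin \o (fun x => v_laplace x * phi x - s^-1 * (f x * phi x))).
  exact: (integrableB measurableT iv if1).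
rewrite -RintegralZl// -RintegralB// -RintegralZl//.
congr fine; apply: ae_eq_integral_nonmeasurable.
apply: aeS ae_v_laplace => x [_ -> _] _; congr EFin.
have s0 : s != 0 by rewrite gt_eqF.
have -> : a = k * s `^ (2 * alpha).
  rewrite /k mulrDl mul1r -mulrA -powRD ?s0 ?implybT//.
  by rewrite (_ : - alpha + 2 * alpha = alpha)//; ring.
have : s `^ (2 * alpha) * s `^ (- (2 * alpha)) = 1.
  by rewrite -powRD ?subrr ?powRr0// s0 implybT.
clearbody k; move: (s `^ (2 * alpha)) (s `^ (- (2 * alpha))) (c_laplace x) (phi x) (f x) (k).
move=> u w c p g k0 uw.
transitivity (k0 * (u * w) * c * p); first by rewrite uw mulr1.
by ring.
Qed.

End fixed_s.
End laplace_of_solution.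

(** * Smooth test functions *)

Section pointwise_derivatives.
Context {R : realType}.
Implicit Types (f g : R -> R) (x : R).

Lemma is_deriveD_fun f g x df dg : is_derive x 1 f df -> is_derive x 1 g dg ->
  is_derive x 1 (fun y => f y + g y) (df + dg).
Proof. by move=> hf hg; exact: is_deriveD. Qed.

Lemma is_deriveM_fun f g x df dg : is_derive x 1 f df -> is_derive x 1 g dg ->
  is_derive x 1 (fun y => f y * g y) (df * g x + f x * dg).
Proof.
move=> hf hg; rewrite (_ : _ + _ = f x *: dg + g x *: df); first exact: is_deriveM.
by rewrite /GRing.scale/= addrC [g x * df]mulrC.
Qed.

Lemma is_deriveZ_fun (k : R) f x df : is_derive x 1 f df ->
  is_derive x 1 (fun y => k * f y) (k * df).
Proof. by move=> hf; exact: (is_deriveZ k hf). Qed.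

Lemma is_derive_affine (k c x : R) : is_derive x 1 (fun y => k * y + c) k.
Proof.
rewrite -[X in is_derive _ _ _ X]addr0 -[X in is_derive _ _ _ (X + _)]mulr1.
exact: (is_deriveD_fun (is_deriveZ_fun k (is_derive_id x 1)) (is_derive_cst c x 1)).
Qed.

Lemma is_derive_comp_affine f (k c x df : R) : is_derive (k * x + c) 1 f df ->
  is_derive x 1 (fun y => f (k * y + c)) (k * df).
Proof.
move=> hf; rewrite mulrC.
exact: (@is_derive1_comp R f (fun y => k * y + c) x df k hf (is_derive_affine k c x)).
Qed.

Lemma is_derive_expR_comp f x df : is_derive x 1 f df ->
  is_derive x 1 (fun y => expR (f y)) (df * expR (f x)).
Proof.
move=> hf; rewrite mulrC.
exact: (@is_derive1_comp R expR f x _ df (is_derive_expR (f x)) hf).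
Qed.

Lemma is_derive_near_eq f g x df : {near x, f =1 g} -> is_derive x 1 f df -> is_derive x 1 g df.
Proof.
move=> fg [d1 d2]; apply: DeriveDef; first exact: near_eq_derivable d1.
by rewrite -d2; apply/esym/near_eq_derive.
Qed.

Lemma is_derive_quadratic f (C : R) : (forall x, `|f x| <= C * x ^+ 2) -> is_derive (0 : R) 1 f 0.
Proof.
move=> hf; have f0 : f 0 = 0.
  by apply/eqP; rewrite -normr_le0 (le_trans (hf 0))// expr0n/= mulr0.
have lim0 : h^-1 *: (f (h *: 1 + 0) - f 0) @[h --> (0 : R)^'] --> (0 : R).
  apply/cvgr0Pnorm_le => e e0.
  have C0 : 0 <= C by have := hf 1; rewrite expr1n mulr1; exact: le_trans.
  exists (e / (C + 1)) => /=; first by rewrite divr_gt0// ltr_wpDl.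
  move=> h; rewrite /ball/= sub0r normrN => he /eqP h0.
  rewrite f0 subr0 addr0 /GRing.scale/= mulr1 normrM normfV.
  rewrite ler_pdivrMl ?normr_gt0; last exact/eqP.
  apply: (le_trans (hf h)); rewrite -real_normK ?num_real// expr2 mulrCA.
  apply: ler_wpM2l => //; apply: (@le_trans _ _ ((C + 1) * (e / (C + 1)))).
    by rewrite ler_pM// ?lerDl// ltW.
  by rewrite mulrCA divff ?mulr1// gt_eqF// ltr_wpDl.
apply: DeriveDef; first by apply/cvg_ex; exists 0.
exact: cvg_lim lim0.
Qed.

Lemma is_derive_derive1_eq f g : (forall x, is_derive x 1 f (g x)) -> derive1 f = g.
Proof. by move=> h; apply/funext => x; rewrite derive1E; have [_] := h x. Qed.

End pointwise_derivatives.

Section smooth_functions.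
Context {R : realType}.
Implicit Types f g : R -> R.

(** Beware of the shift: [Cn n f] asks for [n + 1] derivatives, since differentiability is demanded
    at level [0] as well. *)
Fixpoint Cn n f : Prop :=
  (forall x : R, derivable f x 1) /\ if n is m.+1 then Cn m (derive1 f) else True.

Lemma Cn_derivable n f : Cn n f -> forall x : R, derivable f x 1.
Proof. by case: n => [|n] []. Qed.

Lemma Cn_is_derive n f (x : R) : Cn n f -> is_derive x 1 f (derive1 f x).
Proof. by move=> /Cn_derivable/(_ x) df; rewrite derive1E; exact: derivableP. Qed.

Lemma CnW n f : Cn n.+1 f -> Cn n f.
Proof.
elim: n f => [|n IH] f [df cf]; split => //.
exact: IH.
Qed.

Lemma CnS n f g : (forall x : R, is_derive x 1 f (g x)) -> Cn n g -> Cn n.+1 f.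
Proof.
move=> h cg; split => [x|]; first by have [] := h x.
by rewrite (is_derive_derive1_eq h).
Qed.

Lemma Cn0 f g : (forall x : R, is_derive x 1 f (g x)) -> Cn 0 f.
Proof. by move=> h; split => // x; have [] := h x. Qed.

Lemma Cn_cst n (c : R) : Cn n (fun=> c).
Proof.
elim: n c => [|n IH] c; first by apply: (@Cn0 _ (fun=> 0)) => x; exact: is_derive_cst.
by apply: (@CnS _ _ (fun=> 0)) => // x; exact: is_derive_cst.
Qed.

Lemma CnD n f g : Cn n f -> Cn n g -> Cn n (fun x => f x + g x).
Proof.
elim: n f g => [|n IH] f g cf cg.
  by apply: Cn0 => x; apply: is_deriveD_fun; [exact: Cn_is_derive cf|exact: Cn_is_derive cg].
apply: (@CnS _ _ (fun x => derive1 f x + derive1 g x)).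
  by move=> x; apply: is_deriveD_fun; [exact: Cn_is_derive cf|exact: Cn_is_derive cg].
by apply: IH; [case: cf|case: cg].
Qed.

Lemma CnM n f g : Cn n f -> Cn n g -> Cn n (fun x => f x * g x).
Proof.
elim: n f g => [|n IH] f g cf cg.
  by apply: Cn0 => x; apply: is_deriveM_fun; [exact: Cn_is_derive cf|exact: Cn_is_derive cg].
apply: (@CnS _ _ (fun x => derive1 f x * g x + f x * derive1 g x)).
  by move=> x; apply: is_deriveM_fun; [exact: Cn_is_derive cf|exact: Cn_is_derive cg].
have f1 := CnW cf; have g1 := CnW cg.
by apply: CnD; apply: IH => //; [case: cf|case: cg].
Qed.

Lemma CnZ n (k : R) f : Cn n f -> Cn n (fun x => k * f x).
Proof. by move=> cf; apply: CnM => //; exact: Cn_cst. Qed.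

Lemma Cn_affine n f (k c : R) : Cn n f -> Cn n (fun x => f (k * x + c)).
Proof.
elim: n f => [|n IH] f cf.
  by apply: Cn0 => x; apply: is_derive_comp_affine; exact: Cn_is_derive cf.
apply: (@CnS _ _ (fun x => k * derive1 f (k * x + c))).
  by move=> x; apply: is_derive_comp_affine; exact: Cn_is_derive cf.
by apply: CnZ; apply: IH; case: cf.
Qed.

Lemma Cn_expR n f : Cn n f -> Cn n (fun x => expR (f x)).
Proof.
elim: n f => [|n IH] f cf.
  by apply: Cn0 => x; apply: is_derive_expR_comp; exact: Cn_is_derive cf.
apply: (@CnS _ _ (fun x => derive1 f x * expR (f x))).
  by move=> x; apply: is_derive_expR_comp; exact: Cn_is_derive cf.
by apply: CnM; [case: cf|apply: IH; exact: CnW].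
Qed.

Lemma Cn_derive1n n f : Cn n f -> forall x : R, derivable (derive1n n f) x 1.
Proof. by elim: n f => [|n IH] f [df cf] //; rewrite derive1Sn; exact: IH. Qed.

Lemma smooth_test_function f (M : R) : (forall n, Cn n f) ->
  (forall x, M < `|x| -> f x = 0) -> test_function f.
Proof. by move=> cf fM; split; [move=> k x; exact: Cn_derive1n|exists M]. Qed.

(** The factor [x^(-n)] makes the family closed under differentiation: the derivative of [flat n] is
    a combination of [flat n.+1] and [flat n.+2], so smoothness is an induction for all [n] at
    once. *)
Definition flat n (x : R) : R := if 0 < x then x^-1 ^+ n * expR (- x^-1) else 0.

(** [expR u] is the [k]-th power of [expR (u / k)], which is at least [u / k]. *)
Lemma expR_ge_pow (u : R) k : 0 <= u -> u ^+ k <= k%:R ^+ k * expR u.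
Proof.
case: k => [|k] u0; first by rewrite !expr0 mul1r -expR0 ler_expR.
have -> : expR u = expR (u / k.+1%:R) ^+ k.+1.
  by rewrite -expRM_natl mulrC divfK// pnatr_eq0.
rewrite -exprMn; apply: lerXn2r; rewrite ?nnegrE ?mulr_ge0 ?expR_ge0//.
have := expR_ge1Dx (u / k.+1%:R); rewrite -ler_pdivrMl// => h; rewrite mulrC.
by apply: le_trans h; rewrite lerDr.
Qed.

(** The previous bound at [u = 1 / x] with exponent [n + 2] leaves a factor [x^2]; this gives
    derivative [0] at the origin for the whole family. *)
Lemma flat_quadratic n (x : R) : `|flat n x| <= n.+2%:R ^+ n.+2 * x ^+ 2.
Proof.
rewrite /flat; case: ltP => x0; last by rewrite normr0 mulr_ge0 ?sqr_ge0 ?exprn_ge0.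
rewrite ger0_norm ?mulr_ge0 ?expR_ge0 ?exprn_ge0 ?invr_ge0 ?(ltW x0)//.
have u0 : 0 <= x^-1 by rewrite invr_ge0 ltW.
have := expR_ge_pow n.+2 u0; rewrite expRN ler_pdivrMr ?expR_gt0// => h.
rewrite -ler_pdivrMr ?expR_gt0// in h.
have -> : x^-1 ^+ n = x ^+ 2 * x^-1 ^+ n.+2.
  by rewrite -(addn2 n) exprD [RHS]mulrCA -exprMn divff ?expr1n ?mulr1// gt_eqF.
by rewrite [leRHS]mulrAC [leRHS]mulrC ler_wpM2l ?sqr_ge0// -ler_pdivrMr ?expR_gt0.
Qed.

Lemma flat_is_derive n (x : R) : is_derive x 1 (flat n) (- n%:R * flat n.+1 x + flat n.+2 x).
Proof.
case: (ltgtP x 0) => [x0|x0|->].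
- rewrite /flat ltNge (ltW x0)/= mulr0 addr0.
  apply: (is_derive_near_eq _ (is_derive_cst (0 : R) x 1)).
  have : \forall y \near x, y < 0.
    by apply: open_nbhs_nbhs; split => //; exact: open_lt.
  by apply: filterS => y y0; rewrite ltNge (ltW y0).
- have xn0 : x != 0 by rewrite gt_eqF.
  have dV : is_derive x 1 (fun y : R => y^-1) (- x^-1 ^+ 2).
    rewrite (_ : - _ = - x ^- 2 *: 1); first exact: (is_deriveV xn0 (is_derive_id x 1)).
    by rewrite /GRing.scale/= mulr1 exprVn.
  have dX : is_derive x 1 (fun y : R => y^-1 ^+ n) (- n%:R * x^-1 ^+ n.+1).
    elim: n => [|n IH].
      by rewrite oppr0 mul0r; exact: (is_derive_cst (1 : R) x 1).
    rewrite (_ : (fun y => _) = fun y : R => y^-1 * y^-1 ^+ n); last first.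
      by apply/funext => y; rewrite exprS.
    rewrite (_ : _ * _ = - x^-1 ^+ 2 * x^-1 ^+ n + x^-1 * (- n%:R * x^-1 ^+ n.+1)).
      exact: is_deriveM_fun.
    by rewrite -natr1 !exprS; ring.
  have dE : is_derive x 1 (fun y : R => expR (- y^-1)) (x^-1 ^+ 2 * expR (- x^-1)).
    apply: is_derive_expR_comp; rewrite -[X in is_derive _ _ _ X]opprK.
    exact: is_deriveN.
  have := is_deriveM_fun dX dE; rewrite /flat x0.
  rewrite -mulrA [x^-1 ^+ n * (_ * _)]mulrA -exprD addn2.
  apply: is_derive_near_eq.
  have : \forall y \near x, 0 < y.
    by apply: open_nbhs_nbhs; split => //; exact: open_gt.
  by apply: filterS => y y0; rewrite y0.
- rewrite {2 3}/flat ltxx mulr0 addr0; apply: is_derive_quadratic => y.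
  exact: flat_quadratic.
Qed.

Lemma Cn_flat k n : Cn k (flat n).
Proof.
elim: k n => [|k IH] n; first by apply: Cn0 => x; exact: flat_is_derive.
apply: CnS; first by move=> x; exact: flat_is_derive.
by apply: CnD => //; apply: CnZ.
Qed.

Definition bump (a b x : R) : R := flat 0 (x - a) * flat 0 (b - x).

Lemma Cn_bump k a b : Cn k (bump a b).
Proof.
apply: CnM.
  rewrite (_ : (fun x => _) = fun x => flat 0 (1 * x + - a)).
    by apply: Cn_affine; exact: Cn_flat.
  by apply/funext => x; rewrite mul1r.
rewrite (_ : (fun x => _) = fun x => flat 0 (- 1 * x + b)).
  by apply: Cn_affine; exact: Cn_flat.
by apply/funext => x; rewrite mulN1r addrC.
Qed.

Lemma bump_ge0 a b x : 0 <= bump a b x.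
Proof. by rewrite /bump /flat !expr0 !mul1r; case: ifP; case: ifP; rewrite ?mulr0 ?mul0r ?mulr_ge0 ?expR_ge0. Qed.

Lemma bump_gt0 a b x : a < x -> x < b -> 0 < bump a b x.
Proof. by move=> ax xb; rewrite /bump /flat !subr_gt0 ax xb !expr0 !mul1r mulr_gt0 ?expR_gt0. Qed.

Lemma bump_eq0 a b x : ~~ (a < x < b) -> bump a b x = 0.
Proof.
rewrite /bump /flat !subr_gt0; case: (a < x) => /=; last by rewrite mul0r.
by case: (x < b) => //; rewrite mulr0.
Qed.

(* smooth, supported in [a, b], and increasing to the indicator of ]a, b[ *)
Definition plateau (a b : R) (n : nat) (x : R) : R := 1 - expR (- n%:R * bump a b x).

Lemma plateau_test_function a b n : test_function (plateau a b n).
Proof.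
apply: (@smooth_test_function _ (Num.max `|a| `|b|)).
  move=> k; rewrite (_ : plateau a b n = fun x => 1 + -1 * expR (- n%:R * bump a b x)).
    apply: CnD; first exact: Cn_cst.
    by apply/CnZ/Cn_expR/CnZ; exact: Cn_bump.
  by apply/funext => x; rewrite mulN1r.
move=> x; rewrite gt_max => /andP[ax bx]; rewrite /plateau bump_eq0 ?mulr0 ?expR0 ?subrr//.
apply/negP => /andP[xa xb]; have [x0|x0] := leP 0 x.
  by move: bx; rewrite (ger0_norm x0) ltNge (le_trans (ltW xb))// ler_norm.
move: ax; rewrite (ltr0_norm x0) ltNge => /negP; apply.
by rewrite -normrN (le_trans _ (ler_norm _))// lerN2 ltW.
Qed.

Lemma plateau01 a b n x : 0 <= plateau a b n x <= 1.
Proof.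
apply/andP; split; rewrite /plateau; last by rewrite gerBl expR_ge0.
by rewrite subr_ge0 -[leRHS]expR0 ler_expR mulNr oppr_le0 mulr_ge0 ?bump_ge0.
Qed.

Lemma plateau_eq0 a b n x : ~~ (a < x < b) -> plateau a b n x = 0.
Proof. by move=> h; rewrite /plateau bump_eq0// mulr0 expR0 subrr. Qed.

Lemma plateau_cvg a b x : plateau a b n x @[n --> \oo] --> (\1_(`]a, b[%classic : set R) x : R).
Proof.
rewrite indicE mem_setE in_itv/=; have [axb|axb] := boolP (a < x < b); last first.
  by under eq_fun do rewrite plateau_eq0//; exact: cvg_cst.
have b0 : 0 < bump a b x by have /andP[ax xb] := axb; exact: bump_gt0.
rewrite -[X in _ --> X]subr0; apply: cvgB; first exact: cvg_cst.
have -> : (fun n => expR (- n%:R * bump a b x)) = (fun n => (expR (- bump a b x)) ^+ n).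
  by apply/funext => n; rewrite -expRM_natl mulNr mulrN.
by apply: cvg_expr; rewrite ger0_norm ?expR_ge0// -expR0 ltr_expR oppr_lt0.
Qed.

End smooth_functions.

(** * Weak uniqueness *)

Section fundamental_lemma.
Context {R : realType}.
Local Notation mu := (leb R).
Implicit Types (h phi psi : R -> R).

Lemma uli_ind_integrable h (M : R) : uli h ->
  mu.-integrable setT (EFin \o (fun x => h x * (`|x| <= M)%R%:R)).
Proof.
move=> uh; have [C /(_ 0 (fun x => (`|x| <= M)%R%:R))] := uli_pairing_bound M uh ler01.
move=> [||//].
  rewrite (_ : (fun x => _) = fun x : R => (`|x - 0| <= M)%R%:R).
    exact: measurable_near_ind.
  by apply/funext => x; rewrite subr0.
by move=> x; rewrite mul1r subr0 ger0_norm.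
Qed.

Lemma uli_locally_integrable h : uli h -> locally_integrable setT h.
Proof.
move=> uh; have [mh _] := uh; split => // [|K _ cK]; first exact: openT.
have [M [_ hM]] := compact_bounded cK.
have [N] : exists N : R, M < N by exists (M + 1); rewrite ltrDl.
move=> /hM{}hM; have /integrableP[_] := uli_ind_integrable N uh.
apply: le_lt_trans; rewrite integral_mkcond.
apply: ge0_le_integral_nonmeasurable => x; rewrite patchE; case: ifPn => //; last first.
  by move=> _; rewrite /= lee_fin.
move=> /set_mem Kx; rewrite /= lee_fin normrM [X in _ <= _ * X]ger0_norm//.
by rewrite (hM x Kx) mulr1.
Qed.

(** The indicator of an interval is a limit of test functions with values in [[0, 1]] that vanish
    off the interval, so dominated convergence applies. *)
Lemma integral_plateau h a b : uli h ->
  (forall phi, test_function phi -> \int[mu]_x (h x * phi x) = 0) ->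
  \int[mu]_(x in `]a, b[) h x = 0.
Proof.
move=> uh h0; have [mh _] := uh.
pose M := Num.max `|a| `|b|.
have out x : `|x| <= M = false -> ~~ (a < x < b).
  move=> xM; apply/negP => /andP[xa xb].
  move: xM => /negbT; rewrite -ltNge gt_max => /andP[ax bx].
  have [x0|x0] := leP 0 x.
    by move: bx; rewrite (ger0_norm x0) ltNge (le_trans (ltW xb))// ler_norm.
  move: ax; rewrite (ltr0_norm x0) ltNge => /negP; apply.
  by rewrite -normrN (le_trans _ (ler_norm _))// lerN2 ltW.
pose I (x : R) : R := \1_(`]a, b[%classic : set R) x.
pose G x := `|h x * (`|x| <= M)%R%:R|.
have iG : mu.-integrable setT (EFin \o G) by exact: (integrable_norm (uli_ind_integrable M uh)).
have mI : measurable_fun setT I by apply: measurable_indic; exact: measurable_itv.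
have [|||||] := @dominated_convergence _ _ R mu setT measurableT
  (fun n x => (h x * plateau a b n x)%:E) (fun x => (h x * I x)%:E) (EFin \o G).
- move=> n; apply/measurable_EFinP/measurable_funM => //.
  by apply: test_function_measurable; exact: plateau_test_function.
- by apply/measurable_EFinP; exact: measurable_funM.
- apply: aeW => x _; apply: cvg_EFin; first exact: nearW.
  by apply: cvgM; [exact: cvg_cst|exact: plateau_cvg].
- exact: iG.
- apply: aeW => x n _; rewrite /= lee_fin /G !normrM ler_wpM2l//.
  have /andP[p0 p1] := plateau01 a b n x; rewrite ger0_norm//.
  have [//|xM] := boolP (`|x| <= M); first by rewrite normr1.
  by rewrite plateau_eq0// out//; exact/negbTE.
move=> _ _ /= lim; rewrite /Rintegral integral_mkcond.
have -> : (\int[mu]_x ((fun x => (h x)%:E) \_ `]a, b[) x = \int[mu]_x (h x * I x)%:E)%E.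
  apply: eq_integral => x _; rewrite patchE /I indicE.
  by case: ifP; rewrite ?mulr1 ?mulr0.
suff : (\int[mu]_x (h x * I x)%:E = 0)%E by move=> ->.
apply: (cvg_unique _ lim) => //.
have -> : (fun n => \int[mu]_x (h x * plateau a b n x)%:E)%E = (fun=> 0%E).
  apply/funext => n; have tp := plateau_test_function a b n.
  have := h0 _ tp; rewrite /Rintegral => z.
  by rewrite -[LHS]fineK ?z// integrable_fin_num//; exact: uli_test_integrable.
exact: cvg_cst.
Qed.

(** The primitive of [h] from [- k] vanishes identically, and by Lebesgue differentiation its
    derivative is [h] almost everywhere. *)
Lemma ae_eq0_of_itv h : uli h -> (forall a b, \int[mu]_(x in `]a, b[) h x = 0) ->
  {ae mu, forall x, h x = 0}.
Proof.
move=> uh h0; have lh := uli_locally_integrable uh; have [mh _] := uh.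
have : forall k : nat, {ae mu, forall x, - k%:R < x -> h x = 0}.
  move=> k.
  have ih y : mu.-integrable [set` Interval (BRight (- k%:R)) (BRight y)] (EFin \o h).
    apply: (@integrableS _ _ _ mu `[- k%:R, y]%classic) => //.
      exact: subset_itv_oc_cc.
    apply/integrableP; split; first by apply/measurable_EFinP; exact: measurable_funTS.
    have [_ _ /(_ `[- k%:R, y]%classic)] := lh; apply => //.
    exact: segment_compact.
  have := FTC1 ih lh; apply: aeS => x hx kx.
  have [|_ <-] := hx; first exact: kx.
  rewrite (_ : (fun x => _) = fun=> 0); first by rewrite derive1_cst.
  apply/funext => y; rewrite -(h0 (- k%:R) y).
  congr fine; rewrite integral_mkcond [RHS]integral_mkcond.
  apply: ae_eq_integral_nonmeasurable; apply: aeS (ae_neq y) => z /eqP zy _.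
  by rewrite !patchE !mem_setE !in_itv/= le_eqVlt (negbTE zy).
move=> /ae_foralln; apply: aeS => x hx.
apply: (hx (Num.bound `|x|)).
by rewrite ltrNl (le_lt_trans (ler_norm _))// normrN archi_boundP.
Qed.

Lemma fundamental_lemma h : uli h ->
  (forall phi, test_function phi -> \int[mu]_x (h x * phi x) = 0) ->
  {ae mu, forall x, h x = 0}.
Proof. by move=> uh h0; apply: ae_eq0_of_itv => // a b; exact: integral_plateau. Qed.

Lemma derive1_shift phi (y : R) : (forall x : R, derivable phi x 1) ->
  derive1 (fun x => phi (x - y)) = fun x => derive1 phi (x - y).
Proof.
move=> dphi; apply: is_derive_derive1_eq => x.
have dx : is_derive (1 * x + - y) 1 phi (derive1 phi (1 * x + - y)).
  by rewrite derive1E; apply: derivableP.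
have := is_derive_comp_affine dx; rewrite !mul1r.
by rewrite (_ : (fun z => phi (1 * z + - y)) = fun z => phi (z - y))//; apply/funext => z; rewrite mul1r.
Qed.

Lemma test_function_shift phi (y : R) : test_function phi ->
  test_function (fun x => phi (x - y)) /\
  forall k, derive1n k (fun x => phi (x - y)) = fun x => derive1n k phi (x - y).
Proof.
move=> tphi; have sh k : derive1n k (fun x => phi (x - y)) = fun x => derive1n k phi (x - y).
  elim: k => // k IH; rewrite derive1nS IH derive1_shift -?derive1nS//.
  by case: tphi.
split => //; have [dphi [M phi0]] := tphi; split => [k x|].
  rewrite sh; have dx : is_derive (1 * x + - y) 1 (derive1n k phi) (derive1 (derive1n k phi) (1 * x + - y)).
    by rewrite derive1E; apply: derivableP.
  have [+ _] := is_derive_comp_affine dx.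
  by rewrite (_ : (fun z => _ (1 * z + - y)) = fun z => derive1n k phi (z - y))//; apply/funext => z; rewrite mul1r.
exists (M + `|y|) => x xM; apply: phi0.
by rewrite (lt_le_trans _ (lerB_dist _ _))// ltrBrDr.
Qed.

Lemma weak_convolution_derive h phi : uli h -> test_function phi -> forall y : R,
  is_derive y 1 (fun y => \int[mu]_x (h x * phi (x - y)))
    (- \int[mu]_x (h x * derive1 phi (x - y))).
Proof.
move=> uh tphi y; have tphi' := test_function_derive tphi.
have [M [B [B0 hB]]] := test_function_bound tphi'.
pose f (z x : R) := h x * phi (x - z).
(* When the shift stays within [1] of [y], the support of the shifted derivative lies within [M + 1]
   of [y]; one majorant serves the whole neighbourhood. *)
pose G (x : R) := `|h x * (B * (`|x - y| <= M + 1)%R%:R)|.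
have iG : mu.-integrable setT (EFin \o G).
  have [C /(_ y (fun x => B * (`|x - y| <= M + 1)%R%:R))] := uli_pairing_bound (M + 1) uh B0.
  move=> [||i1 _]; last exact: (integrable_norm i1).
    by apply: measurable_funM => //; exact: measurable_near_ind.
  by move=> x; rewrite ger0_norm// mulr_ge0.
have intf z : mu.-integrable setT (EFin \o f z).
  by have [t _] := test_function_shift z tphi; exact: uli_test_integrable.
have df (z x : R) : is_derive z 1 (f ^~ x) (- (h x * derive1 phi (x - z))).
  have dx : is_derive (-1 * z + x) 1 phi (derive1 phi (-1 * z + x)).
    exact: test_function_is_derive.
  have := is_deriveZ_fun (h x) (is_derive_comp_affine dx).
  rewrite !mulN1r mulrN [- z + x]addrC.
  by rewrite (_ : (fun z => h x * phi (-1 * z + x)) = f ^~ x)//; apply/funext => w; rewrite /f mulN1r addrC.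
have p1 z x : partial1of2 f z x = - (h x * derive1 phi (x - z)).
  by rewrite partial1of2E; have [] := df z x.
have Iy : (`]y - 1, y + 1[%classic : set R) y.
  by rewrite /= in_itv/= ltrDl ltr01 gtrDl oppr_lt0 ltr01.
have Gub x z : (`]y - 1, y + 1[%classic : set R) x -> setT z -> `|partial1of2 f x z| <= G z.
  rewrite /= in_itv/= => /andP[x1 x2] _; rewrite p1 normrN /G !normrM ler_wpM2l//.
  apply: le_trans (hB _) _; rewrite (ger0_norm B0) ler_wpM2l// [leRHS]ger0_norm//.
  have [zx|//] := boolP (`|z - x| <= M).
  rewrite (_ : `|z - y| <= M + 1 = true)//.
  rewrite (_ : z - y = (z - x) + (x - y)); last by rewrite addrA subrK.
  rewrite (le_trans (ler_normD _ _))// lerD// ler_norml.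
  by apply/andP; split; lra.
have int_f x : (`]y - 1, y + 1[%classic : set R) x -> mu.-integrable setT (EFin \o f x).
  by move=> _; exact: intf.
have der_f x z : (`]y - 1, y + 1[%classic : set R) x -> setT z -> derivable (f ^~ z) x 1.
  by move=> _ _; have [] := df x z.
have G0 z : 0 <= G z by exact: normr_ge0.
have d1 := @derivable_under_integral R _ _ mu f setT measurableT y (y - 1) (y + 1) Iy int_f der_f G G0 iG Gub.
have d2 := @differentiation_under_integral R _ _ mu f setT measurableT y (y - 1) (y + 1) Iy int_f der_f G G0 iG Gub.
apply: DeriveDef => //; rewrite -derive1E d2.
have [t' _] := test_function_shift y tphi'.
transitivity (\int[mu]_x (-1 * (h x * derive1 phi (x - y)))).
  by apply: eq_Rintegral => x _; rewrite p1 mulN1r.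
by rewrite RintegralZl ?mulN1r//; exact: uli_test_integrable.
Qed.

Lemma weak_convolution_bounded h phi : uli h -> test_function phi ->
  exists C, forall y, `|\int[mu]_x (h x * phi (x - y))| <= C.
Proof.
move=> uh tphi; have [M [B [B0 hB]]] := test_function_bound tphi.
have [C hC] := uli_pairing_bound M uh B0; exists C => y.
have [t _] := test_function_shift y tphi.
by have [] := hC y _ (test_function_measurable t) (fun x => hB (x - y)).
Qed.

Lemma exp_growth_bounded (m : R -> R) (r C : R) : r != 0 ->
  (forall y : R, is_derive y 1 m (r * m y)) -> (forall y, `|m y| <= C) -> forall y, m y = 0.
Proof.
move=> r0 dm mC y.
have E z : expR (- r * z + 0) * m z = expR (- r * y + 0) * m y.
  apply: (@is_derive_0_is_cst R (fun z => expR (- r * z + 0) * m z)) => w.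
  have := is_deriveM_fun (is_derive_expR_comp (is_derive_affine (- r) 0 w)) (dm w).
  rewrite (_ : _ + _ = 0)//; ring.
apply/eqP; rewrite -normr_le0; apply/ler_addgt0Pr => e e0; rewrite add0r.
have mE z : m y = expR (- r * (z - y)) * m z.
  have -> : expR (- r * (z - y)) = expR (- r * z + 0) / expR (- r * y + 0).
    by rewrite -expRN -expRD; congr expR; ring.
  by rewrite mulrAC E mulrAC divff ?mul1r// gt_eqF ?expR_gt0.
have C0 : 0 <= C by exact: le_trans (mC 0).
(* At signed distance [ln K / r] from [y] the exponential factor is [1 / K], and [C / K < e]. *)
pose K := (C + 1) / e.
have K0 : 0 < K by rewrite divr_gt0// ltr_wpDl.
rewrite (mE (y + ln K / r)).
have -> : - r * (y + ln K / r - y) = - ln K by field.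
rewrite expRN lnK ?posrE// normrM gtr0_norm ?invr_gt0//.
rewrite mulrC ler_pdivrMr//; apply: (le_trans (mC _)).
by rewrite /K mulrC divfK ?gt_eqF// lerDl.
Qed.

(** Convolution with a test function turns the equation into [k'' = a k] for a bounded [k] with
    bounded derivative. With [r^2 = a] it factors: [m = k' + r k] solves [m' = r m], so [m = 0];
    then [k' = - r k], so [k = 0]. The value of [k] at [0] is the pairing of [h] with [phi]. *)
Lemma weak_uniqueness h (a : R) : uli h -> 0 < a ->
  (forall phi, test_function phi ->
    \int[mu]_x (h x * derive1n 2 phi x) = a * \int[mu]_x (h x * phi x)) ->
  {ae mu, forall x, h x = 0}.
Proof.
move=> uh a0 hw; apply: fundamental_lemma => // phi tphi.
pose k (y : R) := \int[mu]_x (h x * phi (x - y)).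
pose k1 (y : R) := - \int[mu]_x (h x * derive1 phi (x - y)).
have tphi1 := test_function_derive tphi.
have dk (y : R) : is_derive y 1 k (k1 y) by exact: weak_convolution_derive.
have dk1 (y : R) : is_derive y 1 k1 (a * k y).
  have := is_deriveZ_fun (-1) (weak_convolution_derive uh tphi1 y).
  rewrite (_ : -1 * - _ = a * k y); last first.
    have [t sh] := test_function_shift y tphi.
    have := hw _ t; rewrite /k => <-; rewrite mulN1r opprK.
    by apply: eq_Rintegral => x _; rewrite sh.
  by rewrite (_ : (fun y => -1 * _) = k1)//; apply/funext => z; rewrite mulN1r.
have [C hC] := weak_convolution_bounded uh tphi.
have [C1 hC1] := weak_convolution_bounded uh tphi1.
pose r := Num.sqrt a; have r0 : 0 < r by rewrite sqrtr_gt0.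
have r2 : r * r = a by rewrite -expr2 sqr_sqrtr// ltW.
pose m y := k1 y + r * k y.
have dm (y : R) : is_derive y 1 m (r * m y).
  have := is_deriveD_fun (dk1 y) (is_deriveZ_fun r (dk y)).
  by rewrite (_ : a * k y + r * k1 y = r * m y)// /m -r2; ring.
have mC y : `|m y| <= C1 + r * C.
  rewrite (le_trans (ler_normD _ _))// lerD ?normrN// normrM (gtr0_norm r0).
  by rewrite ler_wpM2l ?hC// ltW.
have m0 := exp_growth_bounded (negbT (gt_eqF r0)) dm mC.
have dk' (y : R) : is_derive y 1 k (- r * k y).
  by rewrite (_ : - r * k y = k1 y)//; have := m0 y; rewrite /m; move: (k1 y) (k y) => p q; lra.
have rn0 : - r != 0 by rewrite oppr_eq0 gt_eqF.
have := exp_growth_bounded rn0 dk' hC 0; rewrite /k => <-.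
by apply: eq_Rintegral => x _; rewrite subr0.
Qed.

End fundamental_lemma.

(** * The resolvent of the second derivative *)

Section resolvent_kernel.
Context {R : realType} (p : R) (p_gt0 : 0 < p).
Local Notation mu := (leb R).
Implicit Types (g phi : R -> R).

(* [locked] keeps unification from looking inside the kernel *)
Definition ek (x : R) : R := locked (2^-1 * expR (- p * `|x|)).

Lemma ek_def x : ek x = 2^-1 * expR (- p * `|x|).
Proof. by rewrite /ek -lock. Qed.

Definition resolvent g (x : R) : R := \int[mu]_y (ek (x - y) * g y).

Lemma ek_ge0 x : 0 <= ek x. Proof. by rewrite ek_def mulr_ge0 ?expR_ge0. Qed.

Lemma ek_le1 x : ek x <= 1.
Proof.
rewrite ek_def -[leRHS]mulr1; apply: ler_pM; rewrite ?expR_ge0 ?invf_le1 ?ler1n//.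
by rewrite -[leRHS]expR0 ler_expR mulNr oppr_le0 mulr_ge0// ltW.
Qed.

Lemma ekB x y : ek (x - y) = ek (y - x). Proof. by rewrite !ek_def distrC. Qed.

Lemma continuous_ek : continuous ek.
Proof.
rewrite (_ : ek = fun x => 2^-1 * expR (- p * `|x|)); last by apply/funext => x; exact: ek_def.
move=> x; apply: cvgM; first exact: cvg_cst.
apply: continuous_comp; last exact: continuous_expR.
by apply: cvgM; [exact: cvg_cst|exact: norm_continuous].
Qed.

Lemma continuous_ekB y : continuous (fun z : R => ek (z - y)).
Proof.
move=> z; apply: (@continuous_comp _ _ _ (fun z : R => z - y) ek); last exact: continuous_ek.
by apply: cvgB; [exact: cvg_id|exact: cvg_cst].
Qed.

Lemma measurable_ek : measurable_fun setT ek.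
Proof. exact: continuous_measurable_fun continuous_ek. Qed.

Lemma measurable_ekB x : measurable_fun setT (fun y : R => ek (x - y)).
Proof. by apply: (measurableT_comp measurable_ek); exact: measurable_funB. Qed.

Lemma measurable_ekB2 : measurable_fun setT (fun z : R * R => ek (z.1 - z.2)).
Proof. by apply: (measurableT_comp measurable_ek); exact: measurable_funB. Qed.

Lemma ekE : {ae mu, forall x, ek x = 2^-1 * posexp p x + 2^-1 * posexp p (- x)}.
Proof.
apply: aeS (ae_neq 0) => x /eqP; rewrite ek_def /posexp oppr_gt0.
case: ltgtP => // x0 _.
  by rewrite (gtr0_norm x0) mulr0 addr0.
by rewrite (ltr0_norm x0) mulr0 add0r.
Qed.

(** The line is folded at [x]. In this form the kernel is an exponential length [r] with a fair
    choice between [x + r] and [x - r], that is, one renewal interval of the process. *)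
Lemma ge0_integral_ek (Phi : R -> R) x : measurable_fun setT Phi -> (forall y, 0 <= Phi y) ->
  (\int[mu]_y (ek (x - y) * Phi y)%:E =
   \int[mu]_r (posexp p r * (2^-1 * (Phi (x + r) + Phi (x - r))))%:E)%E.
Proof.
move=> mPhi Phi0.
have mPo : measurable_fun setT (fun r : R => Phi (x - r)).
  by apply: (measurableT_comp mPhi); exact: measurable_funB.
have mPp : measurable_fun setT (fun r : R => Phi (x + r)).
  by apply: (measurableT_comp mPhi); exact: measurable_funD.
have mp := @measurable_posexp R p.
have mpo : measurable_fun setT (fun r : R => posexp p (- r)).
  by apply: (measurableT_comp mp); exact: oppr_measurable.
transitivity (\int[mu]_z (ek z * Phi (x - z))%:E)%E.
  rewrite -(ge0_integral_opp (f := fun y => (ek (x - y) * Phi y)%:E)).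
  - rewrite -(ge0_integral_shift (- x) (f := fun y => (ek (x - - y) * Phi (- y))%:E)).
    + apply: eq_integral => z _; congr (_ * _)%:E; last by congr Phi; ring.
      by congr ek; ring.
    + apply/measurable_EFinP/measurable_funM.
        by apply: (measurableT_comp measurable_ek); apply: measurable_funB => //; exact: oppr_measurable.
      by apply: (measurableT_comp mPhi); exact: oppr_measurable.
    + by move=> z; rewrite lee_fin mulr_ge0 ?ek_ge0.
  - by apply/measurable_EFinP/measurable_funM => //; exact: measurable_ekB.
  - by move=> z; rewrite lee_fin mulr_ge0 ?ek_ge0.
pose F1 z : R := 2^-1 * (posexp p z * Phi (x - z)).
pose F2 z : R := 2^-1 * (posexp p (- z) * Phi (x - z)).
pose F3 z : R := 2^-1 * (posexp p z * Phi (x + z)).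
have m1 : measurable_fun setT F1 by apply: measurable_funM => //; exact: measurable_funM.
have m2 : measurable_fun setT F2 by apply: measurable_funM => //; exact: measurable_funM.
have m3 : measurable_fun setT F3 by apply: measurable_funM => //; exact: measurable_funM.
have F10 z : 0 <= F1 z by rewrite /F1 !mulr_ge0 ?posexp_ge0.
have F20 z : 0 <= F2 z by rewrite /F2 !mulr_ge0 ?posexp_ge0.
have F30 z : 0 <= F3 z by rewrite /F3 !mulr_ge0 ?posexp_ge0.
transitivity (\int[mu]_z ((F1 z)%:E + (F2 z)%:E))%E.
  apply: ae_eq_integral_nonmeasurable; apply: aeS ekE => z -> _.
  by rewrite /F1 /F2 -EFinD; congr EFin; ring.
transitivity (\int[mu]_z ((F1 z)%:E + (F3 z)%:E))%E.
  have e10 z : setT z -> (0 <= (F1 z)%:E)%E by rewrite lee_fin.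
  have e20 z : setT z -> (0 <= (F2 z)%:E)%E by rewrite lee_fin.
  have e30 z : setT z -> (0 <= (F3 z)%:E)%E by rewrite lee_fin.
  have em1 : measurable_fun setT (EFin \o F1) by exact/measurable_EFinP.
  have em2 : measurable_fun setT (EFin \o F2) by exact/measurable_EFinP.
  have em3 : measurable_fun setT (EFin \o F3) by exact/measurable_EFinP.
  rewrite !ge0_integralD//; congr (_ + _)%E.
  rewrite -(ge0_integral_opp (f := EFin \o F3))//.
by apply: eq_integral => z _; rewrite /F1 /F3 -EFinD; congr EFin; ring.
Qed.

Lemma integral_ek x : (\int[mu]_y (ek (x - y))%:E = (p^-1)%:E)%E.
Proof.
have := @ge0_integral_ek (fun=> 1) x (measurable_cst _) (fun=> ler01).
under eq_integral do rewrite mulr1.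
move=> ->; rewrite -integral_posexp//; apply: eq_integral => r _.
by rewrite -[1 + 1]/(2 : R) mulVf// mulr1.
Qed.

(** A common home for [L^2], bounded and test functions, on which the resolvent converges absolutely
    at every point, with a bound uniform in [x]. *)
Definition kbounded g := measurable_fun setT g /\ exists C : R, forall x,
  (\int[mu]_y (ek (x - y) * `|g y|)%:E <= C%:E)%E.

Lemma kbounded_bounded g (B : R) : measurable_fun setT g -> (forall x, `|g x| <= B) -> kbounded g.
Proof.
move=> mg gB; have B0 : 0 <= B by exact: le_trans (gB 0).
split => //; exists (B * p^-1) => x.
apply: (@le_trans _ _ (\int[mu]_y (B * ek (x - y))%:E)%E).
  apply: ge0_le_integral_nonmeasurable => y; first by rewrite lee_fin mulr_ge0 ?ek_ge0.
  by rewrite lee_fin mulrC ler_wpM2r ?ek_ge0.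
by rewrite ge0_integralZl_R ?integral_ek//; [exact: measurable_ekB|move=> y; exact: ek_ge0].
Qed.

Lemma kbounded_test phi : test_function phi -> kbounded phi.
Proof.
move=> tphi; have [M [B [B0 hB]]] := test_function_bound tphi.
apply: (@kbounded_bounded _ B); first exact: test_function_measurable.
by move=> x; apply: le_trans (hB x) _; rewrite ler_piMr//; case: (_ <= M).
Qed.

(** Since the kernel lies in [[0, 1]], its product with [|g|] is at most the kernel plus [g^2]. *)
Lemma kbounded_L2 g : L2 g -> kbounded g.
Proof.
move=> /L2P[mg]; rewrite L2normE => gfin; split => //.
have I2 : (\int[mu]_x (g x ^+ 2)%:E < +oo)%E by apply: lty_poweRy gfin; rewrite invr_eq0.
have I0 : (0 <= \int[mu]_x (g x ^+ 2)%:E)%E by apply: integral_ge0 => x _; rewrite lee_fin sqr_ge0.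
exists (p^-1 + fine (\int[mu]_x (g x ^+ 2)%:E)) => x.
rewrite EFinD fineK ?ge0_fin_numE// -(integral_ek x) -ge0_integralD//.
- apply: ge0_le_integral_nonmeasurable => y; first by rewrite lee_fin mulr_ge0 ?ek_ge0.
  rewrite -EFinD lee_fin -(real_normK (num_real (g y))).
  have := ek_ge0 (x - y); have := ek_le1 (x - y); have := normr_ge0 (g y).
  move: (ek _) `|g y| => k n n0 k1 k0; nra.
- by move=> y _; rewrite lee_fin ek_ge0.
- by apply/measurable_EFinP; exact: measurable_ekB.
- by move=> y _; rewrite lee_fin sqr_ge0.
- by apply/measurable_EFinP; exact: measurable_funX.
Qed.

Lemma kboundedD g1 g2 : kbounded g1 -> kbounded g2 -> kbounded (fun x => g1 x + g2 x).
Proof.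
move=> [m1 [C1 h1]] [m2 [C2 h2]]; split; first exact: measurable_funD.
have mk (g : R -> R) (x : R) : measurable_fun setT g -> measurable_fun setT (fun y : R => (ek (x - y) * `|g y|)%:E).
  move=> mg; apply/measurable_EFinP/measurable_funM; first exact: measurable_ekB.
  exact: measurableT_comp.
have k0 (g : R -> R) (x y : R) : (0 <= (ek (x - y) * `|g y|)%:E)%E by rewrite lee_fin mulr_ge0 ?ek_ge0.
exists (C1 + C2) => x; rewrite EFinD; apply: le_trans (leeD (h1 x) (h2 x)).
rewrite -ge0_integralD//; [|exact: mk|exact: mk].
apply: ge0_le_integral_nonmeasurable => y; first exact: (k0 (fun y => g1 y + g2 y)).
by rewrite -EFinD lee_fin -mulrDr ler_wpM2l ?ek_ge0// ler_normD.
Qed.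

Lemma kboundedZ (k : R) g : kbounded g -> kbounded (fun x => k * g x).
Proof.
move=> [mg [C hC]]; split; first exact: measurable_funM.
exists (`|k| * C) => x; rewrite EFinM.
apply: le_trans (lee_wpmul2l _ (hC x)); last by rewrite lee_fin.
rewrite -ge0_integralZl_R//.
- apply: ge0_le_integral_nonmeasurable => y; first by rewrite lee_fin mulr_ge0 ?ek_ge0.
  by rewrite lee_fin normrM mulrCA.
- by apply: measurable_funM; [exact: measurable_ekB|exact: measurableT_comp].
- by move=> y; rewrite mulr_ge0 ?ek_ge0.
Qed.

Lemma resolvent_integrable g x : kbounded g ->
  mu.-integrable setT (EFin \o (fun y => ek (x - y) * g y)).
Proof.
move=> [mg [C hC]]; apply/integrableP; split.
  by apply/measurable_EFinP/measurable_funM => //; exact: measurable_ekB.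
apply: (@le_lt_trans _ _ C%:E); last exact: ltry.
apply: le_trans (hC x); apply: ge0_le_integral_nonmeasurable => y; first by [].
by rewrite /= lee_fin normrM (ger0_norm (ek_ge0 _)).
Qed.

Lemma resolvent_bounded g : kbounded g -> exists C, forall x, `|resolvent g x| <= C.
Proof.
move=> kg; have [mg [C hC]] := kg; exists C => x.
rewrite -lee_fin; apply: le_trans (hC x).
rewrite -abse_EFin /resolvent /Rintegral fineK; last first.
  by rewrite integrable_fin_num//; exact: resolvent_integrable.
apply: le_trans (le_abse_integral _ _ _) _ => //.
  by apply/measurable_EFinP/measurable_funM => //; exact: measurable_ekB.
apply: ge0_le_integral_nonmeasurable => y; first by [].
by rewrite /= lee_fin normrM (ger0_norm (ek_ge0 _)).
Qed.

Lemma measurable_resolvent g : measurable_fun setT g -> measurable_fun setT (resolvent g).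
Proof.
move=> mg; apply: (measurable_Rintegral_snd mu (F := fun z : R * R => ek (z.1 - z.2) * g z.2)).
by apply: measurable_funM; [exact: measurable_ekB2|exact: (measurableT_comp mg)].
Qed.

Lemma continuous_resolvent g : kbounded g -> continuous (resolvent g).
Proof.
move=> kg x; have [mg _] := kg.
(* If [z] is within [1] of [x], then [|x - y| <= 1 + |z - y|], so moving the centre costs at most
   the factor [expR p]. *)
pose G y := expR p * `|ek (x - y) * g y|.
have iG : mu.-integrable setT (EFin \o G).
  exact: (integrableZl measurableT (expR p) (integrable_norm (resolvent_integrable x kg))).
have Ix : (`]x - 1, x + 1[%classic : set R) x.
  by rewrite /= in_itv/= ltrDl ltr01 gtrDl oppr_lt0 ltr01.
have ck y : continuous (fun z : R => ek (z - y) * g y).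
  by move=> z; apply: cvgM; [exact: continuous_ekB|exact: cvg_cst].
apply: (@continuity_under_integral R _ _ mu (fun x y => ek (x - y) * g y) setT measurableT
  (x - 1) (x + 1) _ _ G iG) => //.
- by move=> z _; exact: resolvent_integrable.
- apply: aeW => y _ z _; exact: ck.
- move=> z; rewrite /= in_itv/= => /andP[z1 z2]; apply: aeW => y _.
  rewrite /G !normrM mulrA ler_wpM2r// !(ger0_norm (ek_ge0 _)) !ek_def mulrCA.
  rewrite ler_wpM2l// -expRD ler_expR.
  have : `|x - y| <= 1 + `|z - y|.
    rewrite (_ : x - y = (x - z) + (z - y)); last by rewrite addrA subrK.
    rewrite (le_trans (ler_normD _ _))// lerD2r ler_norml; apply/andP; split; lra.
  move: `|x - y| `|z - y| => a b ab; rewrite !mulNr -[X in X - _]mulr1.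
  by rewrite lerNl opprB lerBlDr -mulrDr ler_pM2l// [b + 1]addrC.
- exact/mem_set.
Qed.

Lemma FTC_is_derive (F f : R -> R) (a b : R) : a < b -> continuous f ->
  (forall y : R, is_derive y 1 F (f y)) -> \int[mu]_(y in `[a, b]) f y = F b - F a.
Proof.
move=> ab cf dF; have cF : continuous F.
  move=> y; apply: differentiable_continuous; apply/derivable1_diffP.
  by have [] := dF y.
rewrite /Rintegral (@continuous_FTC2 _ f F a b ab) //.
- exact: continuous_subspaceT.
- split; first by move=> y _; have [] := dF y.
  + by apply: cvg_at_right_filter; exact: cF.
  + by apply: cvg_at_left_filter; exact: cF.
- by move=> y _; rewrite (is_derive_derive1_eq dF).
Qed.

(** With [psi = p^2 phi - phi''], the function [expR (p (y - x)) psi y] has the primitive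
    [expR (p (y - x)) (p phi - phi')]; to the right of [x] the sign of [p] is reversed. The boundary
    terms at [x] are [p phi - phi'] and [p phi + phi'], and half their sum is [p phi x]. *)
Lemma resolvent_test phi x : test_function phi ->
  resolvent (fun y => p ^+ 2 * phi y - derive1n 2 phi y) x = p * phi x.
Proof.
move=> tphi; have t1 := test_function_derive tphi; have t2 := test_function_derive t1.
have [M [B [B0 hB]]] := test_function_bound tphi.
have [M1 [B1 [_ hB1]]] := test_function_bound t1.
have [M2 [B2 [_ hB2]]] := test_function_bound t2.
(* [K] exceeds [|x|] and the radii of the three supports, so the boundary terms at [- K] and [K]
   vanish. *)
pose K := 1 + `|x| + `|M| + `|M1| + `|M2|.
have xK : `|x| < K by rewrite /K; have := normr_ge0 M; have := normr_ge0 M1; have := normr_ge0 M2; lra.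
have MK : M < K by rewrite /K; have := ler_norm M; have := normr_ge0 M1; have := normr_ge0 M2; have := normr_ge0 x; lra.
have M1K : M1 < K by rewrite /K; have := ler_norm M1; have := normr_ge0 M; have := normr_ge0 M2; have := normr_ge0 x; lra.
have M2K : M2 < K by rewrite /K; have := ler_norm M2; have := normr_ge0 M; have := normr_ge0 M1; have := normr_ge0 x; lra.
have vanish (psi : R -> R) (N D : R) y : (forall x, `|psi x| <= D * (`|x| <= N)%R%:R) -> N < K ->
    K <= `|y| -> psi y = 0.
  move=> h NK Ky; apply/eqP; rewrite -normr_le0; apply: le_trans (h y) _.
  rewrite (_ : (`|y| <= N) = false) ?mulr0//.
  by apply/negbTE; rewrite -ltNge; exact: lt_le_trans NK Ky.
have p0 y : K <= `|y| -> phi y = 0 by exact: (vanish _ M B).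
have p1 y : K <= `|y| -> derive1 phi y = 0 by exact: (vanish _ M1 B1).
have p2 y : K <= `|y| -> derive1n 2 phi y = 0 by exact: (vanish _ M2 B2).
pose psi y := p ^+ 2 * phi y - derive1n 2 phi y.
have d0 (y : R) := test_function_is_derive y tphi.
have d1 (y : R) := test_function_is_derive y t1.
have cpsi : continuous psi.
  move=> y; apply: cvgB; last exact: (test_function_continuous t2).
  by apply: cvgM; [exact: cvg_cst|exact: (test_function_continuous tphi)].
have cE (k c : R) : continuous (fun y => expR (k * y + c) * psi y).
  move=> y; apply: cvgM; last exact: cpsi.
  apply: continuous_comp; last exact: continuous_expR.
  by apply: cvgD; [apply: cvgM; [exact: cvg_cst|exact: cvg_id]|exact: cvg_cst].
have xK1 : - K < x by rewrite ltrNl (le_lt_trans (ler_norm _))// normrN.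
have xK2 : x < K by rewrite (le_lt_trans (ler_norm _)).
have FL := @FTC_is_derive (fun y => expR (p * y + - (p * x)) * (p * phi y - derive1 phi y))
  (fun y => expR (p * y + - (p * x)) * psi y) (- K) x xK1 (cE p _).
have FR := @FTC_is_derive (fun y => expR (- p * y + p * x) * (- (p * phi y) - derive1 phi y))
  (fun y => expR (- p * y + p * x) * psi y) x K xK2 (cE (- p) _).
have KK : K <= `|K| by exact: ler_norm.
have dL (y : R) : is_derive y 1 (fun y => expR (p * y + - (p * x)) * (p * phi y - derive1 phi y))
    (expR (p * y + - (p * x)) * psi y).
  have := is_deriveM_fun (is_derive_expR_comp (is_derive_affine p (- (p * x)) y))
    (is_deriveD_fun (is_deriveZ_fun p (d0 y)) (is_deriveZ_fun (-1) (d1 y))).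
  rewrite (_ : (fun z => _) = (fun y => expR (p * y - p * x) * (p * phi y - derive1 phi y))); last first.
    by apply/funext => z; rewrite mulN1r.
  by rewrite (_ : _ + _ = expR (p * y - p * x) * psi y)// /psi /=; ring.
have {}FL : \int[mu]_(y in `[- K, x]) (expR (p * y + - (p * x)) * psi y) = p * phi x - derive1 phi x.
  by rewrite (FL dL) subrr expR0 mul1r (p0 (- K)) ?(p1 (- K)) ?normrN// mulr0 subr0 mulr0 subr0.
have dR (y : R) : is_derive y 1 (fun y => expR (- p * y + p * x) * (- (p * phi y) - derive1 phi y))
    (expR (- p * y + p * x) * psi y).
  have := is_deriveM_fun (is_derive_expR_comp (is_derive_affine (- p) (p * x) y))
    (is_deriveD_fun (is_deriveZ_fun (- p) (d0 y)) (is_deriveZ_fun (-1) (d1 y))).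
  rewrite (_ : (fun z => _) = (fun y => expR (- p * y + p * x) * (- (p * phi y) - derive1 phi y))); last first.
    by apply/funext => z; congr (_ * _); ring.
  by rewrite (_ : _ + _ = expR (- p * y + p * x) * psi y)// /psi /=; ring.
have {}FR : \int[mu]_(y in `[x, K]) (expR (- p * y + p * x) * psi y) = p * phi x + derive1 phi x.
  rewrite (FR dR) (_ : - p * x + p * x = 0); last by ring.
  by rewrite expR0 mul1r (p0 K)// (p1 K)// mulr0 subr0 oppr0 mulr0 sub0r opprB opprK addrC.
have ik : mu.-integrable `[- K, K] (EFin \o (fun y => ek (x - y) * psi y)).
  apply: continuous_compact_integrable; first exact: segment_compact.
  apply: continuous_subspaceT => y; apply: cvgM; last exact: cpsi.
  have -> : (fun z => ek (x - z)) = fun z => ek (z - x) by apply/funext => z; rewrite ekB.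
  by rewrite [ek (x - y)]ekB; exact: continuous_ekB.
have -> : resolvent psi x = \int[mu]_(y in `[- K, K]) (ek (x - y) * psi y).
  rewrite /Rintegral [in RHS]integral_mkcond; congr fine; apply: eq_integral => y _.
  rewrite patchE mem_setE in_itv/= -ler_norml; case: leP => // /ltW Ky.
  by rewrite /psi p0// p2// mulr0 subr0 mulr0.
have := Rintegral_itvB ik; move=> /(_ x); rewrite !bnd_simp => /(_ (ltW xK1) (ltW xK2)).
rewrite Rintegral_itv_obnd_cbnd; last first.
  apply: (integrableS _ _ _ ik) => //; apply: subset_itvr; rewrite bnd_simp; exact: ltW.
move=> /eqP; rewrite subr_eq => /eqP ->.
have -> : \int[mu]_(y in `[x, K]) (ek (x - y) * psi y) = 2^-1 * (p * phi x + derive1 phi x).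
  rewrite -FR -RintegralZl//; last first.
    apply: continuous_compact_integrable; first exact: segment_compact.
    exact/continuous_subspaceT/cE.
  apply: eq_Rintegral => y; rewrite inE/= in_itv/= => /andP[xy _].
  rewrite ek_def mulrA -subr_le0 in xy *; rewrite (ler0_norm xy); congr (_ * expR _ * _); ring.
have -> : \int[mu]_(y in `[- K, x]) (ek (x - y) * psi y) = 2^-1 * (p * phi x - derive1 phi x).
  rewrite -FL -RintegralZl//; last first.
    apply: continuous_compact_integrable; first exact: segment_compact.
    exact/continuous_subspaceT/cE.
  apply: eq_Rintegral => y; rewrite inE/= in_itv/= => /andP[_ xy].
  rewrite ek_def mulrA -subr_ge0 in xy *; rewrite (ger0_norm xy); congr (_ * expR _ * _); ring.
by field.
Qed.

(** The kernel is symmetric, so Fubini moves the convolution from [g] to the test function, where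
    [resolvent_test] evaluates it. *)
Lemma resolvent_weak g phi : kbounded g -> test_function phi ->
  \int[mu]_x (resolvent g x * (p ^+ 2 * phi x - derive1n 2 phi x)) =
  p * \int[mu]_x (g x * phi x).
Proof.
move=> kg tphi; have [mg [C hC]] := kg.
have t2 := test_function_derive1n 2 tphi.
pose psi y := p ^+ 2 * phi y - derive1n 2 phi y.
have mpsi : measurable_fun setT psi.
  apply: measurable_funB; last exact: test_function_measurable.
  by apply: measurable_funM => //; exact: test_function_measurable.
have u1 : uli (fun=> 1 : R) by apply: (@uli_bounded _ _ 1) => // x; rewrite normr1.
have ipsi : mu.-integrable setT (EFin \o psi).
  have i1 := integrableZl measurableT (p ^+ 2) (uli_test_integrable u1 tphi).
  have := integrableB measurableT i1 (uli_test_integrable u1 t2).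
  by apply: eq_integrable => // x _; rewrite /= !mul1r.
pose F (z : R * R) := ek (z.1 - z.2) * g z.2 * psi z.1.
have mF : measurable_fun setT F.
  apply: measurable_funM; last exact: (measurableT_comp mpsi).
  by apply: measurable_funM; [exact: measurable_ekB2|exact: (measurableT_comp mg)].
have iF : (mu \x mu)%E.-integrable setT (EFin \o F).
  apply: integrable_prod_of_ge0 => //.
  apply: (@le_lt_trans _ _ (\int[mu]_x (C%:E * `|(psi x)%:E|))%E).
    apply: ge0_le_integral_nonmeasurable => x; first by apply: integral_ge0.
    have -> : (\int[mu]_y `|F (x, y)|%:E = \int[mu]_y (ek (x - y) * `|g y| * `|psi x|)%:E)%E.
      by apply: eq_integral => y _; rewrite /F !normrM (ger0_norm (ek_ge0 _)).
    rewrite ge0_integralZr_R//.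
    - exact: lee_wpmul2r.
    - by apply: measurable_funM; [exact: measurable_ekB|exact: measurableT_comp].
    - by move=> y; rewrite mulr_ge0 ?ek_ge0.
  have C0 : (0 <= C%:E)%E.
    by apply: le_trans (hC 0); apply: integral_ge0 => y _; rewrite lee_fin mulr_ge0 ?ek_ge0.
  rewrite ge0_integralZl//; last first.
    by apply: measurableT_comp => //; exact/measurable_EFinP.
  by apply: lte_mul_pinfty => //; have /integrableP[] := ipsi.
transitivity (\int[mu]_x \int[mu]_y F (x, y)).
  by apply: eq_Rintegral => x _; rewrite /resolvent -RintegralZr//; exact: resolvent_integrable.
have kpsi : kbounded psi.
  have := kboundedD (kboundedZ (p ^+ 2) (kbounded_test tphi)) (kboundedZ (-1) (kbounded_test t2)).
  by rewrite (_ : (fun x => _) = psi)//; apply/funext => x; rewrite mulN1r.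
have FE y : \int[mu]_x F (x, y) = p * (g y * phi y).
  transitivity (g y * resolvent psi y); last by rewrite /psi resolvent_test// mulrCA.
  have ry := resolvent_integrable y kpsi.
  rewrite /resolvent -(RintegralZl _ measurableT ry).
  by apply: eq_Rintegral => x _; rewrite /F/= ekB mulrCA mulrA.
have igp : mu.-integrable setT (EFin \o (fun y => g y * phi y)).
  have := integrable_Rintegral_fst iF.
  move=> /(integrableZl measurableT p^-1); apply: eq_integrable => // y _.
  by rewrite /= FE -EFinM mulKf// gt_eqF.
by rewrite Rfubini// -RintegralZl//; apply: eq_Rintegral => y _; rewrite FE.
Qed.

End resolvent_kernel.

(** * Continuous representatives and the weak form of the resolvent equation *)

Section sobolev_representative.
Context {R : realType}.
Local Notation mu := (leb R).

Lemma integrable_sub_test (g : R -> R) (a b : R) phi psi : uli g ->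
  test_function phi -> test_function psi ->
  \int[mu]_x (g x * (a * phi x - b * psi x)) =
  a * \int[mu]_x (g x * phi x) - b * \int[mu]_x (g x * psi x).
Proof.
move=> ug tphi tpsi.
have i1 := uli_test_integrable ug tphi; have i2 := uli_test_integrable ug tpsi.
rewrite -!RintegralZl// -RintegralB//; first by apply: eq_Rintegral => x _; ring.
  exact: (integrableZl measurableT a i1).
exact: (integrableZl measurableT b i2).
Qed.

(** Formally [f = (1 - d^2/dx^2)^-1 (f - f'')]. The right-hand side [g] is bounded and continuous,
    and [h = f - g] solves [h'' = h] weakly, hence vanishes. *)
Lemma sobolev2_regular (f : R -> R) : sobolev 2 f ->
  exists2 g : R -> R, continuous g /\ (exists B, forall x, `|g x| <= B) &
    {ae mu, forall x, f x = g x}.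
Proof.
move=> [fL2 /(_ 2%N isT)[f2 f2L2 [_ _ wk]]].
have p1 : (0 : R) < 1 by exact: ltr01.
have uf := uli_L2 fL2; have uf2 := uli_L2 f2L2.
have kg : kbounded 1 (fun x => f x + -1 * f2 x).
  by apply: kboundedD => //; [exact: kbounded_L2|apply: kboundedZ => //; exact: kbounded_L2].
pose g := resolvent 1 (fun x => f x + -1 * f2 x).
have cg : continuous g by exact: continuous_resolvent.
have [B hB] := resolvent_bounded kg.
exists g; first by split => //; exists B.
have mg : measurable_fun setT g by exact: continuous_measurable_fun.
have ug : uli g by exact: (@uli_bounded _ _ B).
have ud : uli (fun x => f x + -1 * g x) by apply: uli_add => //; exact: uli_scale.
suff : {ae mu, forall x, f x + -1 * g x = 0}.
  by apply: aeS => x; rewrite mulN1r => /eqP; rewrite subr_eq0 => /eqP.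
apply: (weak_uniqueness ud ltr01) => phi tphi; rewrite mul1r.
have t2 := test_function_derive1n 2 tphi.
have ig psi : test_function psi -> \int[mu]_x ((f x + -1 * g x) * psi x) =
    \int[mu]_x (f x * psi x) - \int[mu]_x (g x * psi x).
  move=> tpsi; rewrite -RintegralB//; try exact: uli_test_integrable.
  by apply: eq_Rintegral => x _; ring.
rewrite !ig//.
have := resolvent_weak p1 kg tphi; rewrite mul1r -/g => e1.
have e2 : \int[mu]_x (g x * (1 ^+ 2 * phi x - derive1n 2 phi x)) =
    \int[mu]_x (g x * phi x) - \int[mu]_x (g x * derive1n 2 phi x).
  have := integrable_sub_test 1 1 ug tphi t2; rewrite !mul1r => <-.
  by apply: eq_Rintegral => x _; rewrite expr1n !mul1r.
have e3 : \int[mu]_x ((f x + -1 * f2 x) * phi x) =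
    \int[mu]_x (f x * phi x) - \int[mu]_x (f2 x * phi x).
  rewrite -RintegralB//; try exact: uli_test_integrable.
  by apply: eq_Rintegral => x _; ring.
have := wk _ tphi; rewrite sqrrN expr1n mul1r => e4.
move: e1; rewrite e2 e3 -e4; lra.
Qed.

(** [U] is the resolvent of [q / s * f + lam * U], so [p^2 U - U'' = p (q / s * f + lam * U)]
    weakly, and [p - lam = q]. *)
Lemma resolvent_equation_weak (q lam s : R) (f U : R -> R) phi : 0 < q -> 0 < lam -> 0 < s ->
  kbounded (q + lam) f -> kbounded (q + lam) U -> uli U -> uli f ->
  (forall x, U x = q / s * resolvent (q + lam) f x + lam * resolvent (q + lam) U x) ->
  test_function phi ->
  \int[mu]_x (U x * derive1n 2 phi x) =
  q * (q + lam) * (\int[mu]_x (U x * phi x) - s^-1 * \int[mu]_x (f x * phi x)).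
Proof.
move=> q0 l0 s0; set p := q + lam => kf kU uU uf UE tphi.
have p0 : 0 < p by rewrite addr_gt0.
have t2 := test_function_derive1n 2 tphi.
pose g x := q / s * f x + lam * U x.
have kg : kbounded p g by apply: kboundedD => //; exact: kboundedZ.
have UgE x : U x = resolvent p g x.
  have i1 := resolvent_integrable x kf; have i2 := resolvent_integrable x kU.
  rewrite UE /resolvent -!RintegralZl// -RintegralD//.
  - by apply: eq_Rintegral => y _; rewrite /g; ring.
  - exact: (integrableZl measurableT (q / s) i1).
  - exact: (integrableZl measurableT lam i2).
have := resolvent_weak p0 kg tphi.
have -> : \int[mu]_x (resolvent p g x * (p ^+ 2 * phi x - derive1n 2 phi x)) =
    p ^+ 2 * \int[mu]_x (U x * phi x) - \int[mu]_x (U x * derive1n 2 phi x).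
  have := integrable_sub_test (p ^+ 2) 1 uU tphi t2; rewrite !mul1r => <-.
  by apply: eq_Rintegral => x _; rewrite -UgE mul1r.
have -> : \int[mu]_x (g x * phi x) = q / s * \int[mu]_x (f x * phi x) + lam * \int[mu]_x (U x * phi x).
  have i1 := uli_test_integrable uf tphi; have i2 := uli_test_integrable uU tphi.
  rewrite -!RintegralZl// -RintegralD//.
  - by apply: eq_Rintegral => y _; rewrite /g; ring.
  - exact: (integrableZl measurableT (q / s) i1).
  - exact: (integrableZl measurableT lam i2).
move: (\int[mu]_x (U x * phi x)) (\int[mu]_x (U x * derive1n 2 phi x)) (\int[mu]_x (f x * phi x)).
move=> a b c h.
have -> : b = p ^+ 2 * a - p * (q / s * c + lam * a) by move: h; lra.
by rewrite /p; field; rewrite gt_eqF.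
Qed.

End sobolev_representative.

(** * Lerch theorem *)

Section lerch.
Context {R : realType}.
Local Notation mu := (leb R).
Implicit Types w : R -> R.

Lemma integrable_uli w : mu.-integrable setT (EFin \o w) -> uli w.
Proof.
move=> iw; have mw : measurable_fun setT w by apply/measurable_EFinP; exact: measurable_int iw.
split => // M; exists (fine (\int[mu]_x `|(EFin \o w) x|)) => y.
have /integrableP[_ fw] := iw.
rewrite fineK ?ge0_fin_numE//; last exact: integral_ge0.
apply: ge0_le_integral_nonmeasurable => x; first by rewrite lee_fin mulr_ge0.
by rewrite /= lee_fin ler_piMr//; case: (_ <= M).
Qed.

(** [expR (- expR (m (b - t)))] is a power series in [expR (- m t)], so termwise integration
    involves only Laplace transforms of [w] at the integers [m n]. For [t > 0] the partial sums are
    bounded by [K = expR (expR (m b))]. *)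
Lemma integral_exp_exp w (m : nat) (b : R) : mu.-integrable setT (EFin \o w) ->
  (forall t, t <= 0 -> w t = 0) ->
  (forall j : nat, \int[mu]_t (w t * expR (- j%:R * t)) = 0) ->
  \int[mu]_t (w t * expR (- expR (m%:R * (b - t)))) = 0.
Proof.
move=> iw w0 wj; have mw : measurable_fun setT w by apply/measurable_EFinP; exact: measurable_int iw.
pose y t : R := - expR (m%:R * (b - t)).
have my : measurable_fun setT y.
  apply: measurableT_comp; first exact: oppr_measurable.
  by apply: measurableT_comp => //; apply: measurable_funM => //; exact: measurable_funB.
pose S n t : R := \sum_(0 <= i < n) exp_coeff (y t) i.
have mS n : measurable_fun setT (S n).
  apply: measurable_sum => i; rewrite /exp_coeff/=.
  by apply: measurable_funM => //; exact: measurable_funX.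
pose K := expR (expR (m%:R * b)).
have Sb n t : 0 < t -> `|S n t| <= K.
  move=> t0; apply: (@le_trans _ _ (\sum_(0 <= i < n) exp_coeff (expR (m%:R * b)) i)).
    apply: (le_trans (ler_norm_sum _ _ _)); apply: ler_sum => i _.
    rewrite /exp_coeff/= normrM [X in _ * X]ger0_norm ?invr_ge0// ler_wpM2r ?invr_ge0//.
    rewrite normrX normrN ger0_norm ?expR_ge0//; apply: lerXn2r; rewrite ?nnegrE ?expR_ge0//.
    by rewrite ler_expR ler_wpM2l// gerBl ltW.
  have nd : nondecreasing_seq (series (exp_coeff (expR (m%:R * b)))).
    apply/nondecreasing_seqP => k; rewrite !seriesEnat/= big_nat_recr//= lerDl.
    by rewrite /exp_coeff/= divr_ge0// exprn_ge0// expR_ge0.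
  have := nondecreasing_cvgn_le nd (is_cvg_series_exp_coeff _) n.
  by rewrite seriesEnat.
have [|||||_ _ lim] := @dominated_convergence _ _ R mu setT measurableT
  (fun n t => (w t * S n t)%:E) (fun t => (w t * expR (y t))%:E)
  (fun t => (K%:E * `|(w t)%:E|)%E).
- by move=> n; apply/measurable_EFinP; exact: measurable_funM mw (mS n).
- by apply/measurable_EFinP; apply: measurable_funM mw _; exact: measurableT_comp.
- apply: aeW => t _; apply: cvg_EFin; first exact: nearW.
  apply: cvgM; first exact: cvg_cst.
  have : series (exp_coeff (y t)) n @[n --> \oo] --> expR (y t) := is_cvg_series_exp_coeff (y t).
  by rewrite seriesEnat.
- exact: (integrableZl measurableT K (integrable_abse iw)).
- apply: aeW => t n _; rewrite -EFinM lee_fin normrM mulrC.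
  have [t0|t0] := leP t 0; first by rewrite w0// normr0 !mulr0.
  by rewrite ler_wpM2r// Sb.
suff : (\int[mu]_t (w t * expR (y t))%:E = 0)%E by rewrite /Rintegral => ->.
apply: (cvg_unique _ lim) => //.
rewrite (_ : (fun n => _) = (fun=> 0%E)); first exact: cvg_cst.
apply/funext => n /=.
have iwS : mu.-integrable setT (EFin \o (fun t => w t * S n t)).
  apply: (le_integrable _ _ _ (integrableZl measurableT K (integrable_abse iw))) => //.
    by apply/measurable_EFinP; exact: measurable_funM mw (mS n).
  move=> t _; rewrite /= lee_fin normrM [leRHS]ger0_norm ?mulr_ge0 ?expR_ge0// mulrC.
  have [t0|t0] := leP t 0; first by rewrite w0// normr0 !mulr0.
  by rewrite ler_wpM2r// Sb.
have iwj j : mu.-integrable setT (EFin \o (fun t => w t * expR (- j%:R * t))).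
  apply: (le_integrable _ _ _ iw) => //.
    by apply/measurable_EFinP/measurable_funM => //; exact: measurable_expN.
  move=> t _; rewrite /= lee_fin normrM (ger0_norm (expR_ge0 _)).
  have [t0|t0] := leP t 0; first by rewrite w0// normr0 !mul0r.
  by rewrite ler_piMr// -[leRHS]expR0 ler_expR mulNr oppr_le0 mulr_ge0// ltW.
suff : \int[mu]_t (w t * S n t) = 0.
  rewrite /Rintegral => h; rewrite -[LHS]fineK ?h//.
  by rewrite integrable_fin_num.
elim: n iwS => [|n IH] iwS.
  rewrite /Rintegral integral0_eq// => t _.
  by rewrite /S big_nil mulr0.
pose c := (- expR (m%:R * b)) ^+ n / n`!%:R.
have E t : w t * S n.+1 t = w t * S n t + c * (w t * expR (- (m * n)%:R * t)).
  rewrite /S big_nat_recr//= mulrDr; congr (_ + _).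
  have -> : exp_coeff (y t) n = c * expR (- (m * n)%:R * t); last by ring.
  have yE : y t = - expR (m%:R * b) * expR (- m%:R * t).
    by rewrite /y [RHS]mulNr -expRD; congr (- expR _); ring.
  rewrite /exp_coeff/= yE exprMn -expRM_natl /c -!mulrA; congr (_ * _); rewrite mulrC.
  by congr (_ * expR _); rewrite natrM; ring.
have iwn : mu.-integrable setT (EFin \o (fun t => c * (w t * expR (- (m * n)%:R * t)))).
  exact: (integrableZl measurableT c (iwj (m * n)%N)).
have iwSn : mu.-integrable setT (EFin \o (fun t => w t * S n t)).
  have := integrableB measurableT iwS iwn; apply: eq_integrable => // t _.
  by rewrite /= -EFinB E addrK.
transitivity (\int[mu]_t (w t * S n t + c * (w t * expR (- (m * n)%:R * t)))).
  by apply: eq_Rintegral => t _; exact: E.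
rewrite RintegralD//.
by rewrite IH// RintegralZl// wj mulr0 addr0.
Qed.

(** As [m] grows, [expR (- expR (m (b - t)))] tends to [1] for [t > b] and to [0] for [t < b]. Thus
    [w] has integral [0] over every ray, hence over every bounded interval. *)
Lemma lerch w : mu.-integrable setT (EFin \o w) ->
  (forall t, t <= 0 -> w t = 0) ->
  (forall j : nat, \int[mu]_t (w t * expR (- j%:R * t)) = 0) ->
  {ae mu, forall t, w t = 0}.
Proof.
move=> iw w0 wj; have mw : measurable_fun setT w by apply/measurable_EFinP; exact: measurable_int iw.
have ray b : \int[mu]_t (w t * \1_(`]b, +oo[%classic : set R) t) = 0.
  pose y m t : R := - expR (m%:R * (b - t)).
  have my m : measurable_fun setT (y m).
    apply: measurableT_comp; first exact: oppr_measurable.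
    by apply: measurableT_comp => //; apply: measurable_funM => //; exact: measurable_funB.
  have mi : measurable_fun setT (\1_(`]b, +oo[%classic : set R) : R -> R).
    by apply: measurable_indic; exact: measurable_itv.
  have [|||||_ _ lim] := @dominated_convergence _ _ R mu setT measurableT
    (fun m t => (w t * expR (y m t))%:E) (fun t => (w t * \1_(`]b, +oo[%classic : set R) t)%:E)
    (fun t => `|(w t)%:E|%E).
  - by move=> m; apply/measurable_EFinP; apply: measurable_funM mw _; apply: measurableT_comp => //; exact: my.
  - by apply/measurable_EFinP; exact: measurable_funM mw mi.
  - apply: aeS (ae_neq b) => t /eqP tb _; apply: cvg_EFin; first exact: nearW.
    apply: cvgM; first exact: cvg_cst.
    rewrite indicE mem_setE in_itv/= andbT.
    case: ltgtP tb => // tb _ /=.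
      rewrite -[X in _ --> X](@expR0 R).
      apply: (@continuous_cvg _ _ _ _ _ _ (@expR R)); first exact: continuous_expR.
      rewrite -oppr0; apply: cvgN.
      have -> : (fun m : nat => expR (m%:R * (b - t))) = (fun m => (expR (b - t)) ^+ m).
        by apply/funext => m; rewrite expRM_natl.
      by apply: cvg_expr; rewrite ger0_norm ?expR_ge0// -[ltRHS]expR0 ltr_expR subr_lt0.
    have d0 : 0 < b - t by rewrite subr_gt0.
    apply/cvgr0Pnorm_le => e e0; near=> m.
    rewrite ger0_norm ?expR_ge0// /y.
    have h1 : m%:R * (b - t) <= expR (m%:R * (b - t)).
      by apply: le_trans (expR_ge1Dx _); rewrite lerDr.
    rewrite -[leRHS](lnK (_ : e \in Num.pos)) ?posrE// ler_expR lerNl.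
    apply: le_trans h1; rewrite -ler_pdivrMr//.
    by near: m; exact: nbhs_infty_ger.
  - exact: integrable_abse.
  - apply: aeW => t m _; rewrite lee_fin normrM ler_piMr// ger0_norm ?expR_ge0//.
    by rewrite -[leRHS]expR0 ler_expR oppr_le0 expR_ge0.
  suff : (\int[mu]_t (w t * \1_(`]b, +oo[%classic : set R) t)%:E = 0)%E.
    by rewrite /Rintegral => ->.
  apply: (cvg_unique _ lim) => //.
  rewrite (_ : (fun m => _) = (fun=> 0%E)); first exact: cvg_cst.
  apply/funext => m /=; have := integral_exp_exp m b iw w0 wj; rewrite /Rintegral => h.
  rewrite -[LHS]fineK ?h// integrable_fin_num//.
  apply: (le_integrable _ _ _ iw) => //.
    by apply/measurable_EFinP; apply: measurable_funM mw _; apply: measurableT_comp => //; exact: my.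
  move=> t _; rewrite /= lee_fin normrM ler_piMr// ger0_norm ?expR_ge0//.
  by rewrite -[leRHS]expR0 ler_expR oppr_le0 expR_ge0.
apply: ae_eq0_of_itv; first exact: integrable_uli.
move=> a b; have [ab|ba] := leP a b; last first.
  by rewrite set_itv_ge ?Rintegral_set0// -leNgt bnd_simp ltW.
have ii c : mu.-integrable setT (EFin \o (fun t => w t * \1_(`]c, +oo[%classic : set R) t)).
  apply: (le_integrable _ _ _ iw) => //.
    by apply/measurable_EFinP/measurable_funM.
  by move=> t _; rewrite /= lee_fin normrM ler_piMr// indicE; case: (_ \in _); rewrite ?normr1 ?normr0.
rewrite Rintegral_itv_bndo_bndc; last exact: integrableS iw.
have := RintegralB measurableT (ii a) (ii b); rewrite !ray subrr => <-.
rewrite /Rintegral integral_mkcond; congr fine; apply: eq_integral => t _.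
rewrite patchE !indicE !mem_setE !in_itv/= !andbT -mulrBr.
case: ltP => at_ /=; last by rewrite ltNge (le_trans at_ ab)/= subr0 mulr0.
by case: leP => bt; rewrite ?subrr ?mulr0 ?subr0 ?mulr1.
Unshelve. all: by end_near. Qed.

End lerch.

(** * Independence and exponential laws *)

Definition mfun_of {d1 d2} {T1 : measurableType d1} {T2 : measurableType d2}
    (X : T1 -> T2) (mX : measurable_fun setT X) : {mfun T1 >-> T2} :=
  HB.pack_for {mfun T1 >-> T2} X (isMeasurableFun.Build _ _ T1 T2 X mX).

Section independence.
Context {d} {Omega : measurableType d} {R : realType} (P : probability Omega R).
Implicit Types G : set (set Omega).

Lemma sub_sigma_measurable G : G `<=` measurable -> <<s G >> `<=` measurable.
Proof. by move=> Gm; apply: smallest_sub => //; exact: sigma_algebra_measurable. Qed.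

Lemma gsigma_measurable_fun G {d2} {T2 : measurableType d2} (X : Omega -> T2) :
  G `<=` measurable -> measurable_fun setT (X : g_sigma_algebraType G -> T2) ->
  measurable_fun setT X.
Proof. by move=> Gm mX _ B mB; apply: (sub_sigma_measurable Gm); exact: (mX measurableT B mB). Qed.

(** Two finite measures are compared, [P] restricted to [B] and [P] scaled by the mass of [B]; they
    agree on the pi-system [G], hence on the sigma-algebra that it generates. *)
Lemma sigma_independent_l G (B : set Omega) : G `<=` measurable -> setI_closed G -> G setT ->
  measurable B -> (forall A, G A -> P (A `&` B) = (P A * P B)%E) ->
  forall A, <<s G >> A -> P (A `&` B) = (P A * P B)%E.
Proof.
move=> Gm GI GT mB GB A sA.
have PB : P B \is a fin_num by exact: fin_num_measure.
pose k : {nonneg R} := NngNum (fine_ge0 (measure_ge0 P B)).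
have kE : k%:num%:E = P B by rewrite /= fineK.
suff : mrestr P mB A = mscale k P A by rewrite /mrestr /mscale kE muleC.
apply: (@g_sigma_algebra_measure_unique _ R Omega G Gm (fun=> setT) (fun=> GT)) => //.
- by rewrite bigcup_const.
- move=> C GC; change (P (C `&` B) = (k%:num%:E * P C)%E).
  by rewrite kE GB// muleC.
- move=> _; change (P (setT `&` B) < +oo)%E.
  by rewrite setTI ltey_eq PB.
Qed.

Lemma sigma_independent G1 G2 :
  G1 `<=` measurable -> setI_closed G1 -> G1 setT ->
  G2 `<=` measurable -> setI_closed G2 -> G2 setT ->
  (forall A B, G1 A -> G2 B -> P (A `&` B) = (P A * P B)%E) ->
  forall A B, <<s G1 >> A -> <<s G2 >> B -> P (A `&` B) = (P A * P B)%E.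
Proof.
move=> m1 I1 T1 m2 I2 T2 G12 A B sA sB.
apply: (@sigma_independent_l G1) => //; first exact: (sub_sigma_measurable m2).
move=> A' GA; rewrite setIC muleC; apply: (@sigma_independent_l G2) => //; first exact: m1.
by move=> B' GB; rewrite setIC muleC G12.
Qed.

(** The joint law of [X] and [Y] is the product of their laws, since the two agree on rectangles. *)
Lemma independent_integral {d1 d2} {T1 : measurableType d1} {T2 : measurableType d2}
    (X : Omega -> T1) (Y : Omega -> T2) (F : T1 * T2 -> \bar R) :
  measurable_fun setT X -> measurable_fun setT Y ->
  (forall A B, measurable A -> measurable B ->
     P (X @^-1` A `&` Y @^-1` B) = (P (X @^-1` A) * P (Y @^-1` B))%E) ->
  measurable_fun setT F -> (forall z, 0 <= F z)%E ->
  (\int[P]_w F (X w, Y w) = \int[P]_w \int[P]_w' F (X w, Y w'))%E.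
Proof.
move=> mX mY indep mF F0.
pose pX : probability T1 R := distribution P (mfun_of mX).
pose pY : probability T2 R := distribution P (mfun_of mY).
have mXY : measurable_fun setT (fun w => (X w, Y w)) by exact: measurable_fun_pair.
transitivity (\int[distribution P (mfun_of mXY)]_z F z)%E.
  by rewrite ge0_integral_distribution.
transitivity (\int[(pX \x pY)%E]_z F z)%E.
  apply: eq_measure_integral => C mC _; apply/esym.
  by apply: product_measure_unique mC => A B mA mB; exact: indep.
rewrite fubini_tonelli1// /fubini_F ge0_integral_distribution//.
- apply: eq_integral => w _ /=; rewrite ge0_integral_distribution//.
  exact: (measurableT_comp mF (measurable_pair1 _)).
- exact: measurable_fun_fubini_tonelli_F.
- by move=> x; exact: integral_ge0.
Qed.

End independence.

Section exponential_law.
Context {R : realType}.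
Local Notation mu := (leb R).

Definition expo (s : R) (s0 : 0 < s) : probability (measurableTypeR R) R.
Proof. refine (exponential_prob s); exact: s0. Defined.

Lemma expoE (s : R) (s0 : 0 < s) A :
  expo s0 A = (\int[mu]_(x in A) (exponential_pdf s x)%:E)%E.
Proof. by []. Qed.

Lemma exponential_pdf_posexp s : {ae mu, forall t, exponential_pdf s t = s * posexp s t}.
Proof.
apply: aeS (ae_neq 0) => t /eqP t0; rewrite /posexp.
have [t1|t1] := ltP 0 t; first by rewrite exponential_pdfE// ltW.
by rewrite mulr0 lt0_exponential_pdf// lt_neqAle t0.
Qed.

(** [expo] is given on sets by a density. Its Radon-Nikodym derivative is identified with that
    density almost everywhere, and a change of variables passes to functions. *)
Lemma ge0_integral_expo s (s0 : 0 < s) (f : R -> \bar R) :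
  measurable_fun setT f -> (forall x, 0 <= f x)%E ->
  (\int[expo s0]_x f x = \int[mu]_x (f x * (s * posexp s x)%:E))%E.
Proof.
move=> mf f0.
have dom : expo s0 `<< mu.
  apply/null_content_dominatesP => A mA muA0; rewrite expoE.
  by apply: null_set_integral => //; apply/measurable_funTS/measurable_EFinP; exact: measurable_exponential_pdf.
rewrite -(Radon_Nikodym_SigmaFinite.change_of_variables dom f0 measurableT mf).
apply: ae_eq_integral => //.
- apply: emeasurable_funM => //.
  exact: measurable_int (Radon_Nikodym_SigmaFinite.f_integrable dom).
- apply: emeasurable_funM => //; apply/measurable_EFinP/measurable_funM => //.
  exact: measurable_posexp.
- apply: ae_eqe_mul2l.
  have h : ae_eq mu setT (Radon_Nikodym_SigmaFinite.f (expo s0) mu) (EFin \o exponential_pdf s).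
    apply: integral_ae_eq => //; first exact: Radon_Nikodym_SigmaFinite.f_integrable.
      by apply/measurable_EFinP; exact: measurable_exponential_pdf.
    by move=> E _ mE; rewrite -Radon_Nikodym_SigmaFinite.f_integral// expoE.
  apply: filterS2 h (exponential_pdf_posexp s) => x /(_ I) -> <- _ //.
Qed.

Lemma integral_posexp_gt s r : 0 < s -> 0 <= r ->
  (\int[mu]_t (\1_(`]r, +oo[%classic : set R) t * (s * posexp s t))%:E = (expR (- s * r))%:E)%E.
Proof.
move=> s0 r0.
have mp := measurable_posexp s; have ps := posexp_ge0 s.
transitivity (\int[mu]_t (expR (- s * r) * s * posexp s (t - r))%:E)%E.
  apply: eq_integral => t _; congr EFin; rewrite indicE mem_setE in_itv/= andbT /posexp subr_gt0.
  case: ltP => rt; last by rewrite mul0r mulr0.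
  rewrite (le_lt_trans r0 rt) mul1r mulrAC -expRD mulrC; congr (expR _ * s); ring.
rewrite (ge0_integral_shift (- r) (f := fun t => (expR (- s * r) * s * posexp s t)%:E))//.
- rewrite ge0_integralZl_R//; last by rewrite mulr_ge0 ?expR_ge0// ltW.
  by rewrite integral_posexp// -EFinM -mulrA divff ?mulr1// gt_eqF.
- by apply/measurable_EFinP/measurable_funM.
- by move=> x; rewrite lee_fin mulr_ge0// mulr_ge0 ?expR_ge0// ltW.
Qed.

Lemma expo_gt s (s0 : 0 < s) r : 0 <= r -> expo s0 `]r, +oo[%classic = (expR (- s * r))%:E.
Proof.
move=> r0; have mr : measurable (`]r, +oo[%classic : set R) by exact: measurable_itv.
rewrite -(integral_posexp_gt s0 r0).
transitivity (\int[expo s0]_t (\1_(`]r, +oo[%classic : set R) t)%:E)%E.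
  by rewrite integral_indic// setIT.
rewrite ge0_integral_expo//.
  by apply/measurable_EFinP; exact: measurable_indic.
Qed.

Lemma expo_ge s (s0 : 0 < s) r : 0 <= r -> expo s0 `[r, +oo[%classic = (expR (- s * r))%:E.
Proof.
move=> r0; rewrite -(expo_gt s0 r0) !expoE.
rewrite integral_itv_obnd_cbnd//; apply/measurable_funTS/measurable_EFinP.
exact: measurable_exponential_pdf.
Qed.

Lemma rays_unique (m1 m2 : {measure set (measurableTypeR R) -> \bar R}) :
  (m1 setT < +oo)%E -> (forall r, m1 `]r, +oo[%classic = m2 `]r, +oo[%classic) ->
  forall A, measurable A -> m1 A = m2 A.
Proof.
move=> m1T m12 A mA.
apply: (@measure_unique _ R (measurableTypeR R) (@RGenOInfty.G R)
  (fun n => `](- n%:R), +oo[%classic)) => //.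
- exact: RGenOInfty.measurableE.
- move=> _ _ [a ->] [b ->]; exists (Num.max a b).
  by apply/seteqP; split => x /=; rewrite !in_itv/= !andbT gt_max => /andP.
- by move=> n; exists (- n%:R).
- apply/seteqP; split => // x _; exists (Num.truncn `|x|).+1 => //=.
  rewrite in_itv/= andbT ltrNl (le_lt_trans (ler_norm _))// normrN.
  exact: truncnS_gt.
- by move=> _ [r ->]; exact: m12.
- move=> n; apply: le_lt_trans m1T; apply: le_measure => //; rewrite inE//.
Qed.

(** Finite measures on the line are determined by rays, and rays from a negative point carry full
    mass because [X > 0] almost everywhere. *)
Lemma exponential_law {d} {T : measurableType d} (m : {measure set T -> \bar R})
    (X : T -> R) s (f : R -> \bar R) : 0 < s -> measurable_fun setT X -> m setT = 1%E ->
  (forall r, 0 <= r -> m [set w | r < X w] = (expR (- s * r))%:E) ->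
  measurable_fun setT f -> (forall x, 0 <= f x)%E ->
  (\int[m]_w f (X w) = \int[mu]_t (f t * (s * posexp s t)%:E))%E.
Proof.
move=> s0 mX mT mr mf f0; rewrite -(ge0_integral_expo s0)//.
have E := @ge0_integral_pushforward _ _ T (measurableTypeR R) R X mX m setT f measurableT mf
  (fun y _ => f0 y).
transitivity (\int[m]_(w in X @^-1` setT) (f \o X) w)%E; first by rewrite preimage_setT.
rewrite -E.
have rayE (r : R) : X @^-1` `]r, +oo[ = [set w | r < X w].
  by apply/seteqP; split => w /=; rewrite in_itv/= andbT.
apply: eq_measure_integral => A mA _; apply: rays_unique mA.
  by change (m setT < +oo)%E; rewrite mT ltry.
have mS (r : R) : measurable [set w | r < X w].
  by rewrite -rayE -[X in measurable X]setTI; apply: (mX measurableT); exact: measurable_itv.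
move=> r; change (m (X @^-1` `]r, +oo[) = expo s0 `]r, +oo[%classic); rewrite rayE.
have [r0|r0] := leP 0 r; first by rewrite mr// expo_gt.
have E1 : m [set w | r < X w] = 1%E.
  apply/eqP; rewrite eq_le -{1}mT le_measure ?inE//=.
  have <- : m [set w | 0 < X w] = 1%E by rewrite mr// mulr0 expR0.
  by rewrite le_measure ?inE// => w /=; exact: lt_trans.
rewrite E1; apply/esym/eqP; rewrite eq_le probability_le1//=.
have <- : expo s0 `]0, +oo[%classic = 1%E by rewrite expo_gt// mulr0 expR0.
rewrite le_measure ?inE//.
by apply: subset_itvr; rewrite bnd_simp ltW.
Qed.

(** The series of the [expR (- X n)] has the finite mean [1 / (1 - c)], so it converges almost
    surely. If all [X n] were at most [K], its partial sums would be at least [N * expR (- K)]. *)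
Lemma ae_unbounded {d} {T : measurableType d} (P : probability T R) (X : nat -> T -> R) c :
  0 <= c < 1 -> (forall n, measurable_fun setT (X n)) ->
  (forall n, (\int[P]_w (expR (- X n w))%:E = (c ^+ n)%:E)%E) ->
  {ae P, forall w, forall K, exists n, K < X n w}.
Proof.
move=> /andP[c0 c1] mX EX.
have mE n : measurable_fun setT (fun w => (expR (- X n w))%:E).
  by apply/measurable_EFinP; apply: measurableT_comp => //; exact: measurableT_comp.
pose S w := (\sum_(0 <= n <oo) (expR (- X n w))%:E)%E.
have S0 w : (0 <= S w)%E by apply: nneseries_ge0 => n _ _; rewrite lee_fin expR_ge0.
have mS : measurable_fun setT S.
  by apply: ge0_emeasurable_sum => // n w _ _; rewrite lee_fin expR_ge0.
have iS : P.-integrable setT S.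
  apply/integrableP; split => //; under eq_integral do rewrite gee0_abs//.
  rewrite integral_nneseries//.
  under eq_eseriesr do rewrite EX.
  apply: (@le_lt_trans _ _ ((1 - c)^-1)%:E); last exact: ltry.
  apply: lime_le.
    by apply: is_cvg_nneseries => n _ _; rewrite lee_fin exprn_ge0.
  apply: nearW => n; rewrite sumEFin lee_fin.
  have d0 : 0 < 1 - c by rewrite subr_gt0.
  rewrite -[leRHS]mul1r ler_pdivlMr// mulrC big_mkord.
  by rewrite -[1 - c]opprB mulNr -subrX1 opprB gerBl exprn_ge0.
have := integrable_ae measurableT iS; apply: aeS => w /(_ I) Sfin K.
apply: contrapT => /forallNP XK.
have {}XK n : X n w <= K by rewrite leNgt; exact/negP/XK.
have le N : N%:R * expR (- K) <= fine (S w).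
  rewrite -lee_fin fineK//; apply: le_trans (nneseries_lim_ge N _); last first.
    by move=> n _ _; rewrite lee_fin expR_ge0.
  rewrite sumEFin lee_fin mulr_natl -[N in leLHS]subn0 -sumr_const_nat ler_sum// => n _.
  by rewrite ler_expR lerN2.
have e0 := expR_gt0 (- K).
have := le (Num.truncn (fine (S w) / expR (- K))).+1.
by rewrite -ler_pdivlMr// leNgt truncnS_gt.
Qed.

End exponential_law.

(** * Inverse subordinators *)

Section subordinator_paths.
Context {R : realType}.
Implicit Types (h : R -> R) (r s t : R).

Definition subordinator_path h := [/\ h 0 = 0,
  forall r s, 0 <= r -> r <= s -> h r <= h s,
  forall t, 0 <= t -> h s @[s --> t^'+] --> h t &
  forall K, exists2 r, 0 <= r & K < h r].

Definition path_inverse h t : R := inf [set s | 0 <= s /\ t < h s].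

Lemma path_inverse_le h t r : 0 <= r -> t < h r -> path_inverse h t <= r.
Proof. by move=> r0 tr; apply: ge_inf => //; exists 0 => s []. Qed.

Lemma path_inverse_ge h t r : subordinator_path h -> h r <= t -> r <= path_inverse h t.
Proof.
move=> [_ mono _ unb] rt; have [r1 r10 tr1] := unb t.
apply: lb_le_inf; first by exists r1.
move=> s [s0 ts]; rewrite leNgt; apply/negP => sr.
by have := lt_le_trans ts (mono _ _ s0 (ltW sr)); rewrite ltNge rt.
Qed.

Lemma path_inverse_ge0 h t : subordinator_path h -> 0 <= path_inverse h t.
Proof.
move=> [_ _ _ unb]; have [r1 r10 tr1] := unb t.
by apply: lb_le_inf; [exists r1|move=> s []].
Qed.

Lemma path_inverse_mono h s t : subordinator_path h -> s <= t ->
  path_inverse h s <= path_inverse h t.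
Proof.
move=> hp st; have [_ _ _ unb] := hp; have [r1 r10 tr1] := unb t.
apply: lb_le_inf; first by exists r1.
by move=> r [r0 tr]; apply: path_inverse_le => //; exact: le_lt_trans tr.
Qed.

Lemma path_inverse_right_continuous h t : subordinator_path h ->
  path_inverse h s @[s --> t^'+] --> path_inverse h t.
Proof.
move=> hp; apply/cvgrPdist_lt => e e0.
have [r [r0 tr] rL] : exists2 r, 0 <= r /\ t < h r & r < path_inverse h t + e.
  have [_ _ _ unb] := hp; have [r1 r10 tr1] := unb t.
  have hi : has_inf [set s | 0 <= s /\ t < h s] by split; [exists r1|exists 0 => s []].
  by have [r ? ?] := inf_adherent e0 hi; exists r.
near=> s; have ts : t < s by near: s; exact: nbhs_right_gt.
rewrite distrC ger0_norm; last by rewrite subr_ge0 path_inverse_mono// ltW.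
rewrite ltrBlDl; apply: le_lt_trans rL; apply: path_inverse_le r0 _.
by near: s; exact: nbhs_right_lt.
Unshelve. all: by end_near. Qed.

(** Right continuity provides a point beyond [r] where [h] is still below [t]; this makes the
    inequality strict. *)
Lemma lt_path_inverse h t r : subordinator_path h -> 0 <= r -> h r < t ->
  r < path_inverse h t.
Proof.
move=> hp r0 rt; have [_ _ rc _] := hp.
have [s rs st] : exists2 s, r < s & h s < t.
  have /cvgr_lt/(_ _ rt) near_lt := rc r r0.
  near r^'+ => s; exists s; first by near: s; exact: nbhs_right_gt.
  by near: s.
exact: lt_le_trans rs (path_inverse_ge hp (ltW st)).
Unshelve. all: by end_near. Qed.

(** Codes of no rational give [0], and absolute values keep the enumeration in [[0, +oo[]. *)
Definition nonneg_rat (k : nat) : R := `|ratr (odflt 0 (unpickle k : option rat))|.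

Lemma nonneg_rat_dense a b : 0 <= a -> a < b -> exists k, a < nonneg_rat k < b.
Proof.
move=> a0 ab; have [q] := rat_in_itvoo ab; rewrite in_itv/= => /andP[aq qb].
exists (pickle q); rewrite /nonneg_rat pickleK/= ger0_norm ?aq//.
exact/ltW/(le_lt_trans a0 aq).
Qed.

(** [path_inverse] with its infimum taken over countably many points, hence measurable jointly in
    [t] and the sample. The value [+oo] discards the points where [h] has not passed [t]. *)
Definition rational_inverse h t : R :=
  fine (einfs (fun k => if t < h (nonneg_rat k) then (nonneg_rat k)%:E else +oo%E) 0%N).

Lemma rational_inverseE h t : subordinator_path h -> rational_inverse h t = path_inverse h t.
Proof.
move=> hp; have [_ mono _ unb] := hp.
set u := fun k => if t < h (nonneg_rat k) then (nonneg_rat k)%:E else +oo%E.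
suff uE : einfs u 0%N = (path_inverse h t)%:E by rewrite /rational_inverse -/u uE.
have n0 k : 0 <= nonneg_rat k by exact: normr_ge0.
apply/eqP; rewrite eq_le; apply/andP; split.
  apply/lee_addgt0Pr => e e0; rewrite -EFinD.
  have hi : has_inf [set s | 0 <= s /\ t < h s].
    by have [r1 r10 tr1] := unb t; split; [exists r1|exists 0 => s []].
  have [r [r0 tr] rL] := inf_adherent e0 hi.
  have [k /andP[rk kL]] := nonneg_rat_dense r0 rL.
  apply: (@le_trans _ _ (nonneg_rat k)%:E); last by rewrite lee_fin ltW.
  apply: ereal_inf_lbound; exists k => //=.
  by rewrite /u ifT// (lt_le_trans tr)// mono// ltW.
apply: le_ereal_inf_tmp => _ [k _ <-]; rewrite /u; case: ifPn => [tk|_]; last by rewrite leey.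
by rewrite lee_fin; exact: path_inverse_le.
Qed.

End subordinator_paths.

Lemma measurable_rational_inverse {d} {T : measurableType d} {R : realType} (H : R -> T -> R) :
  (forall s, 0 <= s -> measurable_fun setT (H s)) ->
  measurable_fun setT (fun z : R * T => rational_inverse (H ^~ z.2) z.1).
Proof.
move=> mH; rewrite /rational_inverse; apply: (measurableT_comp (f := fine)) => //.
have := @measurable_fun_einfs _ (R * T)%type R setT
  (fun k z => if z.1 < H (nonneg_rat k) z.2 then (nonneg_rat k)%:E else +oo%E) _ 0%N.
apply => k; apply: measurable_fun_ifT => //.
by apply: measurable_fun_ltr => //; apply: measurableT_comp => //; apply: mH; exact: normr_ge0.
Qed.

Section stable.
Context {d} {Omega : measurableType d} {R : realType} (P : probability Omega R).
Context (alpha : R) (H : R -> {RV P >-> R}).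
Context (H_stable : stable_subordinator alpha H).
Local Notation mu := (leb R).

Lemma stable_exp s r : 0 < s -> 0 <= r ->
  (\int[P]_w (expR (- s * H r w))%:E = (expR (- (s `^ alpha) * r))%:E)%E.
Proof.
move=> s0 r0; have [_ _ _ hL] := H_stable.
have := hL r s r0 s0; rewrite unlock => ->.
by rewrite !mulNr mulrC.
Qed.

(** Paths are unbounded by [ae_unbounded], since the mean of [expR (- H n)] is [expR (- n)]. *)
Lemma ae_subordinator_path : {ae P, forall w, subordinator_path (H ^~ w)}.
Proof.
have [hae _ _ _] := H_stable.
have unb := @ae_unbounded R _ _ P (fun n => H n%:R) (expR (- 1)) _ _ _.
have {unb} : {ae P, forall w, forall K, exists n : nat, K < H n%:R w}.
  apply: unb => [|n|n].
  - by rewrite expR_ge0/= -[ltRHS]expR0 ltr_expR ltrN10.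
  - exact: measurable_funPT.
  have := @stable_exp 1 n%:R ltr01 (ler0n _ _); rewrite powR1.
  under eq_integral do rewrite mulN1r.
  by move=> ->; rewrite -expRM_natl mulrC.
move=> /(aeI hae); apply: aeS => w [[h0 h1 h2] h3]; split => // K.
by have [n Kn] := h3 K; exists n%:R.
Qed.

(* An inverse stable subordinator evaluated at an independent exponential time of
   rate [s] is exponential of rate [s `^ alpha]. *)
Lemma laplace_inverse_subordinator s (G : R -> \bar R) : 0 < s ->
  measurable_fun setT G -> (forall r, 0 <= G r)%E ->
  (\int[P]_w \int[mu]_t (G (rational_inverse (H ^~ w) t) * (s * posexp s t)%:E) =
   \int[mu]_r (G r * (s `^ alpha * posexp (s `^ alpha) r)%:E))%E.
Proof.
move=> s0 mG G0.
have mI : measurable_fun setT (fun z : Omega * R => rational_inverse (H ^~ z.1) z.2).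
  have mH r : 0 <= r -> measurable_fun setT (H r) by move=> _; exact: measurable_funPT.
  apply: (measurableT_comp (measurable_rational_inverse mH) (_ : measurable_fun setT (fun z : Omega * R => (z.2, z.1)))).
  exact: measurable_fun_pair.
have mIw w : measurable_fun setT (rational_inverse (H ^~ w)).
  exact: (measurableT_comp mI (measurable_pair1 w)).
rewrite -(@exponential_law R _ _ (P \x expo s0)%E
  (fun z : Omega * R => rational_inverse (H ^~ z.1) z.2) (s `^ alpha) G)//.
- have -> := @fubini_tonelli1 _ _ _ _ _ P (expo s0)
    (fun z : Omega * R => G (rational_inverse (H ^~ z.1) z.2)) (measurableT_comp mG mI) (fun z => G0 _).
  apply: eq_integral => w _; rewrite /fubini_F ge0_integral_expo//.
  exact: (measurableT_comp mG (mIw w)).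
- by rewrite powR_gt0.
- exact: probability_setT.
(* The tail at [r] is the mean of [expR (- s H_r)]: on a fixed path, [r < L_t] amounts to [H_r < t]
   up to the single time [t = H_r], and an exponential time of rate [s] exceeds [H_r] with
   probability [expR (- s H_r)]. *)
move=> r r0; rewrite -stable_exp//.
pose A := [set z : Omega * R | r < rational_inverse (H ^~ z.1) z.2].
have mA : measurable A.
  rewrite -[A]setTI (_ : A = (fun z : Omega * R => rational_inverse (H ^~ z.1) z.2) @^-1` `]r, +oo[).
    by apply: mI => //; exact: measurable_itv.
  by apply/seteqP; split => z /=; rewrite in_itv/= andbT.
rewrite -/A /product_measure1/=.
apply: ae_eq_integral => //.
- exact: measurable_fun_xsection.
- apply/measurable_EFinP; apply: measurableT_comp => //; apply: measurable_funM => //.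
apply: aeS ae_subordinator_path => w hp _ /=.
have [h0 mono _ _] := hp; have hr : 0 <= H r w by rewrite -h0 mono.
have xE : xsection A w = [set t | r < path_inverse (H ^~ w) t].
  by apply/seteqP; split => t; rewrite /xsection/= inE /A/= rational_inverseE.
have mx : measurable (xsection A w) by exact: measurable_xsection.
rewrite xE in mx *; apply/eqP; rewrite eq_le; apply/andP; split.
  rewrite -(expo_ge s0 hr) le_measure ?inE//.
  move=> t /= rt; rewrite in_itv/= andbT leNgt; apply/negP => tr.
  by have := @path_inverse_le _ (H ^~ w) t r r0 tr; rewrite leNgt rt.
rewrite -(expo_gt s0 hr) le_measure ?inE//.
by move=> t /=; rewrite in_itv/= andbT; exact: lt_path_inverse.
Qed.

End stable.

(** * Renewal paths *)

Section renewal_paths.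
Context {R : realType}.
Implicit Types (a b : nat -> R) (r t : R).

(** Beware of the shift: [b j] stands for [e_(j+1)], because [e_0 = 0] is dropped, and
    [jump_time b n] is then [T_n]. *)
Definition jump_time b (n : nat) : R := \sum_(0 <= j < n) b j.

Definition jump_position a b (n : nat) : R := \sum_(0 <= j < n) a j * b j.

Definition renewal_path b := (forall j, 0 < b j) /\ forall K, exists n, K < jump_time b n.

Lemma jump_timeS b n : jump_time b n.+1 = jump_time b n + b n.
Proof. by rewrite /jump_time big_nat_recr. Qed.

Lemma jump_time_mono b m n : renewal_path b -> (m <= n)%N -> jump_time b m <= jump_time b n.
Proof.
move=> [b0 _] mn; apply: (@homo_leq _ (jump_time b) (fun x y => x <= y)) mn => //.
  by move=> y x z; exact: le_trans.
by move=> k; rewrite jump_timeS lerDl ltW.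
Qed.

Lemma jump_time_ge0 b n : renewal_path b -> 0 <= jump_time b n.
Proof. by move=> [b0 _]; rewrite /jump_time big_mkord; apply: sumr_ge0 => j _; rewrite ltW. Qed.

Lemma jump_time_exists b r : renewal_path b -> 0 <= r ->
  exists n, jump_time b n <= r < jump_time b n.+1.
Proof.
move=> [b0 unb] r0; have ex := unb r.
pose n := ex_minn ex; exists n.-1.
rewrite /n; case: ex_minnP => m rm min.
have m0 : (0 < m)%N by rewrite lt0n; apply/eqP => m0; move: rm; rewrite m0 /jump_time big_geq// ltNge r0.
rewrite prednK// rm andbT leNgt; apply/negP => /min.
by rewrite leqNgt prednK ?leqnn//.
Qed.

Lemma jump_time_unique b r m n : renewal_path b -> jump_time b m <= r < jump_time b m.+1 ->
  jump_time b n <= r < jump_time b n.+1 -> m = n.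
Proof.
move=> hb /andP[m1 m2] /andP[n1 n2]; apply/eqP; rewrite eqn_leq.
apply/andP; split; rewrite leqNgt; apply/negP => /(jump_time_mono hb) h.
  by have := le_lt_trans (le_trans h m1) n2; rewrite ltxx.
by have := le_lt_trans (le_trans h n1) m2; rewrite ltxx.
Qed.

(* contribution of the [n]-th interval between jumps *)
Definition on_interval (Phi : R -> R) r (z : (R * R) * (R * R)) : R :=
  ((z.1.1 <= r) && (r < z.1.1 + z.2.2))%:R * Phi (z.1.2 + z.2.1 * (r - z.1.1)).

Definition jump_data a b n : (R * R) * (R * R) :=
  ((jump_time b n, jump_position a b n), (a n, b n)).

Lemma on_intervalE Phi a b r m n : renewal_path b ->
  jump_time b m <= r < jump_time b m.+1 ->
  on_interval Phi r (jump_data a b n) =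
  (n == m)%:R * Phi (jump_position a b m + a m * (r - jump_time b m)).
Proof.
move=> hb hm; rewrite /on_interval /jump_data/= -jump_timeS.
have [->|nm] := eqVneq n m; first by rewrite hm.
have [hn|] := boolP (jump_time b n <= r < jump_time b n.+1); last by rewrite !mul0r.
by move: nm; rewrite (jump_time_unique hb hn hm) eqxx.
Qed.

(** On a renewal path exactly one interval contains [r], so the partial sums are eventually
    constant. The upper limit is taken because it is measurable in all arguments on every path. *)
Definition telegraph_path a b r : R :=
  fine (limn_esup (fun N => (\sum_(0 <= n < N) on_interval id r (jump_data a b n))%:E)).

Lemma telegraph_pathE a b r m : renewal_path b -> jump_time b m <= r < jump_time b m.+1 ->
  telegraph_path a b r = jump_position a b m + a m * (r - jump_time b m).
Proof.
move=> hb hm; set x := RHS; rewrite /telegraph_path.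
set u := (X in limn_esup X).
suff ux : u N @[N --> \oo] --> x%:E by rewrite (cvg_limn_einf_sup ux).2.
apply: cvg_near_cst; exists m.+1 => // N /= mN.
rewrite /u; congr EFin; under eq_bigr do rewrite (on_intervalE _ _ _ hb hm).
rewrite big_mkord (bigD1 (Ordinal mN))//= eqxx mul1r big1 ?addr0// => i im.
by rewrite (_ : (i == m :> nat) = false) ?mul0r//; apply/negbTE.
Qed.

Lemma nneseries_on_interval (Phi : R -> R) a b r : renewal_path b -> 0 <= r ->
  (forall x, 0 <= Phi x) ->
  (\sum_(0 <= n <oo) (on_interval Phi r (jump_data a b n))%:E = (Phi (telegraph_path a b r))%:E)%E.
Proof.
move=> hb r0 Phi0; have [m hm] := jump_time_exists hb r0.
rewrite (telegraph_pathE _ hb hm).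
apply: cvg_lim => //; apply: cvg_near_cst; exists m.+1 => // N /= mN.
rewrite sumEFin; congr EFin; under eq_bigr do rewrite (on_intervalE _ _ _ hb hm).
rewrite big_mkord (bigD1 (Ordinal mN))//= eqxx mul1r big1 ?addr0// => i im.
by rewrite (_ : (i == m :> nat) = false) ?mul0r//; apply/negbTE.
Qed.

Lemma telegraph_path_right_continuous a b r : renewal_path b -> 0 <= r ->
  telegraph_path a b s @[s --> r^'+] --> telegraph_path a b r.
Proof.
move=> hb r0; have [m hm] := jump_time_exists hb r0; have /andP[m1 m2] := hm.
rewrite (telegraph_pathE _ hb hm).
have lin : jump_position a b m + a m * (s - jump_time b m) @[s --> r^'+] -->
    jump_position a b m + a m * (r - jump_time b m).
  apply: cvg_at_right_filter; apply: cvgD; first exact: cvg_cst.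
  apply: cvgM; first exact: cvg_cst.
  by apply: cvgB; [exact: cvg_id|exact: cvg_cst].
apply: cvg_trans lin; apply: near_eq_cvg; near=> s.
rewrite (@telegraph_pathE a b s m)//; apply/andP; split.
  by apply: (le_trans m1); rewrite ltW//; near: s; exact: nbhs_right_gt.
by near: s; exact: nbhs_right_lt.
Unshelve. all: by end_near. Qed.

Lemma measurable_on_interval {d} {T : measurableType d} (Phi : R -> R) (r : T -> R)
    (z : T -> (R * R) * (R * R)) : measurable_fun setT Phi ->
  measurable_fun setT r -> measurable_fun setT z ->
  measurable_fun setT (fun w => on_interval Phi (r w) (z w)).
Proof.
move=> mPhi mr mz.
have m1 : measurable_fun setT (fun w => (z w).1) by exact: (measurableT_comp measurable_fst mz).
have m2 : measurable_fun setT (fun w => (z w).2) by exact: (measurableT_comp measurable_snd mz).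
have m11 : measurable_fun setT (fun w => (z w).1.1) by exact: (measurableT_comp measurable_fst m1).
have m12 : measurable_fun setT (fun w => (z w).1.2) by exact: (measurableT_comp measurable_snd m1).
have m21 : measurable_fun setT (fun w => (z w).2.1) by exact: (measurableT_comp measurable_fst m2).
have m22 : measurable_fun setT (fun w => (z w).2.2) by exact: (measurableT_comp measurable_snd m2).
apply: measurable_funM; last first.
  apply: (measurableT_comp mPhi); apply: measurable_funD => //.
  by apply: measurable_funM => //; exact: measurable_funB.
have mb : measurable_fun setT (fun b : bool => b%:R : R) by [].
apply: (measurableT_comp mb); apply: measurable_and.
  exact: measurable_fun_ler.
by apply: measurable_fun_ltr => //; exact: measurable_funD.
Qed.

End renewal_paths.

(** * Independence of the past and of the next renewal interval *)

Section cylinders.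
Context {d} {Omega : measurableType d} {R : realType}.
Implicit Types (X : nat -> Omega -> R) (B : nat -> set R).

Definition cylinder X n B : set Omega := [set w | forall j, (j < n)%N -> B j (X j w)].

Lemma cylinder_bigcap X n B :
  cylinder X n B = \bigcap_(j in [set` iota 0 n]) X j @^-1` B j.
Proof.
apply/seteqP; split => w h j /=; first by rewrite mem_iota add0n => /h.
by move=> jn; apply: h; rewrite /= mem_iota add0n.
Qed.

Lemma cylinderI X n B C :
  cylinder X n B `&` cylinder X n C = cylinder X n (fun j => B j `&` C j).
Proof.
apply/seteqP; split => w; first by move=> [h1 h2] j jn; split; [exact: h1|exact: h2].
by move=> h; split => j jn; have [] := h j jn.
Qed.

Lemma cylinderS X n B (C : set R) :
  cylinder X n B `&` X n @^-1` C = cylinder X n.+1 (fun j => if (j < n)%N then B j else C).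
Proof.
apply/seteqP; split => w.
  move=> [h1 h2] j; rewrite ltnS leq_eqVlt => /orP[/eqP ->|jn]; first by rewrite ltnn.
  by rewrite jn; exact: h1.
move=> h; split=> [j jn|]; last by have := h n (ltnSn n); rewrite ltnn.
by have := h j (ltnW jn); rewrite jn.
Qed.

Lemma cylinderT X n : cylinder X n (fun=> setT) = setT.
Proof. by apply/seteqP; split. Qed.

Lemma cylinder1 X n (i : nat) (C : set R) : (i < n)%N ->
  X i @^-1` C = cylinder X n (fun j => if j == i then C else setT).
Proof.
move=> iN; apply/seteqP; split => w /=; first by move=> Cw j _; case: eqP => // ->.
by move=> /(_ i iN); rewrite eqxx.
Qed.

Lemma measurable_cylinder X n B : (forall j, measurable_fun setT (X j)) ->
  (forall j, measurable (B j)) -> measurable (cylinder X n B).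
Proof.
move=> mX mB; rewrite cylinder_bigcap; apply: fin_bigcap_measurable => // j _.
by rewrite -[X in measurable X]setTI; exact: mX.
Qed.

End cylinders.

Lemma measurable_cylinder_past {d} {Omega : measurableType d} {R : realType}
    (G : set (set Omega)) (X : nat -> Omega -> R) n B :
  (forall j, measurable_fun setT (X j : g_sigma_algebraType G -> R)) ->
  (forall j, measurable (B j)) -> <<s G >> (cylinder X n B).
Proof. exact: (@measurable_cylinder _ (g_sigma_algebraType G)). Qed.

Lemma measurable_jump_data {d} {T : measurableType d} {R : realType} (a b : nat -> T -> R) n :
  (forall j, measurable_fun setT (a j)) -> (forall j, measurable_fun setT (b j)) ->
  measurable_fun setT (fun w => jump_data (a ^~ w) (b ^~ w) n).
Proof.
move=> ma mb; apply: measurable_fun_pair; last exact: measurable_fun_pair.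
apply: measurable_fun_pair; apply: measurable_sum => // j.
exact: measurable_funM.
Qed.

Section telegraph_variables.
Context {d} {Omega : measurableType d} {R : realType} (P : probability Omega R).
Context (alpha lam : R) (theta e : nat -> {RV P >-> R}) (H : R -> {RV P >-> R}).
Context (lam_gt0 : 0 < lam).
Context (data : telegraph_data alpha lam theta e H).
Local Notation mu := (leb R).

Let th j (w : Omega) := theta j.+1 w.
Let ep j (w : Omega) := e j.+1 w.

Let mth j : measurable_fun setT (th j). Proof. exact: measurable_funPT. Qed.
Let mep j : measurable_fun setT (ep j). Proof. exact: measurable_funPT. Qed.

(** The generating family inside [sigma_gen], named so that [g_sigma_algebraType] can turn it into a
    measurable type. *)
Definition sigma_generators {I : Type} (D : set I) (X : I -> Omega -> R) : set (set Omega) :=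
  [set A | exists i B, [/\ D i, measurable (B : set R) & A = X i @^-1` B]].

Lemma sigma_gen_measurable_fun {I : Type} (D : set I) (X : I -> Omega -> R) i : D i ->
  measurable_fun setT (X i : g_sigma_algebraType (sigma_generators D X) -> R).
Proof. by move=> Di _ B mB; rewrite setTI; apply: sub_sigma_algebra; exists i, B. Qed.

Lemma sigma_gen_setT {I : Type} (D : set I) (X : I -> Omega -> R) : sigma_gen D X setT.
Proof. exact: (@measurableT _ (g_sigma_algebraType (sigma_generators D X))). Qed.

Lemma cylinder_th n B : (forall j, measurable (B j)) ->
  P (cylinder th n B) = (\prod_(0 <= j < n) P (th j @^-1` B j))%E.
Proof.
move=> mB; have [[hth _] _ _ _] := data.
have := hth (iota 1 n) (fun j => B j.-1) (iota_uniq _ _) (fun j => mB j.-1).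
rewrite -(addn0 1%N) iotaDl big_map /index_iota subn0 => <-; congr (P _).
rewrite cylinder_bigcap; apply/seteqP; split => w h j /=.
  by move=> /mapP[i iN ->]; exact: (h i).
by move=> jn; apply: (h j.+1); apply: map_f.
Qed.

Lemma cylinder_ep n B : (forall j, measurable (B j)) ->
  P (cylinder ep n B) = (\prod_(0 <= j < n) P (ep j @^-1` B j))%E.
Proof.
move=> mB; have [_ [_ [hep _]] _ _] := data.
by rewrite cylinder_bigcap /index_iota subn0; apply: hep => //; exact: iota_uniq.
Qed.

Lemma cylinder_th_ep n B C : (forall j, measurable (B j)) -> (forall j, measurable (C j)) ->
  P (cylinder th n B `&` cylinder ep n C) =
  (\prod_(0 <= j < n) (P (th j @^-1` B j) * P (ep j @^-1` C j)))%E.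
Proof.
move=> mB mC; have [_ _ _ ind] := data.
rewrite big_split/= -cylinder_th// -cylinder_ep//.
have := ind (cylinder th n B) (cylinder ep n C) setT.
rewrite setIT probability_setT mule1; apply; last exact: sigma_gen_setT.
- by apply: measurable_cylinder_past => // j; exact: (@sigma_gen_measurable_fun _ setT (fun j w => theta j w)).
- by apply: measurable_cylinder_past => // j; exact: (@sigma_gen_measurable_fun _ setT (fun j w => e j w)).
Qed.

(** Rectangles in the first [n] signs and waiting times. They form a pi-system, as
    [sigma_independent] requires, and the product formula can be checked on them directly. *)
Definition past n : set (set Omega) := [set A | exists B C,
  [/\ forall j, measurable (B j), forall j, measurable (C j) &
      A = cylinder th n B `&` cylinder ep n C]].

Definition future n : set (set Omega) := [set A | exists B C,
  [/\ measurable (B : set R), measurable (C : set R) & A = th n @^-1` B `&` ep n @^-1` C]].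

Lemma past_measurable n : past n `<=` measurable.
Proof. by move=> _ [B [C [mB mC ->]]]; apply: measurableI; exact: measurable_cylinder. Qed.

Lemma future_measurable n : future n `<=` measurable.
Proof.
move=> _ [B [C [mB mC ->]]]; apply: measurableI.
  by rewrite -[X in measurable X]setTI; exact: mth.
by rewrite -[X in measurable X]setTI; exact: mep.
Qed.

(** A rectangle of the past intersected with a rectangle of the future is a cylinder of length
    [n + 1], whose probability is a product over the coordinates. *)
Lemma past_future_independent n A B : <<s past n >> A -> <<s future n >> B ->
  P (A `&` B) = (P A * P B)%E.
Proof.
apply: sigma_independent.
- exact: past_measurable.
- move=> _ _ [B1 [C1 [mB1 mC1 ->]]] [B2 [C2 [mB2 mC2 ->]]].
  exists (fun j => B1 j `&` B2 j), (fun j => C1 j `&` C2 j); split.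
  + by move=> j; exact: measurableI.
  + by move=> j; exact: measurableI.
  + by rewrite setIACA !cylinderI.
- by exists (fun=> setT), (fun=> setT); split; rewrite ?cylinderT ?setIT.
- exact: future_measurable.
- move=> _ _ [B1 [C1 [mB1 mC1 ->]]] [B2 [C2 [mB2 mC2 ->]]].
  exists (B1 `&` B2), (C1 `&` C2); split; [exact: measurableI|exact: measurableI|].
  by rewrite setIACA !preimage_setI.
- by exists setT, setT; split; rewrite ?preimage_setT ?setIT.
move=> _ _ [B1 [C1 [mB1 mC1 ->]]] [B2 [C2 [mB2 mC2 ->]]].
have m1 (D : nat -> set R) (D' : set R) j : (forall j, measurable (D j)) -> measurable D' ->
  measurable (if (j < n)%N then D j else D') by case: ifP.
rewrite setIACA !cylinderS cylinder_th_ep; last 2 first.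
- by move=> j; exact: m1.
- by move=> j; exact: m1.
rewrite big_nat_recr//= ltnn cylinder_th_ep//; congr (_ * _)%E.
  by apply: eq_big_nat => j /andP[_ jn]; rewrite jn.
(* The future event alone is the cylinder of length [n + 1] with full sets in the first [n]
   coordinates. *)
have := @cylinder_th_ep n.+1 (fun j => if (j < n)%N then setT else B2)
  (fun j => if (j < n)%N then setT else C2) (fun j => m1 (fun=> setT) B2 j (fun=> measurableT) mB2)
  (fun j => m1 (fun=> setT) C2 j (fun=> measurableT) mC2).
rewrite -!(cylinderS _ _ (fun=> setT)) !cylinderT !setTI => ->.
rewrite big_nat_recr//= ltnn big1_seq ?mul1e// => j /andP[_]; rewrite mem_index_iota => /andP[_ ->].
by rewrite !preimage_setT probability_setT mule1.
Qed.

Lemma measurable_past n j : (j < n)%N ->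
  measurable_fun setT (th j : g_sigma_algebraType (past n) -> R) /\
  measurable_fun setT (ep j : g_sigma_algebraType (past n) -> R).
Proof.
move=> jn; split => _ B mB; rewrite setTI; apply: sub_sigma_algebra.
  exists (fun i => if i == j then B else setT), (fun=> setT).
  by split => // [i|]; [case: ifP|rewrite cylinderT setIT -cylinder1].
exists (fun=> setT), (fun i => if i == j then B else setT).
by split => // [i|]; [case: ifP|rewrite cylinderT setTI -cylinder1].
Qed.

Lemma measurable_future n :
  measurable_fun setT ((fun w => (th n w, ep n w)) : g_sigma_algebraType (future n) -> R * R).
Proof.
apply: measurable_fun_pair => _ B mB; rewrite setTI; apply: sub_sigma_algebra.
  by exists B, setT; split => //; rewrite preimage_setT setIT.
by exists setT, B; split => //; rewrite preimage_setT setTI.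
Qed.

Lemma measurable_jumps_past n :
  measurable_fun setT ((fun w => (jump_time (ep ^~ w) n, jump_position (th ^~ w) (ep ^~ w) n))
    : g_sigma_algebraType (past n) -> R * R).
Proof.
apply: measurable_fun_pair; rewrite /jump_time /jump_position.
  under eq_fun do rewrite big_mkord.
  by apply: measurable_sum => j; have [] := @measurable_past n j (ltn_ord j).
under eq_fun do rewrite big_mkord.
apply: measurable_sum => j; have [? ?] := @measurable_past n j (ltn_ord j).
exact: measurable_funM.
Qed.

Lemma integral_theta n (g : R -> \bar R) : (forall x, 0 <= g x)%E ->
  (\int[P]_w g (th n w) = 2^-1%:E * (g 1%R + g (-1)%R))%E.
Proof.
move=> g0; have [[_ /(_ n.+1)[p1 pN1]] _ _ _] := data.
pose A := th n @^-1` [set 1]; pose B := th n @^-1` [set -1].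
have mA : measurable A by rewrite -[X in measurable X]setTI; apply: mth => //; exact: measurable_set1.
have mB : measurable B by rewrite -[X in measurable X]setTI; apply: mth => //; exact: measurable_set1.
have PA : P A = 2^-1%:E by [].
have PB : P B = 2^-1%:E by [].
have AB : A `&` B = set0.
  by apply/seteqP; split => // w; rewrite /A /B/= => -[-> ]; lra.
have mAB : measurable (A `|` B) by exact: measurableU.
have PAB : P (~` (A `|` B)) = 0%E.
  have PU : P (A `|` B) = 1%E.
    transitivity (P A + P B)%E; first exact: measureU.
    by rewrite PA PB -EFinD; congr EFin; field.
  by rewrite probability_setC// PU subee.
transitivity (\int[P]_w (g 1%R * (\1_A w)%:E + g (-1)%R * (\1_B w)%:E))%E.
  apply: ae_eq_integral_nonmeasurable.
  exists (~` (A `|` B)); split; [exact: measurableC|exact: PAB|].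
  move=> w /= h; apply: contra_not h => h _.
  rewrite !indicE; case: h => [Aw|Bw].
    have Bw : w \notin B by apply/negP; rewrite inE => Bw; have : (A `&` B) w by []; rewrite AB.
    by rewrite (mem_set Aw) (negbTE Bw) mule1 mule0 adde0 (_ : th n w = 1).
  have Aw : w \notin A by apply/negP; rewrite inE => Aw; have : (A `&` B) w by []; rewrite AB.
  by rewrite (mem_set Bw) (negbTE Aw) mule1 mule0 add0e (_ : th n w = -1).
have mi C : measurable C -> measurable_fun setT (fun w : Omega => (\1_C w : R)%:E).
  by move=> mC; apply/measurable_EFinP; exact: measurable_indic.
rewrite ge0_integralD//; last 4 first.
- by move=> w _; rewrite mule_ge0.
- by apply: emeasurable_funM => //; exact: mi.
- by move=> w _; rewrite mule_ge0.
- by apply: emeasurable_funM => //; exact: mi.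
rewrite !ge0_integralZl//; last 2 first.
- exact: mi.
- exact: mi.
have -> : (\int[P]_w (\1_A w)%:E = 2^-1%:E)%E by rewrite integral_indic// setIT.
have -> : (\int[P]_w (\1_B w)%:E = 2^-1%:E)%E by rewrite integral_indic// setIT.
by rewrite -ge0_muleDl// muleC.
Qed.

Lemma integral_ep n (g : R -> \bar R) : measurable_fun setT g -> (forall x, 0 <= g x)%E ->
  (\int[P]_w g (ep n w) = \int[mu]_r (g r * (lam * posexp lam r)%:E))%E.
Proof.
move=> mg g0; have [_ [_ [_ he]] _ _] := data.
exact: (exponential_law lam_gt0 (mep n) (probability_setT _) (he n) mg g0).
Qed.

(** Independence of past and future freezes the [n]-th jump; the sign and the length of the interval
    that follows are then averaged out, the sign giving the half sum and the length the exponential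
    density. *)
Lemma renewal_step n (F : (R * R) * (R * R) -> R) : measurable_fun setT F -> (forall z, 0 <= F z) ->
  (\int[P]_w (F (jump_data (th ^~ w) (ep ^~ w) n))%:E =
   \int[P]_w \int[mu]_r
     (2^-1 * (F (jump_time (ep ^~ w) n, jump_position (th ^~ w) (ep ^~ w) n, (1%R, r)) +
        F (jump_time (ep ^~ w) n, jump_position (th ^~ w) (ep ^~ w) n, (-1, r)))
      * (lam * posexp lam r))%:E)%E.
Proof.
move=> mF F0.
pose Y w := (jump_time (ep ^~ w) n, jump_position (th ^~ w) (ep ^~ w) n).
have mEF : measurable_fun setT (EFin \o F) by exact/measurable_EFinP.
rewrite (@independent_integral _ _ _ P _ _ _ _ Y (fun w => (th n w, ep n w)) (EFin \o F))//.
- apply: eq_integral => w _; rewrite -/(Y w); move: (Y w) => y.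
  pose G c r := F (y, (c, r)).
  have mGr c : measurable_fun setT (G c).
    by apply: (measurableT_comp mF); apply: measurable_fun_pair.
  have mG2 : measurable_fun setT (fun z : R * R => (F (y, z))%:E).
    by apply: (measurableT_comp mEF); exact: measurable_fun_pair.
  have ind_th_ep A B : measurable A -> measurable B ->
      P (th n @^-1` A `&` ep n @^-1` B) = (P (th n @^-1` A) * P (ep n @^-1` B))%E.
    move=> mA mB; have [_ _ _ ind] := data.
    have := ind (th n @^-1` A) (ep n @^-1` B) setT; rewrite setIT probability_setT mule1; apply.
    + by apply: sub_sigma_algebra; exists n.+1, A.
    + by apply: sub_sigma_algebra; exists n.+1, B.
    + exact: sigma_gen_setT.
  have yF0 z : (0 <= (F (y, z))%:E)%E by rewrite lee_fin F0.
  transitivity (\int[P]_w1 \int[P]_w2 (G (th n w1) (ep n w2))%:E)%E.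
    exact: (independent_integral (mth n) (mep n) ind_th_ep mG2 yF0).
  rewrite (integral_theta n (g := fun c => (\int[P]_w2 (G c (ep n w2))%:E)%E)); last first.
    by move=> c; apply: integral_ge0 => w2 _; rewrite lee_fin F0.
  have mGE c : measurable_fun setT (fun r => (G c r)%:E) by exact/measurable_EFinP.
  rewrite !(@integral_ep n (fun r => (G _ r)%:E))//; try by move=> r; rewrite lee_fin F0.
  have mP : measurable_fun setT (fun r => lam * posexp lam r).
    by apply: measurable_funM => //; exact: measurable_posexp.
  have P0 r : 0 <= lam * posexp lam r by rewrite mulr_ge0 ?posexp_ge0// ltW.
  have mGP c : measurable_fun setT (fun r => (G c r)%:E * (lam * posexp lam r)%:E)%E.
    by apply: emeasurable_funM => //; exact/measurable_EFinP.
  have GP0 c r : (0 <= (G c r)%:E * (lam * posexp lam r)%:E)%E.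
    by rewrite mule_ge0// lee_fin ?F0.
  have D1 := ge0_integralD mu measurableT (fun r _ => GP0 1 r) (mGP 1)
    (fun r _ => GP0 (-1) r) (mGP (-1)).
  have D2 := ge0_integralZl mu measurableT (emeasurable_funD (mGP 1) (mGP (-1)))
    (fun r _ => adde_ge0 (GP0 1 r) (GP0 (-1) r)) (_ : (0 <= 2^-1%:E)%E).
  rewrite -D1 -D2 ?lee_fin//.
  apply: eq_integral => r _; rewrite -(EFinM (G 1 r)) -(EFinM (G (-1) r)) -EFinD -EFinM.
  by congr EFin; rewrite /G; ring.
- exact: gsigma_measurable_fun (@past_measurable n) (@measurable_jumps_past n).
- exact: measurable_fun_pair.
- move=> A B mA mB; apply: (@past_future_independent n).
    by rewrite -[X in <<s _ >> X]setTI; exact: (@measurable_jumps_past n measurableT).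
  by rewrite -[X in <<s _ >> X]setTI; exact: (@measurable_future n measurableT).
Qed.

End telegraph_variables.

(** * Laplace transform of the telegraph process *)

Section bounded_resolvent.
Context {R : realType} (p : R) (p_gt0 : 0 < p).
Local Notation mu := (leb R).

Definition bounded_by (C : R) (Phi : R -> R) :=
  measurable_fun setT Phi /\ forall x, 0 <= Phi x <= C.

Lemma bounded_by_ge0 C Phi x : bounded_by C Phi -> 0 <= Phi x.
Proof. by move=> [_ /(_ x)/andP[]]. Qed.

Lemma kbounded_bounded_by C Phi : bounded_by C Phi -> kbounded p Phi.
Proof.
move=> [mPhi Phib]; apply: (kbounded_bounded p_gt0 mPhi (B := C)) => x.
by have /andP[h0 hC] := Phib x; rewrite ger0_norm.
Qed.

Lemma EFin_resolvent C Phi x : bounded_by C Phi ->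
  (resolvent p Phi x)%:E = (\int[mu]_y (ek p (x - y) * Phi y)%:E)%E.
Proof.
move=> hPhi; rewrite /resolvent /Rintegral fineK//.
by apply: integrable_fin_num => //; exact/resolvent_integrable/(kbounded_bounded_by hPhi).
Qed.

Lemma EFin_resolvent_posexp C Phi x : bounded_by C Phi ->
  (resolvent p Phi x)%:E =
  (\int[mu]_r (posexp p r * (2^-1 * (Phi (x + r) + Phi (x - r))))%:E)%E.
Proof.
move=> hPhi; rewrite (EFin_resolvent _ hPhi) ge0_integral_ek//; first by case: hPhi.
by move=> y; exact: bounded_by_ge0 hPhi.
Qed.

Lemma bounded_by_resolvent C Phi : bounded_by C Phi -> bounded_by (C / p) (resolvent p Phi).
Proof.
move=> hPhi; have [mPhi Phib] := hPhi.
have C0 : 0 <= C by have /andP[h1 h2] := Phib 0; exact: le_trans h2.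
split; first exact: measurable_resolvent.
move=> x; rewrite -!lee_fin (EFin_resolvent _ hPhi); apply/andP; split.
  apply: integral_ge0 => y _; rewrite lee_fin mulr_ge0 ?ek_ge0//.
  exact: bounded_by_ge0 hPhi.
rewrite EFinM -(integral_ek p_gt0 x) -ge0_integralZl_R//; last 2 first.
- exact: measurable_ekB.
- by move=> y; exact: ek_ge0.
apply: ge0_le_integral_nonmeasurable => y.
  by rewrite lee_fin mulr_ge0 ?ek_ge0//; exact: bounded_by_ge0 hPhi.
by rewrite lee_fin mulrC ler_wpM2r ?ek_ge0//; have /andP[] := Phib y.
Qed.

Lemma resolvent_cst c x : resolvent p (fun=> c) x = c / p.
Proof.
rewrite /resolvent /Rintegral; have mE := measurable_ekB (R := R) p x.
have i1 : mu.-integrable setT (EFin \o (fun y => ek p (x - y))).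
  apply: ge0_integrable => //; first by move=> y; exact: ek_ge0.
  by rewrite integral_ek// ltry.
have : \int[mu]_y (c * ek p (x - y)) = c / p.
  by rewrite RintegralZl// /Rintegral integral_ek.
by rewrite /Rintegral => <-; congr fine; apply: eq_integral => y _; rewrite mulrC.
Qed.

End bounded_resolvent.

Section telegraph_resolvent.
Context {d} {Omega : measurableType d} {R : realType} (P : probability Omega R).
Context (alpha lam : R) (theta e : nat -> {RV P >-> R}) (H : R -> {RV P >-> R}).
Context (lam_gt0 : 0 < lam).
Context (data : telegraph_data alpha lam theta e H).
Local Notation mu := (leb R).

Let th j (w : Omega) := theta j.+1 w.
Let ep j (w : Omega) := e j.+1 w.
Let Y n w := jump_data (th ^~ w) (ep ^~ w) n.
Let T n w := jump_time (ep ^~ w) n.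
Let S n w := jump_position (th ^~ w) (ep ^~ w) n.

Let mth j : measurable_fun setT (th j). Proof. exact: measurable_funPT. Qed.
Let mep j : measurable_fun setT (ep j). Proof. exact: measurable_funPT. Qed.
Let mY n : measurable_fun setT (Y n). Proof. exact: measurable_jump_data. Qed.
Let mT n : measurable_fun setT (T n).
Proof. exact: (measurableT_comp measurable_fst (measurableT_comp measurable_fst (@mY n))). Qed.
Let mS n : measurable_fun setT (S n).
Proof. exact: (measurableT_comp measurable_snd (measurableT_comp measurable_fst (@mY n))). Qed.

Let step n (F : (R * R) * (R * R) -> R) : measurable_fun setT F -> (forall z, 0 <= F z) ->
  (\int[P]_w (F (Y n w))%:E = \int[P]_w \int[mu]_r
     (2^-1 * (F (T n w, S n w, (1%R, r)) + F (T n w, S n w, (-1, r)))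
      * (lam * posexp lam r))%:E)%E.
Proof. exact: (renewal_step lam_gt0 data). Qed.

Let measurable_coordinates :
  [/\ measurable_fun setT (fun z : (R * R) * (R * R) => z.1.1),
      measurable_fun setT (fun z : (R * R) * (R * R) => z.1.2),
      measurable_fun setT (fun z : (R * R) * (R * R) => z.2.1) &
      measurable_fun setT (fun z : (R * R) * (R * R) => z.2.2)].
Proof.
by split; [exact: (measurableT_comp measurable_fst measurable_fst)|
  exact: (measurableT_comp measurable_snd measurable_fst)|
  exact: (measurableT_comp measurable_fst measurable_snd)|
  exact: (measurableT_comp measurable_snd measurable_snd)].
Qed.

Section rate.
Context (q : R) (q_gt0 : 0 < q).
Let p := q + lam.
Let p_gt0 : 0 < p. Proof. exact: addr_gt0. Qed.

Let posexpM r : posexp lam r * expR (- q * r) = posexp p r.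
Proof.
rewrite /posexp /p; case: ifP => // _; last by rewrite mul0r.
by rewrite -expRD; congr expR; ring.
Qed.

Definition jump_mean (Psi : R -> R) n x : \bar R :=
  (\int[P]_w (expR (- q * T n w) * Psi (x + S n w))%:E)%E.

(** Averaging the interval after the [n]-th jump, discounted at rate [q], puts the weight
    [lam * posexp (q + lam)] on lengths together with a fair sign; this is [lam] times the kernel of
    [resolvent p]. *)
Lemma jump_meanS C Psi n x : bounded_by C Psi ->
  jump_mean Psi n.+1 x = (lam%:E * jump_mean (resolvent p Psi) n x)%E.
Proof.
move=> hPsi; have [mPsi _] := hPsi; have Psi0 y := bounded_by_ge0 y hPsi.
have [m11 m12 m21 m22] := measurable_coordinates.
pose F (z : (R * R) * (R * R)) := expR (- q * (z.1.1 + z.2.2)) * Psi (x + (z.1.2 + z.2.1 * z.2.2)).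
have mF : measurable_fun setT F.
  apply: measurable_funM.
    by apply: measurableT_comp => //; apply: measurable_funM => //; exact: measurable_funD.
  apply: (measurableT_comp mPsi); apply: measurable_funD => //; apply: measurable_funD => //.
  exact: measurable_funM.
have F0 z : 0 <= F z by rewrite mulr_ge0 ?expR_ge0.
transitivity (\int[P]_w (F (Y n w))%:E)%E.
  apply: eq_integral => w _; rewrite /F /Y /jump_data /T /S /=.
  by rewrite /jump_time /jump_position !big_nat_recr.
rewrite step// /jump_mean -ge0_integralZl_R//; last 3 first.
- exact: ltW.
- apply: measurable_funM.
    by apply: measurableT_comp => //; exact: measurable_funM.
  apply: (measurableT_comp (measurable_resolvent _ mPsi)); exact: measurable_funD.
- move=> w; rewrite mulr_ge0 ?expR_ge0//.
  exact: bounded_by_ge0 (bounded_by_resolvent p_gt0 hPsi).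
apply: eq_integral => w _; set t := T n w; set s := S n w.
rewrite mulrA EFinM (EFin_resolvent_posexp p_gt0 _ hPsi).
rewrite -ge0_integralZl_R//; last 3 first.
- by rewrite mulr_ge0 ?expR_ge0// ltW.
- apply: measurable_funM; first exact: measurable_posexp.
  apply: measurable_funM => //; apply: measurable_funD.
    by apply: (measurableT_comp mPsi); exact: measurable_funD.
  by apply: (measurableT_comp mPsi); exact: measurable_funB.
- by move=> r; rewrite mulr_ge0 ?posexp_ge0// mulr_ge0// addr_ge0.
apply: eq_integral => r _; congr EFin; rewrite /F/= mulN1r mul1r -posexpM.
have -> : expR (- q * (t + r)) = expR (- q * t) * expR (- q * r) by rewrite mulrDr expRD.
rewrite !addrA; ring.
Qed.

Lemma jump_meanE C Psi n x : bounded_by C Psi ->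
  jump_mean Psi n x = (lam ^+ n * iter n (resolvent p) Psi x)%:E.
Proof.
elim: n C Psi => [|n IH] C Psi hPsi.
  rewrite /jump_mean /T /S /jump_time /jump_position.
  under eq_integral do rewrite !big_geq// mulr0 expR0 addr0 mul1r.
  transitivity ((Psi x)%:E * P setT)%E; first exact: integral_cst.
  by rewrite probability_setT mule1 mul1r.
by rewrite (jump_meanS _ _ hPsi) (IH _ _ (bounded_by_resolvent p_gt0 hPsi)) -EFinM iterSr exprS mulrA.
Qed.

End rate.

(** For [q = 1] and [Psi = 1] the discounted means are [(lam / (1 + lam))^n], so [ae_unbounded]
    excludes accumulation of the jumps. *)
Lemma ae_renewal_path : {ae P, forall w, renewal_path (ep ^~ w)}.
Proof.
have pos : {ae P, forall w, forall j, 0 < ep j w}.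
  apply: ae_foralln => j.
  have [_ [_ [_ /(_ j 0 (lexx _)) p1]] _ _] := data; rewrite mulr0 expR0 in p1.
  have mA : measurable [set w | 0 < e j.+1 w].
    rewrite (_ : [set w | _] = ep j @^-1` `]0, +oo[); last first.
      by apply/seteqP; split => w /=; rewrite in_itv/= andbT.
    by rewrite -[X in measurable X]setTI; apply: mep => //; exact: measurable_itv.
  exists (~` [set w | 0 < e j.+1 w]); split => //; first exact: measurableC.
  have h := probability_setC P mA; rewrite p1 subee// in h; exact: h.
have l1 : 0 < 1 + lam by rewrite addr_gt0.
have iterE n : iter n (resolvent (1 + lam)) (fun=> 1) = (fun=> (1 + lam)^-1 ^+ n) :> (R -> R).
  elim: n => //= n ->; apply/funext => x.
  by rewrite resolvent_cst// exprSr.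
have b1 : bounded_by 1 (fun=> 1 : R) by split => // x; rewrite ler01 lexx.
have := @ae_unbounded R _ _ P T (lam / (1 + lam)) _ (fun n => @mT n) _.
move=> /(_ _ _)/(aeI pos) h; apply: aeS (h _ _).
- by move=> w [h1 h2]; split.
- by rewrite divr_ge0 ?ltW//= ltr_pdivrMr// mul1r ltrDr.
move=> n; have := @jump_meanE 1 ltr01 1 (fun=> 1) n 0 b1.
rewrite /jump_mean iterE expr_div_n -exprVn => <-.
by apply: eq_integral => w _; rewrite mulN1r mulr1.
Qed.

Section laplace_interval.
Context (q : R) (q_gt0 : 0 < q).
Let p := q + lam.
Let p_gt0 : 0 < p. Proof. exact: addr_gt0. Qed.

(** Shifting [r] by the jump time turns it into the age of the current interval and releases the
    discount [expR (- q T_n)]. An age [r] is exceeded with probability [expR (- lam r)], so ages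
    carry the weight [q * posexp (q + lam)], again a multiple of the kernel of [resolvent p]. *)
Lemma interval_laplace C Phi n x : bounded_by C Phi ->
  (\int[P]_w \int[mu]_r (on_interval (fun y => Phi (x + y)) r (Y n w) * (q * posexp q r))%:E =
   q%:E * jump_mean q (resolvent p Phi) n x)%E.
Proof.
move=> hPhi; have [mPhi _] := hPhi; have Phi0 y := bounded_by_ge0 y hPhi.
have [m11 m12 m21 m22] := measurable_coordinates.
pose k (r : R) (z : (R * R) * (R * R)) :=
  expR (- q * z.1.1) * (q * posexp q r) * ((r < z.2.2)%R%:R * Phi (x + z.1.2 + z.2.1 * r)).
have k0 r z : 0 <= k r z.
  by rewrite mulr_ge0// mulr_ge0 ?expR_ge0// mulr_ge0 ?posexp_ge0// ltW.
have mk d' (D : measurableType d') (r : D -> R) (z : D -> (R * R) * (R * R)) :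
    measurable_fun setT r -> measurable_fun setT z -> measurable_fun setT (fun u => k (r u) (z u)).
  move=> mr mz; have mz11 := measurableT_comp m11 mz; have mz12 := measurableT_comp m12 mz.
  have mz21 := measurableT_comp m21 mz; have mz22 := measurableT_comp m22 mz.
  apply: measurable_funM.
    apply: measurable_funM.
      by apply: measurableT_comp => //; exact: measurable_funM.
    by apply: measurable_funM => //; exact: (measurableT_comp (measurable_posexp q)).
  apply: measurable_funM.
    have mb : measurable_fun setT (fun b : bool => b%:R : R) by [].
    by apply: (measurableT_comp mb); exact: measurable_fun_ltr.
  apply: (measurableT_comp mPhi); apply: measurable_funD; last exact: measurable_funM.
  exact: measurable_funD.
transitivity (\int[P]_w \int[mu]_r (k r (Y n w))%:E)%E.
  apply: ae_eq_integral_nonmeasurable.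
  apply: aeS (ae_renewal_path) => w hw _.
  have T0 := jump_time_ge0 n hw.
  pose g r := (on_interval (fun y => Phi (x + y)) r (Y n w) * (q * posexp q r))%:E.
  have mg : measurable_fun setT g.
    apply/measurable_EFinP; apply: measurable_funM.
      apply: measurable_on_interval => //.
      by apply: (measurableT_comp mPhi); exact: measurable_funD.
    by apply: measurable_funM => //; exact: measurable_posexp.
  have g0 r : (0 <= g r)%E.
    by rewrite lee_fin mulr_ge0// ?mulr_ge0 ?posexp_ge0// ltW.
  rewrite -(ge0_integral_shift (T n w) mg g0); apply: ae_eq_integral_nonmeasurable.
  apply: aeS (ae_neq 0) => r /eqP r0 _; rewrite /g /k /on_interval /Y /jump_data/=.
  rewrite -/(T n w) -/(S n w); congr EFin.
  rewrite addrK lerDr (addrC r) ltrD2l /posexp.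
  have [r1|r1|r1] := ltgtP 0 (r : R); last by rewrite -r1 eqxx in r0.
    rewrite ltr_wpDl// addrA mulrDr expRD /=; ring.
  by rewrite /= !(mul0r, mulr0).
pose h (r : R) w := q * expR (- q * T n w) *
  (posexp p r * (2^-1 * (Phi (x + S n w + r) + Phi (x + S n w - r)))).
have h0 r w : 0 <= h r w.
  rewrite mulr_ge0 ?mulr_ge0 ?expR_ge0 ?posexp_ge0 ?addr_ge0//; exact: ltW.
have mh : measurable_fun setT (fun z : Omega * R => h z.2 z.1).
  have mT1 : measurable_fun setT (fun z : Omega * R => T n z.1) by exact: (measurableT_comp (@mT n)).
  have mS1 : measurable_fun setT (fun z : Omega * R => x + S n z.1).
    by apply: measurable_funD => //; exact: (measurableT_comp (@mS n)).
  apply: measurable_funM.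
    apply: measurable_funM => //.
    by apply: measurableT_comp => //; exact: measurable_funM.
  apply: measurable_funM; first exact: (measurableT_comp (measurable_posexp p)).
  apply: measurable_funM => //; apply: measurable_funD.
    by apply: (measurableT_comp mPhi); exact: measurable_funD.
  by apply: (measurableT_comp mPhi); exact: measurable_funB.
transitivity (\int[P]_w \int[mu]_r (h r w)%:E)%E.
  have mkY : measurable_fun setT (fun z : Omega * R => (k z.2 (Y n z.1))%:E).
    by apply/measurable_EFinP; apply: mk => //; exact: (measurableT_comp (@mY n)).
  have mhE : measurable_fun setT (fun z : Omega * R => (h z.2 z.1)%:E) by exact/measurable_EFinP.
  have kY0 (z : Omega * R) : (0 <= (k z.2 (Y n z.1))%:E)%E by rewrite lee_fin.
  have hE0 (z : Omega * R) : (0 <= (h z.2 z.1)%:E)%E by rewrite lee_fin.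
  have E1 := @fubini_tonelli _ _ _ _ _ P mu _ mkY kY0.
  have E2 := @fubini_tonelli _ _ _ _ _ P mu _ mhE hE0.
  rewrite /= in E1 E2; rewrite E1 E2.
  apply: eq_integral => r _; rewrite (@step n (k r))//; last exact: (mk _ _ (fun=> r) id).
  apply: eq_integral => w _; rewrite /k/= mulN1r mul1r.
  have [r0|r0] := leP r 0.
    have -> : h r w = 0 by rewrite /h /posexp ltNge r0/= mul0r mulr0.
    rewrite integral0_eq// => rho _; congr EFin.
    by rewrite {1 2}/posexp ltNge r0/= !(mulr0, mul0r) addr0 !(mulr0, mul0r).
  (* The length [rho] of the interval enters only through the event [rho > r], whose probability is
     given by [integral_posexp_gt]. *)
  transitivity (\int[mu]_rho
    (expR (- q * T n w) * (q * posexp q r) * (2^-1 * (Phi (x + S n w + r) + Phi (x + S n w - r))) *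
     (\1_(`]r, +oo[%classic : set R) rho * (lam * posexp lam rho)))%:E)%E.
    apply: eq_integral => rho _; congr EFin; rewrite indicE mem_setE in_itv/= andbT; ring.
  rewrite ge0_integralZl_R ?integral_posexp_gt//; last 4 first.
  - exact: ltW.
  - by rewrite mulr_ge0 ?mulr_ge0 ?expR_ge0 ?posexp_ge0 ?addr_ge0// ltW.
  - apply: measurable_funM; first exact: measurable_indic.
    by apply: measurable_funM => //; exact: measurable_posexp.
  - by move=> rho; rewrite mulr_ge0// mulr_ge0 ?posexp_ge0// ltW.
  rewrite -EFinM; congr EFin; rewrite /h /posexp r0 /p.
  have -> : expR (- (q + lam) * r) = expR (- q * r) * expR (- lam * r).
    by rewrite -expRD; congr expR; ring.
  ring.
rewrite /jump_mean -ge0_integralZl_R//; last 3 first.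
- exact: ltW.
- apply: measurable_funM.
    by apply: measurableT_comp => //; exact: measurable_funM.
  by apply: (measurableT_comp (measurable_resolvent _ mPhi)); exact: measurable_funD.
- move=> w; rewrite mulr_ge0 ?expR_ge0//.
  exact: bounded_by_ge0 (bounded_by_resolvent p_gt0 hPhi).
apply: eq_integral => w _; rewrite mulrA EFinM (EFin_resolvent_posexp p_gt0 _ hPhi).
rewrite -ge0_integralZl_R//.
- by rewrite mulr_ge0 ?expR_ge0// ltW.
- apply: measurable_funM; first exact: measurable_posexp.
  apply: measurable_funM => //; apply: measurable_funD.
    by apply: (measurableT_comp mPhi); exact: measurable_funD.
  by apply: (measurableT_comp mPhi); exact: measurable_funB.
- by move=> r; rewrite mulr_ge0 ?posexp_ge0// mulr_ge0// addr_ge0.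
Qed.

End laplace_interval.
End telegraph_resolvent.

(** * Time change by the inverse subordinator *)

Section telegraph_time_change.
Context {d} {Omega : measurableType d} {R : realType} (P : probability Omega R).
Context (alpha lam : R) (theta e : nat -> {RV P >-> R}) (H : R -> {RV P >-> R}).
Context (lam_gt0 : 0 < lam).
Context (data : telegraph_data alpha lam theta e H).
Local Notation mu := (leb R).

Let th j (w : Omega) := theta j.+1 w.
Let ep j (w : Omega) := e j.+1 w.
Let Y n w := jump_data (th ^~ w) (ep ^~ w) n.
Let L t w := rational_inverse (H ^~ w) t.

Let mth j : measurable_fun setT (th j). Proof. exact: measurable_funPT. Qed.
Let mep j : measurable_fun setT (ep j). Proof. exact: measurable_funPT. Qed.
Let mY n : measurable_fun setT (Y n). Proof. exact: measurable_jump_data. Qed.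
Let mL : measurable_fun setT (fun z : R * Omega => L z.1 z.2).
Proof.
exact: (@measurable_rational_inverse _ Omega R (fun r w => H r w) (fun s _ => measurable_funPT (H s))).
Qed.

Let GH := sigma_generators [set t : R | 0 <= t] (fun t w => H t w).

Let GH_measurable : GH `<=` measurable.
Proof.
move=> _ [t [B [t0 mB ->]]]; rewrite -[X in measurable X]setTI.
exact: (@measurable_funPT _ _ _ _ (H t)).
Qed.

(** [independent3] treats signs, waiting times and [H] as three families. These intersections form a
    pi-system for the joint events of signs and waiting times, through which the pair becomes
    independent of [H]. *)
Definition telegraph_events : set (set Omega) := [set C | exists A B,
  [/\ sigma_gen setT (fun j w => theta j w) A, sigma_gen setT (fun j w => e j w) B & C = A `&` B]].

Let telegraph_events_measurable : telegraph_events `<=` measurable.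
Proof.
have sub (Z : nat -> {RV P >-> R}) : sigma_gen setT (fun j w => Z j w) `<=` measurable.
  apply: sub_sigma_measurable => _ [j [B [_ mB ->]]]; rewrite -[X in measurable X]setTI.
  exact: (@measurable_funPT _ _ _ _ (Z j)).
by move=> _ [A [B [/sub mA /sub mB ->]]]; exact: measurableI.
Qed.

Let telegraph_events_independent A B : <<s telegraph_events >> A -> <<s GH >> B ->
  P (A `&` B) = (P A * P B)%E.
Proof.
move=> sA sB; have [_ _ _ ind] := data.
have st1 := @sigma_gen_setT _ Omega R _ setT (fun j w => theta j w).
have st2 := @sigma_gen_setT _ Omega R _ setT (fun j w => e j w).
have st3 : sigma_gen [set t : R | 0 <= t] (fun t w => H t w) setT by exact: sigma_gen_setT.
apply: (sigma_independent_l telegraph_events_measurable) sA.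
- move=> _ _ [A1 [B1 [a1 b1 ->]]] [A2 [B2 [a2 b2 ->]]].
  exists (A1 `&` A2), (B1 `&` B2); split; last by rewrite setIACA.
    exact: (@measurableI _ (g_sigma_algebraType (sigma_generators setT (fun j w => theta j w)))).
  exact: (@measurableI _ (g_sigma_algebraType (sigma_generators setT (fun j w => e j w)))).
- by exists setT, setT; split; rewrite ?setIT.
- exact: (sub_sigma_measurable GH_measurable sB).
move=> _ [A1 [B1 [a1 b1 ->]]]; rewrite (ind _ _ _ a1 b1 sB).
by have := ind _ _ _ a1 b1 st3; rewrite setIT probability_setT mule1 => ->.
Qed.

Let mY_events n : measurable_fun setT (Y n : g_sigma_algebraType telegraph_events -> _).
Proof.
have st1 := @sigma_gen_setT _ Omega R _ setT (fun j w => theta j w).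
have st2 := @sigma_gen_setT _ Omega R _ setT (fun j w => e j w).
apply: (@measurable_jump_data _ (g_sigma_algebraType telegraph_events) R th ep) => j _ B mB.
  rewrite setTI; apply: sub_sigma_algebra; exists (th j @^-1` B), setT; split; rewrite ?setIT//.
  by apply: sub_sigma_algebra; exists j.+1, B.
rewrite setTI; apply: sub_sigma_algebra; exists setT, (ep j @^-1` B); split; rewrite ?setTI//.
by apply: sub_sigma_algebra; exists j.+1, B.
Qed.

Lemma measurable_subordinated_interval {d'} {T : measurableType d'} (K : R -> T -> R)
    (Phi : R -> R) (s x : R) (mK : forall s, 0 <= s -> measurable_fun setT (K s)) :
  measurable_fun setT Phi ->
  measurable_fun setT (fun u : (((R * R) * (R * R)) * T) * R =>
    on_interval (fun y => Phi (x + y)) (rational_inverse (K ^~ u.1.2) u.2) u.1.1 * (s * posexp s u.2)).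
Proof.
move=> mPhi; apply: measurable_funM; last first.
  by apply: measurable_funM => //; exact: (measurableT_comp (measurable_posexp s)).
apply: measurable_on_interval.
- by apply: (measurableT_comp mPhi); exact: measurable_funD.
- apply: (measurableT_comp (measurable_rational_inverse mK)
    (_ : measurable_fun setT (fun u : (((R * R) * (R * R)) * T) * R => (u.2, u.1.2)))).
  by apply: measurable_fun_pair => //; exact: (measurableT_comp measurable_snd measurable_fst).
- exact: (measurableT_comp measurable_fst measurable_fst).
Qed.

(** Independence freezes the interval [Y n]; [laplace_inverse_subordinator] then exchanges the
    inverse subordinator at an exponential time of rate [s] for an exponential variable of rate
    [s^alpha]. *)
Lemma subordinated_interval C Phi s n x : 0 < s -> bounded_by C Phi ->
  (\int[P]_w \int[mu]_t (on_interval (fun y => Phi (x + y)) (L t w) (Y n w) * (s * posexp s t))%:E =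
   \int[P]_w \int[mu]_r (on_interval (fun y => Phi (x + y)) r (Y n w) *
     (s `^ alpha * posexp (s `^ alpha) r))%:E)%E.
Proof.
move=> s0 hPhi; have [mPhi _] := hPhi; have Phi0 y := bounded_by_ge0 y hPhi.
(* The whole family [H] acts as one random element: the identity from [Omega] to the same set with
   the sigma-algebra generated by [H]. *)
pose TH := g_sigma_algebraType GH.
have mHT r : 0 <= r -> measurable_fun setT (H r : TH -> R).
  by move=> r0; exact: (@sigma_gen_measurable_fun _ Omega R _ _ (fun t w => H t w)).
have on0 r z : 0 <= on_interval (fun y => Phi (x + y)) r z by rewrite mulr_ge0.
have pe0 t : 0 <= s * posexp s t by rewrite mulr_ge0 ?posexp_ge0// ltW.
pose F (z : ((R * R) * (R * R)) * TH) : \bar R :=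
  (\int[mu]_t (on_interval (fun y => Phi (x + y)) (L t z.2) z.1 * (s * posexp s t))%:E)%E.
have mF : measurable_fun setT F.
  apply: (measurable_integral_snd mu (F := fun u : (((R * R) * (R * R)) * TH) * R =>
    on_interval (fun y => Phi (x + y)) (rational_inverse (H ^~ u.1.2) u.2) u.1.1 * (s * posexp s u.2))).
    exact: (@measurable_subordinated_interval _ TH (fun r w => H r w)).
  by move=> u; rewrite mulr_ge0.
have F0 z : (0 <= F z)%E by apply: integral_ge0 => t _; rewrite lee_fin mulr_ge0.
have mid : measurable_fun setT (id : Omega -> TH).
  by move=> _ B mB; rewrite setTI; exact: (sub_sigma_measurable GH_measurable mB).
have ind A B : measurable A -> measurable B ->
    P (Y n @^-1` A `&` (id : Omega -> TH) @^-1` B) = (P (Y n @^-1` A) * P ((id : Omega -> TH) @^-1` B))%E.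
  move=> mA mB; apply: telegraph_events_independent => //.
  by rewrite -[X in <<s _ >> X]setTI; exact: mY_events.
transitivity (\int[P]_w \int[P]_w' F (Y n w, (w' : TH)))%E.
  exact: (@independent_integral _ Omega R P _ _ _ TH (Y n) id F (@mY n) mid ind mF F0).
apply: eq_integral => w _; rewrite /F/=.
have [_ _ Hs _] := data.
have mG : measurable_fun setT (fun r => (on_interval (fun y => Phi (x + y)) r (Y n w))%:E).
  apply/measurable_EFinP; apply: measurable_on_interval => //.
  by apply: (measurableT_comp mPhi); exact: measurable_funD.
have G0 r : (0 <= (on_interval (fun y => Phi (x + y)) r (Y n w))%:E)%E by rewrite lee_fin.
have := laplace_inverse_subordinator Hs s0 mG G0.
under eq_integral do under eq_integral do rewrite -EFinM.
by under [RHS]eq_integral do rewrite -EFinM.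
Qed.

(* [Ztel] need not be measurable in [(t, w)]: it involves an infimum over an uncountable set *)
Definition telegraph_version t w : R :=
  telegraph_path (th ^~ w) (ep ^~ w) (rational_inverse (H ^~ w) t).

Lemma measurable_telegraph_version :
  measurable_fun setT (fun z : R * Omega => telegraph_version z.1 z.2).
Proof.
apply: (measurableT_comp (f := fine)) => //.
apply: measurable_fun_limn_esup => N; apply/measurable_EFinP; apply: measurable_sum => n.
apply: measurable_on_interval => //.
exact: (measurableT_comp (@mY n) measurable_snd).
Qed.

(** On almost every sample exactly one interval is active at each time, so the average is the sum of
    the contributions of the intervals. With [R] the resolvent and [q = s^alpha], they form the
    Neumann series of [q R (1 - lam R)^-1]. *)
Lemma telegraph_version_laplace C Phi s x : 0 < s -> bounded_by C Phi ->
  (\int[P]_w \int[mu]_t (Phi (x + telegraph_version t w) * (s * posexp s t))%:E =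
   \sum_(0 <= n <oo) (s `^ alpha * (lam ^+ n * iter n.+1 (resolvent (s `^ alpha + lam)) Phi x))%:E)%E.
Proof.
move=> s0 hPhi; have [mPhi _] := hPhi; have Phi0 y := bounded_by_ge0 y hPhi.
have q0 : 0 < s `^ alpha by rewrite powR_gt0.
have p0 : 0 < s `^ alpha + lam by rewrite addr_gt0.
have on0 r z : 0 <= on_interval (fun y => Phi (x + y)) r z by rewrite mulr_ge0.
have pe0 t : 0 <= s * posexp s t by rewrite mulr_ge0 ?posexp_ge0// ltW.
pose g n (z : Omega * R) := on_interval (fun y => Phi (x + y)) (L z.2 z.1) (Y n z.1) * (s * posexp s z.2).
have g0 n z : 0 <= g n z by rewrite mulr_ge0.
have mg n : measurable_fun setT (g n).
  apply: measurable_funM; last first.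
    by apply: measurable_funM => //; exact: (measurableT_comp (measurable_posexp s)).
  apply: measurable_on_interval.
  - by apply: (measurableT_comp mPhi); exact: measurable_funD.
  - apply: (measurableT_comp mL (_ : measurable_fun setT (fun z : Omega * R => (z.2, z.1)))).
    exact: measurable_fun_pair.
  - exact: (measurableT_comp (@mY n)).
transitivity (\int[P]_w \int[mu]_t \sum_(0 <= n <oo) (g n (w, t))%:E)%E.
  apply: ae_eq_integral_nonmeasurable.
  have [_ _ Hs _] := data.
  apply: aeS (aeI (ae_renewal_path lam_gt0 data) (ae_subordinator_path Hs)) => w [hw hH] _.
  apply: eq_integral => t _.
  have L0 : 0 <= L t w by rewrite /L rational_inverseE//; exact: path_inverse_ge0.
  rewrite EFinM -(@nneseries_on_interval _ (fun y => Phi (x + y)) (th ^~ w) (ep ^~ w))//.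
  rewrite muleC -nneseriesZl; last by move=> n _; rewrite lee_fin.
  by apply: eq_eseriesr => n _; rewrite -EFinM mulrC.
transitivity (\int[P]_w \sum_(0 <= n <oo) \int[mu]_t (g n (w, t))%:E)%E.
  apply: eq_integral => w _; rewrite integral_nneseries//.
  - by move=> n; apply/measurable_EFinP; exact: (measurableT_comp (mg n) (measurable_pair1 w)).
  - by move=> n t _; rewrite lee_fin.
rewrite integral_nneseries//; last 2 first.
- by move=> n; exact: (measurable_integral_snd mu (mg n) (g0 n)).
- by move=> n w _; apply: integral_ge0 => t _; rewrite lee_fin.
apply: eq_eseriesr => n _; rewrite /g/= (subordinated_interval _ _ s0 hPhi).
rewrite (interval_laplace lam_gt0 data q0 _ _ hPhi) (jump_meanE lam_gt0 data q0 _ _ (bounded_by_resolvent p0 hPhi)).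
by rewrite -EFinM -iterSr.
Qed.

End telegraph_time_change.

Lemma resolvent_affine {R : realType} (p : R) (p_gt0 : 0 < p) (f : R -> R) (a b x : R) :
  kbounded p f -> resolvent p (fun y => a * f y + b) x = a * resolvent p f x + b / p.
Proof.
move=> kf; rewrite -(resolvent_cst p_gt0 b x) /resolvent.
have i1 := resolvent_integrable x kf.
have kb : kbounded p (fun=> b) by apply: (kbounded_bounded p_gt0 _ (B := `|b|)).
have i2 := resolvent_integrable x kb.
rewrite -RintegralZl// -RintegralD//.
  by apply: eq_Rintegral => y _; ring.
exact: (integrableZl measurableT a i1).
Qed.

Lemma bounded_by_iter {R : realType} (p : R) (p_gt0 : 0 < p) C (Phi : R -> R) n :
  bounded_by C Phi -> exists C', bounded_by C' (iter n (resolvent p) Phi).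
Proof.
move=> hPhi; elim: n => [|n [C' hC']]; first by exists C.
by exists (C' / p); rewrite iterS; exact: bounded_by_resolvent.
Qed.

Lemma bounded_by_add {R : realType} (g : R -> R) B : measurable_fun setT g ->
  (forall x, `|g x| <= B) -> bounded_by (B + B) (fun y => g y + B).
Proof.
move=> mg gB; split; first exact: measurable_funD.
by move=> y; have := gB y; rewrite ler_norml => /andP[h1 h2]; rewrite lerD2r h2 andbT -(addNr B) lerD2r.
Qed.

Lemma Rintegral_probability_cst {d} {T : measurableType d} {R : realType} (P : probability T R) (c : R) :
  \int[P]__ c = c.
Proof.
transitivity (c * fine (P setT)); first by rewrite Rintegral_cst.
by rewrite probability_setT mulr1.
Qed.

Section telegraph_average.
Context {d} {Omega : measurableType d} {R : realType} (P : probability Omega R).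
Context (alpha lam : R) (theta e : nat -> {RV P >-> R}) (H : R -> {RV P >-> R}).
Context (lam_gt0 : 0 < lam).
Context (data : telegraph_data alpha lam theta e H).
Local Notation mu := (leb R).
Local Notation Z := (telegraph_version theta e H).

Let mZ : measurable_fun setT (fun z : R * Omega => Z z.1 z.2).
Proof. exact: measurable_telegraph_version. Qed.

Definition telegraph_average (g : R -> R) (t x : R) : R := \int[P]_w g (x + Z t w).

Section bounded.
Context (g : R -> R) (B : R) (mg : measurable_fun setT g) (gB : forall x, `|g x| <= B).
Local Notation u := (telegraph_average g).

Let mgZ x : measurable_fun setT (fun z : R * Omega => g (x + Z z.1 z.2)).
Proof. by apply: (measurableT_comp mg); exact: measurable_funD. Qed.

Let mgZt t x : measurable_fun setT (fun w => g (x + Z t w)).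
Proof. exact: (measurableT_comp (mgZ x) (measurable_pair1 t)). Qed.

Lemma telegraph_average_integrable t x : P.-integrable setT (EFin \o (fun w => g (x + Z t w))).
Proof.
apply: (@le_integrable _ _ _ P setT measurableT _ (cst B%:E)) => //.
- by apply/measurable_EFinP.
- by move=> w _; rewrite /= lee_fin (le_trans (gB _))// ler_norm.
- exact: finite_measure_integrable_cst.
Qed.

Lemma telegraph_average_bound t x : `|u t x| <= B.
Proof.
apply: le_trans (le_normr_Rintegral measurableT (telegraph_average_integrable t x)) _.
rewrite -[leRHS](Rintegral_probability_cst P).
apply: le_Rintegral => //.
- by have := integrable_abse (telegraph_average_integrable t x).
- exact: finite_measure_integrable_cst.
Qed.

Lemma measurable_telegraph_average x : measurable_fun setT (u ^~ x).
Proof. exact: (measurable_Rintegral_snd P (mgZ x)). Qed.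

Lemma telegraph_average_laplace_integrable s x : 0 < s ->
  mu.-integrable setT (EFin \o (fun t => u t x * posexp s t)).
Proof.
move=> s0; have mp := measurable_posexp s.
have ip : mu.-integrable setT (EFin \o (fun t => B * posexp s t)).
  apply: ge0_integrable.
  - by apply: measurable_funM => //; exact: measurable_posexp.
  - by move=> t; rewrite mulr_ge0 ?posexp_ge0// (le_trans _ (gB 0)).
  - rewrite ge0_integralZl_R//; last by move=> t; exact: posexp_ge0.
      by rewrite integral_posexp// -EFinM ltry.
    by rewrite (le_trans _ (gB 0)).
apply: (le_integrable measurableT _ _ ip).
  by apply/measurable_EFinP; apply: measurable_funM => //; exact: measurable_telegraph_average.
move=> t _; rewrite /= lee_fin !normrM ler_wpM2r//.
by rewrite (le_trans (telegraph_average_bound t x))// ler_norm.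
Qed.

Definition telegraph_laplace s x : R := \int[mu]_t (u t x * posexp s t).

(** Adding the bound [B] makes the integrand nonnegative, as the series identity requires, and costs
    exactly [B] because [s * posexp s] has mass [1]. *)
Lemma telegraph_laplace_series s x : 0 < s ->
  ((s * telegraph_laplace s x + B)%:E =
   \sum_(0 <= n <oo) (s `^ alpha * (lam ^+ n *
     iter n.+1 (resolvent (s `^ alpha + lam)) (fun y => g y + B)%R x))%:E)%E.
Proof.
move=> s0; have mp := measurable_posexp s.
have hPhi := bounded_by_add mg gB.
have pe0 t : 0 <= s * posexp s t by rewrite mulr_ge0 ?posexp_ge0// ltW.
rewrite -(telegraph_version_laplace lam_gt0 data x s0 hPhi).
have mF : measurable_fun setT (fun z : R * Omega => ((g (x + Z z.1 z.2) + B) * (s * posexp s z.1))%:E).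
  apply/measurable_EFinP; apply: measurable_funM; first exact: measurable_funD.
  by apply: measurable_funM => //; exact: (measurableT_comp mp).
have F0 (z : R * Omega) : (0 <= ((g (x + Z z.1 z.2) + B) * (s * posexp s z.1))%:E)%E.
  by rewrite lee_fin mulr_ge0//; have [_ /(_ (x + Z z.1 z.2))/andP[]] := hPhi.
have E1 := @fubini_tonelli _ _ _ _ _ mu P _ mF F0; rewrite /= in E1; rewrite -E1.
have iu := telegraph_average_laplace_integrable x s0.
have ip : mu.-integrable setT (EFin \o posexp s).
  apply: ge0_integrable => //; first by move=> t; exact: posexp_ge0.
  by rewrite integral_posexp// ltry.
transitivity (\int[mu]_t (s * (u t x * posexp s t) + (B * s) * posexp s t)%:E)%E; last first.
  apply: eq_integral => t _.
  rewrite ge0_integralZr_R//; last 2 first.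
  - exact: measurable_funD.
  - by move=> w; have [_ /(_ (x + Z t w))/andP[]] := hPhi.
  have -> : (\int[P]_w (g (x + Z t w) + B)%:E = (u t x + B)%:E)%E.
    have i2 : P.-integrable setT (EFin \o (fun=> B)) by exact: finite_measure_integrable_cst.
    have -> : u t x + B = \int[P]_w (g (x + Z t w) + B).
      rewrite RintegralD//; last exact: telegraph_average_integrable.
      by rewrite Rintegral_probability_cst.
    rewrite /Rintegral fineK//; apply: integrable_fin_num => //.
    have := integrableD measurableT (telegraph_average_integrable t x) i2.
    by apply: eq_integrable => // w _; rewrite /= EFinD.
  by rewrite -EFinM; congr EFin; ring.
have is1 : mu.-integrable setT (EFin \o (fun t => s * (u t x * posexp s t))).
  exact: (integrableZl measurableT s iu).
have is2 : mu.-integrable setT (EFin \o (fun t => B * s * posexp s t)).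
  exact: (integrableZl measurableT (B * s) ip).
have -> : s * telegraph_laplace s x + B =
    \int[mu]_t (s * (u t x * posexp s t) + B * s * posexp s t).
  rewrite RintegralD//; congr (_ + _); first by rewrite RintegralZl.
  by rewrite RintegralZl// /Rintegral integral_posexp//= mulfK// gt_eqF.
rewrite /Rintegral fineK//; apply: integrable_fin_num => //.
have := integrableD measurableT is1 is2.
by apply: eq_integrable => // w _; rewrite /= EFinD.
Qed.

Lemma telegraph_laplace_bound s x : 0 < s -> `|telegraph_laplace s x| <= B / s.
Proof.
move=> s0; have mp := measurable_posexp s.
have iu := telegraph_average_laplace_integrable x s0.
have ip : mu.-integrable setT (EFin \o posexp s).
  apply: ge0_integrable => //; first by move=> t; exact: posexp_ge0.
  by rewrite integral_posexp// ltry.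
apply: le_trans (le_normr_Rintegral measurableT iu) _.
have -> : B / s = \int[mu]_t (B * posexp s t).
  by rewrite RintegralZl// /Rintegral integral_posexp.
apply: le_Rintegral => //.
- by have := integrable_abse iu.
- exact: (integrableZl measurableT B ip).
move=> t _; rewrite normrM (ger0_norm (posexp_ge0 _ _)) ler_wpM2r ?posexp_ge0//.
exact: telegraph_average_bound.
Qed.

(** Measurability in [x] is read off from the series, whose terms are iterated resolvents. *)
Lemma measurable_telegraph_laplace s : 0 < s -> measurable_fun setT (telegraph_laplace s).
Proof.
move=> s0.
pose W n x : R := s `^ alpha * (lam ^+ n *
     iter n.+1 (resolvent (s `^ alpha + lam)) (fun y => g y + B) x).
have mW n : measurable_fun setT (W n).
  apply: measurable_funM => //; apply: measurable_funM => //.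
  elim: n => [|n IH]; first by apply: measurable_resolvent; exact: measurable_funD.
  by rewrite iterS; exact: measurable_resolvent.
have -> : telegraph_laplace s =
    fun x => s^-1 * (fine (\sum_(0 <= n <oo) (W n x)%:E)%E - B).
  apply/funext => x; rewrite -(telegraph_laplace_series x s0)/= addrK mulKf//.
  by rewrite gt_eqF.
apply: measurable_funM => //; apply: measurable_funB => //.
apply: (measurableT_comp (f := fine)) => //.
have mWE n : measurable_fun setT (fun x => (W n x)%:E) by exact/measurable_EFinP.
apply: ge0_emeasurable_sum => // n x _ _.
have q0 : 0 < s `^ alpha by rewrite powR_gt0.
have p0 : 0 < s `^ alpha + lam by rewrite addr_gt0.
have [C hC] := bounded_by_iter p0 n.+1 (bounded_by_add mg gB).
by rewrite lee_fin mulr_ge0 ?mulr_ge0 ?exprn_ge0 ?(bounded_by_ge0 _ hC)// ltW.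
Qed.

(** Splitting off the first term of the Neumann series leaves [lam] times the resolvent of the whole
    series. The added constant cancels because [resolvent p] maps [B] to [B / p] and
    [q + lam = p]. *)
Lemma telegraph_laplace_resolvent s x : 0 < s ->
  telegraph_laplace s x = s `^ alpha / s * resolvent (s `^ alpha + lam) g x +
    lam * resolvent (s `^ alpha + lam) (telegraph_laplace s) x.
Proof.
move=> s0; set q := s `^ alpha; set p := q + lam.
have q0 : 0 < q by rewrite powR_gt0.
have p0 : 0 < p by rewrite addr_gt0.
have hPhi := bounded_by_add mg gB.
pose W n y : R := q * (lam ^+ n * iter n.+1 (resolvent p) (fun y => g y + B) y).
pose V y := s * telegraph_laplace s y + B.
have VE y : ((V y)%:E = \sum_(0 <= n <oo) (W n y)%:E)%E by exact: telegraph_laplace_series.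
have bW n := bounded_by_iter p0 n hPhi.
have W0 n y : 0 <= W n y.
  have [C hC] := bW n.+1.
  by rewrite mulr_ge0 ?mulr_ge0 ?exprn_ge0 ?(bounded_by_ge0 _ hC)// ltW.
have hV : bounded_by (B + B) V.
  split.
    apply: measurable_funD => //; apply: measurable_funM => //.
    exact: measurable_telegraph_laplace.
  move=> y; have := telegraph_laplace_bound y s0.
  rewrite ler_pdivlMr// mulrC -{1}(gtr0_norm s0) -normrM ler_norml => /andP[h1 h2].
  by rewrite /V lerD2r h2 andbT -(addNr B) lerD2r.
have VR : V x = q * resolvent p (fun y => g y + B) x + lam * resolvent p V x.
  apply: EFin_inj; rewrite VE nneseries_recl//; last by move=> n _; rewrite lee_fin.
  rewrite -(nneseries_addn 1); last by move=> n; rewrite lee_fin.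
  rewrite EFinD; congr (_ + _)%E; first by rewrite /W/= mul1r.
  rewrite EFinM (EFin_resolvent p0 _ hV).
  have -> : (\int[mu]_y (ek p (x - y) * V y)%:E =
      \sum_(0 <= n <oo) \int[mu]_y (ek p (x - y) * W n y)%:E)%E.
    rewrite -integral_nneseries//.
    - apply: eq_integral => y _; rewrite EFinM VE -nneseriesZl; last by move=> n _; rewrite lee_fin.
      by apply: eq_eseriesr => n _; rewrite EFinM.
    - move=> n; apply/measurable_EFinP; apply: measurable_funM; first exact: measurable_ekB.
      apply: measurable_funM => //; apply: measurable_funM => //.
      by have [C [mC _]] := bW n.+1.
    - by move=> n y _; rewrite lee_fin mulr_ge0 ?ek_ge0.
  rewrite -nneseriesZl; last by move=> n _; apply: integral_ge0 => y _; rewrite lee_fin mulr_ge0 ?ek_ge0.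
  apply: eq_eseriesr => n _; rewrite addn1 /W.
  have [C hC] := bW n.+1.
  rewrite iterS EFinM EFinM (EFin_resolvent p0 _ hC).
  have m1 : measurable_fun setT (fun y : R => ek p (x - y) * iter n.+1 (resolvent p) (fun y => g y + B) y).
    by apply: measurable_funM; [exact: measurable_ekB|case: hC].
  have m0 y : 0 <= ek p (x - y) * iter n.+1 (resolvent p) (fun y => g y + B) y.
    by rewrite mulr_ge0 ?ek_ge0// (bounded_by_ge0 _ hC).
  rewrite muleA -EFinM -ge0_integralZl_R//; last by rewrite mulr_ge0 ?exprn_ge0// ltW.
  rewrite -[RHS]ge0_integralZl_R//; last 3 first.
  - exact: ltW.
  - apply: measurable_funM; first exact: measurable_ekB.
    by apply: measurable_funM => //; apply: measurable_funM => //; case: hC.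
  - by move=> y; exact: (mulr_ge0 (ek_ge0 p (x - y)) (W0 n y)).
  by apply: eq_integral => y _; congr EFin; rewrite exprS; ring.
have kg : kbounded p g by exact: kbounded_bounded mg gB.
have kU : kbounded p (telegraph_laplace s).
  apply: (kbounded_bounded p0 (measurable_telegraph_laplace s0)) => y.
  exact: telegraph_laplace_bound.
move: VR; rewrite /V (resolvent_affine p0 _ _ _ kU).
have -> : resolvent p (fun y => g y + B) x = resolvent p g x + B / p.
  have := resolvent_affine p0 1 B x kg; rewrite mul1r => <-.
  by congr resolvent; apply/funext => y; rewrite mul1r.
move: (resolvent p (telegraph_laplace s) x) (telegraph_laplace s x) (resolvent p g x) => c a b h.
have : s * a = q * b + lam * s * c.
  have -> : s * a = (s * a + B) - B by ring.
  by rewrite h /p; field; rewrite gt_eqF.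
move=> h2; apply: (mulfI (lt0r_neq0 s0)); rewrite h2; field.
by rewrite gt_eqF.
Qed.

End bounded.
End telegraph_average.

(** * Identification *)

Section almost_everywhere_line.
Context {R : realType}.
Local Notation mu := (leb R).

Lemma ae_exists_itv (Q : R -> Prop) (a b : R) : {ae mu, forall t, Q t} -> a < b ->
  exists2 t, a < t < b & Q t.
Proof.
move=> [N [mN N0 QN]] ab; apply: contrapT => /forall2NP nQ.
have sub : `]a, b[%classic `<=` N.
  move=> t /=; rewrite in_itv/= => tab; apply: QN => /= Qt.
  by have [|] := nQ t; [rewrite tab|].
have mi : measurable (`]a, b[%classic : set R) by exact: measurable_itv.
have : (mu (`]a, b[%classic : set R) <= mu N)%E by apply: le_measure; rewrite ?inE.
rewrite N0 leNgt => /negP; apply.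
by rewrite lebesgue_measure_itv/= lte_fin ab -EFinD lte_fin subr_gt0.
Qed.

(** A nonzero difference at [t] would persist on an interval to the right of [t], which has positive
    measure. *)
Lemma ae_eq_right_continuous (h k : R -> R) (t : R) :
  {ae mu, forall s, t < s -> h s = k s} ->
  h s @[s --> t^'+] --> h t -> k s @[s --> t^'+] --> k t -> h t = k t.
Proof.
move=> hk ch ck; apply/eqP; rewrite -subr_eq0; apply/negP => /negP d0.
have cd : h s - k s @[s --> t^'+] --> h t - k t by exact: cvgB.
have [e /= e0 he] := cvgr_neq0 _ cd d0.
have te : t < t + e by rewrite ltrDl.
have [s /andP[ts se] hks] := ae_exists_itv hk te.
have : h s - k s != 0.
  by apply: he => //=; rewrite distrC gtr0_norm ?subr_gt0// ltrBlDl.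
by rewrite hks// subrr eqxx.
Qed.

Lemma ae_eq_continuous (h k : R -> R) : continuous h -> continuous k ->
  {ae mu, forall x, h x = k x} -> forall x, h x = k x.
Proof.
move=> ch ck hk x; apply: (@ae_eq_right_continuous h k x).
- by apply: aeS hk.
- by apply: cvg_at_right_filter; exact: ch.
- by apply: cvg_at_right_filter; exact: ck.
Qed.

Lemma abs_continuous_at (h : R -> R) (t : R) : 0 < t ->
  (forall T, 0 < T -> abs_continuous `]0, T[ h) -> {for t, continuous h}.
Proof.
move=> t0 hac; apply/cvgrPdist_lt => e e0.
have [del del0 hdel] := hac (t + 1) (addr_gt0 t0 ltr01) e e0.
near=> s.
have st : `|t - s| < del by near: s; exact: cvgr_dist_lt.
have s0 : 0 < s by near: s; exact: lt_nbhsr.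
have s1 : s < t + 1.
  have s1 : `|t - s| < 1 by near: s; exact: cvgr_dist_lt.
  by rewrite -ltrBlDl (le_lt_trans (ler_norm _))// distrC.
have inD : `]0, t + 1[%classic t /\ `]0, t + 1[%classic s.
  by rewrite /= !in_itv/= t0 s0 s1 ltrDl ltr01.
have [ts|ts] := leP t s.
  have := hdel 1%N (fun=> t) (fun=> s) _ _ _; rewrite !big_ord1 distrC; apply => //.
    by move=> _ _; case: inD.
  by rewrite -(ger0_norm (_ : 0 <= s - t)) ?subr_ge0// distrC.
have := hdel 1%N (fun=> s) (fun=> t) _ _ _; rewrite !big_ord1; apply => //.
  by move=> _ _; case: inD => ? ?; split => //; exact: ltW.
by rewrite -(ger0_norm (_ : 0 <= t - s)) ?subr_ge0 ?ltW.
Unshelve. all: by end_near. Qed.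

End almost_everywhere_line.

Section telegraph_process_paths.
Context {d} {Omega : measurableType d} {R : realType} (P : probability Omega R).
Context (alpha lam : R) (theta e : nat -> {RV P >-> R}) (H : R -> {RV P >-> R}).
Context (lam_gt0 : 0 < lam).
Context (data : telegraph_data alpha lam theta e H).
Local Notation mu := (leb R).
Local Notation Z := (telegraph_version theta e H).

Definition regular_sample w := renewal_path (fun j => e j.+1 w) /\ subordinator_path (H ^~ w).

Lemma ae_regular_sample : {ae P, forall w, regular_sample w}.
Proof.
have [_ _ Hs _] := data.
exact: (aeI (ae_renewal_path lam_gt0 data) (ae_subordinator_path Hs)).
Qed.

Lemma arrivalE n w : arrival (fun j w => e j w) n w = jump_time (fun j => e j.+1 w) n.
Proof.
have [_ [e0 _] _ _] := data.
by rewrite /arrival big_nat_recl// e0 add0r /jump_time.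
Qed.

Lemma counting_processE r w m : regular_sample w ->
  jump_time (fun j => e j.+1 w) m <= r < jump_time (fun j => e j.+1 w) m.+1 ->
  counting_process (fun j w => e j w) r w = m.
Proof.
move=> [hw _] hm; have /andP[m1 m2] := hm.
have max n : arrival (fun j w => e j w) n w <= r -> (n <= m)%N.
  rewrite arrivalE leqNgt => nr; apply/negP => mn.
  by have := le_lt_trans (le_trans (jump_time_mono hw mn) nr) m2; rewrite ltxx.
apply: xget_unique => [|n [nr nmax]].
  by split; [rewrite arrivalE|exact: max].
by apply/eqP; rewrite eqn_leq max//= nmax// arrivalE.
Qed.

(** On a regular sample [H] passes every level and the jump times are unbounded, so the infimum is
    over a nonempty set and the default value of [counting_process] does not occur. *)
Lemma Ztel_version t w : regular_sample w ->
  Ztel (fun j w => theta j w) (fun j w => e j w) (fun s w => H s w) t w = Z t w.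
Proof.
move=> hw; have [hr hs] := hw.
have LE : inverse_process (fun s w => H s w) t w = path_inverse (H ^~ w) t by [].
have L0 := path_inverse_ge0 t hs.
have [m hm] := jump_time_exists hr L0.
rewrite /Ztel LE (counting_processE hw hm) /telegraph_version rational_inverseE//.
by rewrite (telegraph_pathE _ hr hm) arrivalE /jump_position big_add1 add1n.
Qed.

Lemma telegraph_version_right_continuous t w : regular_sample w ->
  Z s w @[s --> t^'+] --> Z t w.
Proof.
move=> [hr hs]; rewrite /telegraph_version rational_inverseE//.
under eq_cvg do rewrite rational_inverseE//.
set r := path_inverse _ t.
have r0 : 0 <= r by exact: path_inverse_ge0.
have /cvgrPdist_lt cX := @telegraph_path_right_continuous _ (fun j => theta j.+1 w) _ _ hr r0.
have /cvgrPdist_lt cL := @path_inverse_right_continuous _ (H ^~ w) t hs.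
apply/cvgrPdist_lt => eps eps0.
have [del /= del0 hdel] := cX _ eps0.
near=> s.
have ts : t < s by near: s; exact: nbhs_right_gt.
have rs : r <= path_inverse (H ^~ w) s by apply: path_inverse_mono => //; exact: ltW.
have close : `|r - path_inverse (H ^~ w) s| < del by near: s; exact: cL.
(* If the inverse has not moved there is nothing to prove; otherwise it has moved to the right, the
   side on which [telegraph_path] is continuous. *)
move: rs; rewrite le_eqVlt => /predU1P[<-|rs]; first by rewrite subrr normr0.
exact: hdel.
Unshelve. all: by end_near. Qed.

Section averages.
Context (g : R -> R) (B : R) (cg : continuous g) (gB : forall x, `|g x| <= B).
Local Notation u := (telegraph_average theta e H g).

Let mg : measurable_fun setT g. Proof. exact: continuous_measurable_fun. Qed.

Lemma telegraph_average_right_continuous t x : u s x @[s --> t^'+] --> u t x.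
Proof.
apply/cvg_at_rightP => r [rt rcvg].
have [|||||_ _ lim] := @dominated_convergence _ _ R P setT measurableT
  (fun n w => (g (x + Z (r n) w))%:E) (fun w => (g (x + Z t w))%:E) (cst B%:E).
- by move=> n; exact: measurable_int (telegraph_average_integrable theta e H mg gB (r n) x).
- exact: measurable_int (telegraph_average_integrable theta e H mg gB t x).
- apply: aeS ae_regular_sample => w hw _; apply: cvg_EFin; first exact: nearW.
  apply: continuous_cvg; first exact: cg.
  apply: cvgD; first exact: cvg_cst.
  by have /cvg_at_rightP := @telegraph_version_right_continuous t w hw; apply.
- exact: finite_measure_integrable_cst.
- by apply: aeW => w n _; rewrite lee_fin.
have limu : (\int[P]_w (g (x + Z (r n) w))%:E)%E @[n --> \oo] --> (u t x)%:E.
  rewrite /telegraph_average /Rintegral fineK; first exact: lim.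
  exact/integrable_fin_num/(telegraph_average_integrable theta e H mg gB t x).
exact: (fine_cvg limu).
Qed.

Lemma continuous_telegraph_average t : continuous (u t).
Proof.
move=> x.
have := @continuity_under_integral R _ Omega P (fun y w => g (y + Z t w)) setT measurableT (x - 1) (x + 1).
move=> /(_ _ _ (cst B)) cont.
apply: cont.
- by move=> y _; exact: telegraph_average_integrable.
- apply: aeW => w _ y _.
  apply: (@continuous_comp _ _ _ (fun y => y + Z t w) g); last exact: cg.
  by apply: cvgD; [exact: cvg_id|exact: cvg_cst].
- exact: finite_measure_integrable_cst.
- by move=> y _; apply: aeW => w _; exact: gB.
- by rewrite inE/= in_itv/= ltrBlDr ltrDl ltr01.
Qed.

End averages.

(** Tonelli and translation invariance: for a fixed sample the shifted null set is still null, so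
    for almost every [x] the position [x + Z t w] almost surely avoids it. For a given [x] this may
    fail, as the law of the position can have atoms. *)
Lemma ae_telegraph_version (f g : R -> R) t : {ae mu, forall x, f x = g x} ->
  {ae mu, forall x, {ae P, forall w, f (x + Z t w) = g (x + Z t w)}}.
Proof.
move=> [N [mN N0 fgN]].
have mZt : measurable_fun setT (Z t).
  exact: (measurableT_comp (measurable_telegraph_version theta e H) (measurable_pair1 t)).
have mI : measurable_fun setT (\1_N : R -> R) by exact: measurable_indic.
have mF : measurable_fun setT (fun z : R * Omega => (\1_N (z.1 + Z t z.2) : R)%:E).
  apply/measurable_EFinP; apply: (measurableT_comp mI).
  by apply: measurable_funD => //; exact: (measurableT_comp mZt).
have F0 (z : R * Omega) : (0 <= (\1_N (z.1 + Z t z.2) : R)%:E)%E by rewrite lee_fin.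
have E1 := @fubini_tonelli _ _ _ _ _ mu P _ mF F0; rewrite /= in E1.
have : (\int[mu]_x \int[P]_w (\1_N (x + Z t w) : R)%:E = 0)%E.
  rewrite E1 integral0_eq// => w _.
  rewrite (ge0_integral_shift (Z t w) (f := fun x => (\1_N x : R)%:E))//; last exact/measurable_EFinP.
  by rewrite integral_indic// setIT.
have mI2 : measurable_fun setT (fun x : R => \int[P]_w (\1_N (x + Z t w) : R)%:E)%E.
  exact: (measurable_fun_fubini_tonelli_F _ mF).
have ge0 x : (0 <= \int[P]_w (\1_N (x + Z t w) : R)%:E)%E by exact: integral_ge0.
move=> I0.
have /(ae_eq_integral_abs mu measurableT mI2) : (\int[mu]_x `|\int[P]_w (\1_N (x + Z t w) : R)%:E| = 0)%E.
  by rewrite -[RHS]I0; apply: eq_integral => x _; rewrite gee0_abs.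
apply: aeS => x /(_ I) /= Px.
have mx : measurable_fun setT (fun w => (\1_N (x + Z t w) : R)%:E).
  exact: (measurableT_comp mF (measurable_pair1 x)).
have /(ae_eq_integral_abs P measurableT mx) : (\int[P]_w `|(\1_N (x + Z t w) : R)%:E| = 0)%E.
  by rewrite -[RHS]Px; apply: eq_integral => w _; rewrite gee0_abs.
apply: aeS => w /= /(_ I) h.
have : (\1_N (x + Z t w) : R) = 0 by exact: EFin_inj.
rewrite indicE => N1.
apply: contrapT => fg; have : N (x + Z t w) by exact: fgN.
by move=> /mem_set Nx; move: N1; rewrite Nx => /eqP; rewrite oner_eq0.
Qed.

End telegraph_process_paths.

Section identification.
Context {d} {Omega : measurableType d} {R : realType} (P : probability Omega R).
Context (alpha sigma eta beta zeta : R) (theta e : nat -> {RV P >-> R}) (H : R -> {RV P >-> R}).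
Context (alpha_gt0 : 0 < alpha) (alpha_le1 : alpha <= 1) (lam_gt0 : 0 < sigma / eta).
Context (zeta_gtN1 : -1 < zeta).
Context (data : telegraph_data alpha (sigma / eta) theta e H).
Context (f g : R -> R) (B : R) (v : R -> R -> R) (fL2 : L2 f).
Context (cg : continuous g) (gB : forall x, `|g x| <= B) (fg : {ae leb R, forall x, f x = g x}).
Context (v_sol : telegraph_solution alpha sigma eta beta zeta f v).
Local Notation mu := (leb R).
Local Notation u := (telegraph_average theta e H g).
Local Notation U := (telegraph_laplace theta e H g).

Let mg : measurable_fun setT g. Proof. exact: continuous_measurable_fun. Qed.

(** Both transforms solve the same weak equation, because [s^(2 alpha)] is the square of [s^alpha]
    and [f] may be replaced by [g] under the integral; the difference falls under
    [weak_uniqueness]. *)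
Lemma ae_laplace_eq s : 0 < s -> beta / 2 + 1 <= s -> {ae mu, forall x, v_laplace v s x = U s x}.
Proof.
move=> s0 sbeta.
have q0 : 0 < s `^ alpha by rewrite powR_gt0.
have p0 : 0 < s `^ alpha + sigma / eta by rewrite addr_gt0.
have uV := uli_v_laplace alpha_gt0 alpha_le1 zeta_gtN1 fL2 v_sol s0 sbeta.
have mU := measurable_telegraph_laplace lam_gt0 data mg gB s0.
have UB x := telegraph_laplace_bound theta e H mg gB x s0.
have uU := uli_bounded mU UB.
have ug := uli_bounded mg gB.
have kU := kbounded_bounded p0 mU UB.
have kg := kbounded_bounded p0 mg gB.
suff : {ae mu, forall x, v_laplace v s x + -1 * U s x = 0}.
  by apply: aeS => x; rewrite mulN1r => /eqP; rewrite subr_eq0 => /eqP.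
have ud : uli (fun x => v_laplace v s x + -1 * U s x) by apply: uli_add => //; exact: uli_scale.
have a0 : 0 < s `^ alpha * (s `^ alpha + sigma / eta) by rewrite mulr_gt0.
apply: (weak_uniqueness ud a0) => phi tphi.
have t2 := test_function_derive1n 2 tphi.
have sub psi : test_function psi -> \int[mu]_x ((v_laplace v s x + -1 * U s x) * psi x) =
    \int[mu]_x (v_laplace v s x * psi x) - \int[mu]_x (U s x * psi x).
  move=> tpsi; rewrite -RintegralB//; try exact: uli_test_integrable.
  by apply: eq_Rintegral => x _; ring.
rewrite !sub// (v_laplace_weak alpha_gt0 alpha_le1 zeta_gtN1 fL2 v_sol s0 sbeta lam_gt0 tphi).
rewrite (resolvent_equation_weak q0 lam_gt0 s0 kg kU uU ug _ tphi); last first.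
  by move=> x; exact: telegraph_laplace_resolvent.
have -> : \int[mu]_x (f x * phi x) = \int[mu]_x (g x * phi x).
  rewrite /Rintegral; congr fine; apply: ae_eq_integral_nonmeasurable.
  by apply: aeS fg => x -> _.
have -> : s `^ (2 * alpha) = s `^ alpha * s `^ alpha.
  rewrite -powRD; last by rewrite (gt_eqF s0) implybT.
  by rewrite mulr_natl mulr2n.
move: (\int[mu]_x (v_laplace v s x * phi x)) (\int[mu]_x (U s x * phi x)) (\int[mu]_x (g x * phi x)).
by move: (s `^ alpha) (s^-1) (sigma / eta) => q i l a b c; ring.
Qed.

Lemma ae_eq_telegraph_average : {ae mu, forall x, forall t, 0 < t -> v t x = u t x}.
Proof.
(* An integer beyond the threshold [beta / 2 + 1]. The factor [expR (- n0 t)] is absorbed in [w],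
   whose transforms at the integers [j] are those of [v - u] at [n0 + j]. *)
pose n0 := (Num.truncn (beta / 2 + 1)).+1.
have n0_gt0 : 0 < n0%:R :> R by rewrite ltr0n.
have n0_beta : beta / 2 + 1 <= n0%:R by rewrite ltW// truncnS_gt.
have sj j : 0 < (n0 + j)%:R :> R by rewrite ltr0n.
have sbeta j : beta / 2 + 1 <= (n0 + j)%:R :> R.
  by rewrite (le_trans n0_beta)// ler_nat leq_addr.
have a1 : {ae mu, forall x, forall j, v_laplace v (n0 + j)%:R x = U (n0 + j)%:R x}.
  by apply: ae_foralln => j; exact: ae_laplace_eq.
have a2 : {ae mu, forall x, forall j,
    mu.-integrable setT (fun t => (vpos v (t, x) * expR (- (n0 + j)%:R * t))%:E)}.
  apply: ae_foralln => j.
  by apply: aeS (ae_v_laplace alpha_gt0 alpha_le1 zeta_gtN1 v_sol (sj j) (sbeta j)) => x [].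
have a3 := ae_regular alpha_gt0 alpha_le1 v_sol.
apply: aeS (aeI (aeI a1 a2) a3) => x [[eqx intx] [acx _ _ _ _]].
pose w t := (vpos v (t, x) - (if 0 < t then u t x else 0)) * expR (- n0%:R * t).
have wE j t : w t * expR (- j%:R * t) =
    vpos v (t, x) * expR (- (n0 + j)%:R * t) - u t x * posexp (n0 + j)%:R t.
  rewrite /w -mulrA -expRD mulrBl /posexp.
  have -> : - n0%:R * t + - j%:R * t = - (n0 + j)%:R * t by rewrite natrD; ring.
  by case: ifP => _; rewrite ?mul0r ?mulr0.
have iu j := telegraph_average_laplace_integrable theta e H mg gB x (sj j).
have iw j : mu.-integrable setT (EFin \o (fun t => w t * expR (- j%:R * t))).
  have := integrableB measurableT (intx j) (iu j).
  by apply: eq_integrable => // t _; rewrite /= wE EFinB.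
have w_int : mu.-integrable setT (EFin \o w).
  have := iw 0%N; apply: eq_integrable => // t _.
  by rewrite /= mulr0n oppr0 mul0r expR0 mulr1.
have w_le0 t : t <= 0 -> w t = 0 by move=> t0; rewrite /w /vpos/= ltNge t0/= subrr mul0r.
have w_lap j : \int[mu]_t (w t * expR (- j%:R * t)) = 0.
  transitivity (\int[mu]_t (vpos v (t, x) * expR (- (n0 + j)%:R * t) - u t x * posexp (n0 + j)%:R t)).
    by apply: eq_Rintegral => t _; exact: wE.
  have iv : mu.-integrable setT (EFin \o (fun t => vpos v (t, x) * expR (- (n0 + j)%:R * t))).
    exact: intx.
  rewrite (RintegralB measurableT iv (iu j)); apply/eqP; rewrite subr_eq0; apply/eqP.
  exact: (eqx j).
have vu : {ae mu, forall t, 0 < t -> v t x = u t x}.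
  apply: aeS (lerch w_int w_le0 w_lap) => t wt t0.
  move: wt; rewrite /w /vpos/= t0 => /eqP; rewrite mulf_eq0 [expR _ == 0]gt_eqF ?expR_gt0// orbF.
  by rewrite subr_eq0 => /eqP.
move=> t t0; apply: (@ae_eq_right_continuous R (v ^~ x) (u ^~ x) t).
- by apply: aeS vu => s + ts; apply; exact: lt_trans ts.
- by apply: cvg_at_right_filter; exact: abs_continuous_at.
- exact: (telegraph_average_right_continuous lam_gt0 data cg gB).
Qed.

Lemma expectation_telegraph_average t x :
  {ae P, forall w, f (x + telegraph_version theta e H t w) = g (x + telegraph_version theta e H t w)} ->
  'E_P[fun w => f (x + Ztel (fun j w => theta j w) (fun j w => e j w) (fun s w => H s w) t w)%R]%E
  = (u t x)%:E.
Proof.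
move=> fgx; rewrite unlock /telegraph_average /Rintegral fineK; last first.
  exact/integrable_fin_num/(telegraph_average_integrable theta e H mg gB t x).
apply: ae_eq_integral_nonmeasurable.
apply: aeS (aeI fgx (ae_regular_sample lam_gt0 data)) => w [fgw hw] _.
by rewrite (Ztel_version data)// fgw.
Qed.

End identification.

Theorem theorem2 (R : realType) (d : measure_display) (Omega : measurableType d)
    (P : probability Omega R)
    (alpha sigma eta : R) (alpha_gt0 : 0 < alpha) (alpha_le1 : alpha <= 1)
    (sigma_gt0 : 0 < sigma) (eta_gt0 : 0 < eta)
    (theta e : nat -> {RV P >-> R}) (H : R -> {RV P >-> R})
    (data : telegraph_data alpha (sigma / eta) theta e H)
    (f : R -> R) (fH2 : sobolev 2 f)
    (beta zeta : R) (beta_gt0 : 0 < beta) (zeta_gtN1 : -1 < zeta)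
    (v : R -> R -> R)
    (v_sol : telegraph_solution alpha sigma eta beta zeta f v)
    (t : R) (t_gt0 : 0 < t) :
  {ae leb R, forall x,
     (v t x)%:E = 'E_P[fun w => f (x + Ztel theta e H t w)%R]%E} /\
  (continuous f -> continuous (v t) -> forall x,
     (v t x)%:E = 'E_P[fun w => f (x + Ztel theta e H t w)%R]%E).
Proof.
have [g [cg [B gB]] fg] := sobolev2_regular fH2.
have lam_gt0 : 0 < sigma / eta by rewrite divr_gt0.
have vu := ae_eq_telegraph_average alpha_gt0 alpha_le1 lam_gt0 zeta_gtN1 data
  (proj1 fH2) cg gB fg v_sol.
have Ef := fun x => @expectation_telegraph_average _ _ _ P _ _ _ _ _ _ lam_gt0 data f g B cg gB t x.
split.
  have fgZ : {ae leb R, forall x, {ae P, forall w,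
      f (x + telegraph_version theta e H t w) = g (x + telegraph_version theta e H t w)}}.
    exact: ae_telegraph_version.
  apply: aeS (aeI vu fgZ) => x [vux fgx].
  by rewrite (vux t t_gt0); apply/esym; exact: Ef.
(* For continuous [f] the representative [g] equals [f] everywhere, so the expectation is the
   average of [g] at each [x], and both sides are continuous in [x]. *)
move=> cf cv x.
have fgE := ae_eq_continuous cf cg fg.
have cu : continuous (telegraph_average theta e H g t).
  exact: (@continuous_telegraph_average _ _ _ P theta e H g B cg gB t).
rewrite (ae_eq_continuous cv cu _ x); last by apply: aeS vu => y; apply.
by apply/esym; apply: Ef; apply: aeW => w; exact: fgE.
Qed.
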